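(* Let $1\le m<n$ be fixed natural numbers. For every $c>0$ there exists $C>0$ such that the following is true. Let $a=\mathrm{diag}(a_1,\dots,a_n)$, $b^0=\mathrm{diag}(b_{11},\dots,b_{nn})$ and real reflection coefficients $r=(r^0,r^1)$ satisfy $$a_j,\,b_{jj}\in L^\infty(0,1)\ \text{ and }\ \operatorname{ess\,inf}|a_j|\ge c\quad\text{for all } j=1,\dots,n,$$ $$\sum_{j=1}^n\|b_{jj}\|_\infty+\sum_{j=1}^m\sum_{k=m+1}^n|r^0_{jk}|+\sum_{j=m+1}^n\sum_{k=1}^m|r^1_{jk}|\le\frac1c,$$ $$|\det(I-R_s(a,b^0,r))|\ge c\quad\text{for all } s\in\mathbb{Z}.$$ Then for all real $\gamma\ge1$ the operator $\mathcal{A}(a,b^0)u=\partial_tu+a\partial_xu+b^0u$ is an isomorphism from $V^\gamma(a,r)$ onto $W^\gamma$, and $$\|\mathcal{A}(a,b^0)^{-1}\|_{\mathcal{L}(W^\gamma;V^\gamma(a,r))}\le C.$$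
   Context: All coefficient functions are real-valued functions of $x\in(0,1)$; $r=(r^0,r^1)$ with $r^0=[r^0_{jk}]_{1\le j\le m,\ m+1\le k\le n}$ and $r^1=[r^1_{jk}]_{m+1\le j\le n,\ 1\le k\le m}$ real matrices. $\|\cdot\|$ is the Hermitian norm on $\mathbb{C}^n$. For $\gamma\ge0$, $W^\gamma$ is the Banach space of locally integrable $f:[0,1]\times\mathbb{R}\to\mathbb{R}^n$ with $f(x,t)=f(x,t+2\pi)$ for almost all $x\in(0,1)$, $t\in\mathbb{R}$, and $$\|f\|_{W^\gamma}^2:=\sum_{s\in\mathbb{Z}}(1+s^2)^\gamma\int_0^1\Big\|\int_0^{2\pi}f(x,t)e^{-ist}\,dt\Big\|^2dx<\infty.$$ For $\gamma\ge1$ and diagonal $a\in L^\infty$ with $\operatorname{ess\,inf}|a_j|>0$ for all $j$, $$U^\gamma(a):=\{u\in W^\gamma:\ \partial_xu\in W^0,\ \partial_tu+a\partial_xu\in W^\gamma\},\qquad \|u\|_{U^\gamma(a)}^2:=\|u\|_{W^\gamma}^2+\|\partial_tu+a\partial_xu\|_{W^\gamma}^2.$$ Functions in $U^\gamma(a)$ have traces $u(0,\cdot),u(1,\cdot)\in L^2_{loc}(\mathbb{R};\mathbb{R}^n)$. $V^\gamma(a,r)$ is the closed subspace (with the norm of $U^\gamma(a)$) of those $u\in U^\gamma(a)$ satisfying $$u_j(0,t)=\sum_{k=m+1}^nr^0_{jk}u_k(0,t)\ (j=1,\dots,m),\qquad u_j(1,t)=\sum_{k=1}^mr^1_{jk}u_k(1,t)\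 (j=m+1,\dots,n).$$ For $s\in\mathbb{Z}$, $R_s(a,b^0,r)$ is the complex $(n-m)\times(n-m)$ matrix $$R_s(a,b^0,r):=\Big[\sum_{l=1}^me^{is(\alpha_j(1)-\alpha_l(1))+\beta_j(1)-\beta_l(1)}r^1_{jl}r^0_{lk}\Big]_{j,k=m+1}^n,$$ $$\alpha_j(x):=\int_0^x\frac{dy}{a_j(y)},\qquad\beta_j(x):=\int_0^x\frac{b_{jj}(y)}{a_j(y)}\,dy.$$ *)

(* Defs.v *)
From HB Require Import structures.
From mathcomp Require Import all_boot all_order all_algebra complex.
From mathcomp Require Import all_classical all_reals all_analysis ess_sup_inf.

Set Implicit Arguments.
Unset Strict Implicit.
Unset Printing Implicit Defensive.

Import Order.TTheory GRing.Theory Num.Theory.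
Import numFieldNormedType.Exports.

Local Open Scope classical_set_scope.
Local Open Scope ring_scope.
Local Open Scope complex_scope.

Definition cmod (R : realType) (z : R[i]) : R := ComplexField.Normc.normc z.

Definition cexp (R : realType) (z : R[i]) : R[i] :=
  (expR (complex.Re z) * cos (complex.Im z)) +i* (expR (complex.Re z) * sin (complex.Im z)).

Definition cintegral (R : realType) (D : set R) (f : R -> R[i]) : R[i] :=
  (\int[lebesgue_measure]_(t in D) complex.Re (f t))
  +i* (\int[lebesgue_measure]_(t in D) complex.Im (f t)).

Definition leb01 (R : realType) :=
  mrestr (@lebesgue_measure R) (measurable_itv `]0%R, 1%R[).
Arguments leb01 : clear implicits.

Definition Linfty_norm (R : realType) (f : R -> R) : \bar R :=
  ess_sup (leb01 R) (fun x => `|f x|%:E).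

Definition Linfty (R : realType) (f : R -> R) : Prop :=
  measurable_fun (`]0, 1[ : set R) f /\ (Linfty_norm f < +oo)%E.

Definition ess_inf_abs (R : realType) (f : R -> R) : \bar R :=
  ess_inf (leb01 R) (fun x => `|f x|%:E).

(* A vector valued function (x,t) |-> u(x,t) in R^n is given by its components,
   as a total function on R * R of which only the values on [strip] matter.
   Elements of the function spaces are classes modulo equality almost
   everywhere on [strip]; they are handled through representatives and the
   relation [ae_strip]. *)

Definition leb2 (R : realType) :=
  ((@lebesgue_measure R) \x (@lebesgue_measure R))%E.
Arguments leb2 : clear implicits.

Definition strip (R : realType) : set (R * R) := `]0, 1[ `*` [set: R].
Arguments strip : clear implicits.

Definition ae_strip (R : realType) (n : nat) (f g : 'I_n -> R * R -> R) : Prop :=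
  {ae leb2 R, forall z, strip R z -> forall j, f j z = g j z}.

Definition loc_integrable (R : realType) (g : R * R -> R) : Prop :=
  forall T : R, (leb2 R).-integrable (`]0, 1[ `*` `[- T, T]) (EFin \o g).

Definition periodic_2pi (R : realType) (g : R * R -> R) : Prop :=
  {ae leb2 R, forall z, strip R z -> g (z.1, z.2 + 2 * pi) = g z}.

Definition fourier (R : realType) (g : R * R -> R) (s : int) (x : R) : R[i] :=
  cintegral `[0, 2 * pi]
    (fun t => (g (x, t))%:C * cexp (0 +i* (- (s%:~R * t)))).

Definition Wnorm2 (R : realType) (n : nat) (gamma : R) (f : 'I_n -> R * R -> R)
    : \bar R :=
  (\esum_(s in [set: int])
     (((1 + s%:~R ^+ 2) `^ gamma)%R%:E *
      \int[lebesgue_measure]_(x in `]0%R, 1%R[)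
        (\sum_(j < n) cmod (fourier (f j) s x) ^+ 2)%R%:E))%E.

Definition W (R : realType) (n : nat) (gamma : R) : set ('I_n -> R * R -> R) :=
  [set f | [/\ forall j, loc_integrable (f j),
               forall j, periodic_2pi (f j)
             & (Wnorm2 gamma f < +oo)%E]].

Definition Wnorm (R : realType) (n : nat) (gamma : R) (f : 'I_n -> R * R -> R)
    : R :=
  Num.sqrt (fine (Wnorm2 gamma f)).

(* [foldr derive phi vs] is the iterated directional derivative of phi in the
   directions vs, so this is C^oo regularity. *)
Definition smooth (R : realType) (phi : R * R -> R) : Prop :=
  forall (vs : seq (R * R)) (z : R * R),
    differentiable (foldr (fun v f => 'D_v f) phi vs) z.

Definition test_function (R : realType) (phi : R * R -> R) : Prop :=
  smooth phi /\
  exists K : set (R * R),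
    [/\ compact K, K `<=` strip R & forall z, ~ K z -> phi z = 0].

Definition is_weak_derive (R : realType) (e : R * R) (g h : R * R -> R) : Prop :=
  loc_integrable h /\
  forall phi, test_function phi ->
    \int[leb2 R]_(z in strip R) (g z * 'D_e phi z) =
    - \int[leb2 R]_(z in strip R) (h z * phi z).

Definition weak_derive (R : realType) (e : R * R) (g : R * R -> R) : R * R -> R :=
  xget (fun=> 0) [set h | is_weak_derive e g h].

Definition dx (R : realType) : R * R := (1, 0).
Definition dt (R : realType) : R * R := (0, 1).

Definition has_weak_derive (R : realType) (n : nat) (e : R * R)
    (u : 'I_n -> R * R -> R) : Prop :=
  forall j, exists h, is_weak_derive e (u j) h.

Definition transport (R : realType) (n : nat) (a : 'I_n -> R -> R)
    (u : 'I_n -> R * R -> R) : 'I_n -> R * R -> R :=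
  fun j z => weak_derive (dt R) (u j) z + a j z.1 * weak_derive (dx R) (u j) z.

Definition opA (R : realType) (n : nat) (a b : 'I_n -> R -> R)
    (u : 'I_n -> R * R -> R) : 'I_n -> R * R -> R :=
  fun j z => transport a u j z + b j z.1 * u j z.

(* If d_x u is in W^0, a is in L^oo and the distribution d_t u + a d_x u is in
   W^gamma, then the distribution d_t u is a locally integrable function; hence
   requiring [has_weak_derive (dt R) u] is no restriction. *)
Definition U (R : realType) (n : nat) (gamma : R) (a : 'I_n -> R -> R)
    : set ('I_n -> R * R -> R) :=
  [set u | [/\ W gamma u,
               has_weak_derive (dx R) u,
               W 0 (fun j => weak_derive (dx R) (u j)),
               has_weak_derive (dt R) u
             & W gamma (transport a u)]].

Definition Unorm (R : realType) (n : nat) (gamma : R) (a : 'I_n -> R -> R)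
    (u : 'I_n -> R * R -> R) : R :=
  Num.sqrt (Wnorm gamma u ^+ 2 + Wnorm gamma (transport a u) ^+ 2).

Definition L2loc (R : realType) (h : R -> R) : Prop :=
  measurable_fun setT h /\
  forall T : R,
    (\int[lebesgue_measure]_(t in `[(- T)%R, T]) ((h t) ^+ 2)%R%:E < +oo)%E.

(* h is the trace of g on the line x = y, for y an endpoint of (0,1): some
   representative g' of g satisfies g'(x,.) --> h in L^2_loc as x --> y.
   This determines h almost everywhere. *)
Definition is_trace (R : realType) (y : R) (g : R * R -> R) (h : R -> R) : Prop :=
  L2loc h /\
  exists g' : R * R -> R,
    [/\ measurable_fun (strip R) g',
        {ae leb2 R, forall z, strip R z -> g' z = g z}
      & forall T : R,
          (\int[lebesgue_measure]_(t in `[(- T)%R, T])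
              ((g' (x, t) - h t) ^+ 2)%R%:E)%E
            @[x --> within `]0, 1[ (nbhs y)] --> 0%E].

(* The dimension is n = m + p: [lshift p] embeds the indices 1..m into 1..n and
   [rshift m] the indices m+1..n. *)
Definition V (R : realType) (m p : nat) (gamma : R) (a : 'I_(m + p) -> R -> R)
    (r0 : 'M[R]_(m, p)) (r1 : 'M[R]_(p, m)) : set ('I_(m + p) -> R * R -> R) :=
  [set u | U gamma a u /\
    exists u0 u1 : 'I_(m + p) -> R -> R,
      [/\ forall j, is_trace 0 (u j) (u0 j),
          forall j, is_trace 1 (u j) (u1 j),
          forall j : 'I_m, {ae (@lebesgue_measure R), forall t,
            u0 (lshift p j) t = \sum_(k < p) r0 j k * u0 (rshift m k) t}
        & forall j : 'I_p, {ae (@lebesgue_measure R), forall t,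
            u1 (rshift m j) t = \sum_(k < m) r1 j k * u1 (lshift p k) t}]].

Definition alpha (R : realType) (n : nat) (a : 'I_n -> R -> R) (j : 'I_n) (x : R)
    : R :=
  \int[lebesgue_measure]_(y in `[0, x]) (a j y)^-1.

Definition beta (R : realType) (n : nat) (a b : 'I_n -> R -> R) (j : 'I_n) (x : R)
    : R :=
  \int[lebesgue_measure]_(y in `[0, x]) (b j y / a j y).

Definition Rmx (R : realType) (m p : nat) (a b : 'I_(m + p) -> R -> R)
    (r0 : 'M[R]_(m, p)) (r1 : 'M[R]_(p, m)) (s : int) : 'M[R[i]]_p :=
  \matrix_(j < p, k < p)
    \sum_(l < m)
      cexp ((beta a b (rshift m j) 1 - beta a b (lshift p l) 1)
            +i* (s%:~R * (alpha a (rshift m j) 1 - alpha a (lshift p l) 1)))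
      * (r1 j l)%:C * (r0 l k)%:C.

(* [T], acting on representatives, induces a well defined and injective map
   on classes, which is linear, onto, bounded and has a bounded inverse. *)

Definition isomorphism (R : realType) (n : nat)
    (X : set ('I_n -> R * R -> R)) (normX : ('I_n -> R * R -> R) -> R)
    (Y : set ('I_n -> R * R -> R)) (normY : ('I_n -> R * R -> R) -> R)
    (T : ('I_n -> R * R -> R) -> ('I_n -> R * R -> R)) : Prop :=
  [/\ forall u, X u -> Y (T u),
      forall (k : R) u v, X u -> X v ->
        let w := fun j z => k * u j z + v j z in
        X w /\ ae_strip (T w) (fun j z => k * T u j z + T v j z),
      forall u v, X u -> X v -> (ae_strip (T u) (T v) <-> ae_strip u v),
      forall f, Y f -> exists2 u, X u & ae_strip (T u) f
    & (exists M : R, forall u, X u -> normY (T u) <= M * normX u) /\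
      (exists M : R, forall u, X u -> normX u <= M * normY (T u))].

(* Main.v *)
Require Import Defs.
From HB Require Import structures.
From mathcomp Require Import all_boot all_order all_algebra perm complex.
From mathcomp Require Import all_classical all_reals all_analysis ess_sup_inf measurable_realfun.
From mathcomp Require Import zify ring lra.

Set Implicit Arguments.
Unset Strict Implicit.
Unset Printing Implicit Defensive.

Import Order.TTheory GRing.Theory Num.Theory.
Import numFieldNormedType.Exports.

Local Open Scope classical_set_scope.
Local Open Scope ring_scope.

(** A Fourier expansion in t turns [A u = f] into the boundary value problems
    i s z + a z' + b z = f^_s on (0, 1), for s in Z.  Variation of constants gives
    z(x) = exp (- theta(x)) (z(0) + ...) with theta = i s alpha + beta, and the
    boundary conditions become a linear system for z(0) with determinant
    det (I - R_s).  Only the real part of theta enters the size of exp (- theta),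
    so |det| >= c and Cramer's rule give sup |z|^2 <= K int |f^_s|^2 with K
    depending on c, m and n only.  A function of V has as Fourier coefficients such
    solutions z, because a weak derivative tested against N(x) e^(i s t) is a
    one-dimensional weak derivative (du Bois-Reymond); uniqueness of Fourier
    coefficients then yields injectivity, and summation over s the estimate.
    Conversely, since gamma >= 1, the sum of the sup norms of the solutions z is
    finite, so that their Fourier series converges uniformly up to x = 0 and x = 1;
    its limit has the required traces, a t-derivative by Riesz-Fischer, and an
    x-derivative by the equation. *)

(** Since a and b are merely bounded and measurable, a mode solves its equation in the integrated
    sense only: [is_prim] pairs a function with its density, and product and chain rules for such
    pairs follow by summing increments of second order over fine partitions. All computations are
    real: f^_s is [fcos] - i [fsin], and the coefficient at -s is the conjugate of that at s, so
    that series run over s in [nat]. The constant is uniform in s because |exp (- theta)| = exp (-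
    beta), with beta bounded by means of c, and uniform in gamma because energies are compared for
    each s before any weight is applied. Summability of the sup norms is a weighted AM-GM
    inequality: with v = 1 + s^2 one has 2 |z| <= v |z|^2 + 1 / v, where sup v |z|^2 is summable
    thanks to gamma >= 1. The time derivative is not covered by this bound; its series is only known
    to converge in L^1 on boxes, which suffices to pass to the limit in weak derivatives and in
    Fourier coefficients. *)

Section almost_everywhere_monotone.
Context d (T : ringOfSetsType d) (R : realFieldType).
Variable mu : {measure set T -> \bar R}.
Implicit Types P Q S U : T -> Prop.

Lemma ae_imp P Q : (forall x, P x -> Q x) ->
  {ae mu, forall x, P x} -> {ae mu, forall x, Q x}.
Proof. by move=> PQ; apply: filterS => x; exact: PQ. Qed.

Lemma ae_imp2 P Q S : (forall x, P x -> Q x -> S x) ->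
  {ae mu, forall x, P x} -> {ae mu, forall x, Q x} -> {ae mu, forall x, S x}.
Proof. by move=> h; apply: filterS2 => x; exact: h. Qed.

Lemma ae_imp3 P Q S U : (forall x, P x -> Q x -> S x -> U x) ->
  {ae mu, forall x, P x} -> {ae mu, forall x, Q x} -> {ae mu, forall x, S x} ->
  {ae mu, forall x, U x}.
Proof. by move=> h; apply: filterS3 => x; exact: h. Qed.

End almost_everywhere_monotone.

(** * Real-valued Lebesgue integrals *)

Section integrals.
Context d (T : measurableType d) (R : realType).
Variable mu : {measure set T -> \bar R}.
Implicit Types (D : set T) (f g : T -> R).

Lemma integrable_measurable D f :
  mu.-integrable D (EFin \o f) -> measurable_fun D f.
Proof. by move=> /integrableP[/measurable_EFinP]. Qed.

Lemma integrable_bounded_mul D f g (K : R) : measurable D ->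
  mu.-integrable D (EFin \o f) -> measurable_fun D g ->
  (forall x, D x -> `|g x| <= K) ->
  mu.-integrable D (EFin \o (fun x => f x * g x)).
Proof.
move=> mD fi mg gK.
have -> : EFin \o (fun x => f x * g x) = ((EFin \o f) \* (EFin \o g))%E.
  by apply/funext => x /=; rewrite EFinM.
apply: integrableMl => //; exists K; split; first exact: num_real.
by move=> x Kx y /= Dy; apply: le_trans (ltW Kx); exact: gK.
Qed.

Lemma integrable_add D f g : measurable D ->
  mu.-integrable D (EFin \o f) -> mu.-integrable D (EFin \o g) ->
  mu.-integrable D (EFin \o (fun x => f x + g x)).
Proof.
by move=> mD fi gi; apply: eq_integrable (integrableD mD fi gi).
Qed.

Lemma integrable_sub D f g : measurable D ->
  mu.-integrable D (EFin \o f) -> mu.-integrable D (EFin \o g) ->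
  mu.-integrable D (EFin \o (fun x => f x - g x)).
Proof.
by move=> mD fi gi; apply: eq_integrable (integrableB mD fi gi).
Qed.

Lemma integrable_scale D f (k : R) : measurable D ->
  mu.-integrable D (EFin \o f) -> mu.-integrable D (EFin \o (fun x => k * f x)).
Proof.
by move=> mD fi; apply: eq_integrable (integrableZl mD k fi).
Qed.

Lemma integrable_opp D f : measurable D ->
  mu.-integrable D (EFin \o f) -> mu.-integrable D (EFin \o (fun x => - f x)).
Proof.
move=> mD fi; apply: eq_integrable (integrable_scale (-1) mD fi) => //.
by move=> x _ /=; rewrite mulN1r.
Qed.

Lemma finite_measure_integrable_cst_on D (K : R) : measurable D -> (mu D < +oo)%E ->
  mu.-integrable D (EFin \o cst K).
Proof.
move=> mD muD; apply/integrableP; split; first exact/measurable_EFinP/measurable_cst.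
rewrite (_ : (fun x => _) = cst (`|K|%:E)); last exact/funext.
by rewrite integral_cst// lte_mul_pinfty.
Qed.

Lemma integrable_bigsum D (I : Type) (s : seq I) (h : I -> T -> R) : measurable D ->
  (forall i, mu.-integrable D (EFin \o h i)) ->
  mu.-integrable D (EFin \o (fun x => \sum_(i <- s) h i x)).
Proof.
move=> mD hi; elim: s => [|i s ih].
  under [X in EFin \o X]eq_fun do rewrite big_nil.
  exact: integrable0.
under [X in EFin \o X]eq_fun do rewrite big_cons.
exact: integrable_add.
Qed.

Lemma Rintegral_bigsum D (I : Type) (s : seq I) (h : I -> T -> R) : measurable D ->
  (forall i, mu.-integrable D (EFin \o h i)) ->
  \int[mu]_(x in D) (\sum_(i <- s) h i x) = \sum_(i <- s) \int[mu]_(x in D) h i x.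
Proof.
move=> mD hi; elim: s => [|i s ih].
  under eq_Rintegral do rewrite big_nil.
  by rewrite big_nil Rintegral_cst// mul0r.
under eq_Rintegral do rewrite big_cons.
by rewrite RintegralD// ?ih ?big_cons//; exact: integrable_bigsum.
Qed.

Lemma integrable_dominated D f g : measurable D -> measurable_fun D f ->
  mu.-integrable D (EFin \o g) -> (forall x, D x -> `|f x| <= g x) ->
  mu.-integrable D (EFin \o f).
Proof.
move=> mD mf gi fg; apply: (le_integrable mD _ _ gi).
  exact/measurable_EFinP.
by move=> x Dx /=; rewrite lee_fin (le_trans (fg x Dx))// ler_norm.
Qed.

Lemma integrable_bounded D f (K : R) : measurable D -> (mu D < +oo)%E ->
  measurable_fun D f -> (forall x, D x -> `|f x| <= K) ->
  mu.-integrable D (EFin \o f).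
Proof.
move=> mD muD mf fK; apply: (@integrable_dominated _ _ (cst K)) => //.
exact: finite_measure_integrable_cst_on.
Qed.

Lemma ae_eq_Rintegral D f g : measurable D ->
  mu.-integrable D (EFin \o f) -> measurable_fun D g ->
  {ae mu, forall x, D x -> f x = g x} ->
  \int[mu]_(x in D) f x = \int[mu]_(x in D) g x.
Proof.
move=> mD fi mg fg; congr fine; apply: ae_eq_integral => //.
- exact: measurable_int fi.
- exact/measurable_EFinP.
- by apply: filterS fg => x /= h Dx; rewrite h.
Qed.

Lemma ae_eq_integrable D f g : measurable D ->
  mu.-integrable D (EFin \o f) -> measurable_fun D g ->
  {ae mu, forall x, D x -> f x = g x} -> mu.-integrable D (EFin \o g).
Proof.
move=> mD fi mg fg; apply/integrableP; split; first exact/measurable_EFinP.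
have /integrableP[mf] := fi.
rewrite (@ae_eq_integral _ _ _ mu D (fun x => `|(g x)%:E|)%E (fun x => `|(f x)%:E|)%E)//.
- by apply: measurableT_comp.
- by apply: measurableT_comp => //; exact/measurable_EFinP.
- by apply: filterS fg => x /= h Dx; rewrite h.
Qed.

Lemma Rintegral_norm_eq0 D f : measurable D -> mu.-integrable D (EFin \o f) ->
  \int[mu]_(x in D) `|f x| = 0 -> {ae mu, forall x, D x -> f x = 0}.
Proof.
move=> mD fi f0.
have fin : (\int[mu]_(x in D) `|(EFin \o f) x|)%E \is a fin_num.
  by apply: integrable_fin_num => //; apply: integrable_abse.
have : (\int[mu]_(x in D) `|(EFin \o f) x|)%E = 0%E.
  by rewrite -(fineK fin); congr EFin; rewrite -f0.
move=> /(ae_eq_integral_abs mu mD (measurable_int mu fi)).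
by apply: filterS => x /= h Dx; have [] := h Dx.
Qed.

Lemma Rintegral_dominated_cvg D (F : nat -> T -> R) f g : measurable D ->
  (forall n, measurable_fun D (F n)) -> measurable_fun D f ->
  (forall x, D x -> F ^~ x @ \oo --> f x) ->
  mu.-integrable D (EFin \o g) ->
  (forall n x, D x -> `|F n x| <= g x) ->
  (fun n => \int[mu]_(x in D) F n x) @ \oo --> \int[mu]_(x in D) f x.
Proof.
move=> mD mF mf Ff gi Fg.
have [] := @dominated_convergence _ _ _ mu D mD (fun n => EFin \o F n)
  (EFin \o f) (EFin \o g).
- by move=> n; exact/measurable_EFinP.
- exact/measurable_EFinP.
- by apply: aeW => x Dx; apply: cvg_EFin; [exact: nearW|exact: Ff].
- exact: gi.
- by apply: aeW => x n Dx; rewrite lee_fin; exact: Fg.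
move=> fi _ cv.
apply: fine_cvg; rewrite /Rintegral fineK//; exact: integrable_fin_num.
Qed.

Lemma Rintegral_le_norm D f (K : R) : measurable D -> (mu D < +oo)%E ->
  mu.-integrable D (EFin \o f) ->
  (forall x, D x -> `|f x| <= K) -> `|\int[mu]_(x in D) f x| <= K * fine (mu D).
Proof.
move=> mD muD fi fK; apply: (le_trans (le_normr_Rintegral mD fi)).
rewrite -Rintegral_cst//; apply: le_Rintegral => //.
- exact: integrable_norm.
- exact: finite_measure_integrable_cst_on.
Qed.

(** Meant for the partial integrals of Fubini's theorem, which take extended values: [fine] sends
    infinite values to 0, so the modulus cannot grow. *)
Lemma integrable_fine D (F : T -> \bar R) : measurable D ->
  mu.-integrable D F -> mu.-integrable D (EFin \o (fine \o F)).
Proof.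
move=> mD /integrableP[mF Fi]; apply/integrableP; split.
  by apply/measurable_EFinP; exact: measurableT_comp.
apply: le_lt_trans Fi; apply: ge0_le_integral => //.
- by apply: measurableT_comp => //; apply/measurable_EFinP; exact: measurableT_comp.
- exact: measurableT_comp.
- by move=> x _ /=; case: (F x) => //= *; rewrite normr0 leey.
Qed.

Lemma measurable_fun_bigsum D (I : Type) (s : seq I) (h : I -> T -> R) :
  (forall i, measurable_fun D (h i)) ->
  measurable_fun D (fun x => \sum_(i <- s) h i x).
Proof.
move=> mh; elim: s => [|i s ih].
  by under eq_fun do rewrite big_nil; exact: measurable_cst.
by under eq_fun do rewrite big_cons; exact: measurable_funD.
Qed.

End integrals.

(** * Fubini, Tonelli and null sets on product sets *)

Section product.
Context (R : realType).
Notation leb := (@lebesgue_measure R).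
Notation mR := (measurableTypeR R).
Implicit Types (A B : set mR) (g : mR * mR -> R).

Lemma restrict_setX A B g x t :
  (g \_ (A `*` B)) (x, t) = ((fun x => (fun t => g (x, t)) \_ B t) \_ A) x.
Proof.
rewrite !patchE; case: ifPn => [|/negP]; rewrite inE.
  by move=> -[/= Ax Bt]; rewrite !mem_set.
move=> AB; case: ifPn => //; rewrite inE => Ax.
by case: ifPn => //; rewrite inE => Bt; exfalso; apply: AB.
Qed.

Lemma integrable_setXP A B g : measurable A -> measurable B ->
  (leb2 R).-integrable (A `*` B) (EFin \o g) <->
  (leb2 R).-integrable setT (EFin \o (g \_ (A `*` B))).
Proof.
move=> mA mB; rewrite -restrict_EFin; apply: integrable_mkcond.
exact: measurableX.
Qed.

Lemma ae_integrable_section1 A B g : measurable A -> measurable B ->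
  (leb2 R).-integrable (A `*` B) (EFin \o g) ->
  {ae leb, forall x, A x -> leb.-integrable B (EFin \o (fun t => g (x, t)))}.
Proof.
move=> mA mB /(integrable_setXP _ mA mB) gi.
have := ae_integrable1 gi; apply: filterS => x /= + Ax.
move=> h; apply/(integrable_mkcond _ mB).
apply: eq_integrable h => // t _ /=.
by rewrite restrict_setX patchE mem_set// restrict_EFin.
Qed.

Lemma integrable_Rintegral_section1 A B g : measurable A -> measurable B ->
  (leb2 R).-integrable (A `*` B) (EFin \o g) ->
  leb.-integrable A (EFin \o (fun x => \int[leb]_(t in B) g (x, t))).
Proof.
move=> mA mB /(integrable_setXP _ mA mB) gi.
have Fi := integrable_fine measurableT (integrable_fubini_F gi).
apply/(integrable_mkcond _ mA); rewrite restrict_EFin.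
apply: eq_integrable Fi => // x _ /=; congr EFin; rewrite /fubini_F.
under eq_integral do rewrite /= restrict_setX.
rewrite [RHS]patchE; case: ifPn => xA.
  under eq_integral do rewrite patchE xA.
  by rewrite Rintegral_mkcond.
under eq_integral do rewrite patchE (negbTE xA).
by rewrite integral0.
Qed.

(** Fubini on the whole plane applied to the extension of [g] by zero. The inner real integral
    agrees with the extended one only where the section is integrable, that is for almost every
    x. *)
Lemma Rintegral_setX1 A B g : measurable A -> measurable B ->
  (leb2 R).-integrable (A `*` B) (EFin \o g) ->
  \int[leb2 R]_(z in A `*` B) g z = \int[leb]_(x in A) \int[leb]_(t in B) g (x, t).
Proof.
move=> mA mB gi0; have := gi0 => /(integrable_setXP _ mA mB) gi.
have Fi := integrable_Rintegral_section1 mA mB gi0.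
rewrite Rintegral_mkcond /Rintegral -(integral12_prod_meas1 gi).
rewrite [in RHS]integral_mkcond; congr fine.
apply: ae_eq_integral => //.
- exact: measurable_fubini_F gi.
- by apply/(measurable_restrictT _ mA); exact: measurable_int Fi.
have := ae_integrable1 gi; apply: filterS => x /(integrable_fin_num measurableT) + _.
rewrite /fubini_F /= => /fineK <-.
under eq_integral do rewrite /= restrict_setX.
rewrite [RHS]patchE; case: ifPn => xA.
  under eq_integral do rewrite patchE xA.
  by rewrite [in RHS]integral_mkcond restrict_EFin.
under eq_integral do rewrite patchE (negbTE xA).
by rewrite integral0.
Qed.

Lemma Rintegral_setX2 A B g : measurable A -> measurable B ->
  (leb2 R).-integrable (A `*` B) (EFin \o g) ->
  \int[leb2 R]_(z in A `*` B) g z = \int[leb]_(t in B) \int[leb]_(x in A) g (x, t).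
Proof.
move=> mA mB gi0; have := gi0 => /(integrable_setXP _ mA mB) gi.
rewrite Rintegral_mkcond /Rintegral -(integral21_prod_meas1 gi).
rewrite [in RHS]integral_mkcond; congr fine.
apply: ae_eq_integral => //.
- exact: measurable_fubini_G gi.
- apply: (eq_measurable_fun (EFin \o (fine \o fubini_G leb (EFin \o g \_ (A `*` B))))).
    move=> t _ /=; rewrite /fubini_G.
    under eq_integral do rewrite /= restrict_setX.
    rewrite [RHS]patchE; case: ifPn => tB.
      rewrite [in RHS]integral_mkcond restrict_EFin; congr (fine _)%:E.
      by apply: eq_integral => x _; rewrite !patchE tB.
    under eq_integral do rewrite patchE patchE (negbTE tB) if_same.
    by rewrite integral0.
  apply/measurable_EFinP; apply: measurableT_comp => //.
  exact: measurable_fubini_G gi.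
have := ae_integrable2 gi; apply: filterS => t /(integrable_fin_num measurableT) + _.
rewrite /fubini_G /= => /fineK <-.
under eq_integral do rewrite /= restrict_setX.
rewrite [RHS]patchE; case: ifPn => tB.
  rewrite [in RHS]integral_mkcond restrict_EFin; congr (fine _)%:E.
  by apply: eq_integral => x _; rewrite !patchE tB.
under eq_integral do rewrite patchE patchE (negbTE tB) if_same.
by rewrite integral0.
Qed.

(** Tonelli: an integrable majorant of the L^1 norms of the sections makes the double integral of
    |g| finite. *)
Lemma integrable_prod_of_section A B (g : mR * mR -> R) (h : mR -> R) :
  measurable A -> measurable B -> measurable_fun (A `*` B) g ->
  (forall x, A x -> leb.-integrable B (EFin \o (fun t => g (x, t)))) ->
  leb.-integrable A (EFin \o h) ->
  (forall x, A x -> \int[leb]_(t in B) `|g (x, t)| <= h x) ->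
  (leb2 R).-integrable (A `*` B) (EFin \o g).
Proof.
move=> mA mB mg gi hi gh; apply/(integrable_setXP _ mA mB).
have mG : measurable_fun setT (EFin \o g \_ (A `*` B)).
  by apply/measurable_EFinP; apply/(measurable_restrictT _ (measurableX mA mB)).
apply: (proj2 (integrable12ltyP leb leb mG)).
have /integrableP[mh hlt] := hi.
apply: le_lt_trans hlt; rewrite [leRHS]integral_mkcond.
apply: ge0_le_integral => //.
- by move=> x _; apply: integral_ge0.
- apply: (measurable_fun_fubini_tonelli_F (fun z => `|(EFin \o g \_ (A `*` B)) z|%E)) => //.
  exact: measurableT_comp.
- by apply/(measurable_restrictT _ mA); apply: measurableT_comp.
move=> x _.
under eq_integral do rewrite /= restrict_setX.
rewrite [leRHS]patchE; case: ifPn => xA.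
  under eq_integral do rewrite patchE xA.
  have Ax : A x by rewrite inE in xA.
  have -> : (\int[leb]_t (`|((fun t => g (x, t)) \_ B) t|)%:E =
     (\int[leb]_(t in B) `|g (x, t)|)%:E)%E.
    rewrite /Rintegral fineK; last first.
      by apply: integrable_fin_num => //; exact: (integrable_norm (gi x Ax)).
    by rewrite [RHS]integral_mkcond; apply: eq_integral => t _; rewrite !patchE;
      case: ifP; rewrite ?normr0.
  by rewrite lee_fin (le_trans (gh x Ax))// ler_norm.
under eq_integral do rewrite patchE (negbTE xA) normr0.
by rewrite integral0.
Qed.

Lemma ae_leb2_section1 (P : mR * mR -> Prop) :
  {ae leb2 R, forall z, P z} -> {ae leb, forall x, {ae leb, forall t, P (x, t)}}.
Proof.
move=> [N [mN N0 PN]].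
have mx x : measurable (xsection N x) by exact: measurable_xsection.
have F0 : (\int[leb]_x leb (xsection N x) = 0)%E by rewrite -N0.
have mF : measurable_fun setT (fun x => leb (xsection N x)).
  exact: measurable_fun_xsection.
have : ae_eq leb setT (fun x => leb (xsection N x)) (cst 0%E).
  apply/(ae_eq_integral_abs leb measurableT mF); rewrite -{}[RHS]F0.
  by apply: eq_integral => x _; rewrite gee0_abs.
apply: filterS => x /= /(_ I) x0; exists (xsection N x); split => // t /= Pt.
by rewrite /xsection /= inE; exact: PN.
Qed.

(** Null sections force a null set by Tonelli, which requires the exceptional set itself to be
    measurable; hence the first hypothesis, in contrast to the converse above. *)
Lemma ae_leb2_of_section (P : mR * mR -> Prop) : measurable [set z | P z] ->
  {ae leb, forall x, {ae leb, forall t, P (x, t)}} -> {ae leb2 R, forall z, P z}.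
Proof.
move=> mP h; exists (~` [set z | P z]); split => //; first exact: measurableC.
have mx x : measurable (xsection (~` [set z | P z]) x).
  by apply: measurable_xsection; exact: measurableC.
rewrite /leb2/= /product_measure1 /=.
transitivity (\int[leb]_(x in setT) (cst 0%E x))%E; last by rewrite integral0.
apply: ae_eq_integral => //.
- by apply: measurable_fun_xsection; exact: measurableC.
- apply: filterS h => x [N [mN N0 PN]] _ /=.
  apply/eqP; rewrite eq_le measure_ge0 andbT -N0 le_measure ?inE//.
  by move=> t; rewrite /xsection /= inE => Pt; exact: PN.
Qed.

End product.

(** * Translation invariance *)

Section translation.
Context (R : realType).
Notation leb := (@lebesgue_measure R).
Notation mR := (measurableTypeR R).

Lemma measurable_translate (h : R) : measurable_fun [set: mR] ((fun x => x + h) : mR -> mR).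
Proof. by apply: measurable_funD. Qed.

(** The pushforward under a translation agrees with Lebesgue measure on half-open intervals, so
    uniqueness of the extension applies. *)
Lemma lebesgue_translate (h : R) (A : set mR) : measurable A ->
  leb ((fun x => x + h) @^-1` A) = leb A.
Proof.
move=> mA; rewrite [RHS](@lebesgue_measure_unique R
  (pushforward leb ((fun x => x + h) : mR -> mR)))//.
  exact: measurable_translate.
move=> mh X [[a b] _ <-].
transitivity (leb (`]a - h, b - h] : set mR)); last first.
  transitivity (leb ((fun x : R => x + h) @^-1` (`]a, b] : set R))) => //; congr (leb _).
  by apply/seteqP; split=> x /=; rewrite !in_itv/= ltrBlDr lerBrDr.
have := @lebesgue_measure_itv R `]a, b]; have := @lebesgue_measure_itv R `]a - h, b - h].
rewrite /= => -> ->.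
by rewrite !lte_fin ltrD2r -!EFinD opprB addrA subrK.
Qed.

Lemma ae_translate (h : R) (P : mR -> Prop) :
  {ae leb, forall x, P x} -> {ae leb, forall x, P (x + h)}.
Proof.
move=> [N [mN N0 PN]]; exists ((fun x => x + h) @^-1` N); split.
- by rewrite -[X in measurable X]setTI; exact: measurable_translate.
- by rewrite lebesgue_translate.
- by move=> x /= Px; apply: PN.
Qed.

Lemma integral_translate (h : R) (F : mR -> \bar R) : leb.-integrable setT F ->
  leb.-integrable setT (fun x => F (x + h)%R) /\
  (\int[leb]_x F (x + h)%R = \int[leb]_x F x)%E.
Proof.
move=> Fi; have mF := measurable_int leb Fi.
pose phi := (fun x => x + h) : mR -> mR.
have mphi : measurable_fun setT phi by exact: measurable_translate.
have pushE (G : mR -> \bar R) :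
    (\int[pushforward leb phi]_x G x = \int[leb]_x G x)%E.
  by apply: eq_measure_integral => A mA _; exact: lebesgue_translate.
have Fphi : leb.-integrable setT (F \o phi).
  apply/integrableP; split; first exact: measurableT_comp.
  have /integrableP[_] := Fi; rewrite -pushE ge0_integral_pushforward//.
  exact: measurableT_comp.
by split => //; rewrite -(pushE F) (integral_pushforward mphi mF)//= preimage_setT.
Qed.

Lemma Rintegral_translate (h a b : R) (f : R -> R) :
  leb.-integrable `[a + h, b + h] (EFin \o f) ->
  leb.-integrable `[a, b] (EFin \o (fun x => f (x + h))) /\
  \int[leb]_(x in `[a, b]) f (x + h) = \int[leb]_(x in `[a + h, b + h]) f x.
Proof.
have mI (c e : R) : measurable (`[c, e] : set mR) by exact: measurable_itv.
move=> /(integrable_mkcond _ (mI _ _)) /(integral_translate h).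
have E : (fun x => ((EFin \o f) \_ `[a + h, b + h]) (x + h)) =
    (EFin \o (fun x => f (x + h))) \_ `[a, b].
  apply/funext => x; rewrite !patchE.
  have -> // : (x + h \in `[a + h, b + h]%classic) = (x \in `[a, b]%classic).
  by apply/idP/idP; rewrite !inE/= !in_itv/= !lerD2r.
rewrite E => -[fi fE]; split; first exact/(integrable_mkcond _ (mI _ _)).
rewrite /Rintegral [in LHS]integral_mkcond [in RHS]integral_mkcond -[in RHS]fE.
by congr fine; apply: eq_integral => x _; rewrite -E.
Qed.

Lemma ae_leb2_translate2 (h : R) (P : mR * mR -> Prop) :
  {ae leb2 R, forall z, P z} -> {ae leb2 R, forall z, P (z.1, z.2 + h)}.
Proof.
move=> [N [mN N0 PN]].
pose phi := (fun z => (z.1, z.2 + h)) : mR * mR -> mR * mR.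
have mphi : measurable_fun setT phi.
  apply: measurable_fun_pair; first exact: measurable_fst.
  by apply: (measurableT_comp (measurable_translate h)); exact: measurable_snd.
have mN' : measurable (phi @^-1` N) by rewrite -[X in measurable X]setTI; exact: mphi.
(* The argument is run on the measurable cover [N] instead of [P], because the return from sections
   to the plane is valid for measurable sets. *)
have : {ae leb2 R, forall z, ~ N z} by exists N; split => // z /= /contrapT.
move=> /ae_leb2_section1 aeN.
suff : {ae leb2 R, forall z, ~ N (phi z)}.
  by apply: filterS => z nN; apply: contrapT => /PN.
apply: ae_leb2_of_section; first exact: measurableC.
by apply: filterS aeN => x; exact: ae_translate.
Qed.

End translation.

(** * Indefinite integrals on [0, 1] *)

Section primitives.
Context (R : realType).
Notation leb := (@lebesgue_measure R).
Notation mR := (measurableTypeR R).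
Implicit Types (f g F : R -> R).

Definition prim f (x : R) : R := \int[leb]_(y in `[0, x]) f y.

Lemma prim0 f : prim f 0 = 0.
Proof. by rewrite /prim set_itv1 Rintegral_set1. Qed.

Lemma lebesgue_cc (a b : R) : a <= b ->
  (leb `[a, b] < +oo)%E /\ fine (leb `[a, b]) = b - a.
Proof.
move=> ab; suff -> : leb `[a, b] = (b - a)%:E by rewrite ltry.
have -> := @lebesgue_measure_itv R `[a, b].
move: ab; rewrite /= lte_fin le_eqVlt => /predU1P[->|->]; first by rewrite ltxx subrr.
by rewrite -EFinD.
Qed.

Lemma lebesgue_oo (a b : R) : a <= b ->
  (leb `]a, b[ < +oo)%E /\ fine (leb `]a, b[) = b - a.
Proof.
move=> ab; suff -> : leb `]a, b[ = (b - a)%:E by rewrite ltry.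
have -> := @lebesgue_measure_itv R `]a, b[.
move: ab; rewrite /= lte_fin le_eqVlt => /predU1P[->|->]; first by rewrite ltxx subrr.
by rewrite -EFinD.
Qed.

Lemma integrable_subitv (a b x y : R) f : leb.-integrable `[a, b] (EFin \o f) ->
  a <= x -> y <= b -> leb.-integrable `[x, y] (EFin \o f).
Proof.
move=> fi ax yb; apply: integrableS fi => // z /=; rewrite !in_itv/= => /andP[xz zy].
by rewrite (le_trans ax xz) (le_trans zy yb).
Qed.

Lemma Rintegral_itv_split (a b c : R) f : a <= b -> b <= c ->
  leb.-integrable `[a, c] (EFin \o f) ->
  \int[leb]_(x in `[a, c]) f x =
  \int[leb]_(x in `[a, b]) f x + \int[leb]_(x in `[b, c]) f x.
Proof.
move=> ab bc fi; have := @Rintegral_itvB R f (BLeft a) (BRight c) b fi.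
rewrite !bnd_simp => /(_ ab bc) /eqP; rewrite subr_eq => /eqP ->.
rewrite addrC Rintegral_itv_obnd_cbnd//.
apply: integrableS fi => // z /=; rewrite !in_itv/= => /andP[xz ->].
by rewrite (le_trans ab (ltW xz)).
Qed.

(** Bridge between the open interval, on which coefficients and weak derivatives are given, and the
    closed one, on which primitives and boundary values live. *)
Lemma Rintegral_itv_oo (a b : R) f : leb.-integrable `]a, b[ (EFin \o f) ->
  leb.-integrable `[a, b] (EFin \o f) /\
  \int[leb]_(x in `[a, b]) f x = \int[leb]_(x in `]a, b[) f x.
Proof.
move=> fi; have mf := integrable_measurable fi.
have mf' : measurable_fun `[a, b] f by apply/measurable_fun_itv_bndo_bndcP/measurable_fun_itv_obnd_cbndP.
have fi' : leb.-integrable `[a, b] (EFin \o f).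
  apply/integrableP; split; first exact/measurable_EFinP.
  have /integrableP[_] := fi.
  rewrite (@integral_itv_bndoo _ _ _ _ true false)//.
  by apply: measurableT_comp => //; exact/measurable_EFinP.
by split => //; rewrite /Rintegral integral_itv_bndoo//; exact/measurable_EFinP.
Qed.

Lemma integrable_cc_oo (a b : R) f : leb.-integrable `[a, b] (EFin \o f) ->
  leb.-integrable `]a, b[ (EFin \o f).
Proof. by apply: integrableS => //; exact: subset_itv_oo_cc. Qed.

Section on01.
Variable f : R -> R.
Hypothesis fi : leb.-integrable `[0, 1] (EFin \o f).

Lemma primB (x y : R) : 0 <= x -> x <= y -> y <= 1 ->
  prim f y - prim f x = \int[leb]_(z in `[x, y]) f z.
Proof.
move=> x0 xy y1; rewrite /prim (Rintegral_itv_split x0 xy); first by rewrite addrC addKr.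
exact: integrable_subitv fi _ _.
Qed.

Lemma prim_norm_le (x y : R) : 0 <= x -> x <= y -> y <= 1 ->
  `|prim f y - prim f x| <= prim (fun z => `|f z|) y - prim (fun z => `|f z|) x.
Proof.
move=> x0 xy y1; rewrite primB//.
have fi' := integrable_subitv fi x0 y1.
rewrite {1}/prim (Rintegral_itv_split x0 xy); last first.
  by apply: (integrable_norm); exact: integrable_subitv fi _ _.
by rewrite addrC addKr; exact: le_normr_Rintegral.
Qed.

Lemma prim_continuous : {within `[0, 1], continuous (prim f)}.
Proof. exact: parameterized_integral_continuous. Qed.

Lemma prim_Lipschitz (K : R) : (forall x, 0 <= x <= 1 -> `|f x| <= K) ->
  forall x y : R, 0 <= x -> x <= y -> y <= 1 -> `|prim f y - prim f x| <= K * (y - x).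
Proof.
move=> fK x y x0 xy y1; rewrite primB//.
have [xyoo <-] := lebesgue_cc xy.
apply: Rintegral_le_norm => //; first exact: integrable_subitv fi _ _.
move=> z /=; rewrite in_itv/= => /andP[xz zy]; apply: fK.
by rewrite (le_trans x0 xz) (le_trans zy y1).
Qed.

End on01.

(* Splitting [x, y] into n equal parts bounds |D y - D x| by K (y - x) (M y - M x) / n. *)
Lemma eq_of_small_increments (D M : R -> R) (K : R) : 0 <= K ->
  (forall x y, 0 <= x -> x <= y -> y <= 1 -> M x <= M y) ->
  (forall x y, 0 <= x -> x <= y -> y <= 1 ->
    `|D y - D x| <= K * (y - x) * (M y - M x)) ->
  forall x, 0 <= x <= 1 -> D x = D 0.
Proof.
move=> K0 Mnd DM x /andP[x0 x1].
have key n : `|D x - D 0| <= K * (M x - M 0) / n.+1%:R.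
  pose p k := x * k%:R / n.+1%:R.
  have pE k : (p k.+1 - p k = x / n.+1%:R) by rewrite /p -mulrBl -mulrBr -natrB// subSnn mulr1.
  have p0 : p 0%N = 0 by rewrite /p mulr0 mul0r.
  have pn : p n.+1 = x by rewrite /p mulfK// pnatr_eq0.
  have pge k : 0 <= p k by rewrite /p divr_ge0 ?mulr_ge0.
  have ple k : (k <= n.+1)%N -> p k <= 1.
    by move=> kn; rewrite (le_trans _ x1)// /p ler_pdivrMr ?ltr0n// ler_wpM2l// ler_nat.
  have pinc k : p k <= p k.+1 by rewrite -subr_ge0 pE divr_ge0.
  have H k : (k <= n.+1)%N -> `|D (p k) - D 0| <= K * (x / n.+1%:R) * (M (p k) - M 0).
    elim: k => [|k ih] kn; first by rewrite p0 !subrr normr0 mulr0.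
    have -> : D (p k.+1) - D 0 = (D (p k.+1) - D (p k)) + (D (p k) - D 0) by ring.
    rewrite (le_trans (ler_normD _ _))//.
    rewrite (le_trans (lerD (DM _ _ (pge k) (pinc k) (ple _ kn)) (ih (ltnW kn))))//.
    by rewrite pE -mulrDr subrKA.
  have := H n.+1 (leqnn _); rewrite pn => /le_trans; apply.
  rewrite -(mulrA K) -[leRHS]mulrA ler_wpM2l// mulrAC ler_wpM2r// ?invr_ge0//.
  by rewrite ler_piMl// subr_ge0 Mnd.
apply/eqP; rewrite -subr_eq0 -normr_eq0 eq_le normr_ge0 andbT.
apply/ler_addgt0Pl => e e0; rewrite addr0.
pose A := K * (M x - M 0).
have [n An] : exists n, A / e < n.+1%:R.
  by exists (Num.trunc (A / e)); rewrite truncnS_gt.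
apply: (le_trans (key n)); rewrite -/A ler_pdivrMr ?ltr0n// [leRHS]mulrC -ler_pdivrMr//.
exact: ltW.
Qed.

End primitives.

(** * Absolutely continuous functions: product and chain rule *)

Section absolutely_continuous.
Context (R : realType).
Notation leb := (@lebesgue_measure R).
Notation mR := (measurableTypeR R).
Implicit Types (f g F G : R -> R).

(** Absolute continuity of [F] on [0, 1] with the density kept as data. The density may be changed
    on null sets, and differential equations become identities between densities. *)
Definition is_prim F f := leb.-integrable `[0, 1] (EFin \o f) /\
  forall x, 0 <= x <= 1 -> F x = F 0 + prim f x.

Definition bounded01 f := exists K : R, forall x, 0 <= x <= 1 -> `|f x| <= K.

Lemma is_prim_incr F f (x y : R) : is_prim F f -> 0 <= x -> x <= y -> y <= 1 ->
  F y - F x = \int[leb]_(z in `[x, y]) f z.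
Proof.
move=> [fi FE] x0 xy y1; rewrite -(primB fi x0 xy y1) (FE x) ?(FE y).
- by ring.
- by rewrite y1 (le_trans x0).
- by rewrite x0 (le_trans xy).
Qed.

Lemma is_prim_continuous F f : is_prim F f -> {within `[0, 1], continuous F}.
Proof.
move=> [fi FE].
have : {within `[0, 1], continuous (fun x => F 0 + prim f x)}.
  apply: (@within_continuousD _ _ _ _ (cst (F 0)) (prim f)); last exact: prim_continuous.
  by apply: continuous_subspaceT => x; exact: cvg_cst.
apply: subspace_eq_continuous => x; rewrite inE/= in_itv/= => x01.
by rewrite /from_subspace; apply/esym; exact: FE.
Qed.

Lemma is_prim_measurable F f : is_prim F f -> measurable_fun (`[0, 1] : set mR) F.
Proof.
move=> /is_prim_continuous cF; exact: subspace_continuous_measurable_fun.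
Qed.

Lemma is_prim_bounded F f : is_prim F f -> bounded01 F.
Proof.
move=> Ff; have [fi _] := Ff.
exists (`|F 0| + prim (fun z => `|f z|) 1) => x /andP[x0 x1].
have -> : F x = F 0 + (F x - F 0) by ring.
apply: (le_trans (ler_normD _ _)); rewrite lerD2l (is_prim_incr Ff) ?lexx//.
have fix_ : leb.-integrable `[0, x] (EFin \o f) by exact: integrable_subitv fi _ _.
apply: (le_trans (le_normr_Rintegral _ fix_)) => //.
rewrite /prim (Rintegral_itv_split x0 x1) ?lerDl; first exact: Rintegral_ge0.
exact: integrable_norm.
Qed.

Lemma is_prim_Lipschitz F f (K : R) : is_prim F f ->
  (forall x, 0 <= x <= 1 -> `|f x| <= K) ->
  forall x y, 0 <= x -> x <= y -> y <= 1 -> `|F y - F x| <= K * (y - x).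
Proof.
move=> Ff fK x y x0 xy y1; rewrite (is_prim_incr Ff)// -(primB Ff.1)//.
exact: (prim_Lipschitz Ff.1).
Qed.

Lemma is_primD F f G g : is_prim F f -> is_prim G g ->
  is_prim (fun x => F x + G x) (fun x => f x + g x).
Proof.
move=> [fi FE] [gi GE]; split; first exact: integrable_add.
move=> x x01; rewrite FE// GE// /prim RintegralD//; first by ring.
- by apply: integrable_subitv fi _ _ => //; case/andP: x01.
- by apply: integrable_subitv gi _ _ => //; case/andP: x01.
Qed.

Lemma is_primZ F f (k : R) : is_prim F f ->
  is_prim (fun x => k * F x) (fun x => k * f x).
Proof.
move=> [fi FE]; split; first exact: integrable_scale.
move=> x x01; rewrite FE// /prim RintegralZl//; first by ring.
by apply: integrable_subitv fi _ _ => //; case/andP: x01.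
Qed.

Lemma is_primB F f G g : is_prim F f -> is_prim G g ->
  is_prim (fun x => F x - G x) (fun x => f x - g x).
Proof.
move=> Ff /(is_primZ (-1)) Gg.
rewrite (_ : (fun x => F x - G x) = fun x => F x + -1 * G x); last first.
  by apply/funext => x; ring.
rewrite (_ : (fun x => f x - g x) = fun x => f x + -1 * g x); last first.
  by apply/funext => x; ring.
exact: is_primD.
Qed.

Lemma is_prim_prim f (k : R) : leb.-integrable `[0, 1] (EFin \o f) ->
  is_prim (fun x => k + prim f x) f.
Proof. by move=> fi; split => // x x01; rewrite prim0 addr0. Qed.

(** For D = F G - [prim] (f G + F g), the increment over [y, z] is the sum of the integrals of f(w)
    (G z - G w) and g(w) (F y - F w). Boundedness of g makes G Lipschitz, and F varies by at most M
    z - M y with M the primitive of |f|; so each integral is at most K (z - y) (M z - M y), and D is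
    constant. *)
Lemma is_prim_mul F f G g (K : R) : is_prim F f -> is_prim G g ->
  (forall x, 0 <= x <= 1 -> `|g x| <= K) ->
  is_prim (fun x => F x * G x) (fun x => f x * G x + F x * g x).
Proof.
move=> Ff Gg gK; have [fi FE] := Ff; have [gi GE] := Gg.
have K0 : 0 <= K by rewrite (le_trans _ (gK 0 _)) ?lexx ?ler01.
have [BG GB] := is_prim_bounded Gg.
have [BF FB] := is_prim_bounded Ff.
have hi1 : leb.-integrable `[0, 1] (EFin \o (fun x => f x * G x)).
  apply: (integrable_bounded_mul _ fi (is_prim_measurable Gg) (K := BG)) => //.
have hi2 : leb.-integrable `[0, 1] (EFin \o (fun x => F x * g x)).
  under [X in EFin \o X]eq_fun do rewrite mulrC.
  apply: (integrable_bounded_mul _ gi (is_prim_measurable Ff) (K := BF)) => //.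
have hi : leb.-integrable `[0, 1] (EFin \o (fun x => f x * G x + F x * g x)).
  exact: integrable_add.
split => // x x01.
pose D y := F y * G y - prim (fun x => f x * G x + F x * g x) y.
pose M := prim (fun z => `|f z|).
have MP : is_prim M (fun z => `|f z|).
  by split; [exact: integrable_norm|move=> y _; rewrite /M prim0 add0r].
have Mnd (y z : R) : 0 <= y -> y <= z -> z <= 1 -> M y <= M z.
  move=> y0 yz z1; rewrite -subr_ge0 (is_prim_incr MP)//; exact: Rintegral_ge0.
suff /(_ x x01) : forall x, 0 <= x <= 1 -> D x = D 0.
  by rewrite /D prim0 subr0 => <-; ring.
apply: (@eq_of_small_increments _ _ M (2 * K)) => //; first by rewrite mulr_ge0.
move=> y z y0 yz z1.
have fyz : leb.-integrable `[y, z] (EFin \o f) by exact: integrable_subitv fi _ _.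
have gyz : leb.-integrable `[y, z] (EFin \o g) by exact: integrable_subitv gi _ _.
have h1 : leb.-integrable `[y, z] (EFin \o (fun x => f x * G x)) by exact: integrable_subitv hi1 _ _.
have h2 : leb.-integrable `[y, z] (EFin \o (fun x => F x * g x)) by exact: integrable_subitv hi2 _ _.
have DE : D z - D y = \int[leb]_(w in `[y, z]) (f w * (G z - G w)) +
    \int[leb]_(w in `[y, z]) (g w * (F y - F w)).
  have E1 : \int[leb]_(w in `[y, z]) (f w * (G z - G w)) =
     G z * (F z - F y) - \int[leb]_(w in `[y, z]) (f w * G w).
    rewrite (is_prim_incr Ff)// -RintegralZl// -RintegralB//; last exact: integrable_scale.
    by apply: eq_Rintegral => w _; ring.
  have E2 : \int[leb]_(w in `[y, z]) (g w * (F y - F w)) =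
     F y * (G z - G y) - \int[leb]_(w in `[y, z]) (F w * g w).
    rewrite (is_prim_incr Gg)// -RintegralZl// -RintegralB//; last exact: integrable_scale.
    by apply: eq_Rintegral => w _; ring.
  rewrite {}E1 {}E2 /D.
  have -> : F z * G z - prim (fun x => f x * G x + F x * g x) z -
    (F y * G y - prim (fun x => f x * G x + F x * g x) y) = F z * G z - F y * G y -
    (prim (fun x => f x * G x + F x * g x) z - prim (fun x => f x * G x + F x * g x) y).
    by ring.
  by rewrite (primB hi)// RintegralD//; ring.
have FM (w : R) : y <= w <= z -> `|F y - F w| <= M z - M y.
  move=> /andP[yw wz]; rewrite distrC (is_prim_incr Ff) ?(le_trans wz)//.
  have fyw : leb.-integrable `[y, w] (EFin \o f) by exact: integrable_subitv fyz _ _.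
  apply: (le_trans (le_normr_Rintegral _ fyw)) => //.
  rewrite -(is_prim_incr MP) ?(le_trans wz)// lerD2r Mnd ?(le_trans y0)//.
have GM (w : R) : y <= w <= z -> `|G z - G w| <= K * (z - y).
  move=> /andP[yw wz]; apply: (le_trans (is_prim_Lipschitz Gg gK _ _ _)) => //.
    exact: le_trans yw.
  by rewrite ler_wpM2l// lerD2l lerN2.
rewrite DE; apply: (le_trans (ler_normD _ _)).
have -> : 2 * K * (z - y) * (M z - M y) =
    (K * (z - y)) * (M z - M y) + K * (M z - M y) * (z - y) by ring.
have m1 : measurable_fun `[y, z] G.
  apply: measurable_funS (is_prim_measurable Gg) => // w /=; rewrite !in_itv/= => /andP[yw wz].
  by rewrite (le_trans y0 yw) (le_trans wz z1).
have m2 : measurable_fun `[y, z] F.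
  apply: measurable_funS (is_prim_measurable Ff) => // w /=; rewrite !in_itv/= => /andP[yw wz].
  by rewrite (le_trans y0 yw) (le_trans wz z1).
apply: lerD.
- have hI : leb.-integrable `[y, z] (EFin \o (fun w => f w * (G z - G w))).
    have mGG : measurable_fun (`[y, z] : set mR) (fun w => G z - G w).
      by apply: measurable_funB.
    by apply: (integrable_bounded_mul _ fyz mGG) => // w; rewrite /= in_itv; exact: GM.
  apply: (le_trans (le_normr_Rintegral _ hI)) => //.
  rewrite (is_prim_incr MP)// -RintegralZl//; last exact: integrable_norm.
  apply: le_Rintegral => //; [exact: integrable_norm|
    by apply: integrable_scale => //; exact: integrable_norm|].
  by move=> w /=; rewrite in_itv/= => wyz; rewrite normrM mulrC ler_wpM2r// GM.
- have hI : leb.-integrable `[y, z] (EFin \o (fun w => g w * (F y - F w))).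
    have mFF : measurable_fun (`[y, z] : set mR) (fun w => F y - F w).
      by apply: measurable_funB.
    by apply: (integrable_bounded_mul _ gyz mFF) => // w; rewrite /= in_itv; exact: FM.
  have [yzoo <-] := lebesgue_cc yz.
  apply: Rintegral_le_norm => // w /=; rewrite in_itv/= => wyz.
  rewrite normrM ler_pM// ?FM// gK//; case/andP: wyz => yw wz.
  by rewrite (le_trans y0 yw) (le_trans wz z1).
Qed.

Lemma derive_increment_le (phi dphi : R -> R) (B L : R) :
  (forall x : R, is_derive x 1 phi (dphi x)) ->
  (forall x, `|x| <= B -> `|dphi x| <= L) ->
  forall u v, `|u| <= B -> `|v| <= B -> `|phi v - phi u| <= L * `|v - u|.
Proof.
move=> dphiP dL.
have main u v : u <= v -> `|u| <= B -> `|v| <= B -> `|phi v - phi u| <= L * `|v - u|.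
  move=> uv uB vB.
  have [|c] := @MVT_segment _ phi dphi u v uv (fun x _ => dphiP x).
    apply: continuous_subspaceT => x.
    exact/differentiable_continuous/derivable1_diffP/(@ex_derive _ _ _ _ _ _ _ (dphiP x)).
  rewrite in_itv/= => /andP[uc cv] ->; rewrite normrM ler_wpM2r// dL//.
  move: uB vB; rewrite !ler_norml => /andP[Bu uB] /andP[Bv vB].
  by rewrite (le_trans Bu uc) (le_trans cv vB).
move=> u v uB vB; have [uv|/ltW vu] := leP u v; first exact: main.
by rewrite distrC [X in L * X]distrC main.
Qed.

(** F is Lipschitz because f is bounded, so the increment of phi(F) - [prim] (dphi(F) f) is a
    first-order Taylor remainder of phi plus an integral of (dphi(F y) - dphi(F w)) f(w); both are
    O((z - y)^2), and increments of that order add up to zero. *)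
Lemma is_prim_comp F f (K : R) (phi dphi ddphi : R -> R) (B L : R) : is_prim F f ->
  (forall x, 0 <= x <= 1 -> `|f x| <= K) ->
  (forall x, 0 <= x <= 1 -> `|F x| <= B) ->
  (forall x : R, is_derive x 1 phi (dphi x)) ->
  (forall x : R, is_derive x 1 dphi (ddphi x)) ->
  (forall x, `|x| <= B -> `|ddphi x| <= L) ->
  is_prim (fun x => phi (F x)) (fun x => dphi (F x) * f x).
Proof.
move=> Ff fK FB dphiP ddphiP ddL; have [fi FE] := Ff.
have K0 : 0 <= K by rewrite (le_trans _ (fK 0 _)) ?lexx ?ler01.
have B0 : 0 <= B by rewrite (le_trans _ (FB 0 _)) ?lexx ?ler01.
have L0 : 0 <= L by rewrite (le_trans _ (ddL 0 _)) ?normr0.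
have dL := derive_increment_le ddphiP ddL.
have cdphi : continuous dphi.
  move=> x; exact/differentiable_continuous/derivable1_diffP/(@ex_derive _ _ _ _ _ _ _ (ddphiP x)).
have mF := is_prim_measurable Ff.
have mdF : measurable_fun (`[0, 1] : set mR) (fun x => dphi (F x)).
  by apply: measurableT_comp mF; exact: continuous_measurable_fun.
have dB x : 0 <= x <= 1 -> `|dphi (F x)| <= `|dphi 0| + L * B.
  move=> x01; have -> : dphi (F x) = dphi 0 + (dphi (F x) - dphi 0) by ring.
  apply: (le_trans (ler_normD _ _)); rewrite lerD2l.
  apply: (le_trans (dL _ _ _ _)); rewrite ?normr0 ?FB//.
  by rewrite subr0 ler_wpM2l// FB.
have hi : leb.-integrable `[0, 1] (EFin \o (fun x => dphi (F x) * f x)).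
  under [X in EFin \o X]eq_fun do rewrite mulrC.
  by apply: (integrable_bounded_mul _ fi mdF) => // x /=; rewrite in_itv; exact: dB.
split => // x x01.
pose D y := phi (F y) - prim (fun x => dphi (F x) * f x) y.
suff /(_ x x01) : forall x, 0 <= x <= 1 -> D x = D 0.
  by rewrite /D prim0 subr0 => <-; ring.
apply: (@eq_of_small_increments _ _ id (2 * L * K ^+ 2)) => //.
  by rewrite !mulr_ge0// sqr_ge0.
move=> y z y0 yz z1.
have y1 := le_trans yz z1; have z0 := le_trans y0 yz.
have y01 : 0 <= y <= 1 by rewrite y0.
have z01 : 0 <= z <= 1 by rewrite z0.
have fyz : leb.-integrable `[y, z] (EFin \o f) by exact: integrable_subitv fi _ _.
have hyz : leb.-integrable `[y, z] (EFin \o (fun x => dphi (F x) * f x)).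
  exact: integrable_subitv hi _ _.
have FK w : y <= w <= z -> `|F w - F y| <= K * (z - y).
  move=> /andP[yw wz]; apply: (le_trans (is_prim_Lipschitz Ff fK _ _ _)) => //.
    exact: le_trans wz z1.
  by rewrite ler_wpM2l// lerD2r.
have DE : D z - D y = (phi (F z) - phi (F y) - dphi (F y) * (F z - F y)) +
    \int[leb]_(w in `[y, z]) ((dphi (F y) - dphi (F w)) * f w).
  have -> : \int[leb]_(w in `[y, z]) ((dphi (F y) - dphi (F w)) * f w) =
     dphi (F y) * (F z - F y) - \int[leb]_(w in `[y, z]) (dphi (F w) * f w).
    rewrite (is_prim_incr Ff)// -RintegralZl// -RintegralB//; last exact: integrable_scale.
    by apply: eq_Rintegral => w _; ring.
  rewrite /D -(primB hi)//; by ring.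
rewrite DE; apply: (le_trans (ler_normD _ _)).
have -> : 2 * L * K ^+ 2 * (z - y) * (z - y) =
  (L * (K * (z - y))) * (K * (z - y)) + ((L * (K * (z - y))) * K) * (z - y) by ring.
have zy0 : 0 <= z - y by rewrite subr_ge0.
apply: lerD.
(* The remainder is an increment of u |-> phi u - dphi(F y) u, whose derivative is small near F y;
   the mean value theorem is applied on [F y, F z] or [F z, F y] according to their order. *)
- have gP (u : R) : is_derive u 1 (fun u => phi u - dphi (F y) * u) (dphi u - dphi (F y)).
    have -> : (fun u => phi u - dphi (F y) * u) = phi - (dphi (F y) *: (id : R -> R)).
      by apply/funext.
    have h := @is_deriveZ _ _ _ (id : R -> R) (dphi (F y)) u 1 _ (is_derive_id u 1).
    by have := is_deriveB (dphiP u) h; rewrite [_ *: 1]mulr1.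
  have [uv|vu] := leP (F y) (F z).
  + have [|c] := @MVT_segment _ _ _ _ _ uv (fun x _ => gP x).
      apply: continuous_subspaceT => u.
      exact/differentiable_continuous/derivable1_diffP/(@ex_derive _ _ _ _ _ _ _ (gP u)).
    rewrite in_itv/= => /andP[yc cz] E.
    have -> : phi (F z) - phi (F y) - dphi (F y) * (F z - F y) =
      phi (F z) - dphi (F y) * F z - (phi (F y) - dphi (F y) * F y) by ring.
    have cB : `|c| <= B.
      have := FB y y01; have := FB z z01; rewrite !ler_norml => /andP[_ h1] /andP[h2 _].
      by rewrite (le_trans h2 yc) (le_trans cz h1).
    rewrite E normrM; apply: ler_pM => //; last by apply: FK; rewrite yz lexx.
    apply: (le_trans (dL _ _ _ _)) => //; first exact: FB.
    rewrite ler_wpM2l//; apply: (le_trans _ (FK z _)); last by rewrite yz lexx.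
    by rewrite !ger0_norm ?subr_ge0// lerD2r.
  + have [|c] := @MVT_segment _ _ _ _ _ (ltW vu) (fun x _ => gP x).
      apply: continuous_subspaceT => u.
      exact/differentiable_continuous/derivable1_diffP/(@ex_derive _ _ _ _ _ _ _ (gP u)).
    rewrite in_itv/= => /andP[zc cy] E.
    have -> : phi (F z) - phi (F y) - dphi (F y) * (F z - F y) =
      - (phi (F y) - dphi (F y) * F y - (phi (F z) - dphi (F y) * F z)) by ring.
    have cB : `|c| <= B.
      have := FB y y01; have := FB z z01; rewrite !ler_norml => /andP[h1 _] /andP[_ h2].
      by rewrite (le_trans h1 zc) (le_trans cy h2).
    rewrite E normrN normrM; apply: ler_pM => //; last first.
      by rewrite distrC; apply: FK; rewrite yz lexx.
    apply: (le_trans (dL _ _ _ _)) => //; first exact: FB.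
    rewrite ler_wpM2l//; apply: (le_trans _ (FK z _)); last by rewrite yz lexx.
    by rewrite distrC [leRHS]distrC !ger0_norm ?subr_ge0// ?(ltW vu)// lerD2l lerN2.
- have [yzoo yzE] := lebesgue_cc yz.
  rewrite -[X in _ <= _ * X]yzE.
  have sub : `[y, z] `<=` (`[0, 1] : set mR).
    by move=> w /=; rewrite !in_itv/= => /andP[yw wz]; rewrite (le_trans y0 yw) (le_trans wz z1).
  have bnd w : y <= w <= z -> `|dphi (F y) - dphi (F w)| <= L * (K * (z - y)).
    move=> ywz; have w01 : 0 <= w <= 1.
      by move: ywz => /andP[yw wz]; rewrite (le_trans y0 yw) (le_trans wz z1).
    rewrite distrC; apply: (le_trans (dL _ _ _ _)); rewrite ?FB//.
    by rewrite ler_wpM2l// FK.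
  apply: Rintegral_le_norm => //.
    under [X in EFin \o X]eq_fun do rewrite mulrC.
    have mw : measurable_fun (`[y, z] : set mR) (fun w => dphi (F y) - dphi (F w)).
      by apply: measurable_funB => //; exact: measurable_funS mdF.
    by apply: (integrable_bounded_mul _ fyz mw) => // w; rewrite /= in_itv; exact: bnd.
  move=> w wyz; have := wyz; rewrite /= in_itv/= => wyz'.
  rewrite normrM; apply: ler_pM => //; first exact: bnd.
  by apply: fK; have := sub w wyz; rewrite /= in_itv.
Qed.

End absolutely_continuous.

(** * Smooth functions of one variable *)

Section smooth_functions.
Context (R : realType).
Implicit Types (f g : R -> R).

(* The algebra generated by a set B of functions; it is stable under
   differentiation as soon as the derivatives of the elements of B belong to it. *)
Inductive generated (T : Type) (B : set (T -> R)) : (T -> R) -> Prop :=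
| gen_base u : B u -> generated B u
| gen_cst k : generated B (cst k)
| gen_add u v : generated B u -> generated B v -> generated B (fun x => u x + v x)
| gen_mul u v : generated B u -> generated B v -> generated B (fun x => u x * v x).

Definition derivative_closed (S : set (R -> R)) :=
  forall f, S f -> exists2 g, S g & forall x : R, is_derive x 1 f (g x).

(** C^oo regularity in coinductive form: membership in some set of functions stable under
    differentiation. Smoothness is then proved by exhibiting such a set, usually a generated
    algebra, without iterating derivatives. *)
Definition smooth1 f := exists S, derivative_closed S /\ S f.

Lemma is_derive_mul f g (x a b : R) : is_derive x 1 f a -> is_derive x 1 g b ->
  is_derive x 1 (fun y => f y * g y) (a * g x + f x * b).
Proof.
move=> fa gb; have := is_deriveM fa gb.
rewrite (_ : f * g = fun y => f y * g y)// => h; apply: is_derive_eq h _.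
by rewrite /GRing.scale/= addrC mulrC.
Qed.

Lemma is_derive_add f g (x a b : R) : is_derive x 1 f a -> is_derive x 1 g b ->
  is_derive x 1 (fun y => f y + g y) (a + b).
Proof. by move=> fa gb; have := is_deriveD fa gb. Qed.

Lemma generated_derivative_closed (B : set (R -> R)) :
  (forall f, B f -> exists2 g, generated B g & forall x : R, is_derive x 1 f (g x)) ->
  derivative_closed (generated B).
Proof.
move=> HB f; elim=> {f} [f /HB//|k|f g fB [f' f'B fd] gB [g' g'B gd]|
  f g fB [f' f'B fd] gB [g' g'B gd]].
- by exists (cst 0); [exact: gen_cst|move=> x; exact: is_derive_cst].
- exists (fun x => f' x + g' x); first exact: gen_add.
  by move=> x; exact: is_derive_add.
- exists (fun x => f' x * g x + f x * g' x); first by apply: gen_add; exact: gen_mul.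
  by move=> x; exact: is_derive_mul.
Qed.

Lemma smooth1_gen (B : set (R -> R)) f :
  (forall f, B f -> exists2 g, generated B g & forall x : R, is_derive x 1 f (g x)) ->
  generated B f -> smooth1 f.
Proof. by move=> HB Bf; exists (generated B); split => //; exact: generated_derivative_closed. Qed.

Lemma smooth1_derive f : smooth1 f ->
  exists2 g, smooth1 g & forall x : R, is_derive x 1 f (g x).
Proof. by move=> [S [HS /[dup] /HS [g Sg fg] Sf]]; exists g => //; exists S. Qed.

Lemma smooth1_alg f : generated smooth1 f -> smooth1 f.
Proof.
apply: smooth1_gen => {}f /smooth1_derive [g sg fg]; exists g => //.
exact: gen_base.
Qed.

Lemma smooth1_cst (k : R) : smooth1 (cst k).
Proof. by apply: smooth1_alg; exact: gen_cst. Qed.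

Lemma smooth1_add f g : smooth1 f -> smooth1 g -> smooth1 (fun x => f x + g x).
Proof. by move=> sf sg; apply: smooth1_alg; apply: gen_add; exact: gen_base. Qed.

Lemma smooth1_mul f g : smooth1 f -> smooth1 g -> smooth1 (fun x => f x * g x).
Proof. by move=> sf sg; apply: smooth1_alg; apply: gen_mul; exact: gen_base. Qed.

Lemma smooth1_scale k f : smooth1 f -> smooth1 (fun x => k * f x).
Proof. by move=> sf; exact: smooth1_mul (smooth1_cst k) sf. Qed.

Lemma smooth1_sub f g : smooth1 f -> smooth1 g -> smooth1 (fun x => f x - g x).
Proof.
move=> sf sg; rewrite (_ : (fun _ => _) = (fun x => f x + (-1) * g x)).
  exact: smooth1_add sf (smooth1_scale _ sg).
by apply/funext => x; rewrite mulN1r.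
Qed.

Lemma smooth1_primitive F f : smooth1 f -> (forall x : R, is_derive x 1 F (f x)) ->
  smooth1 F.
Proof.
move=> sf Ff; apply: (@smooth1_gen [set g | smooth1 g \/ g = F]); last by apply: gen_base; right.
move=> g [|->].
  by move=> /smooth1_derive [g' sg' gg']; exists g' => //; apply: gen_base; left.
by exists f => //; apply: gen_base; left.
Qed.

Lemma is_derive_affine f (f' : R -> R) (p q x : R) :
  (forall x : R, is_derive x 1 f (f' x)) ->
  is_derive x 1 (fun x => f (p * x + q)) (p * f' (p * x + q)).
Proof.
move=> ff'.
have h : is_derive x 1 (fun x : R => p * x + q) p.
  have h1 := @is_deriveZ _ _ _ (id : R -> R) p x 1 _ (is_derive_id x 1).
  have := is_deriveD h1 (is_derive_cst q x 1); rewrite addr0 [_ *: 1]mulr1.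
  by rewrite (_ : _ + _ = (fun x : R => p * x + q)).
have := @is_derive1_comp _ f (fun x : R => p * x + q) x _ _ (ff' _) h.
by rewrite mulrC.
Qed.

Lemma smooth1_affine f (p q : R) : smooth1 f -> smooth1 (fun x => f (p * x + q)).
Proof.
move=> sf; exists [set g | exists h k, smooth1 h /\ g = fun x => k * h (p * x + q)].
split; last by exists f, 1; split => //; apply/funext => x; rewrite mul1r.
move=> g [h [k [/smooth1_derive [h' sh' hh'] ->]]].
exists (fun x => k * p * h' (p * x + q)); first by exists h', (k * p).
move=> x; have := is_derive_mul (is_derive_cst k x 1) (is_derive_affine p q x hh').
by rewrite mul0r add0r mulrA.
Qed.

(** Adjoining 1 / f to the smooth functions keeps the generated algebra stable, because the
    derivative - f' (1 / f)^2 is again a polynomial in the generators. *)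
Lemma smooth1_inv f : smooth1 f -> (forall x, f x != 0) -> smooth1 (fun x => (f x)^-1).
Proof.
move=> sf f0; pose B := [set g | smooth1 g \/ g = fun x => (f x)^-1].
apply: (@smooth1_gen B); last by apply: gen_base; right.
move=> g [|->].
  by move=> /smooth1_derive [g' sg' gg']; exists g' => //; apply: gen_base; left.
have [f' sf' ff'] := smooth1_derive sf.
exists (fun x => (fun x => -1 * f' x) x * (fun x => (f x)^-1 * (f x)^-1) x).
  apply: gen_mul; first by apply: gen_base; left; exact: smooth1_scale.
  by apply: gen_mul; apply: gen_base; right.
have E (u v : R) : - u ^- 2 * v = -1 * v * (u^-1 * u^-1).
  by rewrite mulN1r !mulNr -invfM -expr2 mulrC.
move=> x; have h := is_deriveV (f0 x) (ff' x).
by apply: is_derive_eq h _; exact: E.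
Qed.

Lemma smooth1_cossin (s : R) :
  smooth1 (fun x => cos (s * x)) /\ smooth1 (fun x => sin (s * x)).
Proof.
suff [sc ss] : smooth1 (@cos R) /\ smooth1 (@sin R).
  have E (h : R -> R) : (fun x => h (s * x)) = (fun x => h (s * x + 0)).
    by apply/funext => x; rewrite addr0.
  by rewrite E (E sin); split; exact: smooth1_affine.
pose B := [set g | g = @cos R \/ g = @sin R].
have HB : forall f, B f -> exists2 g, generated B g & forall x : R, is_derive x 1 f (g x).
  move=> f [->|->].
    exists (fun x => cst (-1) x * sin x).
      by apply: gen_mul; [exact: gen_cst|apply: gen_base; right].
    by move=> x; rewrite /= mulN1r; exact: is_derive_cos.
  by exists (@cos R); [apply: gen_base; left|move=> x; exact: is_derive_sin].
by split; apply: (smooth1_gen HB); apply: gen_base; [left|right].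
Qed.

(** x^-n exp (- 1 / x) extended by 0. The index n makes the family stable under differentiation: the
    derivative of member n is - n times member n + 1 plus member n + 2. *)
Definition expinv (n : nat) (x : R) : R :=
  if x <= 0 then 0 else x ^- n * expR (- x^-1).

Lemma expinv_le0 n (x : R) : x <= 0 -> expinv n x = 0.
Proof. by rewrite /expinv => ->. Qed.

Lemma expR_ge_pow (n : nat) (y : R) : 0 <= y -> y ^+ n / n`!%:R <= expR y.
Proof.
case: n => [|n] y0; first by rewrite expr0 fact0 divr1 (le_trans _ (expR_ge1Dx y))// lerDl.
by rewrite (le_trans _ (expR_ge1Dxn n y0))// lerDr.
Qed.

(** From exp y >= y^N / N! at y = 1 / x with N = n + k. The case k = 2 makes the difference quotient
    at 0 of order x, so that the derivative there is 0. *)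
Lemma expinv_le (n k : nat) (x : R) : 0 < x ->
  `|expinv n x| <= (n + k)`!%:R * x ^+ k.
Proof.
move=> x0; rewrite /expinv (lt_geF x0).
have y0 : 0 < x^-1 by rewrite invr_gt0.
have := expR_ge_pow (n + k) (ltW y0); set N := (n + k)%N => h.
rewrite ger0_norm; last by rewrite mulr_ge0 ?expR_ge0// invr_ge0 exprn_ge0// ltW.
rewrite expRN ler_pdivrMr ?expR_gt0//.
apply: (@le_trans _ _ (N`!%:R * x ^+ k * (x^-1 ^+ N / N`!%:R))); last first.
  by rewrite ler_wpM2l// mulr_ge0// exprn_ge0// ltW.
have xn0 : x != 0 by rewrite gt_eqF.
have fn0 : (N`!%:R : R) != 0 by rewrite pnatr_eq0 -lt0n fact_gt0.
rewrite exprVn /N exprD -/N.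
have xk0 m : x ^+ m != 0 by rewrite expf_neq0.
by rewrite le_eqVlt; apply/orP; left; apply/eqP; field; rewrite !xk0 fn0.
Qed.

Lemma is_derive_expinv (n : nat) (x : R) :
  is_derive x 1 (expinv n) (- n%:R * expinv n.+1 x + expinv n.+2 x).
Proof.
have [x0|x0|->] := ltgtP x 0.
- rewrite /expinv (ltW x0) mulr0 add0r -/(expinv n).
  have near0 : {near x, (cst 0 : R -> R) =1 expinv n}.
    near=> y; rewrite /expinv ifT//; near: y.
    by apply: filterS (lt_nbhsl x0) => y; exact: ltW.
  by apply: near_eq_is_derive near0 _; exact: is_derive_cst.
- have nearx : {near x, (fun y => y^-1 ^+ n * expR (- y^-1)) =1 expinv n}.
    near=> y; rewrite /expinv exprVn ifF//; apply: lt_geF; near: y.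
    exact: lt_nbhsr.
  apply: near_eq_is_derive nearx _.
  have xn0 : x != 0 by rewrite gt_eqF.
  have dV : is_derive x 1 (fun y : R => y^-1) (- x ^- 2).
    have := @is_deriveV _ (id : R -> R) x 1 1 xn0 (is_derive_id x 1).
    by rewrite [_ *: 1]mulr1.
  have dE : is_derive x 1 (fun y : R => expR (- y^-1)) (x ^- 2 * expR (- x^-1)).
    have dN : is_derive x 1 (fun y : R => - y^-1) (x ^- 2).
      by have := is_deriveN dV; rewrite opprK.
    have := @is_derive1_comp _ expR (fun y : R => - y^-1) x _ _ (is_derive_expR _) dN.
    by rewrite mulrC.
  have dX : is_derive x 1 (fun y : R => y^-1 ^+ n) (n%:R * x^-1 ^+ n.-1 * (- x ^- 2)).
    have := @is_deriveX _ _ (fun y : R => y^-1) n x 1 _ dV.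
    by rewrite (_ : _ ^+ n = fun y : R => y^-1 ^+ n)//; apply/funext => y; rewrite exprfctE.
  have := is_derive_mul dX dE.
  move=> h; apply: is_derive_eq h _; rewrite /expinv (lt_geF x0).
  clear dX; case: n => [|n]; first by rewrite !mul0r !oppr0 !mul0r !add0r expr0 mul1r.
  rewrite /= !exprVn !exprS; field.
  by rewrite expf_neq0.
- rewrite expinv_le0// expinv_le0// mulr0 addr0.
  have cv : h^-1 *: ((expinv n \o shift 0) (h *: 1) - expinv n 0) @[h --> 0^'] --> (0 : R).
    apply/cvgr0Pnorm_le => e e0; near=> h.
    rewrite /= addr0 [h *: 1]mulr1 (expinv_le0 n (lexx 0)) subr0.
    have [h0|h0] := leP h 0; first by rewrite expinv_le0// scaler0 normr0 ltW.
    rewrite [_ *: _]/(_ * _) normrM normfV (gtr0_norm h0) mulrC ler_pdivrMr//.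
    apply: (le_trans (expinv_le n 2 h0)); rewrite expr2 mulrA ler_pM2r//.
    rewrite mulrC -ler_pdivlMr ?ltr0n ?fact_gt0//.
    near: h; apply: cvg_within.
    have : 0 < e / (n + 2)`!%:R by rewrite divr_gt0// ltr0n fact_gt0.
    by move=> /(lt_nbhsl (x := 0 : R)); apply: filterS => y /ltW.
  apply: DeriveDef; first by apply/cvg_ex; exists 0.
  by apply/cvg_lim.
Unshelve. all: by end_near.
Qed.

Lemma smooth1_expinv n : smooth1 (expinv n).
Proof.
pose B := [set g | exists n, g = expinv n].
apply: (@smooth1_gen B); last by apply: gen_base; exists n.
move=> g [k ->].
exists (fun x => (fun x => cst (- k%:R) x * expinv k.+1 x) x + expinv k.+2 x).
  apply: gen_add; last by apply: gen_base; exists k.+2.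
  by apply: gen_mul; [exact: gen_cst|apply: gen_base; exists k.+1].
by move=> x; exact: is_derive_expinv.
Qed.

Lemma expinv_gt0 n (x : R) : 0 < x -> 0 < expinv n x.
Proof.
by move=> x0; rewrite /expinv leNgt x0/= mulr_gt0 ?expR_gt0// invr_gt0 exprn_gt0.
Qed.

Lemma expinv_ge0 n (x : R) : 0 <= expinv n x.
Proof. by have [/(expinv_le0 n)->//|/(expinv_gt0 n)/ltW] := leP x 0. Qed.

(** The usual smooth transition from 0 on x <= 0 to 1 on x >= 1; the denominator is positive because
    x and 1 - x are never both nonpositive. *)
Definition step (x : R) : R := expinv 0 x / (expinv 0 x + expinv 0 (1 - x)).

Lemma step_den_gt0 (x : R) : 0 < expinv 0 x + expinv 0 (1 - x).
Proof.
have [x0|x0] := leP x 0; last by rewrite ltr_wpDr ?expinv_gt0// expinv_ge0.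
by rewrite ltr_wpDl ?expinv_ge0// expinv_gt0// subr_gt0 (le_lt_trans x0).
Qed.

Lemma smooth1_step : smooth1 step.
Proof.
apply: smooth1_mul; first exact: smooth1_expinv.
apply: smooth1_inv => [|x]; last by rewrite gt_eqF// step_den_gt0.
apply: smooth1_add; first exact: smooth1_expinv.
rewrite (_ : (fun _ => _) = (fun x => expinv 0 (-1 * x + 1))).
  exact: smooth1_affine (smooth1_expinv 0).
by apply/funext => x; rewrite mulN1r addrC.
Qed.

Lemma step_le0 (x : R) : x <= 0 -> step x = 0.
Proof. by move=> x0; rewrite /step expinv_le0// mul0r. Qed.

Lemma step_ge1 (x : R) : 1 <= x -> step x = 1.
Proof.
move=> x1; rewrite /step (@expinv_le0 0 (1 - x)) ?subr_le0// addr0 divff// gt_eqF//.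
by rewrite expinv_gt0// (lt_le_trans ltr01).
Qed.

Lemma step_bound (x : R) : 0 <= step x <= 1.
Proof.
rewrite /step divr_ge0 ?expinv_ge0 ?(ltW (step_den_gt0 x))//=.
by rewrite ler_pdivrMr ?step_den_gt0// mul1r lerDl expinv_ge0.
Qed.

End smooth_functions.

(** * Test functions on the strip *)

Section test_functions.
Context (R : realType).
Notation leb := (@lebesgue_measure R).
Notation mR := (measurableTypeR R).
Implicit Types (f g : R -> R) (phi : R * R -> R).

Definition tensor f g : R * R -> R := fun z => f z.1 * g z.2.

Lemma is_derive_dir (f : R -> R) (x a v : R) : is_derive x 1 f a ->
  derivable f x v /\ 'D_v f x = v * a.
Proof.
move=> fa; have df : differentiable f x by apply/derivable1_diffP; exact: ex_derive.
split; first exact: diff_derivable.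
rewrite deriveE// -[v in 'd f x v]mulr1 -[v * 1]/(v *: 1) linearZ /=.
by rewrite -deriveE// derive_val.
Qed.

(** Generators of an algebra that contains the tensor products and is stable under every directional
    derivative, as the definition of [smooth] demands. *)
Definition coordinate_smooth : set (R * R -> R) :=
  [set u | exists2 f, smooth1 f & u = (fun z => f z.1) \/ u = (fun z => f z.2)].

Lemma generated_coordinate_derive (u : R * R -> R) (v : R * R) :
  generated coordinate_smooth u ->
  (forall z, differentiable u z) /\ generated coordinate_smooth ('D_v u).
Proof.
elim=> {u} [u [f sf]|k|u w _ [du gu] _ [dw gw]|u w bu [du gu] bw [dw gw]].
- have [f' sf' ff'] := smooth1_derive sf; have df x := is_derive_dir v.1 (ff' x).
  have dfx x : differentiable f x by apply/derivable1_diffP; exact: (@ex_derive _ _ _ _ _ _ _ (ff' x)).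
  case=> ->.
  + split.
      by move=> z; apply: (@differentiable_comp _ _ _ _ fst f) => //; apply: linear_differentiable => w; exact: cvg_fst.
    rewrite (_ : 'D_v _ = fun z => cst v.1 z * (fun z => f' z.1) z).
      by apply: gen_mul; [exact: gen_cst|apply: gen_base; exists f' => //; left].
    by apply/funext => z /=; rewrite -(df z.1).2.
  + have df2 x := is_derive_dir v.2 (ff' x).
    split.
      by move=> z; apply: (@differentiable_comp _ _ _ _ snd f) => //; apply: linear_differentiable => w; exact: cvg_snd.
    rewrite (_ : 'D_v _ = fun z => cst v.2 z * (fun z => f' z.2) z).
      by apply: gen_mul; [exact: gen_cst|apply: gen_base; exists f' => //; right].
    by apply/funext => z /=; rewrite -(df2 z.2).2.
- split; first by move=> z; exact: differentiable_cst.
  rewrite (_ : 'D_v _ = cst 0); first exact: gen_cst.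
  by apply/funext => z; rewrite derive_cst.
- split; first by move=> z; exact: differentiableD.
  rewrite (_ : 'D_v _ = fun z => 'D_v u z + 'D_v w z); first exact: gen_add.
  by apply/funext => z; rewrite -deriveD//; exact: diff_derivable.
- split; first by move=> z; exact: differentiableM.
  rewrite (_ : 'D_v _ = fun z => (fun z => u z * 'D_v w z) z + (fun z => w z * 'D_v u z) z).
    by apply: gen_add; apply: gen_mul.
  apply/funext => z.
  have := @deriveM _ _ u w z v (diff_derivable (du z)) (diff_derivable (dw z)).
  by move=> ->.
Qed.

Lemma smooth_generated (u : R * R -> R) : generated coordinate_smooth u -> smooth u.
Proof.
move=> gu vs z.
suff : generated coordinate_smooth (foldr (fun (v : R * R) (f : R * R -> R) => 'D_v f) u vs).
  by move=> /(generated_coordinate_derive 0)[].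
by elim: vs => //= v vs ih; have [] := generated_coordinate_derive v ih.
Qed.

Lemma generated_tensor f g : smooth1 f -> smooth1 g ->
  generated coordinate_smooth (tensor f g).
Proof.
by move=> sf sg; apply: gen_mul; apply: gen_base; [exists f|exists g] => //; [left|right].
Qed.

Lemma derive_tensor f g (f' g' : R -> R) (v z : R * R) :
  (forall x : R, is_derive x 1 f (f' x)) -> (forall x : R, is_derive x 1 g (g' x)) ->
  'D_v (tensor f g) z = v.1 * f' z.1 * g z.2 + v.2 * f z.1 * g' z.2.
Proof.
move=> ff' gg'.
have [df Ef] := is_derive_dir v.1 (ff' z.1); have [dg Eg] := is_derive_dir v.2 (gg' z.2).
have := @deriveM _ _ (fun z : R * R => f z.1) (fun z : R * R => g z.2) z v df dg.
rewrite [X in X = _ -> _](_ : _ = 'D_v (tensor f g) z)// => ->.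
have -> : 'D_v (fun z : R * R => f z.1) z = v.1 * f' z.1 by rewrite -Ef.
have -> : 'D_v (fun z : R * R => g z.2) z = v.2 * g' z.2 by rewrite -Eg.
by rewrite /GRing.scale/=; ring.
Qed.

Definition supported_in f (a b : R) := forall x, f x != 0 -> a <= x <= b.

Lemma test_function_tensor f g (a b c d : R) : smooth1 f -> smooth1 g ->
  0 < a -> b < 1 -> supported_in f a b -> supported_in g c d ->
  test_function (tensor f g).
Proof.
move=> sf sg a0 b1 fab gcd; split.
  exact/smooth_generated/generated_tensor.
exists (`[a, b] `*` `[c, d]); split.
- by apply: compact_setX; exact: segment_compact.
- move=> [x t] [/=]; rewrite in_itv/= => /andP[ax xb] _; split => //=.
  by rewrite in_itv/= (lt_le_trans a0 ax) (le_lt_trans xb b1).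
- move=> [x t] K; apply/eqP; rewrite /tensor/= mulf_eq0 -[_ || _]negbK negb_or.
  by apply/negP => /andP[/fab fx /gcd gt]; apply: K; split => /=; rewrite in_itv.
Qed.

(** Smooth approximation of the indicator of ]a, b[ whose support stays in [a, b] for every k, so
    that it remains admissible as a test function. *)
Definition plateau (a b : R) (k : nat) (x : R) : R :=
  step (k%:R * (x - a)) * step (k%:R * (b - x)).

Lemma smooth1_plateau a b k : smooth1 (plateau a b k).
Proof.
apply: smooth1_mul.
  rewrite (_ : (fun _ => _) = (fun x => step (k%:R * x + (- (k%:R * a))))).
    exact: smooth1_affine (@smooth1_step R).
  by apply/funext => x; rewrite mulrBr.
rewrite (_ : (fun _ => _) = (fun x => step (- k%:R * x + (k%:R * b)))).
  exact: smooth1_affine (@smooth1_step R).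
by apply/funext => x; rewrite mulrBr mulNr addrC.
Qed.

Lemma plateau_supported a b k : supported_in (plateau a b k) a b.
Proof.
move=> x; rewrite /plateau; apply: contraNT; rewrite negb_and -!ltNge => /orP[xa|bx].
  by rewrite (@step_le0 _ (_ * (x - a))) ?mul0r// mulr_ge0_le0// subr_le0 ltW.
by rewrite (@step_le0 _ (_ * (b - x))) ?mulr0// mulr_ge0_le0// subr_le0 ltW.
Qed.

Lemma plateau_bound a b k x : `|plateau a b k x| <= 1.
Proof.
rewrite normrM; have /andP[h1 h2] := step_bound (k%:R * (x - a)).
have /andP[h3 h4] := step_bound (k%:R * (b - x)).
by rewrite !ger0_norm// mulr_ile1.
Qed.

Lemma step_cvg (y : R) : 0 < y -> (fun k : nat => step (k%:R * y)) @ \oo --> (1 : R).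
Proof.
move=> y0; apply: cvg_near_cst; near=> k; apply: step_ge1.
rewrite -ler_pdivrMr// mul1r; near: k; exact: nbhs_infty_ger.
Unshelve. all: by end_near.
Qed.

Lemma plateau_cvg a b x : plateau a b ^~ x @ \oo --> (\1_(`]a, b[ : set R) x : R).
Proof.
rewrite indicE; have [|xab] := boolP (x \in _).
  rewrite inE/= in_itv/= => /andP[ax xb]; rewrite -[1%:R]mulr1.
  by apply: cvgM; apply: step_cvg; rewrite subr_gt0.
apply: cvg_near_cst; near=> k; rewrite /plateau.
move: xab; rewrite notin_setE /= in_itv/= => /negP; rewrite negb_and -!leNgt => /orP[xa|bx].
  by rewrite (@step_le0 _ (_ * (x - a))) ?mul0r// mulr_ge0_le0// subr_le0.
by rewrite (@step_le0 _ (_ * (b - x))) ?mulr0// mulr_ge0_le0// subr_le0.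
Unshelve. all: by end_near.
Qed.

Lemma continuous2_cvg (T : Type) (F : set_system T) (FF : Filter F) phi (f g : T -> R)
  (a b : R) : continuous phi -> f @ F --> a -> g @ F --> b ->
  phi (f x, g x) @[x --> F] --> phi (a, b).
Proof.
move=> cphi fa gb.
exact: (cvg_comp (fun x => (f x, g x)) phi (cvg_pair fa gb) (cphi (a, b))).
Qed.

(** Measurability for the product sigma-algebra. Rounding the first coordinate down to a multiple of
    1 / (n + 1) turns preimages into countable unions of rectangles, and [phi] is the pointwise
    limit of the rounded functions. *)
Lemma continuous2_measurable phi : continuous phi ->
  measurable_fun (setT : set (mR * mR)) phi.
Proof.
move=> cphi.
pose p (n : nat) (z : R * R) : R * R := ((Num.floor (n.+1%:R * z.1))%:~R / n.+1%:R, z.2).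
apply: (@measurable_fun_cvg _ _ _ _ (fun n z => phi (p n z))).
- move=> n _ Y mY; rewrite setTI.
  have -> : (fun z => phi (p n z)) @^-1` Y = \bigcup_(k in [set: int])
      ([set x : mR | k%:~R <= n.+1%:R * x < k%:~R + 1] `*`
       ((fun t => phi (k%:~R / n.+1%:R, t)) @^-1` Y)).
    apply/seteqP; split=> [[x t] /= h|[x t] [k _ [/= /andP[k1 k2] h]]].
      exists (Num.floor (n.+1%:R * x)) => //; split => //=.
      by rewrite floor_le_tmp ?num_real//= -intrD1 floorD1_gt ?num_real.
    rewrite /p /=; have -> // : Num.floor (n.+1%:R * x) = k.
    by apply/eqP; rewrite floor_eq ?num_real// k1 intrD1.
  apply: countable_bigcupT_measurable => // k; apply: measurableX.
    rewrite (_ : [set x | _] = `[k%:~R / n.+1%:R, (k%:~R + 1) / n.+1%:R[%classic); first exact: measurable_itv.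
    by apply/seteqP; split => x /=; rewrite in_itv/= ler_pdivrMr ?ltr0n// ltr_pdivlMr ?ltr0n// mulrC.
  rewrite -[X in measurable X]setTI; apply: continuous_measurable_fun => // t.
  by apply: continuous2_cvg => //; exact: cvg_cst.
- move=> [x t] _; apply: continuous2_cvg => //=; last exact: cvg_cst.
  apply/cvgrPdist_le => e e0; near=> n.
  have n0 : 0 < n.+1%:R :> R by rewrite ltr0n.
  have h1 := @floor_le_tmp R (n.+1%:R * x).
  have h2 := @floorD1_gt R (n.+1%:R * x).
  have -> : x - (Num.floor (n.+1%:R * x))%:~R / n.+1%:R =
     (n.+1%:R * x - (Num.floor (n.+1%:R * x))%:~R) / n.+1%:R.
    by rewrite mulrBl mulrAC divff ?mul1r// gt_eqF.
  rewrite normrM [`|n.+1%:R^-1|]gtr0_norm ?invr_gt0// ger0_norm ?subr_ge0//.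
  rewrite ler_pdivrMr// (@le_trans _ _ 1)//.
    by rewrite lerBlDl ltW// -intrD1.
  rewrite mulrC -ler_pdivrMr// div1r.
  rewrite (@le_trans _ _ n%:R) ?ler_nat//; near: n; exact: nbhs_infty_ger.
Unshelve. all: by end_near.
Qed.

(* All that is used of a test function and of its first derivatives in estimates. *)
Definition test_bound (T M : R) phi := [/\ continuous phi, forall z, `|phi z| <= M &
  forall z, phi z != 0 -> 0 < z.1 < 1 /\ `|z.2| <= T].

Lemma smooth_continuous phi (vs : seq (R * R)) : smooth phi ->
  continuous (foldr (fun (v : R * R) (f : R * R -> R) => 'D_v f) phi vs).
Proof. by move=> sphi z; exact/differentiable_continuous/sphi. Qed.

Lemma test_function_bound phi : test_function phi ->
  exists T M : R, [/\ 0 < T, test_bound T M phi, test_bound T M ('D_(dx R) phi)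
                    & test_bound T M ('D_(dt R) phi)].
Proof.
move=> [sphi [K [cK Ks K0]]].
have bnd (psi : R * R -> R) : continuous psi -> (forall z, ~ K z -> psi z = 0) ->
    exists M : R, 0 <= M /\ forall z, `|psi z| <= M.
  move=> cpsi psi0.
  have := @compact_bounded _ _ _ (continuous_compact (continuous_subspaceT cpsi) cK).
  move=> [M [Mr HM]]; exists (`|M| + 1); split; first by rewrite addr_ge0.
  move=> z; have [Kz|nKz] := pselect (K z); last by rewrite psi0// normr0 addr_ge0.
  by apply: HM; [rewrite (le_lt_trans (ler_norm M))// ltrDl|exists z].
have D0 v z : ~ K z -> 'D_v phi z = 0.
  move=> nKz; rewrite -(derive_cst (0 : R) z v); apply: near_eq_derive.
  have oK : open (~` K) by apply: closed_openC; apply: compact_closed cK; exact: norm_hausdorff.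
  by apply: filterS (open_nbhs_nbhs (conj oK nKz)) => y nKy; rewrite K0.
have cphi := smooth_continuous (vs := [::]) sphi.
have cx := smooth_continuous (vs := [:: dx R]) sphi.
have ct := smooth_continuous (vs := [:: dt R]) sphi.
have [M0 [M00 HM0]] := bnd _ cphi K0.
have [M1 [M10 HM1]] := bnd _ cx (D0 _).
have [M2 [M20 HM2]] := bnd _ ct (D0 _).
have [T [Tr HT]] : bounded_set [set z.2 | z in K].
  apply: compact_bounded; apply: continuous_compact cK.
  by apply: continuous_subspaceT => z; exact: cvg_snd.
exists (`|T| + 1), (M0 + M1 + M2).
have supp (psi : R * R -> R) : (forall z, ~ K z -> psi z = 0) ->
    forall z, psi z != 0 -> 0 < z.1 < 1 /\ `|z.2| <= `|T| + 1.
  move=> psi0 z pz; have Kz : K z by apply: contrapT => /psi0 E; rewrite E eqxx in pz.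
  split; first by have [/=] := Ks _ Kz; rewrite in_itv.
  by apply: HT; [rewrite (le_lt_trans (ler_norm T))// ltrDl|exists z].
split; first by rewrite ltr_wpDl.
- split; [exact: cphi| |exact: (supp _ K0)].
  by move=> z; rewrite (le_trans (HM0 z))// -addrA lerDl addr_ge0.
- split; [exact: cx| |exact: (supp _ (D0 (dx R)))].
  by move=> z; rewrite (le_trans (HM1 z))// addrAC lerDr addr_ge0.
- split; [exact: ct| |exact: (supp _ (D0 (dt R)))].
  by move=> z; rewrite (le_trans (HM2 z))// lerDr addr_ge0.
Qed.

End test_functions.

(** * Fundamental lemma of the calculus of variations *)

Section vanishing.
Context (R : realType).
Notation leb := (@lebesgue_measure R).
Notation mR := (measurableTypeR R).
Implicit Types (f g : R -> R) (phi : R * R -> R).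

Lemma integrable_restrictE (D : set mR) f : measurable D ->
  leb.-integrable D (EFin \o f) <-> leb.-integrable setT (EFin \o (f \_ D)).
Proof. by move=> mD; rewrite -restrict_EFin; exact: integrable_mkcond. Qed.

(** Lebesgue differentiation applied to the extension of [f] by zero: its indefinite integral is
    constant near each interior point. *)
Lemma prim_constant_ae0 (l r : R) f : leb.-integrable `[l, r] (EFin \o f) ->
  (forall x, l < x < r -> \int[leb]_(y in `[l, x]) f y = \int[leb]_(y in `[l, r]) f y) ->
  {ae leb, forall x, l < x < r -> f x = 0}.
Proof.
move=> fi fc.
pose g := f \_ (`[l, r] : set R).
have gi : leb.-integrable setT (EFin \o g).
  by apply: (iffLR (integrable_restrictE _ (measurable_itv `[l, r])) fi).
have gl : locally_integrable [set: R] g.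
  split => //; first exact: (integrable_measurable gi).
    exact: openT.
  move=> K _ cK; have mK : measurable (K : set mR) by apply: closed_measurable; exact: compact_closed.
  have giK : leb.-integrable (K : set mR) (EFin \o g) by exact: integrableS gi.
  by have /integrableP[_] := integrable_norm giK; under eq_integral do rewrite /= normr_id.
have gy (y : R) : leb.-integrable `]-oo, y] (EFin \o g).
  exact: integrableS gi.
have := FTC1Ny gy gl; apply: filterS; first exact: (ae_filter_ringOfSetsType leb).
move=> x [_ dg] /andP[lx xr].
have <- : g x = f x by rewrite /g patchE mem_set//= in_itv/= !ltW.
rewrite -dg derive1E; apply: derive_val.
apply: near_eq_is_derive (is_derive_cst (\int[leb]_(y in `[l, r]) f y) x 1).
near=> z.
have lz : l < z by near: z; exact: lt_nbhsr.
have zr : z < r by near: z; exact: lt_nbhsl.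
rewrite /= -(fc z) ?lz//.
rewrite [LHS]Rintegral_mkcond [RHS]Rintegral_mkcond; apply: eq_Rintegral => w _.
rewrite /g !patchE; have [|wlz] := boolP (w \in (`[l, z]%classic : set R)).
  rewrite inE/= in_itv/= => /andP[lw wz].
  by rewrite !mem_set//= in_itv/= ?wz// lw (le_trans wz (ltW zr)).
case: ifPn => //; rewrite inE/= in_itv/= => wz; case: ifPn => //.
rewrite inE/= in_itv/= => /andP[lw _]; move: wlz; rewrite notin_setE/= in_itv/= lw.
by rewrite wz.
Unshelve. all: by end_near.
Qed.

(** Rational endpoints keep the conditions countable, so that they can be imposed for almost every
    value of a parameter; continuity of the indefinite integral extends them to all endpoints. *)
Lemma ae0_of_rational_intervals (l r : R) f : l < r -> leb.-integrable `[l, r] (EFin \o f) ->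
  (forall p q : rat, l < (ratr p : R) -> (ratr p : R) < (ratr q : R) -> (ratr q : R) < r ->
    \int[leb]_(y in `](ratr p : R), (ratr q : R)[) f y = 0) ->
  {ae leb, forall x, l < x < r -> f x = 0}.
Proof.
move=> lr fi f0.
pose H x := \int[leb]_(y in `[l, x]) f y.
have cH : {within `[l, r], continuous H}.
  exact: (parameterized_integral_continuous (ltW lr) fi).
have sub (x y : R) : l <= x -> y <= r -> leb.-integrable `[x, y] (EFin \o f).
  by move=> lx yr; exact: integrable_subitv fi _ _.
have Hpq (p q : rat) : l < ratr p < r -> l < ratr q < r -> H (ratr p) = H (ratr q).
  wlog pq : p q / ratr p < ratr q :> R.
    move=> W hp hq; have [pq|qp|->//] := ltgtP (ratr p : R) (ratr q).
      exact: W.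
    by apply/esym; exact: W.
  move=> /andP[lp _] /andP[_ qr].
  rewrite /H [RHS](@Rintegral_itv_split _ _ (ratr p) (ratr q))//; last first.
  - by apply: sub => //; exact: ltW.
  - exact: ltW.
  - exact: ltW.
  have fpq : leb.-integrable `]ratr p, ratr q[ (EFin \o f).
    by apply: integrable_cc_oo; apply: sub; exact: ltW.
  by rewrite (Rintegral_itv_oo fpq).2 f0// addr0.
have [q0 /[!in_itv]/= q0lr] := rat_in_itvoo lr.
have main x : l < x < r -> H x = H (ratr q0).
  move=> /andP[lx xr]; apply/eqP; rewrite -subr_eq0 -normr_eq0 eq_le normr_ge0 andbT.
  apply/ler_addgt0Pl => e e0; rewrite addr0.
  have cx : {for x, continuous H}.
    have : x \in `]l, r[ by rewrite in_itv/= lx.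
    by have [] := (continuous_within_itvP H lr).1 cH; move=> /(_ x) + _ _; apply.
  move/cvgrPdist_le: cx => /(_ e e0) [d /= d0 Hd].
  have xdr : x < Num.min (x + d) r by rewrite lt_min ltrDl d0.
  have [q] := rat_in_itvoo xdr.
  rewrite in_itv/= lt_min => /and3P[xq qd qr].
  rewrite -(Hpq q q0)//; last by rewrite qr (lt_trans lx).
  apply: Hd => /=; rewrite distrC gtr0_norm ?subr_gt0//.
  by rewrite ltrBlDl.
apply: prim_constant_ae0 fi _ => x xlr; rewrite -!/(H _) (main x xlr).
apply/eqP; rewrite -subr_eq0 -normr_eq0 eq_le normr_ge0 andbT.
apply/ler_addgt0Pl => e e0; rewrite addr0.
have [_ _ cr] := (continuous_within_itvP H lr).1 cH.
move/cvgrPdist_le: cr => /(_ ((e : R) : R)) /(_ e0) [d /= d0 Hd].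
pose y := Num.max (r - d / 2) ((l + r) / 2).
have yr : y < r by rewrite /y gt_max; apply/andP; split; lra.
have ly : l < y by rewrite /y lt_max; apply/orP; right; lra.
rewrite -(main y) ?ly// distrC; apply: Hd => //=.
rewrite gtr0_norm ?subr_gt0// /y; case: (leP (r - d / 2) ((l + r) / 2)) => h; lra.
Qed.

Definition box (T : R) : set (mR * mR) := `]0, 1[ `*` `[- T, T].

Lemma measurable_box T : measurable (box T).
Proof. by apply: measurableX. Qed.

Lemma measurable_strip : measurable (strip R : set (mR * mR)).
Proof. by apply: measurableX. Qed.

Lemma box_subset_strip T : box T `<=` strip R.
Proof. by move=> z []. Qed.

Lemma test_bound_measurable (T M : R) phi (D : set (mR * mR)) : measurable D ->
  test_bound T M phi -> measurable_fun D phi.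
Proof.
by move=> mD [cphi _ _]; apply: measurable_funS (continuous2_measurable cphi).
Qed.

Lemma Rintegral_strip_box (g : R * R -> R) phi (T M : R) : test_bound T M phi ->
  \int[leb2 R]_(z in strip R) (g z * phi z) = \int[leb2 R]_(z in box T) (g z * phi z).
Proof.
move=> [_ _ supp]; rewrite [LHS]Rintegral_mkcond [RHS]Rintegral_mkcond.
apply: eq_Rintegral => z _; rewrite !patchE.
have [->|/supp [z1 z2]] := eqVneq (phi z) 0; first by rewrite mulr0 !if_same.
by rewrite !mem_set//; split => //=; rewrite in_itv/= // -ler_norml.
Qed.

Lemma integrable_box_test (g : R * R -> R) phi (T M : R) : loc_integrable g ->
  test_bound T M phi -> (leb2 R).-integrable (box T) (EFin \o (fun z => g z * phi z)).
Proof.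
move=> gl tb; have mb := measurable_box T; have [_ bd _] := tb.
by apply: (integrable_bounded_mul mb (gl T) (test_bound_measurable mb tb)) => z _.
Qed.

Lemma measurable_strip_of_boxes (g : mR * mR -> R) :
  (forall n : nat, measurable_fun (box n%:R) g) -> measurable_fun (strip R) g.
Proof.
move=> gn; rewrite (_ : strip R = \bigcup_n box n%:R).
  by apply/measurable_fun_bigcup => // n; exact: measurable_box.
apply/seteqP; split=> [[x t] [/= x01 _]|[x t] [n _ [/= x01 _]]//].
exists (Num.trunc `|t|).+1 => //; split => //=; rewrite in_itv/= -ler_norml.
by apply: ltW; exact: truncnS_gt.
Qed.

Lemma loc_integrable_measurable (g : R * R -> R) : loc_integrable g ->
  measurable_fun (strip R : set (mR * mR)) g.
Proof.
move=> gl; apply: measurable_strip_of_boxes => n.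
exact: (integrable_measurable (gl _)).
Qed.

Lemma ae_section_integrable (g : R * R -> R) : loc_integrable g ->
  {ae leb, forall x, 0 < x < 1 -> forall T : R,
     leb.-integrable `[- T, T] (EFin \o (fun t => g (x, t)))}.
Proof.
move=> gl.
have h (n : nat) := @ae_integrable_section1 R _ _ _ (measurable_itv `]0, 1[)
  (measurable_itv `[- n%:R, n%:R]) (gl n%:R).
have := ae_foralln h; apply: filterS => x hx x01 T.
have [n Tn] : exists n : nat, T <= n%:R.
  by exists (Num.trunc T).+1; apply: ltW; exact: truncnS_gt.
have xI : `]0, 1[%classic x by rewrite /= in_itv.
by apply: integrable_subitv (hx n xI) _ _ => //; rewrite lerN2.
Qed.

(** Tensor products of plateaus converge to indicators of rectangles, so [h] has zero integral over
    each of them. The one-dimensional statement in x, for every rational interval in t, and then in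
    t, for almost every x, gives h = 0. *)
Lemma weak_vanishing (h : R * R -> R) : loc_integrable h ->
  (forall phi, test_function phi -> \int[leb2 R]_(z in strip R) (h z * phi z) = 0) ->
  {ae leb2 R, forall z, strip R z -> h z = 0}.
Proof.
move=> hl h0.
have rect (a b c d : R) : 0 < a -> a < b -> b < 1 -> c < d ->
    \int[leb]_(x in `]a, b[) \int[leb]_(t in `]c, d[) h (x, t) = 0.
  move=> a0 ab b1 cd.
  pose T := Num.max `|c| `|d|.
  have cT : - T <= c by rewrite lerNl (le_trans (ler_norm _))// normrN /T le_max lexx.
  have dT : d <= T by rewrite (le_trans (ler_norm _))// /T le_max lexx orbT.
  have sub : `]a, b[ `*` `]c, d[ `<=` box T.
    move=> [x t] [/=]; rewrite !in_itv/= => /andP[ax xb] /andP[ct td]; split => /=.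
      by rewrite in_itv/= (lt_trans a0 ax) (lt_trans xb b1).
    by rewrite in_itv/= (le_trans cT (ltW ct)) (le_trans (ltW td) dT).
  have mrect : measurable (`]a, b[ `*` `]c, d[ : set (mR * mR)) by apply: measurableX.
  have hrect : (leb2 R).-integrable (`]a, b[ `*` `]c, d[) (EFin \o h).
    by apply: integrableS (hl T) => //; exact: measurable_box.
  rewrite -Rintegral_setX1//.
  pose phi k := tensor (plateau a b k) (plateau c d k).
  have test k : test_function (phi k).
    by apply: test_function_tensor (@plateau_supported R a b k) (@plateau_supported R c d k) => //; exact: smooth1_plateau.
  have cphi k : continuous (phi k).
    by have [s _] := test k; exact: (smooth_continuous (vs := [::]) s).
  have phiT k : test_bound T 1 (phi k).
    split => //.
      by move=> z; rewrite normrM mulr_ile1// plateau_bound.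
    move=> z; rewrite mulf_eq0 negb_or => /andP[/plateau_supported /andP[az zb]].
    move=> /plateau_supported /andP[cz zd]; split.
      by rewrite (lt_le_trans a0 az) (le_lt_trans zb b1).
    by rewrite ler_norml (le_trans cT cz) (le_trans zd dT).
  have mb := measurable_box T.
  have mh : measurable_fun (box T) h by exact: (integrable_measurable (hl T)).
  rewrite Rintegral_mkcond.
  transitivity (\int[leb2 R]_(z in box T) (h z * \1_(`]a, b[ `*` `]c, d[ : set (R * R)) z)).
    rewrite [RHS]Rintegral_mkcond; apply: eq_Rintegral => z _; rewrite !patchE indicE.
    have [zr|zr] := boolP (z \in _); last by rewrite mulr0 if_same.
    rewrite ifT ?mulr1//; apply/mem_set/sub; exact: set_mem.
  suff cv : (fun k => \int[leb2 R]_(z in box T) (h z * phi k z)) @ \oo -->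
      \int[leb2 R]_(z in box T) (h z * \1_(`]a, b[ `*` `]c, d[ : set (R * R)) z).
    rewrite -(cvg_lim (@Rhausdorff R) cv) (_ : (fun k => _) = cst 0); first exact: lim_cst.
    by apply/funext => k; rewrite -(Rintegral_strip_box _ (phiT k)) h0.
  - apply: (Rintegral_dominated_cvg mb _ _ _ (integrable_norm (hl T))) => //.
    + by move=> k; apply: measurable_funM => //; exact: test_bound_measurable (phiT k).
    + by apply: measurable_funM => //; apply: measurable_indic.
    + move=> z _; apply: cvgMr.
      have -> : \1_(`]a, b[ `*` `]c, d[ : set (R * R)) z =
          \1_(`]a, b[ : set R) z.1 * \1_(`]c, d[ : set R) z.2 :> R.
        by rewrite !indicE -natrM mulnb; congr (_%:R); congr nat_of_bool; rewrite in_setX.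
      by apply: cvgM; exact: plateau_cvg.
    + by move=> k z _; have [_ /(_ z) b1' _] := phiT k; rewrite normrM ler_piMr.
have mI : measurable (`]0, 1[ : set mR) by exact: measurable_itv.
have mJ (c d : R) : measurable (`]c, d[ : set mR) by exact: measurable_itv.
have hcd (c d : R) : (leb2 R).-integrable (`]0, 1[ `*` `]c, d[) (EFin \o h).
  pose T := Num.max `|c| `|d|.
  have cT : - T <= c by rewrite lerNl (le_trans (ler_norm _))// normrN /T le_max lexx.
  have dT : d <= T by rewrite (le_trans (ler_norm _))// /T le_max lexx orbT.
  apply: integrableS (hl T) => //; [exact: measurable_box|exact: measurableX|].
  move=> [x t] [/= x01]; rewrite !in_itv/= => /andP[ct td]; split => //=.
  by rewrite (le_trans cT (ltW ct)) (le_trans (ltW td) dT).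
have col (c d : R) : c < d ->
    {ae leb, forall x, 0 < x < 1 -> \int[leb]_(t in `]c, d[) h (x, t) = 0}.
  move=> cd; apply: (ae0_of_rational_intervals ltr01) => [|p q p0 pq q1].
    by apply: (Rintegral_itv_oo _).1; apply: integrable_Rintegral_section1.
  exact: rect.
(* Pairs of rationals are enumerated by [unpickle], so that a single null set of x serves all
   intervals in t. *)
have colq (n : nat) : {ae leb, forall x, 0 < x < 1 ->
    if unpickle n is Some (p, q) then ratr p < ratr q :> R ->
      \int[leb]_(t in `](ratr p : R), (ratr q : R)[) h (x, t) = 0 else True}.
  case: (unpickle n) => [[p q]|]; last by apply: aeW.
  have [pq|qp] := ltP (ratr p : R) (ratr q); last exact: aeW.
  by apply: ae_imp (col _ _ pq) => x hx x01 _; exact: hx.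
have sec : {ae leb, forall x, {ae leb, forall t, strip R (x, t) -> h (x, t) = 0}}.
  have := ae_section_integrable hl; apply: filterS2 (ae_foralln colq) => x hq hi.
  have [x01|nx] := boolP (0 < x < 1); last first.
    by apply: aeW => t [/=]; rewrite in_itv/= (negbTE nx).
  have hn (n : nat) : {ae leb, forall t, - n.+1%:R < t < n.+1%:R -> h (x, t) = 0}.
    apply: ae0_of_rational_intervals; [by rewrite gtrN|exact: hi|].
    move=> p q _ pq _; have := hq (pickle (p, q)) x01.
    by rewrite pickleK; apply.
  have := ae_foralln hn; apply: filterS => t ht _.
  apply: (ht (Num.trunc `|t|)); rewrite -ltr_norml; exact: truncnS_gt.
apply: ae_leb2_of_section sec.
have mh := loc_integrable_measurable hl.
have -> : [set z | strip R z -> h z = 0] = ~` (strip R `&` h @^-1` (~` [set 0])).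
  apply/seteqP; split=> [z hz [sz hn]|z hz sz]; first by apply: hn; exact: hz.
  by apply: contrapT => hn; apply: hz.
apply: measurableC; apply: mh; first exact: measurable_strip.
by apply: measurableC; exact: measurable_set1.
Qed.

End vanishing.

(** * Weak derivatives in the coordinate directions *)

Section weak_derivatives.
Context (R : realType).
Notation leb := (@lebesgue_measure R).
Notation mR := (measurableTypeR R).
Implicit Types (g h : R * R -> R) (phi : R * R -> R) (e : R * R).

Lemma loc_integrable_add g h : loc_integrable g -> loc_integrable h ->
  loc_integrable (fun z => g z + h z).
Proof. by move=> gl hl T; apply: integrable_add => //; exact: measurable_box. Qed.

Lemma loc_integrable_scale g (k : R) : loc_integrable g -> loc_integrable (fun z => k * g z).
Proof. by move=> gl T; apply: integrable_scale => //; exact: measurable_box. Qed.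

Lemma loc_integrable_sub g h : loc_integrable g -> loc_integrable h ->
  loc_integrable (fun z => g z - h z).
Proof. by move=> gl hl T; apply: integrable_sub => //; exact: measurable_box. Qed.

Lemma ae_strip_box g h (T : R) : {ae leb2 R, forall z, strip R z -> g z = h z} ->
  {ae leb2 R, forall z, box T z -> g z = h z}.
Proof. by apply: ae_imp => z gh /box_subset_strip; exact: gh. Qed.

Lemma loc_integrable_ae g h : loc_integrable g -> measurable_fun (strip R) h ->
  {ae leb2 R, forall z, strip R z -> g z = h z} -> loc_integrable h.
Proof.
move=> gl mh gh T; apply: (ae_eq_integrable (measurable_box T) (gl T)).
  by apply: measurable_funS mh; [exact: measurable_strip|exact: box_subset_strip].
exact: ae_strip_box.
Qed.

Lemma ae_leb2_fst (P : mR -> Prop) : {ae leb, forall x, P x} ->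
  {ae leb2 R, forall z, P z.1}.
Proof.
move=> [N [mN N0 PN]]; exists (N `*` setT); split.
- exact: measurableX.
- have E := @product_measure1E _ _ _ _ R leb leb N setT mN measurableT.
  apply: (eq_trans E); apply: (eq_trans (congr1 (fun y => (y * _)%E) N0)); exact: mul0e.
- by move=> [x t] /= Px; split => //; exact: PN.
Qed.

Lemma measurable_strip_fst (a : R -> R) (D : set (mR * mR)) : measurable D ->
  D `<=` strip R -> measurable_fun (`]0, 1[ : set mR) a ->
  measurable_fun D (fun z => a z.1).
Proof.
move=> mD Ds ma; have mI : measurable (`]0, 1[ : set mR) by exact: measurable_itv.
apply: (eq_measurable_fun (fun z => (a \_ (`]0, 1[ : set mR)) z.1)).
  by move=> z /set_mem /Ds [z1 _]; rewrite patchE mem_set.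
apply: (measurable_funS measurableT) => //.
apply: (measurableT_comp _ measurable_fst).
by apply/(measurable_restrictT _ mI).
Qed.

Lemma loc_integrable_mul1 g (a : R -> R) (K : R) : loc_integrable g ->
  measurable_fun (`]0, 1[ : set mR) a -> {ae leb, forall x, 0 < x < 1 -> `|a x| <= K} ->
  loc_integrable (fun z => a z.1 * g z).
Proof.
move=> gl ma aK T; have mb := measurable_box T.
(* Clamping changes [a] on a null set only and turns the essential bound into a bound everywhere, as
   [integrable_bounded_mul] requires. *)
pose c x := Num.max (- `|K|) (Num.min `|K| (a x)).
have cK x : `|c x| <= `|K|.
  by rewrite ler_norml le_max lexx/= ge_max ge_min lexx/= andbT (le_trans _ (normr_ge0 K)) ?oppr_le0.
have mc : measurable_fun (`]0, 1[ : set mR) c.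
  by apply: measurable_maxr => //; apply: measurable_minr.
have mgc : measurable_fun (box T) (fun z => c z.1).
  by apply: measurable_strip_fst mc => //; exact: box_subset_strip.
apply: (ae_eq_integrable mb (integrable_bounded_mul mb (gl T) mgc (fun z _ => cK z.1))).
  apply: measurable_funM; last exact: (integrable_measurable (gl T)).
  by apply: measurable_strip_fst ma => //; exact: box_subset_strip.
apply: ae_imp (ae_leb2_fst aK) => z az bz; rewrite mulrC; congr (_ * _).
have := bz.1; rewrite /= in_itv /= => /az; rewrite ler_norml => /andP[a1 a2].
have KK := ler_norm K.
rewrite /c min_r ?(le_trans a2)// max_r//.
by rewrite (le_trans _ a1)// lerN2.
Qed.

Lemma test_derive_bound phi : test_function phi -> forall e, e = dx R \/ e = dt R ->
  exists T M : R, [/\ 0 < T, test_bound T M phi & test_bound T M ('D_e phi)].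
Proof.
move=> /test_function_bound [T [M [T0 b bx bt]]] e [->|->]; by exists T, M.
Qed.

Section direction.
Variables (e : R * R).
Hypothesis e_dir : e = dx R \/ e = dt R.

Lemma Rintegral_strip_add g h phi (T M : R) : loc_integrable g -> loc_integrable h ->
  test_bound T M phi ->
  \int[leb2 R]_(z in strip R) ((g z + h z) * phi z) =
  \int[leb2 R]_(z in strip R) (g z * phi z) + \int[leb2 R]_(z in strip R) (h z * phi z).
Proof.
move=> gl hl tb; rewrite !(Rintegral_strip_box _ tb) -RintegralD.
- by apply: eq_Rintegral => z _; rewrite mulrDl.
- exact: measurable_box.
- exact: integrable_box_test tb.
- exact: integrable_box_test tb.
Qed.

Lemma Rintegral_strip_scale g (k : R) phi (T M : R) : loc_integrable g ->
  test_bound T M phi ->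
  \int[leb2 R]_(z in strip R) ((k * g z) * phi z) =
  k * \int[leb2 R]_(z in strip R) (g z * phi z).
Proof.
move=> gl tb; rewrite !(Rintegral_strip_box _ tb) -RintegralZl.
- by apply: eq_Rintegral => z _; rewrite mulrA.
- exact: measurable_box.
- exact: integrable_box_test tb.
Qed.

Lemma Rintegral_strip_ae g h phi (T M : R) : loc_integrable g -> loc_integrable h ->
  {ae leb2 R, forall z, strip R z -> g z = h z} -> test_bound T M phi ->
  \int[leb2 R]_(z in strip R) (g z * phi z) = \int[leb2 R]_(z in strip R) (h z * phi z).
Proof.
move=> gl hl gh tb; rewrite !(Rintegral_strip_box _ tb).
apply: ae_eq_Rintegral; first exact: measurable_box.
- exact: integrable_box_test tb.
- apply: (integrable_measurable (mu := leb2 R)); exact: integrable_box_test tb.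
- by apply: filterS (ae_strip_box T gh) => z E /E ->.
Qed.

Lemma is_weak_derive_lin g g' h h' (k : R) : loc_integrable g -> loc_integrable h ->
  is_weak_derive e g g' -> is_weak_derive e h h' ->
  is_weak_derive e (fun z => k * g z + h z) (fun z => k * g' z + h' z).
Proof.
move=> gl hl [gl' gg'] [hl' hh']; split.
  by apply: loc_integrable_add => //; exact: loc_integrable_scale.
move=> phi tphi; have [T [M [_ b be]]] := test_derive_bound tphi e_dir.
rewrite (Rintegral_strip_add _ _ be)//; last exact: loc_integrable_scale.
rewrite (Rintegral_strip_add _ _ b)//; last exact: loc_integrable_scale.
by rewrite (Rintegral_strip_scale _ _ be)// (Rintegral_strip_scale _ _ b)// gg'// hh'//; ring.
Qed.

Lemma is_weak_derive_unique g h h' : is_weak_derive e g h -> is_weak_derive e g h' ->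
  {ae leb2 R, forall z, strip R z -> h z = h' z}.
Proof.
move=> [hl gh] [hl' gh'].
have dl := loc_integrable_sub hl hl'.
suff : {ae leb2 R, forall z, strip R z -> h z - h' z = 0}.
  by apply: ae_imp => z hz /hz /eqP; rewrite subr_eq0 => /eqP.
apply: weak_vanishing => // phi tphi.
have [T [M [_ b _]]] := test_derive_bound tphi e_dir.
transitivity (\int[leb2 R]_(z in strip R) ((h z + -1 * h' z) * phi z)).
  by apply: eq_Rintegral => z _; rewrite mulN1r.
rewrite (Rintegral_strip_add _ _ b)//; last exact: loc_integrable_scale.
by rewrite (Rintegral_strip_scale _ _ b)// -[X in X + _]opprK -gh// gh'//; ring.
Qed.

Lemma is_weak_derive_ae g g2 h : loc_integrable g -> loc_integrable g2 ->
  {ae leb2 R, forall z, strip R z -> g z = g2 z} ->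
  is_weak_derive e g h -> is_weak_derive e g2 h.
Proof.
move=> gl gl2 gg2 [hl gh]; split => // phi tphi; rewrite -gh//.
have [T [M [_ b be]]] := test_derive_bound tphi e_dir.
by apply/esym; exact: Rintegral_strip_ae gl gl2 gg2 be.
Qed.

Lemma weak_deriveP g : (exists h, is_weak_derive e g h) ->
  is_weak_derive e g (weak_derive e g).
Proof. by move=> [h gh]; exact: (xgetPex _ (ex_intro _ h gh)). Qed.

End direction.

End weak_derivatives.

(** * Fourier coefficients in t *)

Section fourier_coefficients.
Context (R : realType).
Notation leb := (@lebesgue_measure R).
Notation mR := (measurableTypeR R).
Implicit Types (g h : R * R -> R) (s : int) (x : R).

(** For real g the coefficient of order s is [fcos] - i [fsin]; working with this pair keeps all
    integrals real. *)
Definition fcos g s x : R := \int[leb]_(t in `[0, 2 * pi]) (g (x, t) * cos (s%:~R * t)).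
Definition fsin g s x : R := \int[leb]_(t in `[0, 2 * pi]) (g (x, t) * sin (s%:~R * t)).

Lemma two_pi_gt0 : 0 < 2 * pi :> R.
Proof. by rewrite mulr_gt0// pi_gt0. Qed.

Lemma period_sub : - (2 * pi) <= 0 :> R. Proof. by rewrite oppr_le0 ltW// two_pi_gt0. Qed.

Lemma ae_period_integrable g : loc_integrable g ->
  {ae leb, forall x, 0 < x < 1 -> leb.-integrable `[0, 2 * pi] (EFin \o (fun t => g (x, t)))}.
Proof.
move=> /ae_section_integrable; apply: ae_imp => x h x01.
exact: integrable_subitv (h x01 (2 * pi)) period_sub (lexx _).
Qed.

Lemma measurable_trig (f : R -> R) (s : R) (D : set mR) : continuous f ->
  measurable_fun D (fun t => f (s * t)).
Proof.
move=> cf; apply: measurable_funS (continuous_measurable_fun _) => // t.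
have h : s * y @[y --> t] --> s * t by apply: cvgMr; exact: cvg_id.
exact: (cvg_comp _ _ h (cf _)).
Qed.

Lemma integrable_cos (l r s : R) (f : R -> R) : leb.-integrable `[l, r] (EFin \o f) ->
  leb.-integrable `[l, r] (EFin \o (fun t => f t * cos (s * t))).
Proof.
move=> fi; apply: (integrable_bounded_mul _ fi (measurable_trig s (D := `[l, r]) (@continuous_cos R)) (K := 1)) => //.
by move=> t _; rewrite ler_norml cos_geN1 cos_le1.
Qed.

Lemma integrable_sin (l r s : R) (f : R -> R) : leb.-integrable `[l, r] (EFin \o f) ->
  leb.-integrable `[l, r] (EFin \o (fun t => f t * sin (s * t))).
Proof.
move=> fi; apply: (integrable_bounded_mul _ fi (measurable_trig s (D := `[l, r]) (@continuous_sin R)) (K := 1)) => //.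
by move=> t _; rewrite ler_norml sin_geN1 sin_le1.
Qed.

Lemma fcos_add g h s x (k : R) :
  leb.-integrable `[0, 2 * pi] (EFin \o (fun t => g (x, t))) ->
  leb.-integrable `[0, 2 * pi] (EFin \o (fun t => h (x, t))) ->
  fcos (fun z => k * g z + h z) s x = k * fcos g s x + fcos h s x.
Proof.
move=> gi hi; rewrite /fcos -RintegralZl//; last exact: integrable_cos.
rewrite -RintegralD//; [|apply: integrable_scale => //; exact: integrable_cos|exact: integrable_cos].
by apply: eq_Rintegral => t _; ring.
Qed.

Lemma fsin_add g h s x (k : R) :
  leb.-integrable `[0, 2 * pi] (EFin \o (fun t => g (x, t))) ->
  leb.-integrable `[0, 2 * pi] (EFin \o (fun t => h (x, t))) ->
  fsin (fun z => k * g z + h z) s x = k * fsin g s x + fsin h s x.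
Proof.
move=> gi hi; rewrite /fsin -RintegralZl//; last exact: integrable_sin.
rewrite -RintegralD//; [|apply: integrable_scale => //; exact: integrable_sin|exact: integrable_sin].
by apply: eq_Rintegral => t _; ring.
Qed.

Lemma fcos_scale0 g s x :
  fcos (fun z => 0 * g z) s x = 0 /\ fsin (fun z => 0 * g z) s x = 0.
Proof.
rewrite /fcos /fsin; split; under eq_Rintegral do rewrite !mul0r.
  by rewrite Rintegral_cst//= mul0r.
by rewrite Rintegral_cst//= mul0r.
Qed.

Lemma ae_section_eq g h : {ae leb2 R, forall z, strip R z -> g z = h z} ->
  {ae leb, forall x, 0 < x < 1 -> {ae leb, forall t, g (x, t) = h (x, t)}}.
Proof.
move=> /ae_leb2_section1; apply: ae_imp => x E x01; apply: filterS E => t; apply.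
by split => //=; rewrite in_itv.
Qed.

Lemma ae_fcos g h s : loc_integrable g -> loc_integrable h ->
  {ae leb2 R, forall z, strip R z -> g z = h z} ->
  {ae leb, forall x, 0 < x < 1 -> fcos g s x = fcos h s x /\ fsin g s x = fsin h s x}.
Proof.
move=> gl hl /ae_section_eq; move: (ae_period_integrable gl) (ae_period_integrable hl).
apply: ae_imp3 => x gi hi E x01; split; apply: ae_eq_Rintegral => //.
- exact/integrable_cos/gi.
- exact: (integrable_measurable (integrable_cos _ (hi x01))).
- by apply: ae_imp (E x01) => t ->.
- exact/integrable_sin/gi.
- exact: (integrable_measurable (integrable_sin _ (hi x01))).
- by apply: ae_imp (E x01) => t ->.
Qed.

Lemma integrable_box_cos g (T s : R) : loc_integrable g ->
  (leb2 R).-integrable (box T) (EFin \o (fun z => g z * cos (s * z.2))) /\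
  (leb2 R).-integrable (box T) (EFin \o (fun z => g z * sin (s * z.2))).
Proof.
move=> gl; have mb := measurable_box T.
have m (f : R -> R) : continuous f -> measurable_fun (box T) (fun z : mR * mR => f (s * z.2)).
  move=> cf; apply: measurable_funS (measurableT_comp (measurable_trig s (D := setT) cf) measurable_snd) => //.
split; apply: (integrable_bounded_mul mb (gl T) (m _ _) (K := 1)) => //.
- exact: continuous_cos.
- by move=> z _; rewrite ler_norml cos_geN1 cos_le1.
- exact: continuous_sin.
- by move=> z _; rewrite ler_norml sin_geN1 sin_le1.
Qed.

Lemma integrable_fcos g s : loc_integrable g ->
  leb.-integrable `]0, 1[ (EFin \o fcos g s) /\ leb.-integrable `]0, 1[ (EFin \o fsin g s).
Proof.
move=> gl; have [ic is_] := integrable_box_cos (2 * pi) s%:~R gl.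
have mI : measurable (`]0, 1[ : set mR) by exact: measurable_itv.
have mJ : measurable (`[0, 2 * pi] : set mR) by exact: measurable_itv.
have sub : (`]0, 1[ `*` `[0, 2 * pi] : set (mR * mR)) `<=` box (2 * pi).
  move=> [x t] [/= x01]; rewrite !in_itv/= => /andP[t0 t1]; split => //=.
  by rewrite in_itv/= t1 (le_trans period_sub).
have mX : measurable (`]0, 1[ `*` `[0, 2 * pi] : set (mR * mR)) by exact: measurableX.
split.
  apply: (@integrable_Rintegral_section1 _ _ _ (fun z => g z * cos (s%:~R * z.2)) mI mJ).
  exact: integrableS (measurable_box _) mX sub ic.
apply: (@integrable_Rintegral_section1 _ _ _ (fun z => g z * sin (s%:~R * z.2)) mI mJ).
exact: integrableS (measurable_box _) mX sub is_.
Qed.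

End fourier_coefficients.

(** * Unfolding integrals of periodic functions *)

Section unfolding.
Context (R : realType).
Notation leb := (@lebesgue_measure R).
Notation mR := (measurableTypeR R).
Let w : R := 2 * pi.

(* A smooth function supported in [0, 2w] whose w-periodization is 1. *)
Definition cutoff (t : R) : R := step (w^-1 * t) - step (w^-1 * t - 1).

Let w0 : 0 < w. Proof. exact: two_pi_gt0. Qed.

Lemma step_derive0 (step' : R -> R) (x : R) : (forall x : R, is_derive x 1 (@step R) (step' x)) ->
  x < 0 \/ 1 < x -> step' x = 0.
Proof.
move=> dstep x01; have [c nc] : exists c : R, {near x, cst c =1 @step R}.
  case: x01 => hx; [exists 0|exists 1]; near=> y.
    by rewrite step_le0//=; apply: ltW; near: y; exact: lt_nbhsl.
  by rewrite step_ge1//=; apply: ltW; near: y; exact: lt_nbhsr.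
have h := near_eq_is_derive nc (is_derive_cst c x 1).
by rewrite -(@derive_val _ _ _ _ _ _ _ (dstep x)) (@derive_val _ _ _ _ _ _ _ h).
Unshelve. all: by end_near.
Qed.

(** For 0 < t < w the second step vanishes at t and the first is 1 at t + w, so that the two values
    are step(t / w) and 1 - step(t / w). The derivatives cancel accordingly, which later removes the
    terms where a time derivative falls on the cutoff. *)
Lemma cutoffP : exists cutoff' : R -> R,
  [/\ smooth1 cutoff, smooth1 cutoff', forall t : R, is_derive t 1 cutoff (cutoff' t),
      forall t, 0 < t < w -> cutoff t + cutoff (t + w) = 1
    & forall t, 0 < t < w -> cutoff' t + cutoff' (t + w) = 0].
Proof.
have [step' sstep' dstep] := smooth1_derive (@smooth1_step R).
pose c' t := w^-1 * step' (w^-1 * t + 0) - w^-1 * step' (w^-1 * t + -1).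
have E : cutoff = fun t => step (w^-1 * t + 0) - step (w^-1 * t + -1).
  by apply/funext => t; rewrite addr0.
exists c'; split.
- rewrite E; apply: smooth1_sub; exact: smooth1_affine (@smooth1_step R).
- by apply: smooth1_sub; apply: smooth1_scale; exact: smooth1_affine.
- move=> t; rewrite E; apply: is_deriveB; exact: is_derive_affine.
- move=> t /andP[t0 tw]; rewrite /cutoff mulrDr mulVf ?gt_eqF// addrK.
  have wt0 : 0 < w^-1 * t by rewrite mulr_gt0// invr_gt0.
  have wt1 : w^-1 * t < 1 by rewrite mulrC ltr_pdivrMr ?mul1r.
  rewrite (step_le0 (x := w^-1 * t - 1)); last lra.
  rewrite (step_ge1 (x := w^-1 * t + 1)); last lra.
  by rewrite subr0 addrC subrK.
- move=> t /andP[t0 tw]; rewrite /c' mulrDr mulVf ?gt_eqF// addrK !addr0.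
  have wt0 : 0 < w^-1 * t by rewrite mulr_gt0// invr_gt0.
  have wt1 : w^-1 * t < 1 by rewrite mulrC ltr_pdivrMr ?mul1r.
  rewrite (step_derive0 (x := w^-1 * t - 1) dstep); last by left; lra.
  rewrite (step_derive0 (x := w^-1 * t + 1) dstep); last by right; lra.
  by ring.
Qed.

Lemma cutoff_supported : supported_in cutoff 0 (2 * w).
Proof.
move=> t; apply: contraNT; rewrite negb_and -!ltNge /cutoff => /orP[t0|t2].
  have h : w^-1 * t <= 0 by rewrite mulr_ge0_le0 ?invr_ge0 ?ltW.
  by rewrite !step_le0 ?subrr//; lra.
have h : 2 <= w^-1 * t by rewrite mulrC ler_pdivlMr// ltW.
by rewrite !step_ge1 ?subrr//; lra.
Qed.

(** The second half of [0, 2 w] is translated back by one period; periodicity of [f] leaves the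
    periodization Q of q as the weight on [0, w]. *)
Lemma unfold_period (f q Q : R -> R) (K : R) :
  leb.-integrable `[0, 2 * w] (EFin \o f) -> measurable_fun [set: mR] q ->
  (forall t, `|q t| <= K) -> {ae leb, forall t, f (t + w) = f t} ->
  measurable_fun [set: mR] Q ->
  (forall t, 0 < t < w -> q t + q (t + w) = Q t) ->
  \int[leb]_(t in `[0, 2 * w]) (f t * q t) = \int[leb]_(t in `[0, w]) (f t * Q t).
Proof.
move=> fi mq qK fper mQ qQ.
have mI (a b : R) : measurable (`[a, b] : set mR) by exact: measurable_itv.
have sub (a b : R) : measurable_fun (`[a, b] : set mR) q by exact: measurable_funS mq.
have fqi : leb.-integrable `[0, 2 * w] (EFin \o (fun t => f t * q t)).
  exact: (integrable_bounded_mul (mI _ _) fi (sub _ _) (fun t _ => qK t)).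
have ww : w <= 2 * w by rewrite mulr_natl mulr2n lerDl ltW.
rewrite (Rintegral_itv_split (ltW w0) ww)//.
have fi1 : leb.-integrable `[0, w] (EFin \o f) by exact: integrable_subitv fi _ _.
have h1 : leb.-integrable `[0, w] (EFin \o (fun t => f t * q t)) by exact: integrable_subitv fqi _ _.
have h2 : leb.-integrable `[0 + w, w + w] (EFin \o (fun t => f t * q t)).
  by rewrite add0r -mulr2n -mulr_natl; apply: integrable_subitv fqi _ _ => //; exact: ltW.
have [h2i] := Rintegral_translate h2.
rewrite add0r -mulr2n -[w *+ 2]mulr_natl => <-.
rewrite -RintegralD//.
have mf1 : measurable_fun (`[0, w] : set mR) f by exact: (integrable_measurable fi1).
apply: ae_eq_Rintegral => //.
- exact: integrable_add.
- by apply: measurable_funM => //; exact: measurable_funS mQ.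
have ne (c : R) : {ae leb, forall t, t != c}.
  exists [set c]; split; [exact: measurable_set1|exact: lebesgue_measure_set1|].
  by move=> t /negP; rewrite negbK => /eqP.
apply: ae_imp3 (ne 0) (ne w) fper => t t0 tw ft /=; rewrite in_itv/= => /andP[t0' tw'].
by rewrite ft -mulrDr qQ// lt_neqAle eq_sym t0 t0' lt_neqAle tw tw'.
Qed.

Lemma test_bound_mono (T T' M : R) (phi : R * R -> R) : T <= T' ->
  test_bound T M phi -> test_bound T' M phi.
Proof.
move=> TT' [c b s]; split => // z /s [z1 z2]; split => //; exact: le_trans TT'.
Qed.

Lemma ae_section_periodic (g : R * R -> R) : periodic_2pi g ->
  {ae leb, forall x, 0 < x < 1 -> {ae leb, forall t, g (x, t + w) = g (x, t)}}.
Proof.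
move=> /ae_leb2_section1; apply: ae_imp => x E x01; apply: ae_imp E => t; apply.
by split => //=; rewrite in_itv.
Qed.

Lemma integrable_period_section (g : R * R -> R) (Q : R -> R) : loc_integrable g ->
  continuous Q ->
  leb.-integrable `]0, 1[ (EFin \o (fun x => \int[leb]_(t in `[0, w]) (g (x, t) * Q t))).
Proof.
move=> gl cQ.
have mI : measurable (`]0, 1[ : set mR) by exact: measurable_itv.
have wi : (leb2 R).-integrable (`]0, 1[ `*` `[0, w]) (EFin \o (fun z => g z * Q z.2)).
  have sub : (`]0, 1[ `*` `[0, w] : set (mR * mR)) `<=` box w.
    move=> [x t] [/= x01]; rewrite !in_itv/= => /andP[t0 t1]; split => //=.
    by rewrite in_itv/= t1 (le_trans _ t0)// oppr_le0 ltW.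
  have mX : measurable (`]0, 1[ `*` `[0, w] : set (mR * mR)).
    by apply: measurableX => //; exact: measurable_itv.
  have gX : (leb2 R).-integrable (`]0, 1[ `*` `[0, w]) (EFin \o g).
    exact: integrableS (measurable_box _) mX sub (gl w).
  have [B QB] : exists B : R, forall t, `[0, w]%classic t -> `|Q t| <= B.
    have := @compact_bounded _ _ _ (continuous_compact (continuous_subspaceT cQ) (@segment_compact _ 0 w)).
    move=> [B [_ HB]]; exists (`|B| + 1) => t tw; apply: HB; last by exists t.
    by rewrite (le_lt_trans (ler_norm B))// ltrDl.
  apply: (integrable_bounded_mul mX gX (K := B)).
    apply: (measurable_funS measurableT) => //.
    by apply: (measurableT_comp _ measurable_snd); exact: continuous_measurable_fun.
  by move=> z [_ z2]; exact: QB.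
exact: (integrable_Rintegral_section1 mI (measurable_itv `[0, w]) wi).
Qed.

(** Turns a two-dimensional test integral into a one-dimensional one in x: with q = [cutoff] times a
    trigonometric function, Q is that function and the inner integral is a Fourier coefficient. *)
Lemma unfold_strip (g : R * R -> R) (N q Q : R -> R) (T M K : R) :
  loc_integrable g -> periodic_2pi g -> test_bound T M (tensor N q) ->
  continuous N -> continuous q -> (forall t, `|q t| <= K) -> (forall t, q t != 0 -> 0 <= t <= 2 * w) ->
  continuous Q -> (forall t, 0 < t < w -> q t + q (t + w) = Q t) ->
  \int[leb2 R]_(z in strip R) (g z * tensor N q z) =
  \int[leb]_(x in `]0, 1[) (N x * \int[leb]_(t in `[0, w]) (g (x, t) * Q t)).
Proof.
move=> gl gper tb cN cq qK qs cQ qQ.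
pose T' := Num.max T (2 * w).
have TT' : T <= T' by rewrite le_max lexx.
have wT' : 2 * w <= T' by rewrite le_max lexx orbT.
have T'0 : - T' <= 0.
  by rewrite oppr_le0 (le_trans _ wT')// mulr_ge0// ltW.
have tb' := test_bound_mono TT' tb.
have mI : measurable (`]0, 1[ : set mR) by exact: measurable_itv.
have mJ : measurable (`[- T', T'] : set mR) by exact: measurable_itv.
have gphi := integrable_box_test gl tb'.
rewrite (Rintegral_strip_box _ tb') (Rintegral_setX1 mI mJ gphi).
have Fi := integrable_Rintegral_section1 mI mJ gphi.
have mN : measurable_fun (`]0, 1[ : set mR) (fun x => N x * \int[leb]_(t in `[0, w]) (g (x, t) * Q t)).
  have wm := integrable_measurable (integrable_period_section gl cQ).
  by apply: measurable_funM wm; apply: measurable_funS (continuous_measurable_fun cN).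
apply: ae_eq_Rintegral => //.
apply: ae_imp2 (ae_section_integrable gl) (ae_section_periodic gper) => x gi gp.
rewrite /= in_itv/= => x01.
have mq : measurable_fun [set: mR] q by exact: continuous_measurable_fun.
have mQ : measurable_fun [set: mR] Q by exact: continuous_measurable_fun.
have gxi : leb.-integrable `[0, 2 * w] (EFin \o (fun t => g (x, t))).
  exact: integrable_subitv (gi x01 T') _ _.
rewrite -(unfold_period gxi mq qK (gp x01) mQ qQ) -RintegralZl//; last first.
  apply: (integrable_bounded_mul _ gxi (K := K)) => //.
  exact: measurable_funS mq.
rewrite [LHS]Rintegral_mkcond [RHS]Rintegral_mkcond; apply: eq_Rintegral => t _.
rewrite !patchE /tensor /=.
have [->|/qs /andP[t0 tw]] := eqVneq (q t) 0; first by rewrite !mulr0 !if_same.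
rewrite !mem_set/= ?in_itv/= ?t0//; last by rewrite (le_trans T'0 t0) (le_trans tw wT').
by ring.
Qed.

End unfolding.

(** * The lemma of du Bois-Reymond *)

Section du_bois_reymond.
Context (R : realType).
Notation leb := (@lebesgue_measure R).
Notation mR := (measurableTypeR R).
Implicit Types (f g N : R -> R).

Lemma smooth1_continuous N : smooth1 N -> continuous N.
Proof.
move=> /smooth1_derive [N' _ NN'] x.
exact/differentiable_continuous/derivable1_diffP/(@ex_derive _ _ _ _ _ _ _ (NN' x)).
Qed.

Lemma ae0_of_tests f : leb.-integrable `]0, 1[ (EFin \o f) ->
  (forall N (a b : R), smooth1 N -> 0 < a -> b < 1 -> supported_in N a b ->
    \int[leb]_(x in `]0, 1[) (N x * f x) = 0) ->
  {ae leb, forall x, 0 < x < 1 -> f x = 0}.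
Proof.
move=> fi f0.
apply: ae0_of_rational_intervals; [exact: ltr01|exact: (Rintegral_itv_oo fi).1|].
move=> p q p0 pq q1; set a : R := ratr p in p0 pq *; set b : R := ratr q in pq q1 *.
have mI : measurable (`]0, 1[ : set mR) by exact: measurable_itv.
have mf := integrable_measurable fi.
rewrite Rintegral_mkcond.
transitivity (\int[leb]_(x in `]0, 1[) (\1_(`]a, b[ : set R) x * f x)).
  rewrite [RHS]Rintegral_mkcond; apply: eq_Rintegral => z _; rewrite !patchE indicE.
  have [zr|zr] := boolP (z \in _); last by rewrite mul0r if_same.
  rewrite ifT ?mul1r//; apply/mem_set; move: zr; rewrite inE/= !in_itv/= => /andP[az zb].
  by rewrite (lt_trans p0 az) (lt_trans zb q1).
suff cv : (fun k => \int[leb]_(x in `]0, 1[) (plateau a b k x * f x)) @ \oo -->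
    \int[leb]_(x in `]0, 1[) (\1_(`]a, b[ : set R) x * f x).
  rewrite -(cvg_lim (@Rhausdorff R) cv) (_ : (fun k => _) = cst 0); first exact: lim_cst.
  apply/funext => k; apply: (f0 _ a b) => //; first exact: smooth1_plateau.
  exact: plateau_supported.
apply: (Rintegral_dominated_cvg mI _ _ _ (integrable_norm fi)).
- move=> k; apply: measurable_funM => //.
  apply: measurable_funS (continuous_measurable_fun _) => //.
  exact/smooth1_continuous/smooth1_plateau.
- by apply: measurable_funM => //; exact: measurable_indic.
- by move=> x _; apply: cvgMl; exact: plateau_cvg.
- by move=> k x _; rewrite normrM ler_piMl// plateau_bound.
Qed.

(** The base point -1 lies where [step] vanishes: every x >= 0 is then interior to the range of
    integration, and near x < 0 the function is constantly 0. *)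
Definition ramp (x : R) : R := \int[leb]_(t in `[-1, x]) step t.

Lemma integrable_continuous_cc (a b : R) f : continuous f ->
  leb.-integrable `[a, b] (EFin \o f).
Proof.
move=> cf; apply: continuous_compact_integrable; first exact: segment_compact.
exact: continuous_subspaceT.
Qed.

Lemma is_derive_ramp (x : R) : is_derive x 1 ramp (step x).
Proof.
have cs : continuous (@step R) by exact/smooth1_continuous/smooth1_step.
have [x0|x0] := ltP x 0; last first.
  have x1 : -1 < x by rewrite (lt_le_trans _ x0)// ltrN10.
  have [d1 d2] := @continuous_FTC1_closed _ (@step R) (-1) x (x + 1)
    (ltr_pwDr ltr01 (lexx x)) (integrable_continuous_cc _ _ cs) x1 (cs x).
  by apply: DeriveDef; [exact: d1|rewrite -derive1E; exact: d2].
rewrite step_le0 ?ltW//.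
apply: near_eq_is_derive (is_derive_cst 0 x 1); near=> y.
rewrite /ramp (@eq_Rintegral _ _ _ _ _ (cst 0)) ?Rintegral_cst ?mul0r//.
move=> t; rewrite inE/= in_itv/= => /andP[_ ty]; apply: step_le0.
by apply: (le_trans ty); apply: ltW; near: y; exact: lt_nbhsl.
Unshelve. all: by end_near.
Qed.

Lemma smooth1_ramp : smooth1 ramp.
Proof. exact: smooth1_primitive (@smooth1_step R) is_derive_ramp. Qed.

Lemma ramp_le0 (x : R) : x <= 0 -> ramp x = 0.
Proof.
move=> x0; rewrite /ramp (@eq_Rintegral _ _ _ _ _ (cst 0)) ?Rintegral_cst ?mul0r//.
move=> t; rewrite inE/= in_itv/= => /andP[_ tx]; apply: step_le0; exact: le_trans x0.
Qed.

Lemma ramp_ge1 (x : R) : 1 <= x -> ramp x = x - 1 + ramp 1.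
Proof.
move=> x1; have cs : continuous (@step R) by exact/smooth1_continuous/smooth1_step.
have N1 : -1 <= 1 :> R by rewrite (le_trans (lerN10 R)).
rewrite /ramp (Rintegral_itv_split N1 x1); last exact: integrable_continuous_cc.
rewrite addrC; congr (_ + _).
rewrite (@eq_Rintegral _ _ _ _ _ (cst 1)); last first.
  by move=> t; rewrite inE/= in_itv/= => /andP[t1 _]; exact: step_ge1.
by rewrite Rintegral_cst// mul1r (lebesgue_cc x1).2.
Qed.

(* Derivatives of combinations of four ramps approximate the difference of the
   indicators of two intervals of equal length. *)
Definition hat (a b d : R) (k : nat) (x : R) : R := k%:R^-1 *
  (ramp (k%:R * (x - a)) - ramp (k%:R * (x - (a + d)))
   - (ramp (k%:R * (x - b)) - ramp (k%:R * (x - (b + d))))).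

Definition dhat (a b d : R) (k : nat) (x : R) : R :=
  step (k%:R * (x - a)) - step (k%:R * (x - (a + d)))
   - (step (k%:R * (x - b)) - step (k%:R * (x - (b + d)))).

Lemma smooth1_shift f (k y : R) : smooth1 f -> smooth1 (fun x => f (k * (x - y))).
Proof.
move=> sf; rewrite (_ : (fun _ => _) = (fun x => f (k * x + (- (k * y))))).
  exact: smooth1_affine.
by apply/funext => x; rewrite mulrBr.
Qed.

Lemma is_derive_shift f f' (k y x : R) : (forall x : R, is_derive x 1 f (f' x)) ->
  is_derive x 1 (fun x => f (k * (x - y))) (k * f' (k * (x - y))).
Proof.
move=> ff'; have := is_derive_affine k (- (k * y)) x ff'.
rewrite -mulrBr (_ : (fun x => f (k * x - k * y)) = (fun x => f (k * (x - y))))//.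
by apply/funext => z; rewrite mulrBr.
Qed.

Lemma smooth1_hat a b d k : smooth1 (hat a b d k).
Proof.
by apply: smooth1_scale; do !apply: smooth1_sub; apply: smooth1_shift; exact: smooth1_ramp.
Qed.

Lemma is_derive_hat (a b d : R) k (x : R) : (0 < k)%N -> is_derive x 1 (hat a b d k) (dhat a b d k x).
Proof.
move=> k0; have kn0 : (k%:R : R) != 0 by rewrite pnatr_eq0 -lt0n.
have D y := is_derive_shift k%:R y x is_derive_ramp.
have h := is_deriveB (is_deriveB (D a) (D (a + d))) (is_deriveB (D b) (D (b + d))).
have := is_deriveZ (k%:R^-1) h.
move=> h'; apply: is_derive_eq h' _.
by rewrite /dhat -!mulrBr; exact: mulKf.
Qed.

Lemma hat_supported (a b d : R) (k : nat) : (0 < k)%N -> 0 <= d ->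
  supported_in (hat a b d k) (Num.min a b) (Num.max a b + d + k%:R^-1).
Proof.
move=> k0 d0 x; apply: contraNT; rewrite negb_and -!ltNge.
have kp : 0 < (k%:R : R) by rewrite ltr0n.
move=> /orP[]; rewrite ?lt_min.
  move=> /andP[xa xb]; rewrite /hat !ramp_le0 ?subrr ?mulr0//;
    by rewrite mulr_ge0_le0 ?ler0n//; lra.
move=> xh.
have ha : a <= Num.max a b by rewrite le_max lexx.
have hb : b <= Num.max a b by rewrite le_max lexx orbT.
have H y : y <= Num.max a b + d -> 1 <= k%:R * (x - y).
  by move=> yd; rewrite mulrC -ler_pdivrMr// div1r; lra.
rewrite /hat (ramp_ge1 (x := k%:R * (x - a))); last by apply: H; lra.
rewrite (ramp_ge1 (x := k%:R * (x - (a + d)))); last by apply: H; lra.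
rewrite (ramp_ge1 (x := k%:R * (x - b))); last by apply: H; lra.
rewrite (ramp_ge1 (x := k%:R * (x - (b + d)))); last by apply: H; lra.
by rewrite mulf_eq0; apply/orP; right; apply/eqP; ring.
Qed.

Lemma step_shift_cvg (y x : R) : (fun k : nat => step (k%:R * (x - y))) @ \oo -->
  (if y < x then 1 else 0 : R).
Proof.
case: ltP => [yx|xy]; first by apply: step_cvg; rewrite subr_gt0.
apply: cvg_near_cst; near=> k; apply: step_le0.
by rewrite mulr_ge0_le0 ?ler0n// subr_le0.
Unshelve. all: by end_near.
Qed.

(** Testing with [hat] and letting k grow shows that the integral of [f] over an interval depends on
    its length only. Hence the difference quotients of the indefinite integral F agree at all
    points, and so do its derivatives, which equal [f] almost everywhere. *)
Lemma du_bois_reymond f : leb.-integrable `]0, 1[ (EFin \o f) ->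
  (forall N N' (a b : R), smooth1 N -> smooth1 N' -> (forall x : R, is_derive x 1 N (N' x)) ->
    0 < a -> b < 1 -> supported_in N a b ->
    \int[leb]_(x in `]0, 1[) (N' x * f x) = 0) ->
  exists c : R, {ae leb, forall x, 0 < x < 1 -> f x = c}.
Proof.
move=> fi f0.
have mI : measurable (`]0, 1[ : set mR) by exact: measurable_itv.
pose g := f \_ (`]0, 1[ : set R).
have gi : leb.-integrable setT (EFin \o g) by exact: (iffLR (integrable_restrictE _ mI) fi).
have gl : locally_integrable [set: R] g.
  split => //; [exact: (integrable_measurable gi)|exact: openT|].
  move=> K _ cK; have mK : measurable (K : set mR) by apply: closed_measurable; exact: compact_closed.
  have giK : leb.-integrable (K : set mR) (EFin \o g) by exact: integrableS gi.
  by have /integrableP[_] := integrable_norm giK; under eq_integral do rewrite /= normr_id.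
have gy (y : R) : leb.-integrable `]-oo, y] (EFin \o g) by exact: integrableS gi.
pose F y := \int[leb]_(t in `]-oo, y]) g t.
pose chi (d y x : R) : R := (if y < x then 1 else 0) - (if y + d < x then 1 else 0).
have incr (y d : R) : 0 < y -> 0 <= d -> y + d < 1 ->
    F (y + d) - F y = \int[leb]_(x in `]0, 1[) (chi d y x * f x).
  move=> y0 d0 yd1; rewrite /F (Rintegral_itvB (b := BRight (y + d)) (gy _)) ?bnd_simp ?lerDl//.
  rewrite [LHS]Rintegral_mkcond [RHS]Rintegral_mkcond; apply: eq_Rintegral => x _.
  rewrite /g /chi !patchE; have [|xyd] := boolP (x \in (`]y, (y + d)%R]%classic : set R)).
    rewrite inE/= in_itv/= => /andP[yx xyd].
    rewrite mem_set/= ?in_itv/= ?(lt_trans y0 yx) ?(le_lt_trans xyd yd1)//.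
    by rewrite yx ltNge xyd/= subr0 mul1r.
  case: ifPn => // _; move: xyd; rewrite notin_setE/= in_itv/= => /negP.
  rewrite negb_and -leNgt -ltNge => /orP[xy|yd].
    by rewrite !ltNge xy (le_trans xy) ?lerDl//= subrr mul0r.
  by rewrite yd (le_lt_trans _ yd) ?lerDl// subrr mul0r.
have same (a b d : R) : 0 < a -> 0 < b -> 0 <= d -> a + d < 1 -> b + d < 1 ->
    F (a + d) - F a = F (b + d) - F b.
  move=> a0 b0 d0 a1 b1; rewrite !incr//.
  have mchi y : measurable_fun (`]0, 1[ : set mR) (chi d y).
    have mif z : measurable_fun (`]0, 1[ : set mR) (fun x : R => if z < x then 1 else 0 : R).
      have -> : (fun x : R => if z < x then 1 else 0 : R) = \1_(`]z, +oo[ : set R).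
        apply/funext => x; rewrite indicE; case: ltP => [zx|xz].
          by rewrite mem_set//= in_itv/= zx.
        by rewrite memNset//= in_itv/= ltNge xz.
      by apply: measurable_indic; exact: measurable_itv.
    by apply: measurable_funB; exact: mif.
  have chiB y x : `|chi d y x| <= 2.
    rewrite /chi (le_trans (ler_normB _ _))//.
    have le1 (P : bool) : `|if P then 1 else 0 : R| <= 1 by case: P; rewrite ?normr1 ?normr0.
    by rewrite (_ : 2 = 1 + 1)// lerD.
  have chii y : leb.-integrable `]0, 1[ (EFin \o (fun x => chi d y x * f x)).
    under [X in EFin \o X]eq_fun do rewrite mulrC.
    exact: (integrable_bounded_mul mI fi (mchi y) (fun x _ => chiB y x)).
  apply/eqP; rewrite -subr_eq0 -RintegralB//; apply/eqP.
  transitivity (\int[leb]_(x in `]0, 1[) ((chi d a x - chi d b x) * f x)).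
    by apply: eq_Rintegral => x _; exact/esym/mulrBl.
  have dB k x : `|dhat a b d k x| <= 4.
    have sB z : `|step (z : R)| <= 1.
      by have /andP[z0 z1] := step_bound z; rewrite ger0_norm.
    rewrite /dhat (le_trans (ler_normB _ _))// (_ : 4 = 2 + 2); last by ring.
    by apply: lerD; rewrite (le_trans (ler_normB _ _))// (_ : 2 = 1 + 1)// lerD.
  have cv : (fun k => \int[leb]_(x in `]0, 1[) (dhat a b d k x * f x)) @ \oo -->
    \int[leb]_(x in `]0, 1[) ((chi d a x - chi d b x) * f x).
    have mf := integrable_measurable fi.
    apply: (Rintegral_dominated_cvg mI _ _ _ (integrable_scale 4 mI (integrable_norm fi))).
    - move=> k; apply: measurable_funM => //.
      apply: measurable_funS (continuous_measurable_fun _) => //.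
      apply: smooth1_continuous.
      by do !apply: smooth1_sub; apply: smooth1_shift; exact: smooth1_step.
    - by apply: measurable_funM => //; apply: measurable_funB.
    - move=> x _; apply: cvgMl; apply: cvgB; apply: cvgB; exact: step_shift_cvg.
    - by move=> k x _ /=; rewrite normrM ler_wpM2r.
  have c0 : (fun k => \int[leb]_(x in `]0, 1[) (dhat a b d k x * f x)) @ \oo --> (0 : R).
    apply: cvg_near_cst; near=> k.
    have k0 : (0 < k)%N by near: k; exact: nbhs_infty_gt.
    have [dd sdd hdd] := smooth1_derive (smooth1_hat a b d k).
    have E : dd = dhat a b d k.
      apply/funext => x; rewrite -(@derive_val _ _ _ _ _ _ _ (hdd x)).
      exact: (@derive_val _ _ _ _ _ _ _ (is_derive_hat a b d x k0)).
    rewrite -E; apply: f0 (smooth1_hat a b d k) sdd hdd _ _ (hat_supported k0 d0).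
      by rewrite lt_min a0.
    have e0 : 0 < 1 - (Num.max a b + d).
      by rewrite subr_gt0; case: (leP a b).
    rewrite -ltrBrDl -[ltRHS]invrK ltf_pV2 ?posrE ?ltr0n ?invr_gt0//.
    near: k; exact: nbhs_infty_gtr.
  by rewrite -(cvg_lim (@Rhausdorff R) cv) (cvg_lim (@Rhausdorff R) c0).
have FTC := FTC1Ny gy gl.
(* A reference point at which F is differentiable with derivative g exists because ]0, 1[ has
   positive measure; its value is the constant. *)
have [x' [x'0 x'1 [dx' Dx']]] : exists x', [/\ 0 < x', x' < 1 &
    derivable F x' 1 /\ F^`()%classic x' = g x'].
  have [A [mA A0 PA]] := FTC; apply: contrapT => H.
  have sub : `]0, 1[ `<=` A.
    move=> x; rewrite /= in_itv/= => /andP[x0 x1]; apply: PA => /= Px.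
    by apply: H; exists x.
  have : (leb `]0%R, 1%R[ <= leb A)%E by apply: le_measure; rewrite ?inE.
  have /(_ ler01)[fin E] := @lebesgue_oo R 0 1.
  have fn : leb `]0, 1[ \is a fin_num by rewrite ge0_fin_numE.
  have -> : leb `]0, 1[ = 1%:E by rewrite -(fineK fn) E subr0.
  by rewrite [leb A]A0 lee_fin ler10.
exists (g x').
(* Quotients from the right suffice and match [same], which compares intervals of length d >= 0. *)
have quot x : derivable F x 1 -> h^-1 *: ((F \o shift x) (h *: 1) - F x) @[h --> 0^'+] --> 'D_1 F x.
  exact: cvg_dnbhs_at_right.
move: FTC; apply: ae_imp => x [dx Dx] /andP[x0 x1].
have <- : g x = f x by rewrite /g patchE mem_set//= in_itv/= x0.
rewrite -Dx -Dx' !derive1E.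
have h1 := quot _ dx; have h2 := quot _ dx'.
apply: (cvg_unique (@Rhausdorff R) h1).
apply: cvg_trans h2; apply: near_eq_cvg; near=> h.
have h0 : 0 < h by near: h; exact: nbhs_right_gt.
have hx : h < 1 - x by near: h; apply: nbhs_right_lt; rewrite subr_gt0.
have hx' : h < 1 - x' by near: h; apply: nbhs_right_lt; rewrite subr_gt0.
rewrite /= [h *: 1]mulr1; congr (_ *: _).
by rewrite ![h + _]addrC; apply: same => //; rewrite ?ltW// -ltrBrDl.
Unshelve. all: by end_near.
Qed.

End du_bois_reymond.

(** * Fourier coefficients of weak derivatives *)

Section modes.
Context (R : realType).
Notation leb := (@lebesgue_measure R).
Notation mR := (measurableTypeR R).
Implicit Types (g h u : R * R -> R) (s : int).

Lemma trig_periodic s (t : R) : cos (s%:~R * (t + 2 * pi)) = cos (s%:~R * t) /\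
  sin (s%:~R * (t + 2 * pi)) = sin (s%:~R * t) :> R.
Proof.
have gen (f : R -> R) : periodic f (pi *+ 2) -> f (s%:~R * (t + 2 * pi)) = f (s%:~R * t).
  move=> fp; rewrite mulrDr [2 * pi]mulr_natl.
  case: s => n; first by rewrite -pmulrn [n%:R * (pi *+ 2)]mulr_natl periodicn.
  rewrite NegzE mulrNz -pmulrn !mulNr [n.+1%:R * (pi *+ 2)]mulr_natl.
  by rewrite -(periodicn fp n.+1 (_ - _)) subrK.
by split; apply: gen; [exact: cosD2pi|exact: sinD2pi].
Qed.

Lemma is_derive_scaled (f f' : R -> R) (k x : R) : (forall x : R, is_derive x 1 f (f' x)) ->
  is_derive x 1 (fun x : R => f (k * x)) (k * f' (k * x)).
Proof.
move=> ff'; have := is_derive_affine k 0 x ff'; rewrite addr0.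
by rewrite (_ : (fun x => f (k * x + 0)) = (fun x => f (k * x)))//; apply/funext => y; rewrite addr0.
Qed.

Lemma integrable_oo_bounded_mul (a b : R) (f N : R -> R) : leb.-integrable `]a, b[ (EFin \o f) ->
  continuous N -> (exists K : R, forall x, `|N x| <= K) ->
  leb.-integrable `]a, b[ (EFin \o (fun x => N x * f x)).
Proof.
move=> fi cN [K NK]; under [X in EFin \o X]eq_fun do rewrite mulrC.
apply: (integrable_bounded_mul _ fi (K := K)) => //.
exact: measurable_funS (continuous_measurable_fun cN).
Qed.

Lemma supported_bounded (N : R -> R) (a b : R) : continuous N -> supported_in N a b ->
  exists K : R, forall x, `|N x| <= K.
Proof.
move=> cN sN; have := @compact_bounded _ _ _
  (continuous_compact (continuous_subspaceT cN) (@segment_compact _ a b)).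
move=> [B [_ HB]]; exists (`|B| + 1) => t.
have [->|/sN tab] := eqVneq (N t) 0; first by rewrite normr0 addr_ge0.
by apply: HB; [rewrite (le_lt_trans (ler_norm B))// ltrDl|exists t; rewrite //= in_itv].
Qed.

Lemma supported_derive (N N' : R -> R) (a b : R) : (forall x : R, is_derive x 1 N (N' x)) ->
  supported_in N a b -> supported_in N' a b.
Proof.
move=> dN sN x; apply: contraNT => /negP xab; apply/eqP.
have near0 : {near x, cst 0 =1 N}.
  have : x < a \/ b < x by move/negP: xab; rewrite negb_and -!ltNge => /orP.
  case=> hx; near=> y; apply/esym/eqP; apply: contraT => /sN /andP[ay yb].
    have : y < a by near: y; exact: lt_nbhsl.
    by rewrite ltNge ay.
  have : b < y by near: y; exact: lt_nbhsr.
  by rewrite ltNge yb.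
have h := near_eq_is_derive near0 (is_derive_cst (0 : R) x 1).
by rewrite -(@derive_val _ _ _ _ _ _ _ (dN x)) (@derive_val _ _ _ _ _ _ _ h).
Unshelve. all: by end_near.
Qed.

(* The test function N(x) cutoff(t) c(t), with c = cos (s t) or sin (s t). *)
Lemma weak_dx_mode u h s : loc_integrable u -> periodic_2pi u -> periodic_2pi h ->
  is_weak_derive (dx R) u h ->
  forall N N' (a b : R), smooth1 N -> smooth1 N' -> (forall x : R, is_derive x 1 N (N' x)) ->
    0 < a -> b < 1 -> supported_in N a b ->
    \int[leb]_(x in `]0, 1[) (N' x * fcos u s x) =
      - (\int[leb]_(x in `]0, 1[) (N x * fcos h s x)) /\
    \int[leb]_(x in `]0, 1[) (N' x * fsin u s x) =
      - (\int[leb]_(x in `]0, 1[) (N x * fsin h s x)).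
Proof.
move=> ul up hp [hl uh] N N' a b sN sN' dN a0 b1 Nab.
have [chi' [sc sc' dc chi1 chi0]] := cutoffP R.
have [scos ssin] := smooth1_cossin (s%:~R : R).
have gen (c : R -> R) : smooth1 c -> (forall t, c (t + 2 * pi) = c t) ->
    \int[leb]_(x in `]0, 1[) (N' x * \int[leb]_(t in `[0, 2 * pi]) (u (x, t) * c t)) =
    - \int[leb]_(x in `]0, 1[) (N x * \int[leb]_(t in `[0, 2 * pi]) (h (x, t) * c t)).
  move=> sc1 cp; pose q t := cutoff t * c t.
  have sq : smooth1 q by exact: smooth1_mul.
  have qs : supported_in q 0 (2 * (2 * pi)).
    by move=> t; rewrite mulf_eq0 negb_or => /andP[/cutoff_supported].
  have qQ t : 0 < t < 2 * pi -> q t + q (t + 2 * pi) = c t.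
    by move=> tw; rewrite /q cp -mulrDl chi1// mul1r.
  have [T1 [M1 [_ tb _ _]]] := test_function_bound (test_function_tensor sN sq a0 b1 Nab qs).
  have sN'ab := supported_derive dN Nab.
  have [T2 [M2 [_ tb' _ _]]] := test_function_bound (test_function_tensor sN' sq a0 b1 sN'ab qs).
  have cq := smooth1_continuous sq; have cc := smooth1_continuous sc1.
  have [K qK] := supported_bounded cq qs.
  rewrite -(unfold_strip ul up tb' (smooth1_continuous sN') cq qK qs cc qQ).
  rewrite -(unfold_strip hl hp tb (smooth1_continuous sN) cq qK qs cc qQ).
  have [q' sq' dq] := smooth1_derive sq.
  rewrite -uh; last exact: test_function_tensor sN sq a0 b1 Nab qs.
  apply: eq_Rintegral => z _; congr (_ * _).
  by rewrite (derive_tensor _ _ dN dq) /dx/= /tensor; ring.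
by split; apply: gen => // t; have [] := trig_periodic s t.
Qed.

(** Integration by parts in t for almost every x. The weak equation is tested with N(x) cutoff(t)
    c(t); the periodization of (cutoff c)' is c', since the terms with the derivative of the cutoff
    cancel, and N is arbitrary. *)
Lemma weak_dt_mode u h s : loc_integrable u -> periodic_2pi u -> periodic_2pi h ->
  is_weak_derive (dt R) u h ->
  {ae leb, forall x, 0 < x < 1 -> fcos h s x = s%:~R * fsin u s x /\
     fsin h s x = - s%:~R * fcos u s x}.
Proof.
move=> ul up hp [hl uh].
have [chi' [sc sc' dc chi1 chi0]] := cutoffP R.
have [scos ssin] := smooth1_cossin (s%:~R : R).
have [uci usi] := integrable_fcos s ul.
have [hci hsi] := integrable_fcos s hl.
have mI : measurable (`]0, 1[ : set mR) by exact: measurable_itv.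
have gen (c c' : R -> R) (Fu Fh : R -> R) (k : R) : smooth1 c -> smooth1 c' ->
    (forall t : R, is_derive t 1 c (c' t)) ->
    (forall t, c (t + 2 * pi) = c t) -> (forall t, c' (t + 2 * pi) = c' t) ->
    leb.-integrable `]0, 1[ (EFin \o Fu) -> leb.-integrable `]0, 1[ (EFin \o Fh) ->
    (forall x, \int[leb]_(t in `[0, 2 * pi]) (h (x, t) * c t) = Fh x) ->
    {ae leb, forall x, 0 < x < 1 -> \int[leb]_(t in `[0, 2 * pi]) (u (x, t) * c' t) = k * Fu x} ->
    {ae leb, forall x, 0 < x < 1 -> Fh x = - k * Fu x}.
  move=> sc1 sc1' dc1 cp cp' Fui Fhi FhE FuE.
  suff : {ae leb, forall x, 0 < x < 1 -> Fh x + k * Fu x = 0}.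
    by apply: ae_imp => x E /E /eqP; rewrite addr_eq0 mulNr => /eqP.
  have kFui := integrable_scale k mI Fui.
  apply: ae0_of_tests; first exact: integrable_add.
  move=> N a b sN a0 b1 Nab.
  have [N' sN' dN] := smooth1_derive sN.
  pose q t := cutoff t * c t; pose q' t := chi' t * c t + cutoff t * c' t.
  have sq : smooth1 q by exact: smooth1_mul.
  have sq' : smooth1 q' by apply: smooth1_add; exact: smooth1_mul.
  have dq (t : R) : is_derive t 1 q (q' t) by exact: is_derive_mul.
  have qs : supported_in q 0 (2 * (2 * pi)).
    by move=> t; rewrite mulf_eq0 negb_or => /andP[/cutoff_supported].
  have qs' := supported_derive dq qs.
  have qQ t : 0 < t < 2 * pi -> q t + q (t + 2 * pi) = c t.
    by move=> tw; rewrite /q cp -mulrDl chi1// mul1r.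
  have qQ' t : 0 < t < 2 * pi -> q' t + q' (t + 2 * pi) = c' t.
    move=> tw; rewrite /q' cp cp'.
    transitivity ((chi' t + chi' (t + 2 * pi)) * c t + (cutoff t + cutoff (t + 2 * pi)) * c' t).
      by ring.
    by rewrite chi1// chi0// mul0r mul1r add0r.
  have [T1 [M1 [_ tb _ _]]] := test_function_bound (test_function_tensor sN sq a0 b1 Nab qs).
  have [T2 [M2 [_ tb' _ _]]] := test_function_bound (test_function_tensor sN sq' a0 b1 Nab qs').
  have cq := smooth1_continuous sq; have cc := smooth1_continuous sc1.
  have cq' := smooth1_continuous sq'; have cc' := smooth1_continuous sc1'.
  have [K qK] := supported_bounded cq qs; have [K' qK'] := supported_bounded cq' qs'.
  have cN := smooth1_continuous sN; have NB := supported_bounded cN Nab.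
  have E1 := unfold_strip ul up tb' cN cq' qK' qs' cc' qQ'.
  have E2 := unfold_strip hl hp tb cN cq qK qs cc qQ.
  have := uh _ (test_function_tensor sN sq a0 b1 Nab qs).
  rewrite [X in X = _](_ : _ = \int[leb2 R]_(z in strip R) (u z * tensor N q' z)); last first.
    apply: eq_Rintegral => z _; congr (_ * _).
    by rewrite (derive_tensor _ _ dN dq) /dt/= /tensor; ring.
  rewrite E1 E2.
  have E3 : \int[leb]_(x in `]0, 1[) (N x * \int[leb]_(t in `[0, 2 * pi]) (u (x, t) * c' t)) =
      \int[leb]_(x in `]0, 1[) (N x * (k * Fu x)).
    apply: ae_eq_Rintegral => //.
    - apply: integrable_oo_bounded_mul => //; exact: integrable_period_section.
    - exact: (integrable_measurable (integrable_oo_bounded_mul kFui cN NB)).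
    - by apply: ae_imp FuE => x Fx; rewrite /= in_itv/= => /Fx ->.
  rewrite E3 => E4.
  have E : \int[leb]_(x in `]0, 1[) (N x * (k * Fu x)) =
      - \int[leb]_(x in `]0, 1[) (N x * Fh x).
    by rewrite E4; congr (- _); apply: eq_Rintegral => x _; rewrite FhE.
  under eq_Rintegral do rewrite mulrDr.
  rewrite RintegralD//; [|exact: integrable_oo_bounded_mul|exact: integrable_oo_bounded_mul].
  by rewrite E subrr.
have per := trig_periodic s.
have dcos (t : R) : is_derive t 1 (fun t => cos (s%:~R * t)) (- s%:~R * sin (s%:~R * t) : R).
  by have := is_derive_scaled s%:~R t (@is_derive_cos R); rewrite mulrN mulNr.
have dsin (t : R) : is_derive t 1 (fun t => sin (s%:~R * t)) (s%:~R * cos (s%:~R * t) : R).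
  exact: is_derive_scaled (@is_derive_sin R).
have ui := ae_period_integrable ul.
have E1 : {ae leb, forall x, 0 < x < 1 -> fcos h s x = - (- s%:~R) * fsin u s x}.
  apply: (gen _ _ _ _ _ scos (smooth1_scale _ ssin) dcos) => //.
  - by move=> t; have [] := per t.
  - by move=> t; have [_ ->] := per t.
  - apply: ae_imp ui => x ui x01; rewrite /fsin -RintegralZl//; last exact/integrable_sin/ui.
    by apply: eq_Rintegral => t _; rewrite mulrCA.
have E2 : {ae leb, forall x, 0 < x < 1 -> fsin h s x = - s%:~R * fcos u s x}.
  apply: (gen _ _ _ _ _ ssin (smooth1_scale _ scos) dsin) => //.
  - by move=> t; have [] := per t.
  - by move=> t; have [-> _] := per t.
  - apply: ae_imp ui => x ui x01; rewrite /fcos -RintegralZl//; last exact/integrable_cos/ui.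
    by apply: eq_Rintegral => t _; rewrite mulrCA.
apply: ae_imp2 E1 E2 => x e1 e2 x01; split; last exact: e2.
by rewrite e1// opprK.
Qed.

Lemma is_prim_of_derive (N N' : R -> R) : (forall x : R, is_derive x 1 N (N' x)) ->
  continuous N' -> is_prim N N'.
Proof.
move=> dN cN'; split; first exact: integrable_continuous_cc.
move=> x /andP[]; rewrite le_eqVlt => /predU1P[<-|x0] x1; first by rewrite prim0 addr0.
have dNx y : derivable N y 1 by exact: (@ex_derive _ _ _ _ _ _ _ (dN y)).
have cN : continuous N by move=> y; exact/differentiable_continuous/derivable1_diffP/dNx.
have E : (\int[leb]_(y in `[0%R, x]) (N' y)%:E = (N x)%:E - (N 0)%:E)%E.
  apply: continuous_FTC2 => //.
  - exact: continuous_subspaceT.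
  - by split => // [|]; [exact: cvg_at_right_filter (cN 0)|exact: cvg_at_left_filter (cN x)].
  - by move=> y _; rewrite derive1E; exact: (@derive_val _ _ _ _ _ _ _ (dN y)).
by rewrite /prim /Rintegral E /=; ring.
Qed.

(** The coefficient of u minus a primitive of the coefficient of h is orthogonal to every N': the
    product rule for N times the primitive has no boundary terms because N vanishes at 0 and 1. By
    du Bois-Reymond the difference is constant. *)
Lemma weak_dx_prim u h s : loc_integrable u -> periodic_2pi u -> periodic_2pi h ->
  is_weak_derive (dx R) u h ->
  exists A B : R -> R, [/\ is_prim A (fcos h s), is_prim B (fsin h s) &
    {ae leb, forall x, 0 < x < 1 -> fcos u s x = A x /\ fsin u s x = B x}].
Proof.
move=> ul up hp uh; have [hl _] := uh.
have [uci usi] := integrable_fcos s ul.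
have [hci hsi] := integrable_fcos s hl.
have gen (F H : R -> R) : leb.-integrable `]0, 1[ (EFin \o F) -> leb.-integrable `]0, 1[ (EFin \o H) ->
    (forall N N' (a b : R), smooth1 N -> smooth1 N' -> (forall x : R, is_derive x 1 N (N' x)) ->
    0 < a -> b < 1 -> supported_in N a b ->
    \int[leb]_(x in `]0, 1[) (N' x * F x) = - (\int[leb]_(x in `]0, 1[) (N x * H x))) ->
    exists2 A, is_prim A H & {ae leb, forall x, 0 < x < 1 -> F x = A x}.
  move=> Fi Hi FH; have [Hi' _] := Rintegral_itv_oo Hi.
  have primH := is_prim_prim 0 Hi'.
  have [c Gc] : exists c : R, {ae leb, forall x, 0 < x < 1 -> F x - (0 + prim H x) = c}.
    have pHi : leb.-integrable `]0, 1[ (EFin \o (fun x => 0 + prim H x)).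
      have [K HK] := is_prim_bounded primH.
      apply: (@integrable_bounded _ _ _ _ _ _ K) => //; first by have [] := @lebesgue_oo R 0 1 ler01.
        apply: measurable_funS (is_prim_measurable primH) => //.
        exact: subset_itv_oo_cc.
      by move=> x; rewrite /= in_itv/= => /andP[x0 x1]; apply: HK; rewrite !ltW.
    apply: du_bois_reymond; first exact: integrable_sub.
    move=> N N' a b sN sN' dN a0 b1 Nab.
    have cN := smooth1_continuous sN; have cN' := smooth1_continuous sN'.
    have NB := supported_bounded cN Nab.
    have NB' := supported_bounded cN' (supported_derive dN Nab).
    have N0 : N 0 = 0 by apply/eqP; apply: contraT => /Nab; rewrite leNgt a0.
    have N1 : N 1 = 0 by apply/eqP; apply: contraT => /Nab /andP[_]; rewrite leNgt b1.
    under eq_Rintegral do rewrite mulrBr.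
    rewrite RintegralB//; [|exact: integrable_oo_bounded_mul|exact: integrable_oo_bounded_mul].
    rewrite (FH _ _ _ _ sN sN' dN a0 b1 Nab).
    have primN := is_prim_of_derive dN cN'.
    have [K' HK'] := NB'.
    have P := is_prim_mul primH primN (fun x _ => HK' x).
    have := is_prim_incr P (lexx 0) ler01 (lexx 1).
    rewrite N0 N1 !mulr0 subrr (Rintegral_itv_oo (integrable_cc_oo P.1)).2 RintegralD//.
    - move=> /esym /eqP; rewrite addr_eq0 => /eqP.
      under eq_Rintegral do rewrite mulrC.
      move=> ->; rewrite opprK; under [X in X - _]eq_Rintegral do rewrite mulrC.
      by rewrite subrr.
    - by under [X in EFin \o X]eq_fun do rewrite mulrC; exact: integrable_oo_bounded_mul.
    - by under [X in EFin \o X]eq_fun do rewrite mulrC; exact: integrable_oo_bounded_mul.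
  exists (fun x => c + prim H x); first exact: is_prim_prim.
  by apply: ae_imp Gc => x Gx /Gx <-; ring.
have [A pA FA] := gen _ _ uci hci (fun N N' a b e1 e2 e3 e4 e5 e6 =>
  (@weak_dx_mode _ _ s ul up hp uh N N' a b e1 e2 e3 e4 e5 e6).1).
have [B pB FB] := gen _ _ usi hsi (fun N N' a b e1 e2 e3 e4 e5 e6 =>
  (@weak_dx_mode _ _ s ul up hp uh N N' a b e1 e2 e3 e4 e5 e6).2).
exists A, B; split => //.
by apply: ae_imp2 FA FB => x h1 h2 x01; rewrite h1// h2.
Qed.

End modes.

(** * Uniqueness of Fourier coefficients *)

Section fourier_uniqueness.
Context (R : realType).
Notation leb := (@lebesgue_measure R).
Notation mR := (measurableTypeR R).
Let w : R := 2 * pi.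

Inductive trig_poly : (R -> R) -> Prop :=
| tp_cos (k : R) (s : int) : trig_poly (fun t => k * cos (s%:~R * t))
| tp_sin (k : R) (s : int) : trig_poly (fun t => k * sin (s%:~R * t))
| tp_add p q : trig_poly p -> trig_poly q -> trig_poly (fun t => p t + q t).

Lemma trig_poly_eq p q : trig_poly p -> p =1 q -> trig_poly q.
Proof. by move=> tp pq; rewrite -(funext pq). Qed.

Lemma trig_poly_cst (k : R) : trig_poly (cst k).
Proof. by apply: (trig_poly_eq (tp_cos k 0)) => t; rewrite mul0r cos0 mulr1. Qed.

Lemma trig_poly_scale (k : R) p : trig_poly p -> trig_poly (fun t => k * p t).
Proof.
elim=> {p} [l s|l s|p q _ hp _ hq].
- by apply: (trig_poly_eq (tp_cos (k * l) s)) => t; rewrite mulrA.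
- by apply: (trig_poly_eq (tp_sin (k * l) s)) => t; rewrite mulrA.
- by apply: (trig_poly_eq (tp_add hp hq)) => t; rewrite mulrDr.
Qed.

Lemma trig_poly_mul p q : trig_poly p -> trig_poly q -> trig_poly (fun t => p t * q t).
Proof.
have ID (s r : int) (t : R) : (s + r)%:~R * t = s%:~R * t + r%:~R * t.
  by rewrite intrD mulrDl.
have IB (s r : int) (t : R) : (s - r)%:~R * t = s%:~R * t - r%:~R * t.
  by rewrite rmorphB /= mulrBl.
elim=> {p} [k s|k s|p1 p2 _ h1 _ h2] hq; last first.
- by apply: (trig_poly_eq (tp_add (h1 hq) (h2 hq))) => t; rewrite mulrDl.
- elim: hq => {q} [l r|l r|q1 q2 _ h1 _ h2]; last first.
  + by apply: (trig_poly_eq (tp_add h1 h2)) => t; rewrite mulrDr.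
  + apply: (trig_poly_eq (tp_add (tp_cos (k * l / 2) (s - r)) (tp_cos (- (k * l / 2)) (s + r)))) => t.
    by rewrite !IB !ID cosB cosD; field.
  + apply: (trig_poly_eq (tp_add (tp_sin (k * l / 2) (s + r)) (tp_sin (k * l / 2) (s - r)))) => t.
    by rewrite !IB !ID sinB sinD; field.
- elim: hq => {q} [l r|l r|q1 q2 _ h1 _ h2]; last first.
  + by apply: (trig_poly_eq (tp_add h1 h2)) => t; rewrite mulrDr.
  + apply: (trig_poly_eq (tp_add (tp_sin (k * l / 2) (s + r)) (tp_sin (- (k * l / 2)) (s - r)))) => t.
    by rewrite !IB !ID sinB sinD; field.
  + apply: (trig_poly_eq (tp_add (tp_cos (k * l / 2) (s - r)) (tp_cos (k * l / 2) (s + r)))) => t.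
    by rewrite !IB !ID cosB cosD; field.
Qed.

Lemma trig_poly_exp p n : trig_poly p -> trig_poly (fun t => p t ^+ n).
Proof.
move=> hp; elim: n => [|n ih]; first exact: trig_poly_cst 1.
by apply: (trig_poly_eq (trig_poly_mul hp ih)) => t; rewrite exprS.
Qed.

Section one_dimensional.
Variable g : R -> R.
Hypothesis gi : leb.-integrable `[0, w] (EFin \o g).
Hypothesis g0 : forall s : int, \int[leb]_(t in `[0, w]) (g t * cos (s%:~R * t)) = 0 /\
  \int[leb]_(t in `[0, w]) (g t * sin (s%:~R * t)) = 0.

Lemma trig_poly_orthogonal p : trig_poly p ->
  leb.-integrable `[0, w] (EFin \o (fun t => g t * p t)) /\
  \int[leb]_(t in `[0, w]) (g t * p t) = 0.
Proof.
elim=> {p} [k s|k s|p q _ [pi_ p0] _ [qi q0]].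
- have [h _] := g0 s; have hi := integrable_cos s%:~R gi; split.
    under [X in EFin \o X]eq_fun do rewrite mulrCA.
    exact: integrable_scale.
  under eq_Rintegral do rewrite mulrCA.
  by rewrite RintegralZl// h mulr0.
- have [_ h] := g0 s; have hi := integrable_sin s%:~R gi; split.
    under [X in EFin \o X]eq_fun do rewrite mulrCA.
    exact: integrable_scale.
  under eq_Rintegral do rewrite mulrCA.
  by rewrite RintegralZl// h mulr0.
- split.
    under [X in EFin \o X]eq_fun do rewrite mulrDr.
    exact: integrable_add.
  under eq_Rintegral do rewrite mulrDr.
  by rewrite RintegralD// p0 q0 addr0.
Qed.

(* On [0, 1] the polynomials (1 - y^n)^(2^n) tend to 1 below 1/2 and to 0 above 1/2. *)
Lemma bernstein_small (y : R) (n : nat) : 0 <= y -> y <= 1 ->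
  0 <= (1 - y ^+ n) ^+ (2 ^ n) <= 1 /\
  1 - (2 * y) ^+ n <= (1 - y ^+ n) ^+ (2 ^ n) /\
  (1 - y ^+ n) ^+ (2 ^ n) * (2 * y) ^+ n <= 1.
Proof.
move=> y0 y1; have yn0 : 0 <= y ^+ n by exact: exprn_ge0.
have yn1 : y ^+ n <= 1 by exact: exprn_ile1.
have a0 : 0 <= 1 - y ^+ n by rewrite subr_ge0.
have bern (x : R) (m : nat) : -1 <= x -> 1 + m%:R * x <= (1 + x) ^+ m.
  move=> x1; elim: m => [|m ih]; first by rewrite mul0r addr0 expr0.
  rewrite exprS; apply: (@le_trans _ _ ((1 + x) * (1 + m%:R * x))); last first.
    by rewrite ler_wpM2l// -lerBlDl sub0r.
  rewrite -natr1; have : 0 <= m%:R * x ^+ 2 by rewrite mulr_ge0 ?sqr_ge0.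
  by lra.
split; first by rewrite exprn_ge0//= exprn_ile1// gerBl.
split.
  apply: le_trans (bern (- y ^+ n) (2 ^ n)%N _); last by rewrite lerN2.
  by rewrite natrX exprMn mulrN.
have -> : (2 * y) ^+ n = (2 ^ n)%:R * y ^+ n by rewrite natrX exprMn.
(* Bernoulli bounds 2^n y^n by (1 + y^n)^(2^n), and the product becomes (1 - y^(2n))^(2^n) <= 1. *)
apply: (@le_trans _ _ ((1 - y ^+ n) ^+ (2 ^ n) * (1 + y ^+ n) ^+ (2 ^ n))).
  rewrite ler_wpM2l ?exprn_ge0//; apply: le_trans (bern _ _ _); first by rewrite lerDr.
  by rewrite (le_trans _ yn0)// oppr_le0.
rewrite -exprMn; apply: exprn_ile1; first by rewrite mulr_ge0// addr_ge0.
have : 0 <= y ^+ n * y ^+ n by rewrite mulr_ge0.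
by lra.
Qed.

Lemma bernstein_cvg (y : R) : 0 <= y -> y <= 1 -> y != 2^-1 ->
  (fun n => (1 - y ^+ n) ^+ (2 ^ n)) @ \oo --> (if y < 2^-1 then 1 else 0 : R).
Proof.
move=> y0 y1 yh; case: ltP => hy.
- have h2 : `|2 * y| < 1 by rewrite ger0_norm ?mulr_ge0//; lra.
  apply: (@squeeze_cvgr _ _ _ _ (fun n => 1 - (2 * y) ^+ n) (cst 1)).
  + by near=> n; have [/andP[_ ->] [-> _]] := bernstein_small n y0 y1.
  + rewrite -[X in _ --> X]subr0; apply: cvgB; first exact: cvg_cst.
    exact: cvg_expr.
  + exact: cvg_cst.
- have yp : 0 < 2 * y by rewrite mulr_gt0// (lt_le_trans _ hy)// invr_gt0.
  have hy' : 2^-1 < y by rewrite lt_neqAle eq_sym yh.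
  have h2 : `|(2 * y)^-1| < 1.
    by rewrite gtr0_norm ?invr_gt0// invf_lt1//; lra.
  apply: (@squeeze_cvgr _ _ _ _ (cst 0) (fun n => (2 * y)^-1 ^+ n)).
  + near=> n; have [/andP[-> _] [_ h]] := bernstein_small n y0 y1.
    by rewrite exprVn -div1r ler_pdivlMr// exprn_gt0.
  + exact: cvg_cst.
  + exact: cvg_expr.
Unshelve. all: by end_near.
Qed.

(** Makes membership in ]p, q[ a condition on a trigonometric polynomial: within a period, the
    cosine of the distance to the midpoint exceeds its value at the ends exactly inside. A distance
    beyond pi is reflected to w minus that distance, where the cosine is again monotone. *)
Lemma cos_gt_interval (p q t : R) : 0 < p -> p < q -> q < w -> 0 < t < w -> t != p -> t != q ->
  let c := cos ((q - p) / 2) in let d := cos (t - (p + q) / 2) in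
  (c < d) = (p < t < q) /\ c != d.
Proof.
move=> p0 pq qw /andP[t0 tw] tp tq c d.
have wE : w = pi + pi by rewrite /w mulr_natl mulr2n.
have P0 := @pi_gt0 R.
set x := t - (p + q) / 2; set e := (q - p) / 2.
have e0 : 0 <= e by rewrite /e; lra.
have epi : e <= pi by rewrite /e; lra.
have dE : d = cos `|x|.
  by rewrite /d -/x; case: (ger0P x) => // _; rewrite cosN.
have ein : e \in `[0, pi] by rewrite in_itv/= e0.
have key : if `|x| < e then c < d else d < c.
  case: ltP => xe.
    by rewrite dE /c -/e ltr_cos// in_itv/= normr_ge0 (le_trans (ltW xe)).
  have xne : `|x| != e.
    apply/negP => /eqP E; case: (ger0P x) E => _ E.
      by move/eqP: tq; apply; move: E; rewrite /x /e; lra.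
    by move/eqP: tp; apply; move: E; rewrite /x /e; lra.
  have ltx : e < `|x| by rewrite lt_neqAle eq_sym xne.
  have xw : `|x| < w - e by rewrite ltr_norml /x /e; apply/andP; split; lra.
  have [xpi|xpi] := leP `|x| pi.
    by rewrite dE /c -/e ltr_cos// in_itv/= normr_ge0.
  have -> : d = cos (w - `|x|).
    rewrite dE -cosN -(cosD2pi (- `|x|)) addrC; congr cos; congr (_ + _).
    by rewrite wE mulr2n.
  rewrite /c -/e ltr_cos ?in_itv//=; first by lra.
  by apply/andP; split; lra.
have E : (p < t < q) = (`|x| < e).
  rewrite ltr_norml /x /e; apply/idP/idP => /andP[h1 h2]; apply/andP; split; lra.
rewrite E; case: ltP key => xe h; first by rewrite h lt_eqF.
by rewrite (lt_gtF h) gt_eqF.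
Qed.

(** The indicator of a rational interval is, off finitely many points, a bounded limit of the
    trigonometric polynomials F n, to which [g] is orthogonal; so [g] has zero integral over each
    such interval. *)
Lemma fourier_uniqueness : {ae leb, forall t, 0 < t < w -> g t = 0}.
Proof.
have w0 : 0 < w by exact: two_pi_gt0.
apply: ae0_of_rational_intervals => // p' q'; set p : R := ratr p'; set q : R := ratr q'.
move=> p0 pq qw.
have mI : measurable (`[0, w] : set mR) by exact: measurable_itv.
have mg := integrable_measurable gi.
pose t0 := (p + q) / 2; pose c := cos ((q - p) / 2).
(* Both cosines lie in [-1, 1], so dividing by 4 keeps y in [0, 1], while y < 1/2 holds exactly when
   cos (t - t0) > c, that is in ]p, q[. *)
pose y t := 2^-1 - (cos (t - t0) - c) / 4.
pose F n t := (1 - y t ^+ n) ^+ (2 ^ n).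
have typ : trig_poly y.
  apply: (trig_poly_eq (tp_add (trig_poly_cst (2^-1 + c / 4))
    (tp_add (tp_cos (- cos t0 / 4) 1) (tp_sin (- sin t0 / 4) 1)))) => t.
  by rewrite /y/= mul1r cosB; field.
have tpF n : trig_poly (F n).
  apply: trig_poly_exp; apply: (trig_poly_eq (tp_add (trig_poly_cst 1)
    (trig_poly_scale (-1) (trig_poly_exp n typ)))) => t.
  by rewrite /= mulN1r.
have y01 t : 0 <= y t /\ y t <= 1.
  have := cos_geN1 (t - t0); have := cos_le1 (t - t0).
  have := cos_geN1 ((q - p) / 2); have := cos_le1 ((q - p) / 2).
  by rewrite -/c /y; lra.
(* At p and q the value y is 1/2, where the limit is not controlled, and the comparison of cosines
   is for 0 < t < w; these four points form a null set. *)
pose D : set mR := `[0, w] `\` [set p; q; 0; w].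
have mD : measurable D.
  by apply: measurableD => //; do !apply: measurableU; exact: measurable_set1.
pose L t : R := \1_(`]p, q[ : set R) t.
pose G n t := (g t * F n t) * \1_(D : set R) t.
have gF n : \int[leb]_(t in `[0, w]) G n t = 0.
  have [gFi gF0] := trig_poly_orthogonal (tpF n).
  apply: eq_trans gF0; apply: esym; apply: ae_eq_Rintegral => //.
    apply: measurable_funM; first exact: (integrable_measurable gFi).
    exact: measurable_indic.
  have ne (e : R) : {ae leb, forall t, t != e}.
    exists [set e]; split; [exact: measurable_set1|exact: lebesgue_measure_set1|].
    by move=> t /negP; rewrite negbK => /eqP.
  have := ae_imp2 (fun t a b => conj a b) (ne p) (ne q).
  apply: ae_imp3 (ne 0) (ne w) => t tz tw [tp tq] tI.
  rewrite /G indicE mem_set ?mulr1//; split => //=.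
  by rewrite -!orA; case=> [|[|[]]] E; move: tp tq tz tw; rewrite E eqxx.
have mGn n : measurable_fun (`[0, w] : set mR) (G n).
  have [gFi _] := trig_poly_orthogonal (tpF n).
  apply: measurable_funM; first exact: (integrable_measurable gFi).
  exact: measurable_indic.
have Gcvg t : `[0, w]%classic t -> G ^~ t @ \oo --> (g t * L t) * \1_(D : set R) t.
  move=> tI; have [Dt|nDt] := pselect (D t); last first.
    rewrite /G indicE (memNset nDt) mulr0; under eq_fun do rewrite mulr0.
    exact: cvg_cst.
  apply: cvgMl; apply: cvgMr.
  have [/= _ nt] := Dt.
  have t0w : 0 < t < w.
    move: tI; rewrite /= in_itv/= => /andP[h1 h2]; rewrite !lt_neqAle h1 h2 !andbT.
    by apply/andP; split; apply/negP => /eqP E; apply: nt; rewrite -E; [left; right|right].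
  have tp : t != p by apply/negP => /eqP E; apply: nt; do 3 left.
  have tq : t != q by apply/negP => /eqP E; apply: nt; do 2 left; right.
  have [E ne] := cos_gt_interval p0 pq qw t0w tp tq.
  rewrite /L indicE; have -> : (t \in (`]p, q[%classic : set R)) = (y t < 2^-1).
    have -> : (y t < 2^-1) = (p < t < q).
      rewrite -E /y -/c -/t0; apply/idP/idP => h; lra.
    by apply/idP/idP; rewrite inE/= in_itv.
  have [y0 y1] := y01 t.
  have yn : y t != 2^-1.
    apply: contra ne => /eqP; rewrite /y -/c -/t0 => h; apply/eqP; lra.
  have := bernstein_cvg y0 y1 yn.
  by case: ltP.
have cv : (fun n => \int[leb]_(t in `[0, w]) G n t) @ \oo -->
    \int[leb]_(t in `[0, w]) ((g t * L t) * \1_(D : set R) t).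
  apply: (Rintegral_dominated_cvg mI mGn _ Gcvg (integrable_norm gi)).
    apply: measurable_funM; last exact: measurable_indic.
    by apply: measurable_funM => //; apply: measurable_indic; exact: measurable_itv.
  move=> n t _; have [y0 y1] := y01 t.
  have [/andP[f0 f1] _] := bernstein_small n y0 y1.
  rewrite /G !normrM /= (ger0_norm f0) -mulrA ler_piMr// mulr_ile1//.
  by rewrite indicE; case: (_ \in _); rewrite ?normr1 ?normr0.
have : \int[leb]_(t in `[0, w]) ((g t * L t) * \1_(D : set R) t) = 0.
  rewrite -(cvg_lim (@Rhausdorff R) cv) (_ : (fun n => _) = cst 0); first exact: lim_cst.
  exact/funext.
move=> <-; rewrite [LHS]Rintegral_mkcond [RHS]Rintegral_mkcond.
apply: eq_Rintegral => t _; rewrite !patchE /L !indicE.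
have [tpq|tpq] := boolP (t \in (`]p, q[%classic : set R)); last by rewrite mulr0 mul0r if_same.
have : p < t < q by move: tpq; rewrite inE/= in_itv.
move=> /andP[pt tq].
have tI : `[0, w]%classic t by rewrite /= in_itv/= (le_trans (ltW p0) (ltW pt)) (le_trans (ltW tq) (ltW qw)).
rewrite (mem_set tI) mulr1 mem_set ?mulr1//; split => //=.
rewrite -!orA; case=> [|[|[]]] E.
- by rewrite E ltxx in pt.
- by rewrite E ltxx in tq.
- by move: pt; rewrite E ltNge (ltW p0).
- by move: tq; rewrite E ltNge (ltW qw).
Qed.

End one_dimensional.

Lemma ae_strip_of_sections (h : R * R -> R) : loc_integrable h ->
  {ae leb, forall x, 0 < x < 1 -> {ae leb, forall t, h (x, t) = 0}} ->
  {ae leb2 R, forall z, strip R z -> h z = 0}.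
Proof.
move=> hl sec.
have sec' : {ae leb, forall x, {ae leb, forall t, strip R (x, t) -> h (x, t) = 0}}.
  apply: ae_imp sec => x hx; have [x01|nx] := boolP (0 < x < 1).
    by apply: ae_imp (hx x01).
  by apply: aeW => t [/=]; rewrite in_itv/= (negbTE nx).
apply: ae_leb2_of_section sec'.
have mh := loc_integrable_measurable hl.
have -> : [set z | strip R z -> h z = 0] = ~` (strip R `&` h @^-1` (~` [set 0])).
  apply/seteqP; split=> [z hz [sz hn]|z hz sz]; first by apply: hn; exact: hz.
  by apply: contrapT => hn; apply: hz.
apply: measurableC; apply: mh; first exact: measurable_strip.
by apply: measurableC; exact: measurable_set1.
Qed.

(** The interval on which f vanishes grows by one period on each side at every step; shifts in both
    directions use periodicity at t and at t - w. *)
Lemma ae0_of_period (f : R -> R) : {ae leb, forall t, f (t + w) = f t} ->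
  {ae leb, forall t, 0 < t < w -> f t = 0} -> {ae leb, forall t, f t = 0}.
Proof.
move=> fp f0; have w0 : 0 < w by exact: two_pi_gt0.
have fpN : {ae leb, forall t, f t = f (t - w)}.
  by apply: ae_imp (ae_translate (- w) fp) => t; rewrite subrK.
have H (n : nat) : {ae leb, forall t, - (n.+1%:R * w) < t < n.+1%:R * w -> f t = 0}.
  elim: n => [|n ih].
    have ne : {ae leb, forall t : R, t != 0}.
      exists [set 0]; split; [exact: measurable_set1|exact: lebesgue_measure_set1|].
      by move=> t /negP; rewrite negbK => /eqP.
    have f0' := ae_imp2 (fun t a b => conj a b) f0 (ae_translate w f0).
    apply: ae_imp3 ne f0' fp => t tn [h1 h2] h3; rewrite mul1r => /andP[t1 t2].
    case: (ltgtP t 0) tn => // tz _; last by apply: h1; rewrite tz.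
    by rewrite -h3; apply: h2; apply/andP; split; lra.
  have ih' := ae_imp2 (fun t a b => conj a b) (ae_translate w ih) (ae_translate (- w) ih).
  have fp' := ae_imp2 (fun t a b => conj a b) fp fpN.
  apply: ae_imp3 ih ih' fp' => t i0 [i1 i2] [e1 e2] /andP[t1 t2].
  have nw : 0 <= n%:R * w by rewrite mulr_ge0// ltW.
  move: t1 t2 i0 i1 i2; rewrite -!(natr1 n.+1) -!(natr1 n) => t1 t2 i0 i1 i2.
  case: (ltgtP t 0) => tz.
  - by rewrite -e1; apply: i1; apply/andP; split; lra.
  - by rewrite e2; apply: i2; apply/andP; split; lra.
  - by apply: i0; apply/andP; split; lra.
have := ae_foralln H; apply: ae_imp => t Ht.
apply: (Ht (Num.trunc (`|t| / w))).
by rewrite -ltr_norml -ltr_pdivrMr//; exact: truncnS_gt.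
Qed.

Lemma strip_fourier_uniqueness (h : R * R -> R) : loc_integrable h -> periodic_2pi h ->
  (forall s : int, {ae leb, forall x, 0 < x < 1 -> fcos h s x = 0 /\ fsin h s x = 0}) ->
  {ae leb2 R, forall z, strip R z -> h z = 0}.
Proof.
move=> hl hp h0; apply: ae_strip_of_sections => //.
(* One null set of x for all frequencies, obtained by enumerating the integers. *)
have h0n : {ae leb, forall x, forall n : nat, 0 < x < 1 ->
    if unpickle n is Some s then fcos h s x = 0 /\ fsin h s x = 0 else True}.
  apply: ae_foralln => n; case: (unpickle n) => [s|]; first exact: h0.
  by apply: aeW.
apply: ae_imp3 h0n (ae_period_integrable hl) (ae_section_periodic hp) => x H hi hper x01.
apply: ae0_of_period; first exact: hper.
apply: fourier_uniqueness; first exact: hi.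
by move=> s; have := H (pickle s) x01; rewrite pickleK.
Qed.

End fourier_uniqueness.

(** * Completeness of L^1 along fast Cauchy sequences *)

Section fast_limits.
Context d (T : measurableType d) (R : realType).
Variables (mu : {measure set T -> \bar R}) (D : set T).
Hypothesis mD : measurable D.

(** The upper limit is defined and measurable even where the sequence diverges, and it inherits
    exactly every symmetry of the sequence, such as periodicity. *)
Definition fast_limit (f : nat -> T -> R) (x : T) : R :=
  fine (limn_esup (fun k => (f k x)%:E)).

Lemma fast_limitE (f : nat -> T -> R) (x : T) (l : R) : f ^~ x @ \oo --> l ->
  fast_limit f x = l.
Proof.
move=> fl; rewrite /fast_limit.
have h : (fun k => (f k x)%:E) @ \oo --> l%:E by apply: cvg_EFin => //; apply: nearW.
by rewrite (cvg_limn_einf_sup h).2.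
Qed.

Lemma bounded_variation_cvg (v : nat -> R) :
  (\sum_(0 <= k <oo) `|v k.+1 - v k|%:E < +oo)%E -> cvgn v.
Proof.
move=> fin; pose dv k := v k.+1 - v k.
have ge0 k : (0 <= k)%N -> xpredT k -> (0 <= `|v k.+1 - v k|%:E)%E by rewrite lee_fin.
have cs : cvgn [normed series dv].
  apply: nondecreasing_is_cvgn.
    by apply: nondecreasing_series => k _ _; exact: normr_ge0.
  exists (fine (\sum_(0 <= k <oo) `|v k.+1 - v k|%:E)%E) => _ [n _ <-].
  rewrite -lee_fin fineK; last first.
    by rewrite ge0_fin_numE//; exact: nneseries_ge0.
  by rewrite /series/= -sumEFin; exact: nneseries_lim_ge.
have cd := normed_cvg cs.
have -> : v = cst (v 0%N) \+ series dv.
  by apply/funext => n; rewrite /= /series/= telescope_sumr// addrCA subrr addr0.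
by apply: is_cvgD => //; exact: is_cvg_cst.
Qed.

(** The geometric bounds make the sum g of the increments integrable, hence finite almost
    everywhere; so the sequence converges almost everywhere and is dominated by |f_0| + g. *)
Lemma L1_fast_limit (f : nat -> T -> R) (C : R) :
  (forall k, mu.-integrable D (EFin \o f k)) ->
  (forall k, \int[mu]_(x in D) `|f k.+1 x - f k x| <= C / 2 ^+ k.+1) ->
  mu.-integrable D (EFin \o fast_limit f) /\
  (fun k => \int[mu]_(x in D) `|f k x - fast_limit f x|) @ \oo --> (0 : R).
Proof.
move=> fi fC; pose dv k x := `|f k.+1 x - f k x|.
have dvi k : mu.-integrable D (EFin \o dv k).
  by apply: integrable_norm; exact: integrable_sub.
have mdv k : measurable_fun D (EFin \o dv k) by exact: measurable_int (dvi k).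
pose g x := (\sum_(0 <= k <oo) (dv k x)%:E)%E.
have dv0 k x : D x -> (0 <= (dv k x)%:E)%E by rewrite lee_fin normr_ge0.
have g0 x : D x -> (0 <= g x)%E by move=> Dx; apply: nneseries_ge0 => k _ _; exact: dv0.
have mg : measurable_fun D g.
  exact: (@ge0_emeasurable_sum _ _ _ D (fun k x => (dv k x)%:E) xpredT (fun k x Dx _ => dv0 k x Dx) (fun k _ => mdv k)).
have C0 : 0 <= C.
  have := fC 0%N; rewrite expr1 => h; have : 0 <= C / 2; last by lra.
  by apply: le_trans h; apply: Rintegral_ge0.
have gi : mu.-integrable D g.
  apply/integrableP; split=> //.
  rewrite (eq_integral g); last by move=> x; rewrite inE => Dx; rewrite gee0_abs// g0.
  rewrite integral_nneseries//.
  apply: (@le_lt_trans _ _ (\sum_(0 <= k <oo) (C / (2 ^ k.+1)%:R)%:E)%E).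
    apply: lee_nneseries => [k _ _|k _]; first by apply: integral_ge0 => x _; rewrite lee_fin normr_ge0.
    have := fC k; rewrite -lee_fin /Rintegral fineK ?natrX//.
    exact: (integrable_fin_num mD (dvi k)).
  by apply: le_lt_trans (ltry C); exact: (epsilon_trick0 xpredT C0).
have ga := integrable_ae mD gi.
have mF k : measurable_fun D (EFin \o f k) by exact: measurable_int (fi k).
have mlim : measurable_fun D (EFin \o fast_limit f).
  have -> : EFin \o fast_limit f = EFin \o (fine \o (fun x => limn_esup (fun k => (f k x)%:E))) by [].
  apply/measurable_EFinP; apply: measurableT_comp => //.
  exact: (measurable_fun_limn_esup (f := fun k x => (f k x)%:E)).
have cv : {ae mu, forall x, D x -> f k x @[k --> \oo] --> fast_limit f x}.
  apply: ae_imp ga => x fin Dx.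
  have c : cvgn (f ^~ x).
    by apply: bounded_variation_cvg; rewrite -ge0_fin_numE ?fin//; exact: (g0 x Dx).
  by rewrite (fast_limitE c).
have [] := @dominated_convergence _ _ _ mu D mD (fun k => EFin \o f k) (EFin \o fast_limit f)
  (fun x => `|f 0%N x|%:E + g x)%E mF mlim.
- by apply: ae_imp cv => x h Dx; apply: cvg_EFin; [exact: nearW|exact: h].
- by apply: integrableD => //; exact: integrable_norm (fi 0%N).
- apply: aeW => x n Dx; rewrite /=.
  apply: (@le_trans _ _ (`|f 0%N x|%:E + \sum_(0 <= k < n) (dv k x)%:E)%E); last first.
    by apply: leeD => //; apply: nneseries_lim_ge => k _ _; exact: dv0.
  rewrite sumEFin -EFinD lee_fin.
  rewrite -[X in `|X| <= _](subrK (f 0%N x)) addrC (le_trans (ler_normD _ _))// lerD2l.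
  by rewrite -(telescope_sumr (fun k => f k x))// ler_norm_sum.
move=> li l0 _; split=> //.
have <- : fine 0%E = 0 :> R by [].
have -> : (fun k => \int[mu]_(x in D) `|f k x - fast_limit f x|) =
  fine \o (fun k => \int[mu]_(x in D) `|(f k x)%:E - (fast_limit f x)%:E|)%E by [].
exact: (fine_cvg l0).
Qed.

End fast_limits.

(** * Orthogonality of trigonometric waves *)

Section orthogonality.
Context (R : realType).
Notation leb := (@lebesgue_measure R).
Notation mR := (measurableTypeR R).

Lemma Rintegral_derive (N N' : R -> R) (l r : R) : (forall x : R, is_derive x 1 N (N' x)) ->
  continuous N' -> l < r -> \int[leb]_(x in `[l, r]) N' x = N r - N l.
Proof.
move=> dN cN' lr.
have dNx y : derivable N y 1 by exact: (@ex_derive _ _ _ _ _ _ _ (dN y)).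
have cN : continuous N by move=> y; exact/differentiable_continuous/derivable1_diffP/dNx.
have E : (\int[leb]_(y in `[l, r]) (N' y)%:E = (N r)%:E - (N l)%:E)%E.
  apply: continuous_FTC2 => //.
  - exact: continuous_subspaceT.
  - by split => // [|]; [exact: cvg_at_right_filter (cN l)|exact: cvg_at_left_filter (cN r)].
  - by move=> y _; rewrite derive1E; exact: (@derive_val _ _ _ _ _ _ _ (dN y)).
by rewrite /Rintegral E.
Qed.

Lemma continuous_cos_scaled (s : R) : continuous (fun t : R => cos (s * t)).
Proof. by apply: smooth1_continuous; exact: (smooth1_cossin s).1. Qed.

Lemma continuous_sin_scaled (s : R) : continuous (fun t : R => sin (s * t)).
Proof. by apply: smooth1_continuous; exact: (smooth1_cossin s).2. Qed.

Lemma trig_periodic_nat (s : int) (q : nat) (t : R) :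
  cos (s%:~R * (t + 2 * pi * q%:R)) = cos (s%:~R * t) /\
  sin (s%:~R * (t + 2 * pi * q%:R)) = sin (s%:~R * t) :> R.
Proof.
elim: q => [|q [ih1 ih2]]; first by rewrite mulr0 addr0.
have [h1 h2] := trig_periodic s (t + 2 * pi * q%:R).
by rewrite -(natr1 q) (mulrDr (2 * pi)) mulr1 addrA h1 h2.
Qed.

Section period.
Variables (l r : R) (q : nat).
Hypothesis q0 : (0 < q)%N.
Hypothesis lr : r = l + 2 * pi * q%:R.

Let l_lt_r : l < r.
Proof. by rewrite lr ltrDl mulr_gt0 ?two_pi_gt0// ltr0n. Qed.

Lemma Rintegral_cos_sin (s : int) :
  \int[leb]_(t in `[l, r]) cos (s%:~R * t) = (r - l) * (s == 0)%:R /\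
  \int[leb]_(t in `[l, r]) sin (s%:~R * t) = 0.
Proof.
have [cl sl] : cos (s%:~R * r) = cos (s%:~R * l) /\ sin (s%:~R * r) = sin (s%:~R * l).
  by rewrite lr; exact: trig_periodic_nat.
have [->|s0] := eqVneq s 0.
  have [c fc] := lebesgue_cc (ltW l_lt_r).
  split.
    under eq_Rintegral do rewrite mul0r cos0.
    by rewrite Rintegral_cst//= mul1r fc mulr1.
  under eq_Rintegral do rewrite mul0r sin0.
  by rewrite Rintegral_cst//= mul0r.
have sR : s%:~R != 0 :> R by rewrite intr_eq0.
split.
  have := @Rintegral_derive (fun t => s%:~R^-1 * sin (s%:~R * t)) (fun t => cos (s%:~R * t)) l r.
  rewrite sl subrr mulr0; apply => //; last exact: continuous_cos_scaled.
  move=> t; have D := is_derive_scaled (s%:~R) t (fun x => is_derive_sin x).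
  have H := is_derive_mul (is_derive_cst (s%:~R^-1 : R) t (1 : R)) D.
  apply: (is_derive_eq H).
  by rewrite mul0r add0r mulrA mulVf// mul1r.
have := @Rintegral_derive (fun t => (- s%:~R^-1) * cos (s%:~R * t)) (fun t => sin (s%:~R * t)) l r.
rewrite cl subrr; apply => //; last exact: continuous_sin_scaled.
move=> t; have D := is_derive_scaled (s%:~R) t (fun x => is_derive_cos x).
have H := is_derive_mul (is_derive_cst (- s%:~R^-1 : R) t (1 : R)) D.
apply: (is_derive_eq H).
by rewrite mul0r add0r mulNr mulrN mulrN opprK mulrA mulVf// mul1r.
Qed.

Definition wave (s : int) (a b t : R) : R := a * cos (s%:~R * t) + b * sin (s%:~R * t).

Lemma continuous_wave s a b : continuous (wave s a b).
Proof.
move=> t; apply: cvgD; apply: cvgM; try exact: cvg_cst.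
- exact: continuous_cos_scaled.
- exact: continuous_sin_scaled.
Qed.

Lemma wave_product (s v : int) (a b c d : R) :
  \int[leb]_(t in `[l, r]) (wave s a b t * wave v c d t) =
  (r - l) / 2 * ((a * c - b * d) * (s + v == 0)%:R + (a * c + b * d) * (s - v == 0)%:R).
Proof.
have ic (u : int) : leb.-integrable `[l, r] (EFin \o (fun t : R => cos (u%:~R * t))).
  by apply: integrable_continuous_cc; exact: continuous_cos_scaled.
have is_ (u : int) : leb.-integrable `[l, r] (EFin \o (fun t : R => sin (u%:~R * t))).
  by apply: integrable_continuous_cc; exact: continuous_sin_scaled.
have mI : measurable (`[l, r] : set mR) by exact: measurable_itv.
transitivity (\int[leb]_(t in `[l, r])
  (((a * c - b * d) / 2 * cos ((s + v)%:~R * t) + (a * c + b * d) / 2 * cos ((s - v)%:~R * t))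
  + ((a * d + b * c) / 2 * sin ((s + v)%:~R * t) + (b * c - a * d) / 2 * sin ((s - v)%:~R * t)))).
  apply: eq_Rintegral => t _.
  rewrite /wave intrD (rmorphB (intmul 1)) /= !(mulrDl, mulNr) !(cosB, cosD, sinB, sinD).
  by field.
rewrite !RintegralD ?RintegralZl//; try (by apply: integrable_scale);
  try (by apply: integrable_add => //; apply: integrable_scale).
have [-> ->] := Rintegral_cos_sin (s + v); have [-> ->] := Rintegral_cos_sin (s - v).
by field.
Qed.

(** In the product formula the resonance s + v = 0 forces s = v = 0 for natural frequencies, so
    distinct ones leave no term. The interval may contain any number q of periods, because
    convergence is measured on large boxes in t. *)
Lemma wave_orthogonal (s v : nat) (a b c d : R) : s != v ->
  \int[leb]_(t in `[l, r]) (wave s a b t * wave v c d t) = 0.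
Proof.
move=> sv; rewrite wave_product.
have -> : (s%:Z + v%:Z == 0) = false.
  by apply/negbTE; apply: contra sv => /eqP h; apply/eqP; lia.
have -> : (s%:Z - v%:Z == 0) = false.
  by apply/negbTE; apply: contra sv => /eqP h; apply/eqP; lia.
by rewrite !mulr0 addr0 mulr0.
Qed.

Lemma wave_norm_le (s : int) (a b t : R) : wave s a b t ^+ 2 <= a ^+ 2 + b ^+ 2.
Proof.
rewrite /wave; set x := s%:~R * t; have E := cos2Dsin2 x.
have : 0 <= (a * sin x - b * cos x) ^+ 2 by exact: sqr_ge0.
have -> : (a * sin x - b * cos x) ^+ 2 =
  (a ^+ 2 + b ^+ 2) * (cos x ^+ 2 + sin x ^+ 2) - (a * cos x + b * sin x) ^+ 2 by ring.
by rewrite E mulr1 subr_ge0.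
Qed.

Definition wave_sum (a b : nat -> R) (m n : nat) (t : R) : R :=
  \sum_(m <= s < n) wave s (a s) (b s) t.

Lemma continuous_wave_sum a b m n : continuous (wave_sum a b m n).
Proof.
elim: n => [|n ih].
  have -> : wave_sum a b m 0 = cst 0 by apply/funext => t; rewrite /wave_sum big_geq.
  by move=> t; exact: cvg_cst.
have [mn|nm] := leqP m n.
  have -> : wave_sum a b m n.+1 = wave_sum a b m n \+ wave n (a n) (b n).
    by apply/funext => t; rewrite /wave_sum/= big_nat_recr.
  by move=> t; apply: cvgD; [exact: ih|exact: continuous_wave].
have -> : wave_sum a b m n.+1 = cst 0 by apply/funext => t; rewrite /wave_sum big_geq.
by move=> t; exact: cvg_cst.
Qed.

(** Pythagoras: the cross term with the last wave integrates to 0, and the square of each wave is at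
    most a^2 + b^2 pointwise. *)
Lemma wave_sum_norm_le a b m n :
  \int[leb]_(t in `[l, r]) wave_sum a b m n t ^+ 2 <=
  (r - l) * \sum_(m <= s < n) (a s ^+ 2 + b s ^+ 2).
Proof.
have mI : measurable (`[l, r] : set mR) by exact: measurable_itv.
have ii f : continuous f -> leb.-integrable `[l, r] (EFin \o f).
  exact: integrable_continuous_cc.
have cM (f g : R -> R) : continuous f -> continuous g -> continuous (fun t => f t * g t).
  by move=> cf cg t; exact: (cvgM (cf t) (cg t)).
have rl : 0 <= r - l by rewrite subr_ge0 ltW.
elim: n => [|n ih].
  rewrite (big_geq (leq0n m)) mulr0 /wave_sum; under eq_Rintegral do rewrite big_geq// expr0n/=.
  by rewrite Rintegral_cst//= mul0r.
have [mn|nm] := leqP m n; last first.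
  rewrite (big_geq nm) mulr0 /wave_sum; under eq_Rintegral do rewrite big_geq// expr0n/=.
  by rewrite Rintegral_cst//= mul0r.
pose S := wave_sum a b m n; pose w := wave n (a n) (b n).
have cS : continuous S by exact: continuous_wave_sum.
have cw : continuous w by exact: continuous_wave.
have cross : \int[leb]_(t in `[l, r]) (S t * w t) = 0.
  under eq_Rintegral do rewrite /S /wave_sum mulr_suml.
  rewrite Rintegral_bigsum//; last first.
    by move=> s; apply: ii; apply: cM; exact: continuous_wave.
  rewrite big_nat; apply: big1 => s /andP[_ sn]; apply: wave_orthogonal.
  by rewrite neq_ltn sn.
have -> : \int[leb]_(t in `[l, r]) wave_sum a b m n.+1 t ^+ 2 =
  \int[leb]_(t in `[l, r]) ((S t ^+ 2 + w t ^+ 2) + 2 * (S t * w t)).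
  apply: eq_Rintegral => t _; rewrite /wave_sum big_nat_recr//= -/(wave_sum a b m n t) -/S -/w.
  ring.
have iS : leb.-integrable `[l, r] (EFin \o (fun t => S t ^+ 2)).
  by apply: ii; under eq_fun do rewrite expr2; exact: cM.
have iw : leb.-integrable `[l, r] (EFin \o (fun t => w t ^+ 2)).
  by apply: ii; under eq_fun do rewrite expr2; exact: cM.
have iSw : leb.-integrable `[l, r] (EFin \o (fun t => S t * w t)) by apply: ii; exact: cM.
rewrite RintegralD//; [|exact: integrable_add|exact: integrable_scale].
rewrite RintegralD// RintegralZl// cross mulr0 addr0 big_nat_recr//= mulrDr lerD//.
apply: (@le_trans _ _ (\int[leb]_(t in `[l, r]) cst (a n ^+ 2 + b n ^+ 2) t)).
  apply: le_Rintegral => //; first by apply: ii; exact: cst_continuous.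
  by move=> t _; exact: wave_norm_le.
by rewrite Rintegral_cst// (lebesgue_cc (ltW l_lt_r)).2 mulrC.
Qed.

(* AM-GM: [|S| <= e / 2 + S^2 / (2 e)] *)
Lemma wave_sum_L1_le a b m n (e : R) : 0 < e ->
  \int[leb]_(t in `[l, r]) `|wave_sum a b m n t| <=
  (r - l) * (e + e^-1 * \sum_(m <= s < n) (a s ^+ 2 + b s ^+ 2)).
Proof.
move=> e0; set S := wave_sum a b m n.
have mI : measurable (`[l, r] : set mR) by exact: measurable_itv.
have cS : continuous S by exact: continuous_wave_sum.
have iS2 : leb.-integrable `[l, r] (EFin \o (fun t => S t ^+ 2)).
  by apply: integrable_continuous_cc => t; under eq_fun do rewrite expr2; exact: (cvgM (cS t) (cS t)).
have [fin fE] := lebesgue_cc (ltW l_lt_r).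
have ic (k : R) : leb.-integrable `[l, r] (EFin \o cst k).
  exact: finite_measure_integrable_cst_on.
apply: (@le_trans _ _ (\int[leb]_(t in `[l, r]) (e + e^-1 * S t ^+ 2))).
  apply: le_Rintegral => //.
  - exact: (integrable_norm (integrable_continuous_cc l r cS)).
  - by apply: integrable_add => //; [exact: (ic e)|exact: integrable_scale].
  - move=> t _; rewrite -(real_normK (num_real (S t))); set y := `|S t|.
    have y0 : 0 <= y by exact: normr_ge0.
    have [ye|ey] := leP y e; first by rewrite (le_trans ye)// lerDl mulr_ge0 ?invr_ge0 ?sqr_ge0 ?ltW.
    have H : y <= e^-1 * y ^+ 2 by rewrite ler_pdivlMl// expr2 ler_wpM2r// ltW.
    by apply: (le_trans H); rewrite lerDr ltW.
rewrite RintegralD//; [|exact: (ic e)|exact: integrable_scale].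
rewrite RintegralZl// Rintegral_cst//= fE [_ * (r - l)]mulrC mulrDr lerD2l mulrCA.
rewrite ler_wpM2l ?invr_ge0 ?(ltW e0)//; exact: wave_sum_norm_le.
Qed.

End period.

(* Normalisation of the n-th mode of a 2 pi periodic function. *)
Definition kap (s : nat) : R := if s == 0%N then (2 * pi)^-1 else pi^-1.

Lemma kap_bound s : 0 < kap s <= 1.
Proof.
have p2 : 2 <= pi :> R by exact: pi_ge2.
have p0 := @pi_gt0 R.
rewrite /kap; case: ifP => _; rewrite invr_gt0 ?mulr_gt0//= invf_le1 ?mulr_gt0//; lra.
Qed.

(** [kap] compensates the integral of the squared wave, twice as large for the constant mode. At
    frequency 0 the sine is identically 0, so b_0 cannot be recovered; this is the origin of the
    case distinctions on s = 0 further on. *)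
Lemma wave_sum_coef (a b : nat -> R) (n v : nat) : (v < n)%N ->
  let S := wave_sum (fun s => kap s * a s) (fun s => kap s * b s) 0 n in
  \int[leb]_(t in `[0, 2 * pi]) (S t * cos (v%:~R * t)) = a v /\
  \int[leb]_(t in `[0, 2 * pi]) (S t * sin (v%:~R * t)) = if v == 0%N then 0 else b v.
Proof.
move=> vn S; have E : 2 * pi = 0 + 2 * pi * 1%:R :> R by rewrite add0r mulr1.
have mI : measurable (`[0, 2 * pi] : set mR) by exact: measurable_itv.
have gen (c d : R) : \int[leb]_(t in `[0, 2 * pi]) (S t * wave v c d t) =
    \int[leb]_(t in `[0, 2 * pi]) (wave v (kap v * a v) (kap v * b v) t * wave v c d t).
  under eq_Rintegral do rewrite /S /wave_sum mulr_suml.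
  rewrite Rintegral_bigsum//; last first.
    move=> s; apply: integrable_continuous_cc => t.
    exact: (cvgM (@continuous_wave _ _ _ t) (@continuous_wave _ _ _ t)).
  rewrite (bigD1_seq v)/= ?iota_uniq ?mem_index_iota ?vn// big1 ?addr0// => s sv.
  exact: (wave_orthogonal (isT : (0 < 1)%N) E).
have p0 : pi != 0 :> R by rewrite gt_eqF ?pi_gt0.
have v2 : (v%:Z + v%:Z == 0) = (v == 0%N) by apply/eqP/eqP; lia.
split.
  transitivity (\int[leb]_(t in `[0, 2 * pi]) (S t * wave v 1 0 t)).
    by apply: eq_Rintegral => t _; rewrite /wave mul1r mul0r addr0.
  rewrite gen (wave_product (isT : (0 < 1)%N) E) v2 subrr eqxx /kap.
  by move: p0; move: (@pi R) => P P0; case: (v == 0%N); rewrite /= ?mulr0n ?mulr1n; field; rewrite ?P0.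
transitivity (\int[leb]_(t in `[0, 2 * pi]) (S t * wave v 0 1 t)).
  by apply: eq_Rintegral => t _; rewrite /wave mul1r mul0r add0r.
rewrite gen (wave_product (isT : (0 < 1)%N) E) v2 subrr eqxx /kap.
by move: p0; move: (@pi R) => P P0; case: (v == 0%N); rewrite /= ?mulr0n ?mulr1n; field; rewrite ?P0.
Qed.

End orthogonality.

(** * Trigonometric series with square summable energies *)

Section trig_series.
Context (R : realType).
Notation leb := (@lebesgue_measure R).
Notation mR := (measurableTypeR R).
Implicit Types (c d : nat -> R -> R) (w : R * R -> R).

Definition tsum c d (m n : nat) (z : R * R) : R :=
  wave_sum (fun s => kap R s * c s z.1) (fun s => kap R s * d s z.1) m n z.2.

Lemma tsumB c d (m n : nat) z : (m <= n)%N ->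
  tsum c d 0 n z - tsum c d 0 m z = tsum c d m n z.
Proof.
by move=> mn; rewrite /tsum /wave_sum (big_cat_nat (leq0n m) mn)//= addrAC subrr add0r.
Qed.

Lemma loc_integrable_fst (f : R -> R) : leb.-integrable `]0, 1[ (EFin \o f) ->
  loc_integrable (fun z => f z.1).
Proof.
move=> fi T; have mI : measurable (`]0, 1[ : set mR) by exact: measurable_itv.
have mT : measurable (`[- T, T] : set mR) by exact: measurable_itv.
apply: (@integrable_prod_of_section _ _ _ _ (fun x => fine (leb `[- T, T]) * `|f x|)) => //.
- apply: measurable_strip_fst (integrable_measurable fi); first exact: measurableX.
  exact: box_subset_strip.
- move=> x _; apply: (finite_measure_integrable_cst_on (f x)) => //.
  have [TT|TT] := leP (- T) T; first exact: (lebesgue_cc TT).1.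
  by rewrite set_itv_ge ?measure0// -leNgt ltW// bnd_simp.
- by apply: integrable_scale => //; exact: (integrable_norm fi).
- by move=> x _; rewrite /= Rintegral_cst// mulrC.
Qed.

Lemma loc_integrable_wave c d (s : nat) :
  leb.-integrable `]0, 1[ (EFin \o c s) -> leb.-integrable `]0, 1[ (EFin \o d s) ->
  loc_integrable (fun z => wave s (kap R s * c s z.1) (kap R s * d s z.1) z.2).
Proof.
move=> ci di; apply: loc_integrable_add => T.
  have := (integrable_box_cos T (s%:~R) (loc_integrable_scale (kap R s) (loc_integrable_fst ci))).1.
  exact.
exact: (integrable_box_cos T (s%:~R) (loc_integrable_scale (kap R s) (loc_integrable_fst di))).2.
Qed.

Lemma loc_integrable_tsum c d (m n : nat) :
  (forall s, leb.-integrable `]0, 1[ (EFin \o c s)) ->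
  (forall s, leb.-integrable `]0, 1[ (EFin \o d s)) -> loc_integrable (tsum c d m n).
Proof.
move=> ci di T; apply: integrable_bigsum; first exact: measurable_box.
by move=> s; exact: loc_integrable_wave.
Qed.

Lemma tsum_periodic c d m n (x t : R) : tsum c d m n (x, t + 2 * pi) = tsum c d m n (x, t).
Proof.
rewrite /tsum /wave_sum; apply: eq_bigr => s _.
by have [h1 h2] := trig_periodic s t; rewrite /wave/= h1 h2.
Qed.

(** Boxes whose height is a whole number of periods, as orthogonality requires; they exhaust the
    strip. *)
Definition pbox (q : nat) : set (mR * mR) := box (2 * pi * q.+1%:R).

Lemma measurable_pbox q : measurable (pbox q).
Proof. exact: measurable_box. Qed.

Lemma pbox_half_gt0 (q : nat) : 0 < 2 * pi * q.+1%:R :> R.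
Proof. by rewrite mulr_gt0 ?two_pi_gt0// ltr0n. Qed.

Lemma box_sub_pbox (T : R) : exists q, box T `<=` pbox q.
Proof.
exists (Num.trunc `|T|) => z [z1 z2]; split=> //; move: z2 => /=; rewrite !in_itv/=.
have p2 : 2 <= pi :> R by exact: pi_ge2.
have h : T <= 2 * pi * (Num.trunc `|T|).+1%:R.
  apply: (le_trans (ler_norm T)); apply: (le_trans (ltW (truncnS_gt _))).
  by rewrite ler_peMl//; lra.
by move=> /andP[h1 h2]; apply/andP; split; lra.
Qed.

Lemma loc_integrable_of_pboxes w :
  (forall q, (leb2 R).-integrable (pbox q) (EFin \o w)) -> loc_integrable w.
Proof.
move=> wi T; have [q sub] := box_sub_pbox T.
exact: integrableS (measurable_pbox q) (measurable_box T) sub (wi q).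
Qed.

(** L^1 convergence on period boxes is strong enough to determine Fourier coefficients and to pass
    to the limit against test functions, and it follows from square summability by AM-GM. *)
Definition is_trig_series c d w := [/\ loc_integrable w, periodic_2pi w &
  forall q, (fun N => \int[leb2 R]_(z in pbox q) `|tsum c d 0 N z - w z|) @ \oo --> (0 : R)].

Section square_summable.
Variables (c d : nat -> R -> R).
Hypothesis ci : forall s, leb.-integrable `]0, 1[ (EFin \o c s).
Hypothesis di : forall s, leb.-integrable `]0, 1[ (EFin \o d s).
Hypothesis ei : forall s, leb.-integrable `]0, 1[ (EFin \o (fun x => c s x ^+ 2 + d s x ^+ 2)).

Definition mode_energy (s : nat) : R := \int[leb]_(x in `]0, 1[) (c s x ^+ 2 + d s x ^+ 2).

Lemma tsum_L1_le (q m n : nat) (e : R) : 0 < e ->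
  \int[leb2 R]_(z in pbox q) `|tsum c d m n z| <=
  2 * (2 * pi * q.+1%:R) * (e + e^-1 * \sum_(m <= s < n) mode_energy s).
Proof.
move=> e0; set T := 2 * pi * q.+1%:R.
have T0 : 0 < T by exact: pbox_half_gt0.
have E : T = - T + 2 * pi * (2 * q.+1)%:R by rewrite natrM /T; ring.
have mI : measurable (`]0, 1[ : set mR) by exact: measurable_itv.
have mT : measurable (`[- T, T] : set mR) by exact: measurable_itv.
have ti : (leb2 R).-integrable (pbox q) (EFin \o (fun z => `|tsum c d m n z|)).
  exact: (integrable_norm (loc_integrable_tsum m n ci di T)).
rewrite (Rintegral_setX1 mI mT ti).
have [fin fE] := lebesgue_oo (@ler01 R).
have ic (k : R) : leb.-integrable `]0, 1[ (EFin \o cst k).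
  exact: finite_measure_integrable_cst_on.
have si : leb.-integrable `]0, 1[ (EFin \o
    (fun x => \sum_(m <= s < n) (c s x ^+ 2 + d s x ^+ 2))) by exact: integrable_bigsum.
apply: (@le_trans _ _ (\int[leb]_(x in `]0, 1[)
    (2 * T * (e + e^-1 * \sum_(m <= s < n) (c s x ^+ 2 + d s x ^+ 2))))).
  apply: le_Rintegral => //.
  - exact: (integrable_Rintegral_section1 mI mT ti).
  - apply: integrable_scale => //; apply: integrable_add => //; first exact: ic.
    exact: integrable_scale.
  move=> x _.
  have H := wave_sum_L1_le (isT : (0 < 2 * q.+1)%N) E (fun s => kap R s * c s x)
    (fun s => kap R s * d s x) m n e0.
  apply: (le_trans H).
  have -> : T - - T = 2 * T by ring.
  apply: ler_wpM2l; first by rewrite mulr_ge0// ltW.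
  rewrite lerD2l; apply: ler_wpM2l; first by rewrite invr_ge0 ltW.
  apply: ler_sum => s _.
  have /andP[k0 k1] := kap_bound R s.
  by rewrite !exprMn -mulrDr ler_piMl ?addr_ge0 ?sqr_ge0// exprn_ile1// ltW.
rewrite RintegralZl//; last first.
  by apply: integrable_add => //; [exact: ic|exact: integrable_scale].
rewrite RintegralD//; [|exact: ic|exact: integrable_scale].
by rewrite RintegralZl// Rintegral_cst//= fE subr0 mulr1 Rintegral_bigsum.
Qed.

Hypothesis sume : cvgn (series mode_energy).

Lemma mode_energy_ge0 s : 0 <= mode_energy s.
Proof. by apply: Rintegral_ge0 => x _; rewrite addr_ge0// sqr_ge0. Qed.

Lemma mode_energy_tail (e : R) : 0 < e -> exists N, forall m n, (N <= m)%N ->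
  \sum_(m <= s < n) mode_energy s <= e.
Proof.
move=> e0; have cv : series mode_energy @ \oo --> limn (series mode_energy) by exact: sume.
have [N _ HN] := @cvgr_dist_lt _ _ _ _ _ _ _ cv _ e0.
exists N => m n Nm; have [nm|mn] := leqP n m; first by rewrite big_geq// ltW.
have mono : nondecreasing_seq (series mode_energy).
  by apply: nondecreasing_series => s _ _; exact: mode_energy_ge0.
have ln := nondecreasing_cvgn_le mono sume n.
have := HN m Nm; have lm := nondecreasing_cvgn_le mono sume m.
rewrite /= ger0_norm ?subr_ge0// => h.
have -> : \sum_(m <= s < n) mode_energy s = series mode_energy n - series mode_energy m.
  by rewrite /series/= (big_cat_nat (leq0n m) (ltnW mn))//= addrAC subrr add0r.
lra.
Qed.

(** Small tails of the energies give small L^1 norms on every period box. The subsequence [N] is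
    chosen independently of the box, so a single limit w serves all q; the tails then give
    convergence of the full sequence. *)
Theorem riesz_fischer : exists w, is_trig_series c d w.
Proof.
(* A tail of size 4^-k, used in the AM-GM bound with e = 2^-k, gives e + 4^-k / e = 2 e. *)
have /choice [n0 Hn0] : forall k, exists N, forall m n, (N <= m)%N ->
    \sum_(m <= s < n) mode_energy s <= (2^-1) ^+ k * (2^-1) ^+ k.
  by move=> k; apply: mode_energy_tail; rewrite mulr_gt0 ?exprn_gt0// invr_gt0.
(* Cumulative sums make the indices monotone while staying above [n0 k] and above k. *)
pose N k := (\sum_(i < k.+1) n0 i + k)%N.
have Nmono k : (N k <= N k.+1)%N.
  by rewrite /N [X in (_ <= X + _)%N]big_ord_recr/= leq_add ?leq_addr.
have n0N k : (n0 k <= N k)%N by rewrite /N big_ord_recr/= -addnA addnCA leq_addr.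
have kN k : (k <= N k)%N by rewrite /N leq_addl.
pose S k := tsum c d 0 (N k); pose w := fast_limit S.
have Si n m : loc_integrable (tsum c d n m) by exact: loc_integrable_tsum.
(* With T = 2 pi (q + 1) the increments are at most 2 T times 2 / 2^k, that is 8 T / 2^(k+1). *)
have lim q := L1_fast_limit (mu := leb2 R) (measurable_pbox q) (f := S)
  (C := 8 * (2 * pi * q.+1%:R)) (fun k => Si _ _ _).
have {}lim q : (leb2 R).-integrable (pbox q) (EFin \o w) /\
    (fun k => \int[leb2 R]_(z in pbox q) `|S k z - w z|) @ \oo --> (0 : R).
  apply: lim => k; set T := 2 * pi * q.+1%:R.
  rewrite (_ : (fun z => _) = (fun z => `|tsum c d (N k) (N k.+1) z|)); last first.
    by apply/funext => z; rewrite tsumB.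
  have e0 : 0 < (2^-1) ^+ k :> R by rewrite exprn_gt0// invr_gt0.
  apply: le_trans (tsum_L1_le q _ _ e0) _; rewrite -/T.
  have h := Hn0 k (N k) (N k.+1) (n0N k).
  have T0 : 0 < T by exact: pbox_half_gt0.
  apply: (@le_trans _ _ (2 * T * ((2^-1) ^+ k + (2^-1) ^+ k))).
    apply: ler_wpM2l; first by rewrite mulr_ge0 ?(ltW T0).
    by rewrite lerD2l ler_pdivrMl.
  rewrite exprVn exprS invfM; set y := (2 ^+ k)^-1.
  by rewrite [leRHS](_ : _ = 4 * T * y); [lra|field].
exists w; split.
- by apply: loc_integrable_of_pboxes => q; exact: (lim q).1.
- apply: aeW => -[x t] _ /=; rewrite /w /fast_limit.
  by congr (fine (limn_esup _)); apply/funext => k; rewrite /S tsum_periodic.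
move=> q; pose T : R := 2 * pi * q.+1%:R; have T0 : 0 < T by exact: pbox_half_gt0.
have [wi wl] := lim q; have mb := measurable_pbox q.
(* A tail of size e'^2 contributes at most 2 T (e' + e') = e / 2. *)
apply/cvgrPdist_le => /= e e0; pose e' := e / (8 * T).
have e'0 : 0 < e' by rewrite divr_gt0// mulr_gt0.
have [M HM] := mode_energy_tail (mulr_gt0 e'0 e'0).
have [k0 _ Hk0] := @cvgr_dist_lt _ _ _ _ _ _ _ wl _ (divr_gt0 e0 (ltr0n R 2)).
pose k := maxn M k0; have := Hk0 k (leq_maxr M k0).
rewrite /= sub0r normrN ger0_norm; last by apply: Rintegral_ge0.
move=> hk; exists (N k) => // n /= kn.
rewrite sub0r normrN ger0_norm; last by apply: Rintegral_ge0.
have i1 : (leb2 R).-integrable (pbox q) (EFin \o (fun z => `|tsum c d (N k) n z|)).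
  exact: (integrable_norm (Si _ _ T)).
have i2 : (leb2 R).-integrable (pbox q) (EFin \o (fun z => `|S k z - w z|)).
  by apply: (integrable_norm (integrable_sub mb _ wi)); exact: (Si _ _ T).
apply: (@le_trans _ _ (\int[leb2 R]_(z in pbox q) (`|tsum c d (N k) n z| + `|S k z - w z|))).
  apply: le_Rintegral => //.
  - by apply: (integrable_norm (integrable_sub mb _ wi)); exact: (Si _ _ T).
  - exact: integrable_add.
  - move=> z _; rewrite -(tsumB c d z kn) -/(S k z) (le_trans _ (ler_normD _ _))//.
    by rewrite addrA subrK.
rewrite RintegralD//.
have h : \sum_(N k <= s < n) mode_energy s <= e' * e'.
  by apply: HM; rewrite (leq_trans (leq_maxl M k0))// kN.
have : \int[leb2 R]_(z in pbox q) `|tsum c d (N k) n z| <= e / 2.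
  apply: le_trans (tsum_L1_le q _ _ e'0) _; rewrite -/T.
  apply: (@le_trans _ _ (2 * T * (e' + e'))).
    apply: ler_wpM2l; first by rewrite mulr_ge0 ?(ltW T0).
    by rewrite lerD2l ler_pdivrMl.
  by rewrite /e' (_ : _ * _ = e / 2)//; field; rewrite gt_eqF.
lra.
Qed.

End square_summable.

End trig_series.

(** * Limits of trigonometric series *)

Section trig_series_limits.
Context (R : realType).
Notation leb := (@lebesgue_measure R).
Notation mR := (measurableTypeR R).
Implicit Types (c d : nat -> R -> R) (h w : R * R -> R).

(** f + |g - f| dominates f everywhere and equals g almost everywhere on D, which reduces the claim
    to a pointwise inequality. *)
Lemma ae_le_Rintegral dd (T : measurableType dd) (mu : {measure set T -> \bar R}) (D : set T)
  (f g : T -> R) : measurable D -> mu.-integrable D (EFin \o f) -> mu.-integrable D (EFin \o g) ->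
  {ae mu, forall x, D x -> f x <= g x} -> \int[mu]_(x in D) f x <= \int[mu]_(x in D) g x.
Proof.
move=> mD fi gi fg; pose k x := f x + `|g x - f x|.
have ki : mu.-integrable D (EFin \o k).
  by apply: integrable_add => //; apply: integrable_norm; exact: integrable_sub.
have -> : \int[mu]_(x in D) g x = \int[mu]_(x in D) k x.
  apply: ae_eq_Rintegral => //; first exact: integrable_measurable ki.
  by apply: ae_imp fg => x h Dx; rewrite /k ger0_norm ?subr_ge0 ?h//; ring.
by apply: le_Rintegral => // x _; rewrite /k lerDl.
Qed.

Lemma fcos_fsin_norm_le h (s : int) (x : R) :
  leb.-integrable `[0, 2 * pi] (EFin \o (fun t => h (x, t))) ->
  `|fcos h s x| <= \int[leb]_(t in `[0, 2 * pi]) `|h (x, t)| /\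
  `|fsin h s x| <= \int[leb]_(t in `[0, 2 * pi]) `|h (x, t)|.
Proof.
move=> hi; have mI : measurable (`[0, 2 * pi] : set mR) by exact: measurable_itv.
have cb (y : R) : `|cos y| <= 1 by rewrite ler_norml cos_geN1 cos_le1.
have sb (y : R) : `|sin y| <= 1 by rewrite ler_norml sin_geN1 sin_le1.
have ic := integrable_cos s%:~R hi; have is_ := integrable_sin s%:~R hi.
split; apply: le_trans (le_normr_Rintegral _ _) _ => //; apply: le_Rintegral => //.
- exact: integrable_norm ic.
- exact: integrable_norm hi.
- by move=> t _; rewrite normrM ler_piMr.
- exact: integrable_norm is_.
- exact: integrable_norm hi.
- by move=> t _; rewrite normrM ler_piMr.
Qed.

(** Continuity in L^1 of the map from a function to its coefficient, needed to pass from partial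
    sums to the limit. *)
Lemma Rintegral_fcos_norm_le h (s : int) : loc_integrable h ->
  \int[leb]_(x in `]0, 1[) `|fcos h s x| <= \int[leb2 R]_(z in pbox 0) `|h z| /\
  \int[leb]_(x in `]0, 1[) `|fsin h s x| <= \int[leb2 R]_(z in pbox 0) `|h z|.
Proof.
move=> hl; set T : R := 2 * pi * 1%:R.
have TE : T = 2 * pi by rewrite /T mulr1.
have T0 : 0 < T by rewrite TE two_pi_gt0.
have mI : measurable (`]0, 1[ : set mR) by exact: measurable_itv.
have mT : measurable (`[- T, T] : set mR) by exact: measurable_itv.
have mP : measurable (`[0, 2 * pi] : set mR) by exact: measurable_itv.
have hi : (leb2 R).-integrable (pbox 0) (EFin \o (fun z => `|h z|)).
  exact: (integrable_norm (hl T)).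
rewrite (Rintegral_setX1 mI mT hi).
have Gi := integrable_Rintegral_section1 mI mT hi.
have [ci si] := integrable_fcos s hl.
have le : {ae leb, forall x, `]0, 1[%classic x ->
    `|fcos h s x| <= \int[leb]_(t in `[- T, T]) `|h (x, t)| /\
    `|fsin h s x| <= \int[leb]_(t in `[- T, T]) `|h (x, t)|}.
  apply: ae_imp2 (ae_period_integrable hl) (ae_section_integrable hl) => x i1 i2.
  rewrite /= in_itv/= => x01; have [h1 h2] := fcos_fsin_norm_le s (i1 x01).
  have iT : leb.-integrable `[- T, T] (EFin \o (fun t => `|h (x, t)|)).
    exact: (integrable_norm (i2 x01 T)).
  have le0 : \int[leb]_(t in `[0, 2 * pi]) `|h (x, t)| <= \int[leb]_(t in `[- T, T]) `|h (x, t)|.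
    rewrite -TE (@Rintegral_itv_split _ (- T) 0 T) ?lerDr ?oppr_le0 ?(ltW T0)//.
    by apply: Rintegral_ge0.
  by split; [exact: le_trans h1 le0|exact: le_trans h2 le0].
split; apply: ae_le_Rintegral => //.
- exact: integrable_norm ci.
- by apply: ae_imp le => x H xI; exact: (H xI).1.
- exact: integrable_norm si.
- by apply: ae_imp le => x H xI; exact: (H xI).2.
Qed.

Lemma eq0_of_le_cvg0 (x : R) (u : nat -> R) (N : nat) : u @ \oo --> (0 : R) -> 0 <= x ->
  (forall n, (N <= n)%N -> x <= u n) -> x = 0.
Proof.
move=> u0 x0 xu; apply/le_anti; rewrite x0 andbT.
rewrite -(cvg_lim (@Rhausdorff R) u0); apply: limr_ge; first by apply/cvg_ex; exists 0.
by exists N.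
Qed.

Section series.
Variables (c d : nat -> R -> R).
Hypothesis ci : forall s, leb.-integrable `]0, 1[ (EFin \o c s).
Hypothesis di : forall s, leb.-integrable `]0, 1[ (EFin \o d s).

(** The coefficients of the partial sums are stationary from N = s + 1 on, and their L^1 distance to
    those of w tends to 0. *)
Lemma trig_series_fourier w (s : nat) : is_trig_series c d w ->
  {ae leb, forall x, 0 < x < 1 -> fcos w s x = c s x /\ fsin w s x = if s == 0%N then 0 else d s x}.
Proof.
case=> wl wp wc; have mI : measurable (`]0, 1[ : set mR) by exact: measurable_itv.
have Sl N : loc_integrable (tsum c d 0 N) by exact: loc_integrable_tsum.
have [wci wsi] := integrable_fcos s wl.
pose d' x := if s == 0%N then 0 else d s x.
have d'i : leb.-integrable `]0, 1[ (EFin \o d').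
  rewrite /d'; case: (s == 0%N) => //; apply: (finite_measure_integrable_cst_on 0) => //.
  exact: (lebesgue_oo ler01).1.
have SE N : (s < N)%N -> {ae leb, forall x, 0 < x < 1 ->
    fcos (fun z => tsum c d 0 N z - w z) s x = c s x - fcos w s x /\
    fsin (fun z => tsum c d 0 N z - w z) s x = d' x - fsin w s x}.
  move=> sN; apply: ae_imp2 (ae_period_integrable (Sl N)) (ae_period_integrable wl) => x i1 i2 x01.
  have [e1 e2] := wave_sum_coef (fun s => c s x) (fun s => d s x) sN.
  have -> : (fun z => tsum c d 0 N z - w z) = (fun z => (-1) * w z + tsum c d 0 N z).
    by apply/funext => z; ring.
  rewrite fcos_add ?fsin_add//; try (exact: i1); try (exact: i2).
  rewrite /fcos /fsin in e1 e2 *; rewrite /d'; rewrite -e1 -e2.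
  by split; rewrite mulN1r addrC.
have small N : (s < N)%N ->
    \int[leb]_(x in `]0, 1[) `|c s x - fcos w s x| <=
      \int[leb2 R]_(z in pbox 0) `|tsum c d 0 N z - w z| /\
    \int[leb]_(x in `]0, 1[) `|d' x - fsin w s x| <=
      \int[leb2 R]_(z in pbox 0) `|tsum c d 0 N z - w z|.
  move=> sN; have [h1 h2] := Rintegral_fcos_norm_le s (loc_integrable_sub (Sl N) wl).
  have E := SE N sN.
  have [ki li] := integrable_fcos s (loc_integrable_sub (Sl N) wl).
  split; [apply: le_trans h1|apply: le_trans h2]; rewrite le_eqVlt; apply/orP; left; apply/eqP;
    apply: ae_eq_Rintegral => //.
  - by apply: integrable_norm; exact: integrable_sub.
  - exact: integrable_measurable (integrable_norm ki).
  - by apply: ae_imp E => x Ex; rewrite /= in_itv/= => x01; rewrite (Ex x01).1.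
  - by apply: integrable_norm; exact: integrable_sub.
  - exact: integrable_measurable (integrable_norm li).
  - by apply: ae_imp E => x Ex; rewrite /= in_itv/= => x01; rewrite (Ex x01).2.
have z1 : \int[leb]_(x in `]0, 1[) `|c s x - fcos w s x| = 0.
  apply: (eq0_of_le_cvg0 (N := s.+1) (wc 0%N)); first exact: Rintegral_ge0.
  by move=> N sN; exact: (small N sN).1.
have z2 : \int[leb]_(x in `]0, 1[) `|d' x - fsin w s x| = 0.
  apply: (eq0_of_le_cvg0 (N := s.+1) (wc 0%N)); first exact: Rintegral_ge0.
  by move=> N sN; exact: (small N sN).2.
have a1 := Rintegral_norm_eq0 mI (integrable_sub mI (ci s) wci) z1.
have a2 := Rintegral_norm_eq0 mI (integrable_sub mI d'i wsi) z2.
apply: ae_imp2 a1 a2 => x h1 h2 x01.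
have xI : `]0, 1[%classic x by rewrite /= in_itv.
by split; apply/esym/eqP; rewrite -subr_eq0; apply/eqP; [exact: h1|exact: h2].
Qed.

Lemma test_integral_cvg (h : nat -> R * R -> R) w phi (T M : R) :
  (forall n, loc_integrable (h n)) -> loc_integrable w ->
  (forall q, (fun n => \int[leb2 R]_(z in pbox q) `|h n z - w z|) @ \oo --> (0 : R)) ->
  test_bound T M phi ->
  (fun n => \int[leb2 R]_(z in strip R) (h n z * phi z)) @ \oo -->
  \int[leb2 R]_(z in strip R) (w z * phi z).
Proof.
move=> hl wl hw tb; have [_ pM _] := tb.
have M0 : 0 <= M by exact: le_trans (normr_ge0 _) (pM (0, 0)).
have [q sub] := box_sub_pbox T.
have mq := @measurable_pbox R q.
have tq : test_bound (2 * pi * q.+1%:R) M phi.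
  case: tb => cp pb ps; split=> // z pz; have [z1 z2] := ps z pz; split=> //.
  have : pbox q z by apply: sub; split; rewrite /= in_itv/= -?ler_norml.
  by case=> _ /=; rewrite in_itv/= ler_norml.
apply/cvgrPdist_le => /= e e0.
have e1 : 0 < e / (M + 1) by rewrite divr_gt0// ltr_wpDl.
have [N _ HN] := @cvgr_dist_lt _ _ _ _ _ _ _ (hw q) _ e1.
exists N => // n Nn; have := HN n Nn; rewrite /= sub0r normrN ger0_norm ?Rintegral_ge0// => hn.
have hwl : loc_integrable (fun z => w z - h n z) by exact: loc_integrable_sub.
rewrite !(Rintegral_strip_box _ tq) -RintegralB//; [|exact: integrable_box_test tq..].
apply: le_trans (le_normr_Rintegral _ _) _ => //.
  by apply: integrable_sub => //; exact: integrable_box_test tq.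
apply: (@le_trans _ _ (\int[leb2 R]_(z in pbox q) (M * `|h n z - w z|))).
  apply: le_Rintegral => //.
  - by apply: integrable_norm; apply: integrable_sub => //; exact: integrable_box_test tq.
  - by apply: integrable_scale => //; apply: integrable_norm; apply: integrable_sub => //;
      [exact: hl|exact: wl].
  - by move=> z _; rewrite -mulrBl normrM mulrC distrC ler_wpM2r.
rewrite RintegralZl//; last by apply: integrable_norm; apply: integrable_sub => //;
  [exact: hl|exact: wl].
apply: (@le_trans _ _ ((M + 1) * (e / (M + 1)))).
  by apply: ler_pM => //; [exact: Rintegral_ge0|rewrite lerDl|exact: ltW].
by rewrite mulrC divfK// gt_eqF// ltr_wpDl.
Qed.

Lemma leb2_box_lty (T : R) : (leb2 R (box T) < +oo)%E.
Proof.
have mI : measurable (`]0, 1[ : set mR) by exact: measurable_itv.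
have mT : measurable (`[- T, T] : set mR) by exact: measurable_itv.
have E : leb2 R (box T) = (leb `]0%R, 1%R[ * leb `[(- T)%R, T])%E by exact: product_measure1E.
rewrite E; have [TT|TT] := leP (- T) T; last first.
  have -> : `[- T, T]%classic = set0 :> set R by apply: set_itv_ge; rewrite bnd_simp -ltNge.
  by rewrite measure0 mule0.
have [f0 _] := lebesgue_oo (@ler01 R).
by apply: lte_mul_pinfty; rewrite ?ge0_fin_numE// (lebesgue_cc TT).1.
Qed.

Section normal_convergence.
Variables (M : nat -> R).
Hypothesis cd_le : forall s (x : R), 0 <= x <= 1 -> `|c s x| <= M s /\ `|d s x| <= M s.
Hypothesis sumM : cvgn (series M).

Let M0 s : 0 <= M s.
Proof. by apply: le_trans (normr_ge0 (c s 0)) _; apply: (cd_le _ _).1; rewrite lexx ler01. Qed.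

(** A pointwise limit, meaningful on the closed strip as well; its values at x = 0 and x = 1 are the
    traces. *)
Definition tlim (z : R * R) : R := limn (fun N => tsum c d 0 N z).

Lemma tsum_uniform (m n : nat) (x t : R) : 0 <= x <= 1 -> (m <= n)%N ->
  `|tsum c d m n (x, t)| <= 2 * (series M n - series M m).
Proof.
move=> x01 mn; have -> : series M n - series M m = \sum_(m <= s < n) M s.
  by rewrite /series/= (big_cat_nat (leq0n m) mn)//= addrAC subrr add0r.
rewrite mulr_sumr /tsum /wave_sum (le_trans (ler_norm_sum _ _ _))//.
apply: ler_sum => s _; rewrite /wave/= (le_trans (ler_normD _ _))// !normrM.
have /andP[k0 k1] := kap_bound R s; rewrite (gtr0_norm k0).
have [h1 h2] := cd_le s x01.
have cb : `|cos (s%:~R * t)| <= 1 by rewrite ler_norml cos_geN1 cos_le1.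
have sb : `|sin (s%:~R * t)| <= 1 by rewrite ler_norml sin_geN1 sin_le1.
rewrite mulr_natl mulr2n lerD// -[leRHS]mulr1 ler_pM ?mulr_ge0 ?(ltW k0)//.
  by rewrite -[leRHS]mul1r ler_pM ?(ltW k0).
by rewrite -[leRHS]mul1r ler_pM ?(ltW k0).
Qed.

Lemma tsum_tlim (x t : R) (m : nat) : 0 <= x <= 1 ->
  (fun N => tsum c d 0 N (x, t)) @ \oo --> tlim (x, t) /\
  `|tsum c d 0 m (x, t) - tlim (x, t)| <= 2 * (limn (series M) - series M m).
Proof.
move=> x01; have monoM : nondecreasing_seq (series M).
  by apply: nondecreasing_series => s _ _; exact: M0.
have lM := nondecreasing_cvgn_le monoM sumM.
pose u (s : nat) := wave s (kap R s * c s x) (kap R s * d s x) t.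
have uM s : `|u s| <= (2 *: M) s.
  have := tsum_uniform t x01 (leqnSn s).
  by rewrite /tsum /wave_sum big_nat1 /series/= big_nat_recr//= addrAC subrr add0r.
have cv : cvgn (series u).
  apply: normed_cvg; apply: (series_le_cvg (v_ := 2 *: M)) => //.
  - by move=> s; exact: normr_ge0.
  - by move=> s; exact: le_trans (normr_ge0 _) (uM s).
  - exact: is_cvg_seriesZ.
split; first exact: cv.
have cv2 : (fun n => `|tsum c d 0 m (x, t) - tsum c d 0 n (x, t)|) @ \oo -->
    `|tsum c d 0 m (x, t) - tlim (x, t)|.
  by apply: cvg_norm; apply: cvgB; [exact: cvg_cst|exact: cv].
rewrite -(cvg_lim (@Rhausdorff R) cv2); apply: limr_le; first by apply/cvg_ex; eexists; exact: cv2.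
exists m => // n mn; rewrite /= distrC tsumB// (le_trans (tsum_uniform t x01 mn))//.
by rewrite ler_wpM2l// lerD2r.
Qed.

Lemma tlim_measurable : measurable_fun (strip R : set (mR * mR)) tlim.
Proof.
apply: (measurable_fun_cvg (h := fun N => tsum c d 0 N)).
  by move=> N; apply: loc_integrable_measurable; exact: loc_integrable_tsum.
move=> [x t] [/=]; rewrite in_itv/= => /andP[x0 x1] _.
by apply: (tsum_tlim t 0 _).1; rewrite !ltW.
Qed.

Lemma tlim_bound (x t : R) : 0 <= x <= 1 -> `|tlim (x, t)| <= 2 * limn (series M).
Proof.
move=> x01; have [_] := tsum_tlim t 0 x01.
by rewrite /tsum /wave_sum big_geq// /series/= big_geq// sub0r normrN subr0.
Qed.

Lemma tlim_loc_integrable : loc_integrable tlim.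
Proof.
move=> T; have mb := @measurable_box R T.
apply: (@integrable_bounded _ _ _ _ _ _ (2 * limn (series M))) => //.
- exact: leb2_box_lty.
- by apply: measurable_funS tlim_measurable; [exact: measurable_strip|exact: box_subset_strip].
- move=> [x t] [/=]; rewrite in_itv/= => /andP[x0 x1] _.
  by apply: tlim_bound; rewrite !ltW.
Qed.

Lemma tlim_trig_series : is_trig_series c d tlim.
Proof.
split; first exact: tlim_loc_integrable.
  apply: aeW => -[x t] _ /=; rewrite /tlim; congr (limn _).
  by apply/funext => N; rewrite tsum_periodic.
move=> q.
have mb : measurable (pbox q : set (mR * mR)) by exact: measurable_pbox.
have fin : (leb2 R (pbox q) < +oo)%E by exact: leb2_box_lty.
apply: (@squeeze_cvgr _ _ _ _ (cst 0)
  (fun N => 2 * (limn (series M) - series M N) * fine (leb2 R (pbox q)))).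
- apply: nearW => N; rewrite Rintegral_ge0//=.
  have Si : (leb2 R).-integrable (pbox q) (EFin \o (fun z => tsum c d 0 N z - tlim z)).
    apply: integrable_sub => //; last exact: tlim_loc_integrable.
    exact: loc_integrable_tsum.
  rewrite -(Rintegral_cst (leb2 R) mb); apply: le_Rintegral => //.
  + exact: integrable_norm Si.
  + exact: finite_measure_integrable_cst_on.
  + move=> [x t] [/=]; rewrite in_itv/= => /andP[x0 x1] _.
    by apply: (tsum_tlim t N _).2; rewrite !ltW.
- exact: cvg_cst.
- rewrite -[X in _ --> X](mul0r (fine (leb2 R (pbox q)))); apply: cvgMl.
  rewrite -[X in _ --> X](mulr0 2); apply: cvgMr.
  by rewrite -[X in _ --> X](subrr (limn (series M))); apply: cvgB; [exact: cvg_cst|exact: sumM].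
Qed.

Hypothesis cont : forall s, {within `[0, 1], continuous (c s)} /\ {within `[0, 1], continuous (d s)}.

(** Uniformity in t: the tails are bounded by those of M, and finitely many coefficients, all
    continuous at y, control the partial sum independently of t. *)
Lemma tlim_uniform_continuous (y e : R) : 0 <= y <= 1 -> 0 < e ->
  \forall x \near y, 0 <= x <= 1 -> forall t, `|tlim (x, t) - tlim (y, t)| <= e.
Proof.
move=> y01 e0; have yI : `[0, 1]%classic y by rewrite /= in_itv.
have inc m (k : R) : 0 < k -> \forall x \near y, 0 <= x <= 1 ->
    \sum_(0 <= s < m) (`|c s x - c s y| + `|d s x - d s y|) <= k.
  elim: m k => [|m ih] k k0; first by near=> x => _; rewrite big_geq// ltW.
  have k4 : 0 < k / 4 by rewrite divr_gt0.
  have [cm dm] := cont m.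
  move/subspace_continuousP/(_ _ yI) : cm => /cvgrPdist_le/(_ _ k4) cm.
  move/subspace_continuousP/(_ _ yI) : dm => /cvgrPdist_le/(_ _ k4) dm.
  have im := ih (k / 2) (divr_gt0 k0 (ltr0n R 2)).
  near=> x => x01; rewrite big_nat_recr//=.
  have xI : x \in `[0, 1] by rewrite in_itv.
  have h1 : `|c m y - c m x| <= k / 4 by move: xI; near: x; exact: cm.
  have h2 : `|d m y - d m x| <= k / 4 by move: xI; near: x; exact: dm.
  have h3 : \sum_(0 <= s < m) (`|c s x - c s y| + `|d s x - d s y|) <= k / 2.
    by move: x01; near: x; exact: im.
  by rewrite (distrC (c m x)) (distrC (d m x)); lra.
(* The tail enters with the factor 2 at each of the points x and y, so e / 8 leaves e / 2 for the
   partial sums. *)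
have [N _ HN] : \forall N \near \oo, `|limn (series M) - series M N| <= e / 8.
  by move/cvgrPdist_le : sumM; apply; rewrite divr_gt0.
have tail := HN N (leqnn N).
have e2 : 0 < e / 2 by rewrite divr_gt0.
near=> x => x01 t.
have h : \sum_(0 <= s < N) (`|c s x - c s y| + `|d s x - d s y|) <= e / 2.
  by move: x01; near: x; exact: inc.
have [_ h1] := tsum_tlim t N x01; have [_ h2] := tsum_tlim t N y01.
have h3 : `|tsum c d 0 N (x, t) - tsum c d 0 N (y, t)| <= e / 2.
  apply: le_trans h; rewrite /tsum /wave_sum -sumrB (le_trans (ler_norm_sum _ _ _))//.
  apply: ler_sum => s _; have /andP[k0 k1] := kap_bound R s; rewrite /wave/=.
  have -> : kap R s * c s x * cos (s%:~R * t) + kap R s * d s x * sin (s%:~R * t) -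
    (kap R s * c s y * cos (s%:~R * t) + kap R s * d s y * sin (s%:~R * t)) =
    kap R s * (c s x - c s y) * cos (s%:~R * t) + kap R s * (d s x - d s y) * sin (s%:~R * t) by ring.
  rewrite (le_trans (ler_normD _ _))// !normrM (gtr0_norm k0).
  have cb : `|cos (s%:~R * t)| <= 1 by rewrite ler_norml cos_geN1 cos_le1.
  have sb : `|sin (s%:~R * t)| <= 1 by rewrite ler_norml sin_geN1 sin_le1.
  rewrite lerD// -[leRHS]mulr1 ler_pM ?mulr_ge0 ?(ltW k0)//.
    by rewrite -[leRHS]mul1r ler_pM ?(ltW k0).
  by rewrite -[leRHS]mul1r ler_pM ?(ltW k0).
have := ler_norm (limn (series M) - series M N).
move: h1 h2 h3; rewrite !ler_norml => /andP[? ?] /andP[? ?] /andP[? ?] ?; apply/andP; split; lra.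
Unshelve. all: by end_near.
Qed.

(** Uniform closeness in t on a bounded interval implies L^2 closeness, with [tlim] as its own
    representative. *)
Lemma tlim_trace (y : R) : 0 <= y <= 1 -> is_trace y tlim (fun t => tlim (y, t)).
Proof.
move=> y01; have mt : measurable_fun (setT : set mR) (fun t => tlim (y, t)).
  apply: (measurable_fun_cvg (h := fun N t => tsum c d 0 N (y, t))).
    move=> N; apply: continuous_measurable_fun => t.
    exact: (@continuous_wave_sum R (fun s => kap R s * c s y) (fun s => kap R s * d s y)).
  by move=> t _; exact: (tsum_tlim t 0 y01).1.
have bnd (f : R -> R) (K T : R) : (forall t, f t ^+ 2 <= K) -> measurable_fun (setT : set mR) f ->
    0 <= T -> (\int[leb]_(t in `[(- T)%R, T]) (f t ^+ 2)%:E <= (K * (2 * T))%:E)%E.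
  move=> fK mf T0; have TT : - T <= T by lra.
  have [fin fE] := lebesgue_cc TT.
  apply: (@le_trans _ _ (\int[leb]_(t in `[(- T)%R, T]) (cst K%:E) t)%E).
    apply: ge0_le_integral => //.
    - by move=> t _; rewrite lee_fin sqr_ge0.
    - apply/measurable_EFinP; apply: measurable_funX.
      exact: measurable_funS mf.
    - by move=> t _; rewrite lee_fin.
  rewrite integral_cst//= EFinM -(_ : leb `[- T, T] = (2 * T)%:E)//.
  by rewrite -[LHS]fineK ?fE ?ge0_fin_numE//; congr EFin; ring.
have neg (f : R -> R) (T : R) : T < 0 -> (\int[leb]_(t in `[(- T)%R, T]) (f t ^+ 2)%:E = 0)%E.
  move=> T0; rewrite set_itv_ge ?integral_set0// bnd_simp -ltNge; lra.
split.
  split=> // T; have [T0|T0] := leP 0 T; last by rewrite neg// ltry.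
  apply: le_lt_trans (bnd _ ((2 * limn (series M)) ^+ 2) T _ mt T0) (ltry _) => t.
  by rewrite -(real_normK (num_real _)) ler_sqr ?nnegrE ?(le_trans _ (tlim_bound t y01))// tlim_bound.
exists tlim; split; [exact: tlim_measurable|exact: aeW|].
move=> T; have [T0|T0] := leP 0 T; last first.
  by under eq_fun do rewrite neg//; exact: cvg_cst.
have mx (x : R) : 0 <= x <= 1 -> measurable_fun (setT : set mR) (fun t => tlim (x, t)).
  move=> x01; apply: (measurable_fun_cvg (h := fun N t => tsum c d 0 N (x, t))).
    move=> N; apply: continuous_measurable_fun => t.
    exact: (@continuous_wave_sum R (fun s => kap R s * c s x) (fun s => kap R s * d s x)).
  by move=> t _; exact: (tsum_tlim t 0 x01).1.
have close (e : R) : 0 < e -> \forall x \near within `]0, 1[ (nbhs y),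
    (\int[leb]_(t in `[(- T)%R, T]) ((tlim (x, t) - tlim (y, t)) ^+ 2)%:E <= (e ^+ 2 * (2 * T))%:E)%E.
  move=> e0; have := tlim_uniform_continuous y01 e0; apply: filterS => x hx.
  rewrite /= in_itv/= => /andP[x0 x1]; have x01 : 0 <= x <= 1 by rewrite !ltW.
  apply: bnd => //; last by apply: measurable_funB => //; exact: mx.
  by move=> t; rewrite -(real_normK (num_real _)) ler_sqr ?nnegrE ?(ltW e0)//; exact: hx.
apply/fine_cvgP; split.
  near=> x; rewrite ge0_fin_numE; last by apply: integral_ge0 => t _; rewrite lee_fin sqr_ge0.
  by apply: le_lt_trans (ltry (1 ^+ 2 * (2 * T))); near: x; exact: close.
(* k <= 1 gives k^2 <= k, and the denominator 2 T + 1 stays positive for T = 0. *)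
apply/cvgrPdist_le => /= e e0; pose k := Num.min 1 (e / (2 * T + 1)).
have T1 : 0 < 2 * T + 1 by rewrite ltr_wpDl// mulr_ge0.
have k0 : 0 < k by rewrite lt_min ltr01 divr_gt0.
near=> x; rewrite sub0r normrN ger0_norm; last first.
  by apply: fine_ge0; apply: integral_ge0 => t _; rewrite lee_fin sqr_ge0.
have h : (\int[leb]_(t in `[(- T)%R, T]) ((tlim (x, t) - tlim (y, t)) ^+ 2)%:E <= (k ^+ 2 * (2 * T))%:E)%E.
  by near: x; exact: close.
rewrite -lee_fin fineK; last first.
  rewrite ge0_fin_numE; last by apply: integral_ge0 => t _; rewrite lee_fin sqr_ge0.
  exact: le_lt_trans h (ltry _).
apply: (le_trans h); rewrite lee_fin.
have k1 : k <= 1 by rewrite ge_min lexx.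
have ke : k * (2 * T + 1) <= e by rewrite -ler_pdivlMr// ge_min lexx orbT.
apply: le_trans ke; apply: ler_pM; rewrite ?exprn_ge0 ?mulr_ge0 ?(ltW k0) ?lerDl//.
by rewrite expr2 ler_piMl// ltW.
Unshelve. all: by end_near.
Qed.

End normal_convergence.

End series.
End trig_series_limits.

(** * Complex modulus, exponential and Cramer's rule *)

Section complex_modulus.
Context (R : realType).
Local Open Scope complex_scope.
Implicit Types (z w : R[i]).

Lemma cmodM z w : cmod (z * w) = cmod z * cmod w.
Proof. exact: ComplexField.Normc.normcM. Qed.

Lemma cmodD z w : cmod (z + w) <= cmod z + cmod w.
Proof. exact: (le_normcD (z : Rcomplex R) w). Qed.

Lemma cmodN z : cmod (- z) = cmod z.
Proof. exact: (normcN (z : Rcomplex R)). Qed.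

Lemma cmod0 : cmod (0 : R[i]) = 0.
Proof. exact: ComplexField.Normc.normc0. Qed.

Lemma cmod1 : cmod (1 : R[i]) = 1.
Proof. exact: ComplexField.Normc.normc1. Qed.

Lemma cmodE (x y : R) : cmod (x +i* y) = Num.sqrt (x ^+ 2 + y ^+ 2).
Proof. by []. Qed.

Lemma cmod_ge0 z : 0 <= cmod z.
Proof. by case: z => x y; rewrite cmodE sqrtr_ge0. Qed.

Lemma cmod_sqr (x y : R) : cmod (x +i* y) ^+ 2 = x ^+ 2 + y ^+ 2.
Proof. by rewrite cmodE sqr_sqrtr// addr_ge0// sqr_ge0. Qed.

Lemma cmod_real (x : R) : cmod x%:C = `|x|.
Proof. by rewrite cmodE expr0n/= addr0 sqrtr_sqr. Qed.

Lemma cmod_le_abs (x y : R) : cmod (x +i* y) <= `|x| + `|y|.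
Proof.
rewrite -ler_sqr ?nnegrE ?cmod_ge0 ?addr_ge0// cmod_sqr.
rewrite -(real_normK (num_real x)) -(real_normK (num_real y)) sqrrD.
by rewrite lerD2r lerDl mulrn_wge0// mulr_ge0.
Qed.

Lemma cmod_sum (I : Type) (s : seq I) (P : pred I) (F : I -> R[i]) :
  cmod (\sum_(i <- s | P i) F i) <= \sum_(i <- s | P i) cmod (F i).
Proof.
elim/big_ind2: _ => [|x1 x2 y1 y2 h1 h2|i _] //; first by rewrite cmod0.
exact: le_trans (cmodD _ _) (lerD h1 h2).
Qed.

Lemma cmod_prod (I : Type) (s : seq I) (P : pred I) (F : I -> R[i]) :
  cmod (\prod_(i <- s | P i) F i) = \prod_(i <- s | P i) cmod (F i).
Proof. by apply: (big_morph (@cmod R)); [exact: cmodM|exact: cmod1]. Qed.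

Lemma cexpD z w : cexp (z + w) = cexp z * cexp w.
Proof.
case: z => a b; case: w => x y; apply/eqP; rewrite eq_complex /cexp/= expRD cosD sinD.
by apply/andP; split; apply/eqP; ring.
Qed.

Lemma cexp0 : cexp (0 : R[i]) = 1.
Proof. by rewrite /cexp/= expR0 cos0 sin0 mulr1 mulr0. Qed.

Lemma cexpKN z : cexp z * cexp (- z) = 1.
Proof. by rewrite -cexpD subrr cexp0. Qed.

Lemma cmod_cexp z : cmod (cexp z) = expR (complex.Re z).
Proof.
rewrite /cexp cmodE !exprMn -mulrDr cos2Dsin2 mulr1 sqrtr_sqr ger0_norm// expR_ge0.
Qed.

Lemma cmod_det_le (n : nat) (A : 'M[R[i]]_n) (K : R) : 0 <= K ->
  (forall i j, cmod (A i j) <= K) -> cmod (\det A) <= n`!%:R * K ^+ n.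
Proof.
move=> K0 AK; rewrite /determinant (le_trans (cmod_sum _ _ _))//.
apply: (@le_trans _ _ (\sum_(s : 'S_n) K ^+ n)); last first.
  by rewrite sumr_const mulr_natl card_Sn.
apply: ler_sum => s _; rewrite cmodM cmod_prod.
have -> : cmod ((-1) ^+ s : R[i]) = 1.
  by case: (odd_perm s); rewrite ?expr1 ?expr0 ?cmodN cmod1.
rewrite mul1r -[X in _ <= K ^+ X](card_ord n) -prodr_const.
by apply: ler_prod => i _; rewrite cmod_ge0 AK.
Qed.

Lemma cmod_cofactor_le (n : nat) (A : 'M[R[i]]_n) (K : R) i j : 0 <= K ->
  (forall i j, cmod (A i j) <= K) ->
  cmod (cofactor A i j) <= n.-1`!%:R * K ^+ n.-1.
Proof.
move=> K0 AK; rewrite /cofactor cmodM.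
have -> : cmod ((-1) ^+ (i + j) : R[i]) = 1.
  by rewrite -signr_odd; case: (odd _); rewrite ?expr1 ?expr0 ?cmodN cmod1.
by rewrite mul1r; apply: cmod_det_le => // k l; rewrite !mxE.
Qed.

Lemma linear_system_bound (n : nat) (A : 'M[R[i]]_n) (v g : 'cV[R[i]]_n) (K c : R) :
  0 <= K -> 0 < c -> (forall i j, cmod (A i j) <= K) -> c <= cmod (\det A) -> A *m v = g ->
  forall k, cmod (v k 0) <=
    c^-1 * (n.-1`!%:R * K ^+ n.-1) * \sum_j cmod (g j 0).
Proof.
move=> K0 c0 AK cA Av k.
have E : (\det A) * v k 0 = \sum_j (\adj A) k j * g j 0.
  by have := congr1 (fun B : 'cV_n => B k 0) (mul_scalar_mx (\det A) v);
    rewrite -mul_adj_mx -mulmxA Av !mxE => <-.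
have h : c * cmod (v k 0) <= (n.-1`!%:R * K ^+ n.-1) * \sum_j cmod (g j 0).
  apply: (@le_trans _ _ (cmod (\det A * v k 0))).
    by rewrite cmodM ler_wpM2r// cmod_ge0.
  rewrite E mulr_sumr (le_trans (cmod_sum _ _ _))//; apply: ler_sum => j _.
  by rewrite cmodM ler_wpM2r ?cmod_ge0// mxE; exact: cmod_cofactor_le.
by rewrite -mulrA ler_pdivlMl.
Qed.

End complex_modulus.

(** * The linear system for the boundary values *)

Section boundary.
Context (R : realType).
Local Open Scope complex_scope.
Variables (m p : nat).
Implicit Types (theta z Phi : 'I_(m + p) -> R[i]) (rho : 'M[R]_(m, p)) (sig : 'M[R]_(p, m)).

Definition reflection theta rho sig : 'M[R[i]]_p := \matrix_(j < p, k < p)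
  \sum_(l < m) cexp (theta (rshift m j) - theta (lshift p l)) * (sig j l)%:C * (rho l k)%:C.

(* The boundary conditions for the value [z] at 0 of a mode whose value at 1 is
   [exp (- theta) (z + Phi)]. *)
Definition mode_boundary theta rho sig Phi z :=
  (forall j : 'I_m, z (lshift p j) = \sum_(k < p) (rho j k)%:C * z (rshift m k)) /\
  (forall j : 'I_p, cexp (- theta (rshift m j)) * (z (rshift m j) + Phi (rshift m j)) =
     \sum_(l < m) (sig j l)%:C * (cexp (- theta (lshift p l)) * (z (lshift p l) + Phi (lshift p l)))).

Let rhs theta sig Phi : 'cV[R[i]]_p := \col_j (- Phi (rshift m j) +
  \sum_(l < m) cexp (theta (rshift m j) - theta (lshift p l)) * (sig j l)%:C * Phi (lshift p l)).

(** The conditions at 0 express the first m components by the last p. Substituting them into row j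
    of the conditions at 1 and multiplying by exp (theta_j), which is not 0, gives row j of the
    system with matrix I - R. *)
Lemma mode_boundaryE theta rho sig Phi z :
  (forall j : 'I_m, z (lshift p j) = \sum_(k < p) (rho j k)%:C * z (rshift m k)) ->
  (mode_boundary theta rho sig Phi z <->
   (1%:M - reflection theta rho sig) *m (\col_k z (rshift m k)) = rhs theta sig Phi).
Proof.
move=> zl; pose e (j : 'I_p) := cexp (theta (rshift m j)).
have key (j : 'I_p) : ((1%:M - reflection theta rho sig) *m (\col_k z (rshift m k))) j 0 -
    rhs theta sig Phi j 0 = e j * (cexp (- theta (rshift m j)) * (z (rshift m j) + Phi (rshift m j)) -
     \sum_(l < m) (sig j l)%:C * (cexp (- theta (lshift p l)) * (z (lshift p l) + Phi (lshift p l)))).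
  rewrite mulmxBl mul1mx !mxE mulrBr mulrA cexpKN mul1r opprD opprK.
  have -> : \sum_k reflection theta rho sig j k * (\col_k z (rshift m k)) k 0 =
      \sum_(l < m) cexp (theta (rshift m j) - theta (lshift p l)) * (sig j l)%:C * z (lshift p l).
    under eq_bigr do rewrite !mxE mulr_suml.
    rewrite exchange_big/=; apply: eq_bigr => l _; rewrite zl mulr_sumr.
    by apply: eq_bigr => k _; rewrite !mulrA.
  rewrite mulr_sumr.
  have -> : \sum_(l < m) e j * ((sig j l)%:C * (cexp (- theta (lshift p l)) *
      (z (lshift p l) + Phi (lshift p l)))) =
    \sum_(l < m) cexp (theta (rshift m j) - theta (lshift p l)) * (sig j l)%:C * z (lshift p l) +
    \sum_(l < m) cexp (theta (rshift m j) - theta (lshift p l)) * (sig j l)%:C * Phi (lshift p l).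
    by rewrite -big_split/=; apply: eq_bigr => l _; rewrite cexpD /e; ring.
  ring.
split=> [[_ zr]|E].
  apply/colP => j; apply/eqP; rewrite -subr_eq0 key zr subrr mulr0//.
split=> // j; have /eqP := key j; rewrite E subrr eq_sym.
have -> (x : R[i]) : (e j * x == 0) = (x == 0).
  rewrite mulf_eq0; case: eqP => //= e0; exfalso.
  have := cexpKN (theta (rshift m j)); rewrite -/(e j) e0 mul0r => /eqP.
  by rewrite eq_sym oner_eq0.
by rewrite subr_eq0 => /eqP.
Qed.

Lemma mode_boundary_solvable theta rho sig Phi : \det (1%:M - reflection theta rho sig) != 0 ->
  exists z, mode_boundary theta rho sig Phi z.
Proof.
move=> dn; have un : 1%:M - reflection theta rho sig \in unitmx by rewrite unitmxE unitfE.
pose v := invmx (1%:M - reflection theta rho sig) *m rhs theta sig Phi.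
(* The last p components solve the system; the first m are then dictated by the conditions at 0. *)
pose z (j : 'I_(m + p)) := match fintype.split j with
  | inl l => \sum_(k < p) (rho l k)%:C * v k 0 | inr k => v k 0 end.
have zr k : z (rshift m k) = v k 0 by rewrite /z (unsplitK (inr k)).
have zl j : z (lshift p j) = \sum_(k < p) (rho j k)%:C * z (rshift m k).
  by rewrite {1}/z (unsplitK (inl j)); apply: eq_bigr => k _; rewrite zr.
exists z; apply/(mode_boundaryE _ _ _ zl).
have -> : \col_k z (rshift m k) = v by apply/colP => k; rewrite mxE zr.
by rewrite mulmxA mulmxV// mul1mx.
Qed.

(** K precedes [theta] in the order of quantifiers and depends on its real part only through B. The
    imaginary part, which carries s, drops out of every modulus, so the bound is uniform over all
    frequencies. *)
Lemma mode_boundary_bound (B c : R) : 0 < c -> exists2 K : R, 0 <= K &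
  forall theta rho sig Phi z, (forall j, `|complex.Re (theta j)| <= B) ->
    (forall j k, `|rho j k| <= c^-1) -> (forall j k, `|sig j k| <= c^-1) ->
    c <= cmod (\det (1%:M - reflection theta rho sig)) ->
    mode_boundary theta rho sig Phi z -> forall j, cmod (z j) <= K * \sum_k cmod (Phi k).
Proof.
(* E bounds exp (theta_j - theta_l), KA the entries of I - R, and KV comes from Cramer's rule
   together with the bound (1 + E / c) on the right-hand side in terms of Phi. *)
move=> c0; pose E := expR (B + B); pose ci := c^-1.
have ci0 : 0 <= ci by rewrite invr_ge0 ltW.
have E0 : 0 <= E by exact: expR_ge0.
pose KA := 1 + m%:R * (E * ci * ci).
have KA0 : 0 <= KA by rewrite addr_ge0 ?mulr_ge0.
pose KV := ci * (p.-1`!%:R * KA ^+ p.-1) * (p%:R * (1 + E * ci)).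
have KV0 : 0 <= KV by rewrite !mulr_ge0 ?exprn_ge0 ?addr_ge0 ?mulr_ge0.
exists (KV + ci * p%:R * KV); first by rewrite addr_ge0// mulr_ge0// mulr_ge0.
move=> theta rho sig Phi z tB r0c r1c dc zb; set S := \sum_k cmod (Phi k).
have S0 : 0 <= S by apply: sumr_ge0 => k _; exact: cmod_ge0.
have PS k : cmod (Phi k) <= S.
  by rewrite /S (bigD1 k)//= lerDl sumr_ge0// => i _; exact: cmod_ge0.
have ec (j k : 'I_(m + p)) : cmod (cexp (theta j - theta k)) <= E.
  rewrite cmod_cexp ler_expR; have := tB j; have := tB k; rewrite !ler_norml.
  by case: (theta j) => a ?; case: (theta k) => b ? /= /andP[? ?] /andP[? ?]; lra.
have zl := zb.1; have /(mode_boundaryE _ _ _ zl) eqz := zb.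
have AK i j : cmod ((1%:M - reflection theta rho sig) i j) <= KA.
  rewrite !mxE (le_trans (cmodD _ _))// cmodN lerD//.
    by case: (i == j); rewrite ?cmod0 ?cmod1.
  rewrite (le_trans (cmod_sum _ _ _))// mulr_natl -[X in _ *+ X](card_ord m) -sumr_const.
  apply: ler_sum => l _; rewrite !cmodM !cmod_real.
  by rewrite ler_pM ?mulr_ge0 ?cmod_ge0// ler_pM ?cmod_ge0.
have gS j : cmod (rhs theta sig Phi j 0) <= (1 + E * ci) * S.
  rewrite mxE (le_trans (cmodD _ _))// cmodN mulrDl mul1r lerD//.
  rewrite (le_trans (cmod_sum _ _ _))// mulr_sumr big_split_ord/=.
  rewrite (@le_trans _ _ (\sum_(l < m) E * ci * cmod (Phi (lshift p l))))//; last first.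
    by rewrite lerDl sumr_ge0// => k _; rewrite !mulr_ge0 ?cmod_ge0.
  apply: ler_sum => l _; rewrite !cmodM cmod_real.
  by rewrite ler_wpM2r ?cmod_ge0// ler_pM ?cmod_ge0.
have vb k : cmod (z (rshift m k)) <= KV * S.
  have := linear_system_bound KA0 c0 AK dc eqz k; rewrite mxE => /le_trans; apply.
  rewrite /KV -/ci -!mulrA; do 3 (rewrite ler_wpM2l ?exprn_ge0//).
  rewrite mulr_natl -[X in _ *+ X](card_ord p) -sumr_const.
  by apply: ler_sum => j _; exact: gS.
have KVS : 0 <= KV * S by rewrite mulr_ge0.
move=> j; rewrite mulrDl; case: (split_ordP j) => k ->; last first.
  by apply: (le_trans (vb k)); rewrite lerDl mulr_ge0// mulr_ge0// mulr_ge0.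
rewrite zl (le_trans (cmod_sum _ _ _))//.
apply: (@le_trans _ _ (\sum_(k < p) ci * (KV * S))).
  by apply: ler_sum => i _; rewrite cmodM cmod_real ler_pM ?cmod_ge0.
by rewrite sumr_const card_ord -[_ *+ p]mulr_natl !mulrA [p%:R * ci]mulrC lerDr.
Qed.

End boundary.

(** * The differential equation of one mode *)

Section mode_equation.
Context (R : realType).
Notation leb := (@lebesgue_measure R).
Notation mR := (measurableTypeR R).
Implicit Types (A B F f g : R -> R).

Lemma is_prim_eq F f g : is_prim F f -> f =1 g -> is_prim F g.
Proof. by move=> pF /funext <-. Qed.

Lemma is_prim_ae F f g : is_prim F f -> leb.-integrable `]0, 1[ (EFin \o g) ->
  {ae leb, forall x, 0 < x < 1 -> f x = g x} -> is_prim F g.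
Proof.
move=> [fi FE] gi fg; have [gi' _] := Rintegral_itv_oo gi; split=> // x /andP[x0 x1].
have m0x : measurable (`]0, x[ : set mR) by exact: measurable_itv.
have fx : leb.-integrable `]0, x[ (EFin \o f).
  by apply: integrable_cc_oo; exact: integrable_subitv fi _ _.
have gx : leb.-integrable `]0, x[ (EFin \o g).
  by apply: integrable_cc_oo; exact: integrable_subitv gi' _ _.
rewrite FE ?x0// /prim (Rintegral_itv_oo fx).2 (Rintegral_itv_oo gx).2; congr (_ + _).
apply: ae_eq_Rintegral => //; first exact: integrable_measurable gx.
apply: ae_imp fg => y fgy; rewrite /= in_itv/= => /andP[y0 yx].
by apply: fgy; rewrite y0 (lt_le_trans yx).
Qed.

Lemma prim_norm_le_oo f (x : R) : leb.-integrable `]0, 1[ (EFin \o f) -> 0 <= x <= 1 ->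
  `|prim f x| <= \int[leb]_(y in `]0, 1[) `|f y|.
Proof.
move=> fi /andP[x0 x1]; have [fi' _] := Rintegral_itv_oo fi.
have ni := integrable_norm fi; have [ni' <-] := Rintegral_itv_oo ni.
have := prim_norm_le fi' (lexx 0) x0 x1; rewrite !prim0 !subr0 => /le_trans; apply.
rewrite [leRHS](Rintegral_itv_split x0 x1)// /prim lerDl.
by apply: Rintegral_ge0 => y _; exact: normr_ge0.
Qed.

Section oscillation.
Variables (al ia be ib : R -> R) (K : R).
Hypothesis alP : is_prim al ia.
Hypothesis beP : is_prim be ib.
Hypothesis iaK : forall x, 0 <= x <= 1 -> `|ia x| <= K.
Hypothesis ibK : forall x, 0 <= x <= 1 -> `|ib x| <= K.
Variables s : R.

(** Real and imaginary parts of the integrating factor exp (be + i s al). Their densities are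
    bounded, as the product rule asks of its second factor; L depends on s but serves that purpose
    alone and does not enter the final estimate. *)
Lemma oscillation_prim : exists L : R,
  [/\ is_prim (fun x => expR (be x) * cos (s * al x))
        (fun x => expR (be x) * (ib x * cos (s * al x) - s * ia x * sin (s * al x))),
      is_prim (fun x => expR (be x) * sin (s * al x))
        (fun x => expR (be x) * (ib x * sin (s * al x) + s * ia x * cos (s * al x))),
      forall x, 0 <= x <= 1 ->
        `|expR (be x) * (ib x * cos (s * al x) - s * ia x * sin (s * al x))| <= L &
      forall x, 0 <= x <= 1 ->
        `|expR (be x) * (ib x * sin (s * al x) + s * ia x * cos (s * al x))| <= L].
Proof.
have [b bP] := is_prim_bounded beP.
have sal := is_primZ s alP; have [a aP] := is_prim_bounded sal.
have b0 : 0 <= b by apply: le_trans (normr_ge0 _) (bP 0 _); rewrite lexx ler01.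
have sK x : 0 <= x <= 1 -> `|s * ia x| <= `|s| * K.
  by move=> x01; rewrite normrM ler_wpM2l// iaK.
have cb (y : R) : `|cos y| <= 1 by rewrite ler_norml cos_geN1 cos_le1.
have sb (y : R) : `|sin y| <= 1 by rewrite ler_norml sin_geN1 sin_le1.
have pe : is_prim (fun x => expR (be x)) (fun x => expR (be x) * ib x).
  apply: (is_prim_comp (ddphi := expR) (L := expR b) beP ibK bP) => // x xb.
  by rewrite ger0_norm ?expR_ge0// ler_expR (le_trans (ler_norm _)).
have pc : is_prim (fun x => cos (s * al x)) (fun x => - sin (s * al x) * (s * ia x)).
  apply: (is_prim_comp (phi := cos) (dphi := fun x => - sin x) (ddphi := fun x => - cos x)
    (L := 1) sal sK aP) => // x xb; last by rewrite normrN.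
have ps : is_prim (fun x => sin (s * al x)) (fun x => cos (s * al x) * (s * ia x)).
  by apply: (is_prim_comp (phi := sin) (dphi := cos) (ddphi := fun x => - sin x)
    (L := 1) sal sK aP) => // x xb; rewrite normrN.
have mc := is_prim_mul pe pc (K := `|s| * K); have ms := is_prim_mul pe ps (K := `|s| * K).
exists (expR b * (K + `|s| * K)); split.
- have -> : (fun x => expR (be x) * (ib x * cos (s * al x) - s * ia x * sin (s * al x))) =
    (fun x => expR (be x) * ib x * cos (s * al x) + expR (be x) * (- sin (s * al x) * (s * ia x))).
    by apply/funext => x; ring.
  apply: mc => x x01; rewrite normrM normrN -[leRHS]mul1r ler_pM//; exact: sK.
- have -> : (fun x => expR (be x) * (ib x * sin (s * al x) + s * ia x * cos (s * al x))) =
    (fun x => expR (be x) * ib x * sin (s * al x) + expR (be x) * (cos (s * al x) * (s * ia x))).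
    by apply/funext => x; ring.
  apply: ms => x x01; rewrite normrM -[leRHS]mul1r ler_pM//; exact: sK.
- move=> x x01; rewrite normrM ger0_norm ?expR_ge0// ler_pM ?expR_ge0//.
    by rewrite ler_expR (le_trans (ler_norm _))// bP.
  rewrite (le_trans (ler_normB _ _))// lerD//.
    by rewrite normrM -[leRHS]mulr1 ler_pM// ibK.
  by rewrite normrM -[leRHS]mulr1 ler_pM// sK.
- move=> x x01; rewrite normrM ger0_norm ?expR_ge0// ler_pM ?expR_ge0//.
    by rewrite ler_expR (le_trans (ler_norm _))// bP.
  rewrite (le_trans (ler_normD _ _))// lerD//.
    by rewrite normrM -[leRHS]mulr1 ler_pM// ibK.
  by rewrite normrM -[leRHS]mulr1 ler_pM// sK.
Qed.

End oscillation.

(* The real and imaginary parts of the ODE [i s z + a z' + b z = f^] for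
   [z = A - i B] and [f^ = FA - i FB], with [ia = 1 / a] and [ib = b / a]. *)
Definition is_mode (ia ib : R -> R) (s : R) FA FB A B :=
  is_prim A (fun x => ia x * FA x - ib x * A x - s * ia x * B x) /\
  is_prim B (fun x => ia x * FB x - ib x * B x + s * ia x * A x).

Section mode.
Variables (al ia be ib : R -> R) (K Kb : R).
Hypothesis alP : is_prim al ia.
Hypothesis beP : is_prim be ib.
Hypothesis iaK : forall x, 0 <= x <= 1 -> `|ia x| <= K.
Hypothesis ibK : forall x, 0 <= x <= 1 -> `|ib x| <= K.
Hypothesis beK : forall x, 0 <= x <= 1 -> `|be x| <= Kb.
Variables (s : R) (FA FB : R -> R).
Hypothesis FAi : leb.-integrable `]0, 1[ (EFin \o FA).
Hypothesis FBi : leb.-integrable `]0, 1[ (EFin \o FB).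

(** The integrand of variation of constants: [dPhiA] - i [dPhiB] is (1 / a) exp (be + i s al) (FA -
    i FB). *)
Definition dPhiA (x : R) : R :=
  ia x * (expR (be x) * cos (s * al x) * FA x + expR (be x) * sin (s * al x) * FB x).
Definition dPhiB (x : R) : R :=
  ia x * (expR (be x) * cos (s * al x) * FB x - expR (be x) * sin (s * al x) * FA x).

Let mI : measurable (`]0, 1[ : set mR). Proof. exact: measurable_itv. Qed.

Let meas01 (F f : R -> R) : is_prim F f -> measurable_fun (`]0, 1[ : set mR) F.
Proof.
move=> FP; apply: measurable_funS (is_prim_measurable FP); first exact: measurable_itv.
exact: subset_itv_oo_cc.
Qed.

Let mia : measurable_fun (`]0, 1[ : set mR) ia.
Proof. exact: integrable_measurable (integrable_cc_oo alP.1). Qed.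

Let in01 (x : R) : `]0, 1[%classic x -> 0 <= x <= 1.
Proof. by rewrite /= in_itv/= => /andP[x0 x1]; rewrite !ltW. Qed.

(** The trigonometric factors are at most 1 in modulus, so the bounds K exp (Kb) contain no power of
    s. *)
Lemma dPhi_integrable :
  [/\ leb.-integrable `]0, 1[ (EFin \o dPhiA), leb.-integrable `]0, 1[ (EFin \o dPhiB),
      \int[leb]_(x in `]0, 1[) `|dPhiA x| <=
        K * expR Kb * \int[leb]_(x in `]0, 1[) (`|FA x| + `|FB x|) &
      \int[leb]_(x in `]0, 1[) `|dPhiB x| <=
        K * expR Kb * \int[leb]_(x in `]0, 1[) (`|FA x| + `|FB x|)].
Proof.
have [L [pc ps _ _]] := oscillation_prim alP beP iaK ibK s.
have mc := meas01 pc; have ms := meas01 ps.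
have Si : leb.-integrable `]0, 1[ (EFin \o (fun x => K * expR Kb * (`|FA x| + `|FB x|))).
  by apply: integrable_scale => //; apply: integrable_add => //; exact: integrable_norm.
have mFA := integrable_measurable FAi; have mFB := integrable_measurable FBi.
have cb (y : R) : `|cos y| <= 1 by rewrite ler_norml cos_geN1 cos_le1.
have sb (y : R) : `|sin y| <= 1 by rewrite ler_norml sin_geN1 sin_le1.
have K0 : 0 <= K by apply: le_trans (normr_ge0 _) (iaK (x := 0) _); rewrite lexx ler01.
have eb x : 0 <= x <= 1 -> `|expR (be x)| <= expR Kb.
  by move=> x01; rewrite ger0_norm ?expR_ge0// ler_expR (le_trans (ler_norm _))// beK.
have bA x : `]0, 1[%classic x -> `|dPhiA x| <= K * expR Kb * (`|FA x| + `|FB x|).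
  move=> /in01 x01; rewrite /dPhiA normrM -(mulrA K).
  apply: ler_pM; [exact: normr_ge0|exact: normr_ge0|exact: iaK|]; rewrite mulrDr.
  rewrite (le_trans (ler_normD _ _))// !normrM lerD// -mulrA ler_pM ?eb//.
    by rewrite -[leRHS]mul1r ler_pM.
  by rewrite -[leRHS]mul1r ler_pM.
have bB x : `]0, 1[%classic x -> `|dPhiB x| <= K * expR Kb * (`|FA x| + `|FB x|).
  move=> /in01 x01; rewrite /dPhiB normrM -(mulrA K).
  apply: ler_pM; [exact: normr_ge0|exact: normr_ge0|exact: iaK|]; rewrite mulrDr addrC.
  rewrite (le_trans (ler_normD _ _))// normrN !normrM lerD// -mulrA ler_pM ?eb//.
    by rewrite -[leRHS]mul1r ler_pM.
  by rewrite -[leRHS]mul1r ler_pM.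
have Ai : leb.-integrable `]0, 1[ (EFin \o dPhiA).
  apply: (integrable_dominated mI _ Si bA); apply: measurable_funM => //.
  by apply: measurable_funD; apply: measurable_funM.
have Bi : leb.-integrable `]0, 1[ (EFin \o dPhiB).
  apply: (integrable_dominated mI _ Si bB); apply: measurable_funM => //.
  by apply: measurable_funB; apply: measurable_funM.
have SE : \int[leb]_(x in `]0, 1[) (K * expR Kb * (`|FA x| + `|FB x|)) =
    K * expR Kb * \int[leb]_(x in `]0, 1[) (`|FA x| + `|FB x|).
  by rewrite RintegralZl//; apply: integrable_add => //; exact: integrable_norm.
split=> //; rewrite -SE; apply: le_Rintegral => //; exact: integrable_norm.
Qed.

Let dA := let: And4 h _ _ _ := dPhi_integrable in h.
Let dB := let: And4 _ h _ _ := dPhi_integrable in h.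

(** The integrating factor times A - i B has density [dPhiA] - i [dPhiB]: by the product rule the
    terms with b / a and s / a cancel. *)
Lemma is_mode_integrated A B : is_mode ia ib s FA FB A B -> forall x, 0 <= x <= 1 ->
  expR (be x) * (cos (s * al x) * A x + sin (s * al x) * B x) =
    expR (be 0) * (cos (s * al 0) * A 0 + sin (s * al 0) * B 0) + prim dPhiA x /\
  expR (be x) * (cos (s * al x) * B x - sin (s * al x) * A x) =
    expR (be 0) * (cos (s * al 0) * B 0 - sin (s * al 0) * A 0) + prim dPhiB x.
Proof.
move=> [pA pB] x x01.
have [L [pc ps bc bs]] := oscillation_prim alP beP iaK ibK s.
have h1 := is_primD (is_prim_mul pA pc bc) (is_prim_mul pB ps bs).
have h2 := is_primB (is_prim_mul pB pc bc) (is_prim_mul pA ps bs).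
have h1' := is_prim_ae h1 dA (@aeW _ _ _ leb _ _).
have h2' := is_prim_ae h2 dB (@aeW _ _ _ leb _ _).
have [|_ /(_ x x01) E1] := h1' _.
  by move=> y _; rewrite /dPhiA; ring.
have [|_ /(_ x x01) E2] := h2' _.
  by move=> y _; rewrite /dPhiB; ring.
split.
  transitivity (A x * (expR (be x) * cos (s * al x)) + B x * (expR (be x) * sin (s * al x))).
    by ring.
  by rewrite E1; ring.
transitivity (B x * (expR (be x) * cos (s * al x)) - A x * (expR (be x) * sin (s * al x))).
  by ring.
by rewrite E2; ring.
Qed.

(** The solution is exp (- be - i s al) applied to the initial value plus the integral of [dPhiA] -
    i [dPhiB]; the products of the two exponentials and of the two rotations reduce to 1 in the
    density. *)
Lemma is_mode_exists (A0 B0 : R) : al 0 = 0 -> be 0 = 0 ->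
  exists A B, [/\ is_mode ia ib s FA FB A B, A 0 = A0 & B 0 = B0].
Proof.
move=> al0 be0; have beN : is_prim (fun x => - be x) (fun x => - ib x).
  have := is_primZ (-1) beP.
  by under eq_fun do rewrite mulN1r; under [X in is_prim _ X]eq_fun do rewrite mulN1r.
have ibN x : 0 <= x <= 1 -> `|- ib x| <= K by move=> x01; rewrite normrN ibK.
have [L [pc ps bc bs]] := oscillation_prim alP beN iaK ibN s.
have [dA' _] := Rintegral_itv_oo dA; have [dB' _] := Rintegral_itv_oo dB.
have pP := is_prim_prim A0 dA'; have pQ := is_prim_prim B0 dB'.
have h1 := is_primB (is_prim_mul pP pc bc) (is_prim_mul pQ ps bs).
have h2 := is_primD (is_prim_mul pQ pc bc) (is_prim_mul pP ps bs).
have eN x : expR (- be x) * expR (be x) = 1 by rewrite -expRD addNr expR0.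
exists (fun x => (A0 + prim dPhiA x) * (expR (- be x) * cos (s * al x)) -
  (B0 + prim dPhiB x) * (expR (- be x) * sin (s * al x))).
exists (fun x => (B0 + prim dPhiB x) * (expR (- be x) * cos (s * al x)) +
  (A0 + prim dPhiA x) * (expR (- be x) * sin (s * al x))).
split.
- split.
  + apply: is_prim_eq h1 _ => x; have E := eN x; have C := cos2Dsin2 (s * al x).
    have <- : dPhiA x * (expR (- be x) * cos (s * al x)) - dPhiB x * (expR (- be x) * sin (s * al x))
      = ia x * FA x.
      transitivity ((expR (- be x) * expR (be x)) *
        (cos (s * al x) ^+ 2 + sin (s * al x) ^+ 2) * (ia x * FA x)).
        by rewrite /dPhiA /dPhiB; ring.
      by rewrite E C !mul1r.
    by ring.
  + apply: is_prim_eq h2 _ => x; have E := eN x; have C := cos2Dsin2 (s * al x).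
    have <- : dPhiB x * (expR (- be x) * cos (s * al x)) + dPhiA x * (expR (- be x) * sin (s * al x))
      = ia x * FB x.
      transitivity ((expR (- be x) * expR (be x)) *
        (cos (s * al x) ^+ 2 + sin (s * al x) ^+ 2) * (ia x * FB x)).
        by rewrite /dPhiA /dPhiB; ring.
      by rewrite E C !mul1r.
    by ring.
- by rewrite !prim0 al0 be0 mulr0 oppr0 expR0 cos0 sin0; ring.
- by rewrite !prim0 al0 be0 mulr0 oppr0 expR0 cos0 sin0; ring.
Qed.

End mode.
End mode_equation.

(** * The boundary value problem of one frequency *)

Section mode_system.
Context (R : realType) (m p : nat).
Notation leb := (@lebesgue_measure R).
Notation mR := (measurableTypeR R).
Local Open Scope complex_scope.
Implicit Types (FA FB A B : 'I_(m + p) -> R -> R).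

Lemma sum_real_complex (I : finType) (r a b : I -> R) :
  \sum_i (r i)%:C * (a i +i* b i) = (\sum_i r i * a i) +i* (\sum_i r i * b i).
Proof.
elim/big_ind3: _ => [//|x1 x2 x3 y1 y2 y3 -> ->|i _]; first by apply/eqP; rewrite eq_complex/= !eqxx.
by apply/eqP; rewrite eq_complex/= !mul0r subr0 addr0 !eqxx.
Qed.

Definition is_mode_system (ia ib : 'I_(m + p) -> R -> R) (r0 : 'M[R]_(m, p)) (r1 : 'M[R]_(p, m))
    (s : R) FA FB A B :=
  [/\ forall j, is_mode (ia j) (ib j) s (FA j) (FB j) (A j) (B j),
      forall j : 'I_m, A (lshift p j) 0 = \sum_(k < p) r0 j k * A (rshift m k) 0 /\
        B (lshift p j) 0 = \sum_(k < p) r0 j k * B (rshift m k) 0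
    & forall j : 'I_p, A (rshift m j) 1 = \sum_(k < m) r1 j k * A (lshift p k) 1 /\
        B (rshift m j) 1 = \sum_(k < m) r1 j k * B (lshift p k) 1].

Section fixed_coefficients.
Variables (ia ib : 'I_(m + p) -> R -> R) (K : R).
Hypothesis iai : forall j, leb.-integrable `[0, 1] (EFin \o ia j).
Hypothesis ibi : forall j, leb.-integrable `[0, 1] (EFin \o ib j).
Hypothesis iaK : forall j x, 0 <= x <= 1 -> `|ia j x| <= K.
Hypothesis ibK : forall j x, 0 <= x <= 1 -> `|ib j x| <= K.
Let al j := prim (ia j).
Let be j := prim (ib j).

Let alP j : is_prim (al j) (ia j).
Proof. by have := is_prim_prim 0 (iai j); under eq_fun do rewrite add0r. Qed.

Let beP j : is_prim (be j) (ib j).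
Proof. by have := is_prim_prim 0 (ibi j); under eq_fun do rewrite add0r. Qed.

Let K0 (j : 'I_(m + p)) : 0 <= K.
Proof. by apply: le_trans (normr_ge0 _) (iaK j (x := 0) _); rewrite lexx ler01. Qed.

Let beK j x : 0 <= x <= 1 -> `|be j x| <= K.
Proof.
move=> /andP[x0 x1]; have := prim_Lipschitz (ibi j) (ibK j) (lexx 0) x0 x1.
by rewrite prim0 !subr0 => /le_trans; apply; rewrite ler_piMr// K0.
Qed.

Definition phase (s : R) (j : 'I_(m + p)) : R[i] := (prim (ib j) 1) +i* (s * prim (ia j) 1).

Definition forcing (s : R) FA FB (j : 'I_(m + p)) : R[i] :=
  (prim (dPhiA (al j) (ia j) (be j) s (FA j) (FB j)) 1) +i*
  (- prim (dPhiB (al j) (ia j) (be j) s (FA j) (FB j)) 1).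

Section fixed_forcing.
Variables (s : R) (FA FB : 'I_(m + p) -> R -> R).
Hypothesis FAi : forall j, leb.-integrable `]0, 1[ (EFin \o FA j).
Hypothesis FBi : forall j, leb.-integrable `]0, 1[ (EFin \o FB j).

Let I j : R := \int[leb]_(x in `]0, 1[) (`|FA j x| + `|FB j x|).

Let I0 j : 0 <= I j.
Proof. by apply: Rintegral_ge0 => x _; rewrite addr_ge0. Qed.

Lemma forcing_bound j (x : R) : 0 <= x <= 1 ->
  `|prim (dPhiA (al j) (ia j) (be j) s (FA j) (FB j)) x| <= K * expR K * I j /\
  `|prim (dPhiB (al j) (ia j) (be j) s (FA j) (FB j)) x| <= K * expR K * I j.
Proof.
move=> x01; have [iA iB hA hB] :=
  dPhi_integrable (alP j) (beP j) (iaK j) (ibK j) (beK j) s (FAi j) (FBi j).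
by split; [apply: le_trans hA|apply: le_trans hB]; exact: prim_norm_le_oo.
Qed.

(** The integrated identities in complex form, inverted by the rotation identity; at x = 1 this is
    the shape expected by [mode_boundary]. *)
Lemma is_mode_formula j (A B : R -> R) (x : R) : is_mode (ia j) (ib j) s (FA j) (FB j) A B ->
  0 <= x <= 1 ->
  A x +i* (- B x) = cexp (- (be j x +i* (s * al j x))) *
    ((A 0 + prim (dPhiA (al j) (ia j) (be j) s (FA j) (FB j)) x) +i*
     (- (B 0 + prim (dPhiB (al j) (ia j) (be j) s (FA j) (FB j)) x))).
Proof.
move=> AB x01; have [] := is_mode_integrated (alP j) (beP j) (iaK j) (ibK j) (beK j) (FAi j) (FBi j) AB x01.
rewrite /al /be !prim0 mulr0 expR0 cos0 sin0 !mul1r !mul0r addr0 subr0 -/(al j) -/(be j) => <- <-.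
have E : expR (- be j x) * expR (be j x) = 1 by rewrite -expRD addNr expR0.
have C := cos2Dsin2 (s * al j x); move: E C.
rewrite /cexp/= cosN sinN; set e' := expR (- _); set e := expR _; set co := cos _; set si := sin _.
move=> E C; apply/eqP; rewrite eq_complex/=; apply/andP; split; apply/eqP.
- transitivity ((e' * e) * (co ^+ 2 + si ^+ 2) * A x); last by ring.
  by rewrite E C !mul1r.
- transitivity (- ((e' * e) * (co ^+ 2 + si ^+ 2) * B x)); last by ring.
  by rewrite E C !mul1r.
Qed.

Lemma mode_boundary_system r0 r1 A B :
  (forall j, is_mode (ia j) (ib j) s (FA j) (FB j) (A j) (B j)) ->
  is_mode_system ia ib r0 r1 s FA FB A B <->
  mode_boundary (phase s) r0 r1 (forcing s FA FB) (fun j => A j 0 +i* (- B j 0)).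
Proof.
move=> AB; have h01 : 0 <= (1 : R) <= 1 by rewrite ler01/=.
have E j : cexp (- phase s j) * ((A j 0 +i* (- B j 0)) + forcing s FA FB j) = A j 1 +i* (- B j 1).
  rewrite (is_mode_formula (AB j) h01); congr (_ * _).
  by apply/eqP; rewrite eq_complex/= opprD !eqxx.
have sN (J : finType) (r a : J -> R) : \sum_i r i * - a i = - \sum_i r i * a i.
  by under eq_bigr do rewrite mulrN; rewrite sumrN.
split=> [[_ bc0 bc1]|[h0 h1]].
  split=> j.
    by rewrite sum_real_complex sN -(bc0 j).1 -(bc0 j).2.
  rewrite E; under eq_bigr do rewrite E.
  by rewrite sum_real_complex sN -(bc1 j).1 -(bc1 j).2.
split=> // j.
  by have /eqP := h0 j; rewrite sum_real_complex sN eq_complex/= eqr_opp => /andP[/eqP -> /eqP ->].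
have := h1 j; rewrite E; under eq_bigr do rewrite E.
by move=> /eqP; rewrite sum_real_complex sN eq_complex/= eqr_opp => /andP[/eqP -> /eqP ->].
Qed.

Lemma mode_system_exists r0 r1 : \det (1%:M - reflection (phase s) r0 r1) != 0 ->
  exists A B, is_mode_system ia ib r0 r1 s FA FB A B.
Proof.
move=> dn; have [z hz] := mode_boundary_solvable (forcing s FA FB) dn.
have /choice [A /choice [B AB]] : forall j, exists A1 B1 : R -> R,
    [/\ is_mode (ia j) (ib j) s (FA j) (FB j) A1 B1, A1 0 = complex.Re (z j) & B1 0 = - complex.Im (z j)].
  by move=> j; apply: (is_mode_exists (alP j) (beP j) (iaK j) (ibK j) (beK j)) => //; rewrite /al /be prim0.
exists A, B; apply/mode_boundary_system; first by move=> j; have [] := AB j.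
have -> : (fun j => A j 0 +i* (- B j 0)) = z.
  apply/funext => j; have [_ -> ->] := AB j; rewrite opprK; by case: (z j).
exact: hz.
Qed.

(** exp K bounds exp (- theta) on [0, 1]. Inside the bracket, the initial value contributes 2 k and
    the integral up to x contributes 2, both in units of K exp K times the L^1 norm of the data;
    each 2 adds real and imaginary part. *)
Lemma mode_system_bound_of r0 r1 A B (k : R) : 0 <= k ->
  is_mode_system ia ib r0 r1 s FA FB A B ->
  (forall j, cmod (A j 0 +i* (- B j 0)) <= k * \sum_i cmod (forcing s FA FB i)) ->
  forall j x, 0 <= x <= 1 ->
    `|A j x| <= expR K * (k * 2 + 2) * (K * expR K) * \sum_i I i /\
    `|B j x| <= expR K * (k * 2 + 2) * (K * expR K) * \sum_i I i.
Proof.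
move=> k0 [AB _ _] zb j x x01; have Kj := K0 j.
have KE : 0 <= K * expR K by rewrite mulr_ge0// expR_ge0.
set S := \sum_i I i.
have IS i : I i <= S by rewrite /S (bigD1 i)//= lerDl sumr_ge0.
have S0 : 0 <= S by exact: sumr_ge0.
have h01 : 0 <= (1 : R) <= 1 by rewrite ler01/=.
have FS : \sum_i cmod (forcing s FA FB i) <= 2 * (K * expR K) * S.
  rewrite /S mulr_sumr; apply: ler_sum => i _; rewrite (le_trans (cmod_le_abs _ _))// normrN.
  by have [h1 h2] := forcing_bound i h01; rewrite -mulrA mulr_natl mulr2n lerD.
have zj : cmod (A j 0 +i* (- B j 0)) <= k * (2 * (K * expR K) * S).
  by apply: le_trans (zb j) _; rewrite ler_wpM2l.
have F := is_mode_formula (AB j) x01.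
have W : cmod (A j x +i* (- B j x)) <= expR K * (k * 2 + 2) * (K * expR K) * S.
  rewrite F cmodM cmod_cexp -!mulrA; apply: ler_pM; [exact: expR_ge0|exact: cmod_ge0| |].
    by rewrite /= ler_expR (le_trans (ler_norm _))// normrN beK.
  have [hA hB] := forcing_bound j x01.
  pose PA := prim (dPhiA (al j) (ia j) (be j) s (FA j) (FB j)) x.
  pose PB := prim (dPhiB (al j) (ia j) (be j) s (FA j) (FB j)) x; rewrite -/PA -/PB.
  have -> : (A j 0 + PA) +i* (- (B j 0 + PB)) = (A j 0 +i* (- B j 0)) + (PA +i* (- PB)).
    by apply/eqP; rewrite eq_complex/= opprD !eqxx.
  rewrite (le_trans (cmodD _ _))// mulrDl lerD//.
    by apply: le_trans zj _; rewrite !mulrA.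
  rewrite (le_trans (cmod_le_abs _ _))// normrN mulr_natl mulr2n.
  by rewrite lerD//; [apply: le_trans hA _|apply: le_trans hB _]; rewrite -mulrA ler_wpM2l// ler_wpM2l ?expR_ge0.
have re_le (u v : R) : `|u| <= cmod (u +i* v) /\ `|v| <= cmod (u +i* v).
  by rewrite cmodE -!sqrtr_sqr !ler_sqrt ?lerDl ?lerDr ?sqr_ge0// addr_ge0 ?sqr_ge0.
have [h1 h2] := re_le (A j x) (- B j x); rewrite normrN in h2.
by split; [apply: le_trans h1 W|apply: le_trans h2 W].
Qed.

End fixed_forcing.
End fixed_coefficients.

(** The bound K on b / a also bounds the real part of theta, because the interval has length 1; so k
    is fixed before the coefficients and the frequency. *)
Lemma mode_system_bound (c K : R) : 0 < c -> 0 <= K -> exists2 k : R, 0 <= k &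
  forall (ia ib : 'I_(m + p) -> R -> R) (r0 : 'M[R]_(m, p)) (r1 : 'M[R]_(p, m)) (s : R) FA FB A B,
    (forall j, leb.-integrable `[0, 1] (EFin \o ia j)) ->
    (forall j, leb.-integrable `[0, 1] (EFin \o ib j)) ->
    (forall j x, 0 <= x <= 1 -> `|ia j x| <= K) ->
    (forall j x, 0 <= x <= 1 -> `|ib j x| <= K) ->
    (forall j k, `|r0 j k| <= c^-1) -> (forall j k, `|r1 j k| <= c^-1) ->
    c <= cmod (\det (1%:M - reflection (phase ia ib s) r0 r1)) ->
    (forall j, leb.-integrable `]0, 1[ (EFin \o FA j)) ->
    (forall j, leb.-integrable `]0, 1[ (EFin \o FB j)) ->
    is_mode_system ia ib r0 r1 s FA FB A B ->
    forall j x, 0 <= x <= 1 ->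
      `|A j x| <= k * \sum_i \int[leb]_(x in `]0, 1[) (`|FA i x| + `|FB i x|) /\
      `|B j x| <= k * \sum_i \int[leb]_(x in `]0, 1[) (`|FA i x| + `|FB i x|).
Proof.
move=> c0 K0; have [k k0 bnd] := mode_boundary_bound m p K c0.
exists (expR K * (k * 2 + 2) * (K * expR K)); first by rewrite !mulr_ge0 ?expR_ge0 ?addr_ge0 ?mulr_ge0.
move=> ia ib r0 r1 s FA FB A B iai ibi iaK ibK r0c r1c dc FAi FBi AB.
apply: (mode_system_bound_of iai ibi iaK ibK FAi FBi k0 AB) => j.
have [ABj _ _] := AB.
apply: (bnd (phase ia ib s) r0 r1 _ (fun j => A j 0 +i* (- B j 0)) _ r0c r1c dc).
  move=> i /=; have := prim_Lipschitz (ibi i) (ibK i) (lexx 0) ler01 (lexx 1).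
  by rewrite prim0 !subr0 mulr1.
exact/(mode_boundary_system iai ibi iaK ibK FAi FBi).
Qed.

End mode_system.

(** * Energies of Fourier modes and the norms of W *)

Section energies.
Context (R : realType).
Notation leb := (@lebesgue_measure R).
Notation mR := (measurableTypeR R).

Lemma esum_scale_le (I : choiceType) (k : R) (a : I -> \bar R) : 0 <= k ->
  (forall i, (0 <= a i)%E) ->
  (\esum_(i in [set: I]) (k%:E * a i) <= k%:E * \esum_(i in [set: I]) a i)%E.
Proof.
move=> k0 a0; apply: ge_ereal_sup => _ [X fX <-].
rewrite -ge0_mule_fsumr//.
apply: lee_wpmul2l; first by rewrite lee_fin.
by apply: esum_ge; exists X.
Qed.

Lemma nneseries_le_esum_int (a : int -> \bar R) : (forall i, (0 <= a i)%E) ->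
  (\sum_(0 <= s <oo) a (Posz s) <= \esum_(i in [set: int]) a i)%E.
Proof.
move=> a0; rewrite (nneseries_esumT (a := fun s : nat => a (Posz s)))//.
rewrite -(@esum_image _ _ _ setT Posz a); last by move=> x y _ _ [].
rewrite esum_mkcond; apply: le_esum => i _; case: ifP => // _; exact: a0.
Qed.

(** Holds for every f: negation swaps the integrals of the positive and negative parts, and [fine]
    sends infinite differences to 0 on both sides. *)
Lemma RintegralN dd (T : measurableType dd) (mu : {measure set T -> \bar R}) (D : set T)
  (f : T -> R) : \int[mu]_(x in D) (- f x) = - \int[mu]_(x in D) f x.
Proof.
rewrite /Rintegral integralE [in RHS]integralE.
have -> : (\int[mu]_(x in D) ((fun x => (- f x)%:E)^\+ x) = \int[mu]_(x in D) ((fun x => (f x)%:E)^\- x))%E.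
  by apply: eq_integral => x _; rewrite -funeposN.
have -> : (\int[mu]_(x in D) ((fun x => (- f x)%:E)^\- x) = \int[mu]_(x in D) ((fun x => (f x)%:E)^\+ x))%E.
  by apply: eq_integral => x _; rewrite -funenegN.
have h1 : (0 <= \int[mu]_(x in D) ((fun x => (f x)%:E)^\+ x))%E by exact: integral_ge0.
have h2 : (0 <= \int[mu]_(x in D) ((fun x => (f x)%:E)^\- x))%E by exact: integral_ge0.
move: h1 h2; case: (integral _ _ _) => [u| |]; case: (integral _ _ _) => [v| |] //=; rewrite ?oppr0//.
by rewrite opprB.
Qed.

Section vector.
Variable n : nat.
Implicit Types f g h : 'I_n -> R * R -> R.

Definition amplitude f (s : int) (x : R) : R := \sum_(j < n) (fcos (f j) s x ^+ 2 + fsin (f j) s x ^+ 2).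

Definition energy f (s : int) : \bar R := (\int[leb]_(x in `]0%R, 1%R[) (amplitude f s x)%:E)%E.

Lemma amplitude_ge0 f s x : 0 <= amplitude f s x.
Proof. by apply: sumr_ge0 => j _; rewrite addr_ge0 ?sqr_ge0. Qed.

Lemma energy_ge0 f s : (0 <= energy f s)%E.
Proof. by apply: integral_ge0 => x _; rewrite lee_fin amplitude_ge0. Qed.

Lemma amplitudeE f s x : \sum_(j < n) cmod (fourier (f j) s x) ^+ 2 = amplitude f s x.
Proof.
apply: eq_bigr => j _; rewrite /cmod /fourier /cintegral /=.
rewrite sqr_sqrtr ?addr_ge0 ?sqr_ge0//; congr (_ ^+ 2 + _).
  by apply: eq_Rintegral => t _; rewrite expR0 mul1r cosN mul0r subr0.
rewrite -[RHS]sqrrN -RintegralN.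
by congr (_ ^+ 2); apply: eq_Rintegral => t _; rewrite expR0 mul1r sinN mul0r addr0 mulrN.
Qed.

Lemma Wnorm2E (gamma : R) f :
  Wnorm2 gamma f = (\esum_(s in [set: int]) (((1 + s%:~R ^+ 2) `^ gamma)%R%:E * energy f s))%E.
Proof.
rewrite /Wnorm2; apply: eq_esum => s _; congr (_ * _)%E.
by apply: eq_integral => x _; rewrite amplitudeE.
Qed.

Lemma Wnorm2_ge0 (gamma : R) f : (0 <= Wnorm2 gamma f)%E.
Proof.
by rewrite Wnorm2E; apply: esum_ge0 => s _; rewrite mule_ge0 ?lee_fin ?powR_ge0 ?energy_ge0.
Qed.

Lemma measurable_amplitude f s : (forall j, loc_integrable (f j)) ->
  measurable_fun (`]0, 1[ : set mR) (amplitude f s).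
Proof.
move=> fl; apply: measurable_fun_bigsum => j; have [ci si] := integrable_fcos s (fl j).
by apply: measurable_funD; apply: measurable_funX; apply: integrable_measurable; [exact: ci|exact: si].
Qed.

Lemma energy_le f g h (k l : R) (s : int) : 0 <= k -> 0 <= l ->
  (forall j, loc_integrable (f j)) -> (forall j, loc_integrable (g j)) ->
  (forall j, loc_integrable (h j)) ->
  {ae leb, forall x, 0 < x < 1 -> amplitude f s x <= k * amplitude g s x + l * amplitude h s x} ->
  (energy f s <= k%:E * energy g s + l%:E * energy h s)%E.
Proof.
move=> k0 l0 fl gl hl le.
have mI : measurable (`]0, 1[ : set mR) by exact: measurable_itv.
have mf := measurable_amplitude s fl; have mg := measurable_amplitude s gl.
have mh := measurable_amplitude s hl.
rewrite -ge0_integralZl//; [|exact/measurable_EFinP|by move=> x _; rewrite lee_fin amplitude_ge0].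
rewrite -ge0_integralZl//; [|exact/measurable_EFinP|by move=> x _; rewrite lee_fin amplitude_ge0].
rewrite -ge0_integralD//.
- apply: ae_ge0_le_integral => //.
  + by move=> x _; rewrite lee_fin amplitude_ge0.
  + exact/measurable_EFinP.
  + by move=> x _; rewrite adde_ge0// mule_ge0 ?lee_fin ?amplitude_ge0.
  + by apply/measurable_EFinP; apply: measurable_funD; apply: measurable_funM.
- by move=> x _; rewrite mule_ge0 ?lee_fin ?amplitude_ge0.
- by apply/measurable_EFinP; apply: measurable_funM.
- by move=> x _; rewrite mule_ge0 ?lee_fin ?amplitude_ge0.
- by apply/measurable_EFinP; apply: measurable_funM.
Qed.

Lemma Wnorm2_le (gamma : R) f g h (k l : R) : 0 <= k -> 0 <= l ->
  (forall s, (energy f s <= k%:E * energy g s + l%:E * energy h s)%E) ->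
  (Wnorm2 gamma f <= k%:E * Wnorm2 gamma g + l%:E * Wnorm2 gamma h)%E.
Proof.
move=> k0 l0 le; rewrite !Wnorm2E.
pose w (s : int) := ((1 + s%:~R ^+ 2) `^ gamma)%R : R.
have w0 s : 0 <= w s by exact: powR_ge0.
have e0 f' s : (0 <= (w s)%:E * energy f' s)%E by rewrite mule_ge0 ?lee_fin ?energy_ge0.
apply: (@le_trans _ _ (\esum_(s in [set: int]) (k%:E * ((w s)%:E * energy g s)) +
  \esum_(s in [set: int]) (l%:E * ((w s)%:E * energy h s)))%E); last first.
  by apply: leeD; apply: esum_scale_le.
rewrite -esumD; first last.
- by move=> s _; rewrite mule_ge0 ?lee_fin.
- by move=> s _; rewrite mule_ge0 ?lee_fin.
apply: le_esum => s _; apply: (@le_trans _ _ ((w s)%:E * (k%:E * energy g s + l%:E * energy h s))%E).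
  by apply: lee_wpmul2l; [rewrite lee_fin; exact: w0|exact: le].
by rewrite ge0_muleDr ?mule_ge0 ?lee_fin ?energy_ge0// muleCA [X in (_ + X)%E]muleCA.
Qed.

Lemma Wnorm_sqr (gamma : R) f : (Wnorm2 gamma f < +oo)%E ->
  ((Wnorm gamma f ^+ 2)%:E = Wnorm2 gamma f)%E.
Proof.
move=> fin; rewrite /Wnorm sqr_sqrtr ?fine_ge0 ?Wnorm2_ge0// fineK// ge0_fin_numE//.
exact: Wnorm2_ge0.
Qed.

Lemma Wnorm2_lty (gamma : R) f g h (k l : R) :
  (Wnorm2 gamma f <= k%:E * Wnorm2 gamma g + l%:E * Wnorm2 gamma h)%E ->
  (Wnorm2 gamma g < +oo)%E -> (Wnorm2 gamma h < +oo)%E ->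
  (Wnorm2 gamma f < +oo)%E /\
  Wnorm gamma f ^+ 2 <= k * Wnorm gamma g ^+ 2 + l * Wnorm gamma h ^+ 2.
Proof.
move=> le g1 h1; move: le; rewrite -(Wnorm_sqr g1) -(Wnorm_sqr h1) -!EFinM -EFinD => le.
have f1 := le_lt_trans le (ltry _); split=> //.
by move: le; rewrite -(Wnorm_sqr f1) lee_fin.
Qed.

Lemma W_mono (gamma delta : R) f : delta <= gamma -> W gamma f -> W delta f.
Proof.
move=> dg [fl fp fW]; split=> //; apply: le_lt_trans fW; rewrite !Wnorm2E; apply: le_esum => s _.
apply: lee_wpmul2r; first exact: energy_ge0.
by rewrite lee_fin ler_powR// lerDl sqr_ge0.
Qed.

Lemma W_energy (gamma : R) f : 0 <= gamma -> W gamma f -> forall s, (energy f s < +oo)%E.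
Proof.
move=> g0 [fl _ fW] s; apply: le_lt_trans fW; rewrite Wnorm2E.
apply: (@le_trans _ _ ((((1 + s%:~R ^+ 2) `^ gamma)%R : R)%:E * energy f s)%E).
  rewrite -[leLHS]mul1e; apply: lee_wpmul2r; first exact: energy_ge0.
  by rewrite lee_fin -[leLHS](powRr0 (1 + s%:~R ^+ 2)) ler_powR// lerDl sqr_ge0.
apply: esum_ge; exists [set s]; first by split=> //; exact: finite_set1.
by rewrite fsbig_set1.
Qed.

Lemma amplitude_integrable f s : (forall j, loc_integrable (f j)) -> (energy f s < +oo)%E ->
  leb.-integrable `]0, 1[ (EFin \o amplitude f s) /\
  energy f s = (\int[leb]_(x in `]0, 1[) amplitude f s x)%:E.
Proof.
move=> fl fin; have mI : measurable (`]0, 1[ : set mR) by exact: measurable_itv.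
have ai : leb.-integrable `]0, 1[ (EFin \o amplitude f s).
  apply/integrableP; split; first by apply/measurable_EFinP; exact: measurable_amplitude.
  under eq_integral do rewrite /= ger0_norm ?amplitude_ge0//.
  exact: fin.
split=> //; rewrite /Rintegral fineK// ge0_fin_numE//; exact: energy_ge0.
Qed.

(** The weight 1 + s^2 is available because gamma >= 1. This sum controls the sup norms of the
    solved modes and the energies of the time derivative. *)
Lemma W_summable (gamma : R) f : 1 <= gamma -> W gamma f ->
  cvgn (series (fun s : nat => (1 + s%:R ^+ 2) * \int[leb]_(x in `]0, 1[) amplitude f s x)).
Proof.
move=> g1 fW; have g0 : 0 <= gamma by exact: le_trans ler01 g1.
have := W_energy g0 fW; have [fl _ fin] := fW => eF.
have F (s : nat) := (amplitude_integrable fl (eF s)).2.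
have [_ _ fin1] := W_mono g1 fW; rewrite Wnorm2E in fin1.
pose a (s : int) : \bar R := (((1 + s%:~R ^+ 2) `^ 1)%R%:E * energy f s)%E.
have a0 s : (0 <= a s)%E by rewrite mule_ge0 ?lee_fin ?powR_ge0 ?energy_ge0.
have fin2 := le_lt_trans (nneseries_le_esum_int a0) fin1.
have t0 (s : nat) : 0 <= (1 + s%:R ^+ 2) * \int[leb]_(x in `]0, 1[) amplitude f s x.
  by rewrite mulr_ge0 ?addr_ge0 ?sqr_ge0// Rintegral_ge0// => x _; exact: amplitude_ge0.
have aE (s : nat) : a s = ((1 + s%:R ^+ 2) * \int[leb]_(x in `]0, 1[) amplitude f s x)%:E.
  by rewrite /a F powRr1 ?EFinM// addr_ge0 ?sqr_ge0.
apply: nondecreasing_is_cvgn; first exact: nondecreasing_series.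
exists (fine (\sum_(0 <= s <oo) a (Posz s))%E) => _ [N _ <-].
rewrite -lee_fin fineK; last by rewrite ge0_fin_numE//; apply: nneseries_ge0.
rewrite /series/= -sumEFin; under eq_bigr do rewrite -aE.
exact: nneseries_lim_ge.
Qed.

End vector.
End energies.

(** * Everywhere bounded representatives of the coefficients *)

Section coefficients.
Context (R : realType).
Notation leb := (@lebesgue_measure R).
Notation mR := (measurableTypeR R).
Implicit Types a b : R -> R.

Lemma ae_leb01 (P : R -> Prop) : {ae leb01 R, forall x, P x} ->
  {ae leb, forall x, 0 < x < 1 -> P x}.
Proof.
case=> N [mN N0 sub]; exists (N `&` `]0, 1[%classic); split.
- by apply: measurableI => //; exact: measurable_itv.
- exact: N0.
- move=> x /= nP; have x01 : 0 < x < 1 by apply: contrapT => nx; apply: nP => h.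
  by split; [apply: sub => h; apply: nP|rewrite /= in_itv].
Qed.

Lemma Linfty_ae a (K : R) : (Linfty_norm a <= K%:E)%E -> {ae leb, forall x, 0 < x < 1 -> `|a x| <= K}.
Proof. by move=> /ess_supP h; apply: ae_leb01; apply: ae_imp h => x; rewrite lee_fin. Qed.

Lemma Linfty_bounded a : Linfty a -> exists K : R, {ae leb, forall x, 0 < x < 1 -> `|a x| <= K}.
Proof.
case=> _ fin; exists (fine (Linfty_norm a)); case E : (Linfty_norm a) fin => [k| |]//= _.
  by apply: Linfty_ae; rewrite E.
by apply: Linfty_ae; rewrite E leNye.
Qed.

(** 1 / a is a times the power -1 of a^2, a measurable expression that also gives the value 0 at
    zeros of a. *)
Lemma measurable_fun_inv a (D : set mR) : measurable_fun D a -> measurable_fun D (fun x => (a x)^-1).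
Proof.
move=> ma; have -> : (fun x => (a x)^-1) = (fun x => a x * (a x ^+ 2) `^ (-1)).
  apply/funext => x; have [->|a0] := eqVneq (a x) 0; first by rewrite invr0 mul0r.
  by rewrite powR_inv1 ?sqr_ge0// expr2 invfM mulrA divff// mul1r.
apply: measurable_funM => //.
by apply: (measurableT_comp (measurable_powR (-1))); exact: measurable_funX.
Qed.

(* Everywhere bounded representatives [ia] and [ib] of [1 / a] and [b / a]. *)
Definition coef_rep a b (ia ib : R -> R) (c : R) :=
  [/\ leb.-integrable `[0, 1] (EFin \o ia) /\ leb.-integrable `[0, 1] (EFin \o ib),
      forall x, `|ia x| <= c^-1, forall x, `|ib x| <= c^-1 * c^-1,
      {ae leb, forall x, 0 < x < 1 -> [/\ a x * ia x = 1, ib x = b x * ia x & `|b x| <= c^-1]} &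
      prim ia 1 = \int[leb]_(y in `[0, 1]) (a y)^-1 /\
      prim ib 1 = \int[leb]_(y in `[0, 1]) (b y / a y)].

Lemma coef_repP a b (c : R) : 0 < c -> Linfty a -> Linfty b -> (c%:E <= ess_inf_abs a)%E ->
  (Linfty_norm b <= (c^-1)%:E)%E -> exists ia ib, coef_rep a b ia ib c.
Proof.
move=> c0 [ma _] [mb _] ca bc; have ci0 : 0 < c^-1 by rewrite invr_gt0.
have mI : measurable (`]0, 1[ : set mR) by exact: measurable_itv.
have aec : {ae leb, forall x, 0 < x < 1 -> c <= `|a x|}.
  by apply: ae_leb01; move/ess_infP : ca; apply: ae_imp => x; rewrite lee_fin.
have bec := Linfty_ae bc.
(* Clamping at 1 / c changes 1 / a and b on null sets only, by the essential bounds, and provides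
   the pointwise bounds that the product and chain rules need. *)
pose ia x := Num.max (- c^-1) (Num.min (a x)^-1 c^-1).
pose bb x := Num.max (- c^-1) (Num.min (b x) c^-1).
have clamp (y : R) : `|Num.max (- c^-1) (Num.min y c^-1)| <= c^-1.
  rewrite ler_norml le_max lexx/= ge_max ge_min lexx orbT andbT.
  by rewrite (le_trans _ (ltW ci0))// oppr_le0 ltW.
have clampE (y : R) : `|y| <= c^-1 -> Num.max (- c^-1) (Num.min y c^-1) = y.
  by rewrite ler_norml => /andP[h1 h2]; rewrite (min_idPl h2) (max_idPr h1).
have mia : measurable_fun (`]0, 1[ : set mR) ia.
  apply: measurable_maxr; first exact: measurable_cst.
  by apply: measurable_minr; [exact: measurable_fun_inv|exact: measurable_cst].
have mbb : measurable_fun (`]0, 1[ : set mR) bb.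
  apply: measurable_maxr; first exact: measurable_cst.
  by apply: measurable_minr; [exact: mb|exact: measurable_cst].
have f01 := (lebesgue_oo (@ler01 R)).1.
have iaE : {ae leb, forall x, 0 < x < 1 -> ia x = (a x)^-1 /\ a x != 0}.
  apply: ae_imp aec => x h x01; have ax := h x01; split.
    by apply: clampE; rewrite normfV lef_pV2 ?posrE// (lt_le_trans c0).
  by rewrite -normr_gt0 (lt_le_trans c0).
have bbE : {ae leb, forall x, 0 < x < 1 -> bb x = b x}.
  by apply: ae_imp bec => x h x01; apply: clampE; exact: h.
have iai : leb.-integrable `]0, 1[ (EFin \o ia).
  by apply: (integrable_bounded mI f01 mia (K := c^-1)) => x _; exact: clamp.
have ibK x : `|bb x * ia x| <= c^-1 * c^-1 by rewrite normrM ler_pM ?clamp.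
have ibi : leb.-integrable `]0, 1[ (EFin \o (fun x => bb x * ia x)).
  apply: (integrable_bounded mI f01 (measurable_funM mbb mia) (K := c^-1 * c^-1)) => x _.
  exact: ibK.
exists ia, (fun x => bb x * ia x); split=> //.
- by split; [exact: (Rintegral_itv_oo iai).1|exact: (Rintegral_itv_oo ibi).1].
- by move=> x; exact: clamp.
- apply: ae_imp3 iaE bbE bec => x h1 h2 h3 x01; have [-> a0] := h1 x01.
  by rewrite divff// h2// h3.
have mai := measurable_fun_inv ma.
have i1 : leb.-integrable `]0, 1[ (EFin \o (fun x => (a x)^-1)).
  apply: (ae_eq_integrable mI iai mai); apply: ae_imp iaE => x h.
  by rewrite /= in_itv/= => /h[].
have i2 : leb.-integrable `]0, 1[ (EFin \o (fun x => b x / a x)).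
  apply: (ae_eq_integrable mI ibi (measurable_funM mb mai)); apply: ae_imp2 iaE bbE => x h h'.
  by rewrite /= in_itv/= => x01; rewrite h'// (h x01).1.
rewrite /prim (Rintegral_itv_oo iai).2 (Rintegral_itv_oo ibi).2 (Rintegral_itv_oo i1).2 (Rintegral_itv_oo i2).2.
split; apply: ae_eq_Rintegral => //.
- by apply: ae_imp iaE => x h; rewrite /= in_itv/= => /h[].
- exact: measurable_funM.
- by apply: ae_imp2 iaE bbE => x h h'; rewrite /= in_itv/= => x01; rewrite h'// (h x01).1.
Qed.

End coefficients.

(** * Traces and boundary values of modes *)

Section traces.
Context (R : realType).
Notation leb := (@lebesgue_measure R).
Notation mR := (measurableTypeR R).
Implicit Types (g : R * R -> R) (s : int).

Lemma le_sqr_eps (y e : R) : 0 < e -> `|y| <= e + e^-1 * y ^+ 2.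
Proof.
move=> e0; rewrite -(real_normK (num_real y)); set x := `|y|.
have x0 : 0 <= x by exact: normr_ge0.
have [xe|ex] := leP x e; first by rewrite (le_trans xe)// lerDl mulr_ge0 ?invr_ge0 ?sqr_ge0 ?ltW.
have H : x <= e^-1 * x ^+ 2 by rewrite ler_pdivlMl// expr2 ler_wpM2r// ltW.
by apply: (le_trans H); rewrite lerDr ltW.
Qed.

Lemma sqr_integrable_L1 (T e : R) (f : R -> R) : 0 <= T -> 0 < e ->
  measurable_fun (`[- T, T] : set mR) f ->
  (\int[leb]_(t in `[(- T)%R, T]) (f t ^+ 2)%:E <= (e ^+ 2)%:E)%E ->
  leb.-integrable `[- T, T] (EFin \o f) /\
  \int[leb]_(t in `[- T, T]) `|f t| <= e * (2 * T + 1).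
Proof.
move=> T0 e0 mf fe; have mT : measurable (`[- T, T] : set mR) by exact: measurable_itv.
have TT : - T <= T by lra.
have [fin fE] := lebesgue_cc TT.
have f2i : leb.-integrable `[- T, T] (EFin \o (fun t => f t ^+ 2)).
  apply/integrableP; split; first by apply/measurable_EFinP; exact: measurable_funX.
  under eq_integral do rewrite /= ger0_norm ?sqr_ge0//.
  exact: le_lt_trans fe (ltry _).
have ic : leb.-integrable `[- T, T] (EFin \o cst e) by exact: finite_measure_integrable_cst_on.
have si : leb.-integrable `[- T, T] (EFin \o (fun t => e + e^-1 * f t ^+ 2)).
  by apply: integrable_add => //; exact: integrable_scale.
have fi : leb.-integrable `[- T, T] (EFin \o f).
  by apply: (integrable_dominated mT mf si) => t _; exact: le_sqr_eps.
split=> //; apply: (@le_trans _ _ (\int[leb]_(t in `[- T, T]) (e + e^-1 * f t ^+ 2))).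
  by apply: le_Rintegral => //; [exact: integrable_norm fi|move=> t _; exact: le_sqr_eps].
have -> : \int[leb]_(t in `[- T, T]) (e + e^-1 * f t ^+ 2) =
    \int[leb]_(t in `[- T, T]) cst e t + \int[leb]_(t in `[- T, T]) (e^-1 * f t ^+ 2).
  by apply: (RintegralD mT ic); exact: integrable_scale.
rewrite RintegralZl// Rintegral_cst//= fE [leRHS]mulrDr mulr1; apply: lerD.
  by rewrite (_ : T - - T = 2 * T)//; ring.
have f2e : \int[leb]_(t in `[- T, T]) (f t ^+ 2) <= e ^+ 2.
  by rewrite -lee_fin /Rintegral fineK//; exact: (integrable_fin_num mT f2i).
by rewrite ler_pdivrMl// -expr2.
Qed.

Lemma L2loc_integrable (h : R -> R) (T : R) : L2loc h -> 0 <= T -> leb.-integrable `[- T, T] (EFin \o h).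
Proof.
move=> [mh hT] T0; have mT : measurable (`[- T, T] : set mR) by exact: measurable_itv.
have mf : measurable_fun (`[- T, T] : set mR) h by exact: measurable_funS mh.
pose k := fine (\int[leb]_(t in `[(- T)%R, T]) (h t ^+ 2)%:E).
have k0 : 0 <= k by apply: fine_ge0; apply: integral_ge0 => t _; rewrite lee_fin sqr_ge0.
(* Any e with e^2 >= k would do; e = 1 + k avoids the square root and is positive. *)
have e0 : 0 < 1 + k by lra.
apply: (sqr_integrable_L1 T0 e0 mf _).1.
have -> : (\int[leb]_(t in `[(- T)%R, T]) (h t ^+ 2)%:E = k%:E)%E.
  rewrite fineK// ge0_fin_numE//; apply: integral_ge0 => t _; rewrite lee_fin sqr_ge0//.
by rewrite lee_fin sqrrD expr1n; have := sqr_ge0 k; lra.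
Qed.

(** Every neighbourhood of y, even of an endpoint, meets ]0, 1[ in an interval of positive length,
    which no null set can cover. *)
Lemma ae_meets_near (P Q : R -> Prop) (y : R) : 0 <= y <= 1 ->
  {ae leb, forall x, 0 < x < 1 -> Q x} -> (\forall x \near y, 0 < x < 1 -> P x) ->
  exists x, [/\ 0 < x < 1, Q x & P x].
Proof.
move=> /andP[y0 y1] [N [mN N0 sub]] /nbhs_ballP [d /= d0 dP]; apply: contrapT => none.
pose lo := Num.max 0 (y - d); pose hi := Num.min 1 (y + d).
have lohi : lo < hi by rewrite /lo /hi gt_max !lt_min; apply/andP; split; apply/andP; split; lra.
have : (leb `]lo, hi[ <= leb N)%E.
  apply: (le_measure leb); rewrite ?inE; [exact: measurable_itv|exact: mN|].
  move=> x; rewrite /= in_itv/= => /andP[]; rewrite gt_max => /andP[x0 x1].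
  rewrite lt_min => /andP[x2 x3]; apply: sub => /= h; apply: none; exists x.
  have x01 : 0 < x < 1 by rewrite x0 x2.
  split=> //; first exact: h.
  apply: dP => //.
  by rewrite /ball/= ltr_norml; apply/andP; split; lra.
rewrite N0 lebesgue_measure_itv/= lte_fin lohi -EFinD lee_fin; lra.
Qed.

(** For suitable x arbitrarily close to y, the coefficient at x equals A x, near A y by continuity,
    and is near the coefficient of h by L^2 closeness of the section; hence A y is the coefficient
    of the trace, and likewise for B. *)
Lemma trace_mode (y : R) g (h A B : R -> R) s : 0 <= y <= 1 -> loc_integrable g ->
  is_trace y g h -> {within `[0, 1], continuous A} -> {within `[0, 1], continuous B} ->
  {ae leb, forall x, 0 < x < 1 -> fcos g s x = A x /\ fsin g s x = B x} ->
  leb.-integrable `[0, 2 * pi] (EFin \o h) /\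
  A y = \int[leb]_(t in `[0, 2 * pi]) (h t * cos (s%:~R * t)) /\
  B y = \int[leb]_(t in `[0, 2 * pi]) (h t * sin (s%:~R * t)).
Proof.
move=> y01 gl [hL2 [g' [mg' g'g g'h]]] cA cB AB; set T : R := 2 * pi.
have T0 : 0 < T by exact: two_pi_gt0.
have hT := L2loc_integrable hL2 (ltW T0).
have hi : leb.-integrable `[0, T] (EFin \o h).
  by apply: integrable_subitv hT _ _ => //; lra.
have mP : measurable (`[0, T] : set mR) by exact: measurable_itv.
have gg' : {ae leb2 R, forall z, strip R z -> g z = g' z}.
  by apply: ae_imp g'g => z H sz; rewrite H.
have g'l : loc_integrable g' by exact: loc_integrable_ae gl mg' gg'.
have good : {ae leb, forall x, 0 < x < 1 ->
    leb.-integrable `[- T, T] (EFin \o (fun t => g' (x, t))) /\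
    (fcos g' s x = A x /\ fsin g' s x = B x)}.
  apply: ae_imp3 (ae_section_integrable g'l) AB (ae_fcos s gl g'l gg') => x h1 h2 h3 x01.
  by have [e1 e2] := h3 x01; rewrite -e1 -e2; split; [exact: (h1 x01 T)|exact: h2].
have yI : `[0, 1]%classic y by rewrite /= in_itv.
have near01 (F : R -> R) (e : R) : {within `[0, 1], continuous F} -> 0 < e ->
    \forall x \near y, 0 < x < 1 -> `|F y - F x| <= e.
  move=> cF e0; move/subspace_continuousP/(_ _ yI)/cvgrPdist_le/(_ _ e0) : cF => cF.
  have {}cF : \forall x \near y, x \in `[0, 1] -> `|F y - F x| <= e by exact: cF.
  by apply: filterS cF => x H /andP[x0 x1]; apply: H; rewrite in_itv/= !ltW.
have coefs (x e : R) : leb.-integrable `[- T, T] (EFin \o (fun t => g' (x, t))) -> 0 < e ->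
    (\int[leb]_(t in `[(- T)%R, T]) ((g' (x, t) - h t) ^+ 2)%:E <= (e ^+ 2)%:E)%E ->
    `|fcos g' s x - \int[leb]_(t in `[0, T]) (h t * cos (s%:~R * t))| <= e * (2 * T + 1) /\
    `|fsin g' s x - \int[leb]_(t in `[0, T]) (h t * sin (s%:~R * t))| <= e * (2 * T + 1).
  move=> gi e0 D; have mT : measurable (`[- T, T] : set mR) by exact: measurable_itv.
  have di := integrable_sub mT gi hT.
  have [_ L1] := sqr_integrable_L1 (ltW T0) e0 (integrable_measurable di) D.
  have giP : leb.-integrable `[0, T] (EFin \o (fun t => g' (x, t))).
    by apply: integrable_subitv gi _ _ => //; lra.
  have ndi := integrable_norm di.
  have le0 : \int[leb]_(t in `[0, T]) `|g' (x, t) - h t| <= \int[leb]_(t in `[- T, T]) `|g' (x, t) - h t|.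
    rewrite [leRHS](@Rintegral_itv_split _ (- T) 0 T) ?lerDr ?oppr_le0 ?(ltW T0)//.
    by apply: Rintegral_ge0 => t _; exact: normr_ge0.
  have [c1 s1] := @fcos_fsin_norm_le _ (fun z => g' z - h z.2) s x (integrable_sub mP giP hi).
  have E1 : fcos (fun z => g' z - h z.2) s x =
      fcos g' s x - \int[leb]_(t in `[0, T]) (h t * cos (s%:~R * t)).
    rewrite /fcos -RintegralB//; [|exact: integrable_cos|exact: integrable_cos].
    by apply: eq_Rintegral => t _; rewrite mulrBl.
  have E2 : fsin (fun z => g' z - h z.2) s x =
      fsin g' s x - \int[leb]_(t in `[0, T]) (h t * sin (s%:~R * t)).
    rewrite /fsin -RintegralB//; [|exact: integrable_sin|exact: integrable_sin].
    by apply: eq_Rintegral => t _; rewrite mulrBl.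
  rewrite -E1 -E2; split; [apply: le_trans c1 _|apply: le_trans s1 _];
    exact: le_trans le0 L1.
have key (e : R) : 0 < e ->
    `|A y - \int[leb]_(t in `[0, T]) (h t * cos (s%:~R * t))| <= e * (2 * T + 2) /\
    `|B y - \int[leb]_(t in `[0, T]) (h t * sin (s%:~R * t))| <= e * (2 * T + 2).
  move=> e0; have nA := near01 _ _ cA e0; have nB := near01 _ _ cB e0.
  have nD : \forall x \near y, 0 < x < 1 ->
      (\int[leb]_(t in `[(- T)%R, T]) ((g' (x, t) - h t) ^+ 2)%:E <= (e ^+ 2)%:E)%E.
    have /fine_cvgP[fin /cvgrPdist_le/(_ _ (exprn_gt0 2 e0)) D] := g'h T.
    have {}fin : \forall x \near y, x \in `]0, 1[ ->
      (\int[leb]_(t in `[(- T)%R, T]) ((g' (x, t) - h t) ^+ 2)%:E)%E \is a fin_num by exact: fin.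
    have {}D : \forall x \near y, x \in `]0, 1[ -> `|0 - fine
      (\int[leb]_(t in `[(- T)%R, T]) ((g' (x, t) - h t) ^+ 2)%:E)%E| <= e ^+ 2 by exact: D.
    apply: filterS2 fin D => x H1 H2 x01; have xI : x \in `]0, 1[ by rewrite in_itv.
    have := H2 xI; rewrite sub0r normrN => /(le_trans (ler_norm _)).
    by rewrite -lee_fin fineK//; exact: H1.
  have nAB : \forall x \near y, 0 < x < 1 -> [/\ `|A y - A x| <= e, `|B y - B x| <= e &
      (\int[leb]_(t in `[(- T)%R, T]) ((g' (x, t) - h t) ^+ 2)%:E <= (e ^+ 2)%:E)%E].
    by apply: filterS3 nA nB nD => x h1 h2 h3 x01; split; [exact: h1|exact: h2|exact: h3].
  have [x [x01 [gi [fc fs]] [hA hB hD]]] := ae_meets_near y01 good nAB.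
  have [c1 c2] := coefs x e gi e0 hD; move: c1 c2; rewrite fc fs => c1 c2.
  have -> : e * (2 * T + 2) = e + e * (2 * T + 1) by ring.
  by split; [rewrite (le_trans (ler_distD (A x) _ _))// lerD|rewrite (le_trans (ler_distD (B x) _ _))// lerD].
have zero (v : R) : (forall e : R, 0 < e -> `|v| <= e * (2 * T + 2)) -> v = 0.
  move=> H; apply/eqP; rewrite -normr_le0; apply/ler_addgt0Pr => e e0.
  have T2 : 0 < 2 * T + 2 by lra.
  by have := H (e / (2 * T + 2)) (divr_gt0 e0 T2); rewrite divfK ?gt_eqF// add0r.
split=> //; split; apply/eqP; rewrite -subr_eq0; apply/eqP; apply: zero => e e0.
  exact: (key e e0).1.
exact: (key e e0).2.
Qed.

End traces.

Lemma ae_forall_fin d (T : measurableType d) (R : realType) (mu : {measure set T -> \bar R})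
  (I : finType) (P : I -> T -> Prop) :
  (forall i, {ae mu, forall x, P i x}) -> {ae mu, forall x, forall i, P i x}.
Proof.
move=> H; have B : {ae mu, forall x, forall k : nat, if unpickle k is Some i then P i x else True}.
  by apply: ae_foralln => k; case: (unpickle k) => [i|]; [exact: H|exact: aeW].
by apply: ae_imp B => x B i; have := B (pickle i); rewrite pickleK.
Qed.

(** * Linear combinations with coefficients depending on x *)

Section combinations.
Context (R : realType) (n : nat).
Notation leb := (@lebesgue_measure R).
Notation mR := (measurableTypeR R).
Implicit Types f g h : 'I_n -> R * R -> R.

Definition bounded_coef (al : 'I_n -> R -> R) (k : R) :=
  forall j, measurable_fun (`]0, 1[ : set mR) (al j) /\ {ae leb, forall x, 0 < x < 1 -> `|al j x| <= k}.

Lemma bounded_coef_cst (k : R) : bounded_coef (fun=> cst k) `|k|.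
Proof. by move=> j; split; [exact: measurable_cst|apply: aeW]. Qed.

Lemma bounded_coefN al k : bounded_coef al k -> bounded_coef (fun j x => - al j x) k.
Proof.
move=> ak j; have [ma ba] := ak j; split; first exact: measurable_funN.
by apply: ae_imp ba => x H x01; rewrite normrN H.
Qed.

(** One shape for all linear operations on the spaces: [transport], [opA], linear combinations of
    elements and the space derivative of the solution. Coefficients that depend on x only commute
    with Fourier coefficients in t. *)
Definition combine (al be : 'I_n -> R -> R) g h : 'I_n -> R * R -> R :=
  fun j z => al j z.1 * g j z + be j z.1 * h j z.

Section two.
Variables (al be : 'I_n -> R -> R) (k l : R) (g h : 'I_n -> R * R -> R).
Hypotheses (ak : bounded_coef al k) (bl : bounded_coef be l).
Hypotheses (gl : forall j, loc_integrable (g j)) (hl : forall j, loc_integrable (h j)).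

Lemma combine_loc_integrable j : loc_integrable (combine al be g h j).
Proof.
have [ma ba] := ak j; have [mb bb] := bl j.
by apply: loc_integrable_add; [exact: loc_integrable_mul1 ba|exact: loc_integrable_mul1 bb].
Qed.

Lemma combine_fcos j (s : int) : {ae leb, forall x, 0 < x < 1 ->
  fcos (combine al be g h j) s x = al j x * fcos (g j) s x + be j x * fcos (h j) s x /\
  fsin (combine al be g h j) s x = al j x * fsin (g j) s x + be j x * fsin (h j) s x}.
Proof.
apply: ae_imp2 (ae_period_integrable (gl j)) (ae_period_integrable (hl j)) => x i1 i2 x01.
have gi := i1 x01; have hi := i2 x01.
have mP : measurable (`[0, 2 * pi] : set mR) by exact: measurable_itv.
have bhi : leb.-integrable `[0, 2 * pi] (EFin \o (fun t => be j x * h j (x, t))).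
  exact: integrable_scale.
have zi : leb.-integrable `[0, 2 * pi] (EFin \o (fun t => (fun z : R * R => 0 * h j z) (x, t))).
  exact: integrable_scale.
have := @fcos_add _ (h j) (fun z => 0 * h j z) s x (be j x) hi zi.
have := @fsin_add _ (h j) (fun z => 0 * h j z) s x (be j x) hi zi.
have := @fcos_add _ (g j) (fun z => be j x * h j z) s x (al j x) gi bhi.
have := @fsin_add _ (g j) (fun z => be j x * h j z) s x (al j x) gi bhi.
have z0 := fcos_scale0 (h j) s x.
have e : (fun z => be j x * h j z + 0 * h j z) = (fun z => be j x * h j z).
  by apply/funext => z; rewrite mul0r addr0.
by rewrite e z0.1 z0.2 !addr0 => e1 e2 <- <-.
Qed.

Lemma sqr_sum_le (x y : R) : (x + y) ^+ 2 <= 2 * x ^+ 2 + 2 * y ^+ 2.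
Proof. by have := sqr_ge0 (x - y); rewrite !expr2; lra. Qed.

(** Pointwise in x from (y + z)^2 <= 2 y^2 + 2 z^2, so the constants are the same for all
    frequencies and survive any weight in s. *)
Lemma combine_energy f (s : int) : (forall j, loc_integrable (f j)) ->
  ae_strip f (combine al be g h) ->
  (energy f s <= (2 * k ^+ 2)%:E * energy g s + (2 * l ^+ 2)%:E * energy h s)%E.
Proof.
move=> fl fE; apply: energy_le => //; rewrite ?(mulr_ge0 _ (sqr_ge0 _))//.
have fEj j : {ae leb2 R, forall z, strip R z -> f j z = combine al be g h j z}.
  by apply: ae_imp fE => z H sz; exact: H.
have A j : {ae leb, forall x, 0 < x < 1 -> fcos (f j) s x ^+ 2 + fsin (f j) s x ^+ 2 <=
    2 * k ^+ 2 * (fcos (g j) s x ^+ 2 + fsin (g j) s x ^+ 2) +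
    2 * l ^+ 2 * (fcos (h j) s x ^+ 2 + fsin (h j) s x ^+ 2)}.
  have ab := ae_imp2 (fun x a b => conj a b) (ak j).2 (bl j).2.
  apply: ae_imp3 (ae_fcos s (fl j) (combine_loc_integrable j) (fEj j)) (combine_fcos j s) ab.
  move=> x h1 h2 [h3 h4] x01; have [-> ->] := h1 x01; have [-> ->] := h2 x01.
  have sq (y M : R) : `|y| <= M -> y ^+ 2 <= M ^+ 2.
    move=> yM; have M0 : 0 <= M by exact: le_trans (normr_ge0 _) yM.
    by rewrite -(real_normK (num_real y)) ler_sqr.
  have a2 := sq _ _ (h3 x01); have b2 := sq _ _ (h4 x01).
  have := sqr_sum_le (al j x * fcos (g j) s x) (be j x * fcos (h j) s x).
  have := sqr_sum_le (al j x * fsin (g j) s x) (be j x * fsin (h j) s x).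
  have m1 := ler_wpM2r (sqr_ge0 (fcos (g j) s x)) a2.
  have m2 := ler_wpM2r (sqr_ge0 (fsin (g j) s x)) a2.
  have m3 := ler_wpM2r (sqr_ge0 (fcos (h j) s x)) b2.
  have m4 := ler_wpM2r (sqr_ge0 (fsin (h j) s x)) b2.
  by rewrite !exprMn; lra.
apply: ae_imp (ae_forall_fin A) => x H x01; rewrite /amplitude !mulr_sumr -big_split/=.
by apply: ler_sum => j _; exact: H.
Qed.

Lemma combine_Wnorm2 gamma f : (forall j, loc_integrable (f j)) ->
  ae_strip f (combine al be g h) ->
  (Wnorm2 gamma f <= (2 * k ^+ 2)%:E * Wnorm2 gamma g + (2 * l ^+ 2)%:E * Wnorm2 gamma h)%E.
Proof.
move=> fl fE; apply: Wnorm2_le => [||s]; rewrite ?(mulr_ge0 _ (sqr_ge0 _))//.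
exact: combine_energy.
Qed.

End two.

Lemma combine_periodic al be g h j : periodic_2pi (g j) -> periodic_2pi (h j) ->
  periodic_2pi (combine al be g h j).
Proof. by apply: ae_imp2 => z gp hp sz; rewrite /combine/= gp// hp. Qed.

Lemma periodic_ae (g h : R * R -> R) : periodic_2pi g ->
  {ae leb2 R, forall z, strip R z -> h z = g z} -> periodic_2pi h.
Proof.
move=> gp hg; apply: ae_imp3 gp hg (ae_leb2_translate2 (2 * pi) hg) => z h1 h2 h3 sz.
rewrite h2// -h1//; apply: h3; case: sz => z1 z2; split=> //.
Qed.

Lemma ae_strip_fam f g : (forall j, {ae leb2 R, forall z, strip R z -> f j z = g j z}) -> ae_strip f g.
Proof.
by move=> fg; apply: ae_imp (ae_forall_fin fg) => z H sz j; exact: H.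
Qed.

Lemma ae_strip_comp f g j : ae_strip f g -> {ae leb2 R, forall z, strip R z -> f j z = g j z}.
Proof. by apply: ae_imp => z H sz; exact: H. Qed.

Lemma W_combine gamma al be k l f g h : bounded_coef al k -> bounded_coef be l ->
  W gamma g -> W gamma h -> (forall j, measurable_fun (strip R) (f j)) ->
  ae_strip f (combine al be g h) ->
  W gamma f /\ Wnorm gamma f ^+ 2 <= 2 * k ^+ 2 * Wnorm gamma g ^+ 2 + 2 * l ^+ 2 * Wnorm gamma h ^+ 2.
Proof.
move=> ak bl [gl gp gW] [hl hp hW] mf fE.
have fEj j := ae_strip_comp j fE.
have fl j : loc_integrable (f j).
  apply: loc_integrable_ae (combine_loc_integrable ak bl gl hl j) (mf j) _.
  by apply: ae_imp (fEj j) => z H sz; rewrite H.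
have [fW le] := Wnorm2_lty (combine_Wnorm2 ak bl gl hl gamma fl fE) gW hW.
split=> //; split=> // j; apply: periodic_ae (fEj j); exact: combine_periodic.
Qed.

End combinations.

(** * Functions of V have modes as Fourier coefficients *)

Section forward.
Context (R : realType) (m p : nat).
Notation leb := (@lebesgue_measure R).
Notation mR := (measurableTypeR R).
Variables (c : R) (a b ia ib : 'I_(m + p) -> R -> R) (r0 : 'M[R]_(m, p)) (r1 : 'M[R]_(p, m)).
Hypothesis aL : forall j, Linfty (a j).
Hypothesis bL : forall j, Linfty (b j).
Hypothesis rep : forall j, coef_rep (a j) (b j) (ia j) (ib j) c.
Implicit Types u v f : 'I_(m + p) -> R * R -> R.

Lemma coef_a_bounded : exists K : R, bounded_coef a K.
Proof.
have /choice [K HK] : forall j, exists K : R, {ae leb, forall x, 0 < x < 1 -> `|a j x| <= K}.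
  by move=> j; apply: Linfty_bounded.
exists (\sum_j `|K j|) => j; split; first exact: (aL j).1.
apply: ae_imp (HK j) => x H x01; rewrite (le_trans (H x01))// (le_trans (ler_norm _))//.
by rewrite (bigD1 j)//= lerDl sumr_ge0.
Qed.

Lemma coef_b_bounded : bounded_coef b c^-1.
Proof.
move=> j; split; first exact: (bL j).1.
by have [_ _ _ H _] := rep j; apply: ae_imp H => x H x01; have [] := H x01.
Qed.

Lemma coef_ia_bounded : bounded_coef ia c^-1.
Proof.
move=> j; have [[h _] H _ _ _] := rep j; split; last exact: aeW.
exact: integrable_measurable (integrable_cc_oo h).
Qed.

Section element.
Variables (gamma : R) (u : 'I_(m + p) -> R * R -> R).
Hypothesis g1 : 1 <= gamma.
Hypothesis uV : V gamma a r0 r1 u.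

Let h1 j := weak_derive (dx R) (u j).
Let h2 j := weak_derive (dt R) (u j).
Let f := opA a b u.

Lemma V_regular j : [/\ loc_integrable (u j), periodic_2pi (u j),
  is_weak_derive (dx R) (u j) (h1 j) /\ periodic_2pi (h1 j),
  is_weak_derive (dt R) (u j) (h2 j) /\ periodic_2pi (h2 j)
  & loc_integrable (f j) /\ periodic_2pi (f j)].
Proof.
have [[uW hx [h1l h1p _] ht [tl tp _]] _] := uV; have [ul up _] := uW.
have dx1 := weak_deriveP (hx j).
have dt1 := weak_deriveP (ht j).
have [aK _] := coef_a_bounded.
(* The spaces assert periodicity for the transport term and for the x-derivative; that of the
   t-derivative follows by subtraction. *)
have h2p : periodic_2pi (h2 j).
  apply: ae_imp2 (tp j) (h1p j) => z; rewrite /transport/= -/(h1 j) -/(h2 j) => e1 e2 sz.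
  by have := e1 sz; rewrite e2// => /addIr.
split; [exact: ul|exact: up|exact: conj dx1 (h1p j)|exact: conj dt1 h2p|split].
  have [mb bb] := coef_b_bounded j.
  exact: loc_integrable_add (tl j) (loc_integrable_mul1 (ul j) mb bb).
apply: ae_imp2 (tp j) (up j) => z e1 e2 sz; rewrite /f /opA/= e1// e2//.
Qed.

Lemma opA_combine : f = combine (fun=> cst 1) b (transport a u) u.
Proof. by apply/funext => j; apply/funext => z; rewrite /combine/= mul1r. Qed.

Lemma opA_W : W gamma f /\ Wnorm gamma f ^+ 2 <=
  2 * Wnorm gamma (transport a u) ^+ 2 + 2 * (c^-1) ^+ 2 * Wnorm gamma u ^+ 2.
Proof.
have [[uW _ _ _ tW] _] := uV.
have := W_combine (gamma := gamma) (bounded_coef_cst 1) coef_b_bounded tW uW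
  (fun j => loc_integrable_measurable (let: And5 _ _ _ _ (conj h _) := V_regular j in h)).
rewrite opA_combine normr1 expr1n mulr1; apply.
by rewrite -opA_combine; exact: aeW.
Qed.

(** Read off from the equation as A u - b u rather than from the derivatives, so that the constant
    does not involve the sup norm of a. *)
Lemma transport_bound : Wnorm gamma (transport a u) ^+ 2 <=
  2 * Wnorm gamma f ^+ 2 + 2 * (c^-1) ^+ 2 * Wnorm gamma u ^+ 2.
Proof.
have [[uW _ _ _ tW] _] := uV; have [tl _ _] := tW.
have := W_combine (gamma := gamma) (bounded_coef_cst 1) (bounded_coefN coef_b_bounded) opA_W.1 uW
  (fun j => loc_integrable_measurable (tl j)).
rewrite normr1 expr1n mulr1; case=> //; apply: aeW => z _ j.
by rewrite /combine /f /opA/= mul1r mulNr addrK.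
Qed.

Lemma trace_relation (I : finType) (r : I -> R) (h : R -> R) (hk : I -> R -> R) (q : R -> R) :
  continuous q -> (forall t, `|q t| <= 1) ->
  leb.-integrable `[0, 2 * pi] (EFin \o h) ->
  (forall k, leb.-integrable `[0, 2 * pi] (EFin \o hk k)) ->
  {ae leb, forall t, h t = \sum_k r k * hk k t} ->
  \int[leb]_(t in `[0, 2 * pi]) (h t * q t) =
    \sum_k r k * \int[leb]_(t in `[0, 2 * pi]) (hk k t * q t).
Proof.
move=> cq q1 hi hki hE; have mP : measurable (`[0, 2 * pi] : set mR) by exact: measurable_itv.
have mq : measurable_fun (`[0, 2 * pi] : set mR) q.
  by apply: measurable_funTS; exact: continuous_measurable_fun.
have qi (g : R -> R) : leb.-integrable `[0, 2 * pi] (EFin \o g) ->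
    leb.-integrable `[0, 2 * pi] (EFin \o (fun t => g t * q t)).
  by move=> gi; apply: (integrable_bounded_mul mP gi mq) => t _; exact: q1.
have ki k : leb.-integrable `[0, 2 * pi] (EFin \o (fun t => r k * (hk k t * q t))).
  by apply: integrable_scale => //; exact: qi.
transitivity (\int[leb]_(t in `[0, 2 * pi]) (\sum_k r k * (hk k t * q t))).
  apply: ae_eq_Rintegral => //; first exact: qi.
    by apply: measurable_fun_bigsum => k; exact: integrable_measurable (ki k).
  apply: ae_imp hE => t -> _; rewrite mulr_suml; apply: eq_bigr => k _; exact: esym (mulrA _ _ _).
rewrite Rintegral_bigsum//; apply: eq_bigr => k _; rewrite RintegralZl//; exact: qi.
Qed.

(** The transformed equation F = H2 + a H1 + b U solved for the coefficient H1 of the x-derivative.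
    It is used for cosines with s and for sines with - s. *)
Lemma mode_algebra (x y F T H1 H2 U U' A1 B1 s aj bj iaj ibj : R) :
  T = cst 1 x * H2 + aj * H1 -> F = cst 1 y * T + bj * U -> H2 = s * U' ->
  U = A1 -> U' = B1 -> ibj = bj * iaj -> aj * iaj = 1 ->
  H1 = iaj * F - ibj * A1 - s * iaj * B1.
Proof.
move=> -> -> -> -> -> -> aia /=.
by transitivity (aj * iaj * H1); [rewrite aia mul1r|ring].
Qed.

Lemma V_mode (s : int) : exists A B, is_mode_system ia ib r0 r1 s%:~R
    (fun j => fcos (f j) s) (fun j => fsin (f j) s) A B /\
  forall j, {ae leb, forall x, 0 < x < 1 -> fcos (u j) s x = A j x /\ fsin (u j) s x = B j x}.
Proof.
have /choice [A /choice [B AB]] : forall j, exists A1 B1 : R -> R,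
    [/\ is_prim A1 (fcos (h1 j) s), is_prim B1 (fsin (h1 j) s) &
    {ae leb, forall x, 0 < x < 1 -> fcos (u j) s x = A1 x /\ fsin (u j) s x = B1 x}].
  by move=> j; have [ul up [d1 p1] _ _] := V_regular j; exact: weak_dx_prim.
have [Ka aK] := coef_a_bounded.
have ODE j : {ae leb, forall x, 0 < x < 1 ->
    fcos (h1 j) s x = ia j x * fcos (f j) s x - ib j x * A j x - s%:~R * ia j x * B j x /\
    fsin (h1 j) s x = ia j x * fsin (f j) s x - ib j x * B j x + s%:~R * ia j x * A j x}.
  have ul i : loc_integrable (u i) by have [] := V_regular i.
  have h1l i : loc_integrable (h1 i) by have [_ _ [[]]] := V_regular i.
  have h2l i : loc_integrable (h2 i) by have [_ _ _ [[]]] := V_regular i.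
  have [_ up _ [d2 p2] _] := V_regular j; have [_ _ ABu] := AB j.
  have E1 := combine_fcos (fun=> cst 1) a h2l h1l j s.
  have tl i : loc_integrable (transport a u i).
    by have [[_ _ _ _ [tl _ _]] _] := uV.
  have E2 := combine_fcos (fun=> cst 1) b tl ul j s.
  have T : combine (fun=> cst 1) a h2 h1 j = transport a u j.
    by apply/funext => z; rewrite /combine/= mul1r.
  rewrite T in E1; rewrite -opA_combine in E2.
  have [_ _ _ cr _] := rep j.
  have W := ae_imp3 (fun x p1 p2 p3 => conj p1 (conj p2 p3)) E1 E2 cr.
  apply: ae_imp3 W (weak_dt_mode s (ul j) up p2 d2) ABu => x [e1 [e2 e3]] e4 e5 x01.
  have [e1c e1s] := e1 x01; have [e2c e2s] := e2 x01; have [aia ibE _] := e3 x01.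
  have [e4c e4s] := e4 x01; have [e5c e5s] := e5 x01.
  split; first exact: mode_algebra e1c e2c e4c e5c e5s ibE aia.
  apply: eq_trans (mode_algebra e1s e2s e4s e5s e5c ibE aia) _.
  by rewrite !mulNr opprK.
exists A, B; split; last by move=> j; have [] := AB j.
have cont j : {within `[0, 1], continuous (A j)} /\ {within `[0, 1], continuous (B j)}.
  have [pA pB _] := AB j.
  exact: conj (is_prim_continuous pA) (is_prim_continuous pB).
have [[_ [u0 [u1 [t0 t1 bc0 bc1]]]]] := (conj uV I).
have h01 : 0 <= (1 : R) <= 1 by rewrite ler01/=.
have h00 : 0 <= (0 : R) <= 1 by rewrite ler01 lexx.
have tr0 j := trace_mode h00 (let: And5 h _ _ _ _ := V_regular j in h) (t0 j) (cont j).1 (cont j).2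
  (let: And3 _ _ h := AB j in h).
have tr1 j := trace_mode h01 (let: And5 h _ _ _ _ := V_regular j in h) (t1 j) (cont j).1 (cont j).2
  (let: And3 _ _ h := AB j in h).
have cb (y : R) : `|cos y| <= 1 by rewrite ler_norml cos_geN1 cos_le1.
have sb (y : R) : `|sin y| <= 1 by rewrite ler_norml sin_geN1 sin_le1.
have cc := @continuous_cos_scaled R s%:~R; have cs := @continuous_sin_scaled R s%:~R.
split=> j.
- have [pA pB _] := AB j; have [_ _ _ _ [fl _]] := V_regular j.
  have [FAi FBi] := integrable_fcos s fl; have mia := (coef_ia_bounded j).1.
  have mib : measurable_fun (`]0, 1[ : set mR) (ib j).
    by have [[_ h] _ _ _ _] := rep j; exact: integrable_measurable (integrable_cc_oo h).
  have mI : measurable (`]0, 1[ : set mR) by exact: measurable_itv.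
  have m01 (F G : R -> R) : is_prim F G -> measurable_fun (`]0, 1[ : set mR) F.
    move=> FP; apply: measurable_funS (is_prim_measurable FP); first exact: measurable_itv.
    exact: subset_itv_oo_cc.
  have mA := m01 _ _ pA; have mB := m01 _ _ pB.
  have mFA := integrable_measurable FAi; have mFB := integrable_measurable FBi.
  have [ipA _] := pA; have [ipB _] := pB.
  (* The mode equation holds almost everywhere; its right-hand side inherits integrability from the
     coefficient of the x-derivative before replacing it as the density. *)
  split; [apply: (is_prim_ae pA)|apply: (is_prim_ae pB)].
  + apply: (ae_eq_integrable mI (integrable_cc_oo ipA)).
      by apply: measurable_funB; [apply: measurable_funB|]; repeat apply: measurable_funM.
    by apply: ae_imp (ODE j) => x H; rewrite /= in_itv/= => /H[].
  + by apply: ae_imp (ODE j) => x H /H[].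
  + apply: (ae_eq_integrable mI (integrable_cc_oo ipB)).
      by apply: measurable_funD; [apply: measurable_funB|]; repeat apply: measurable_funM.
    by apply: ae_imp (ODE j) => x H; rewrite /= in_itv/= => /H[].
  + by apply: ae_imp (ODE j) => x H /H[].
- have [h [-> ->]] := tr0 (lshift p j).
  rewrite (trace_relation cc (fun t => cb _) h (fun k => (tr0 (rshift m k)).1) (bc0 j)).
  rewrite (trace_relation cs (fun t => sb _) h (fun k => (tr0 (rshift m k)).1) (bc0 j)).
  by split; apply: eq_bigr => k _; have [_ [E1 E2]] := tr0 (rshift m k); rewrite ?E1 ?E2.
- have [h [-> ->]] := tr1 (rshift m j).
  rewrite (trace_relation cc (fun t => cb _) h (fun k => (tr1 (lshift p k)).1) (bc1 j)).
  rewrite (trace_relation cs (fun t => sb _) h (fun k => (tr1 (lshift p k)).1) (bc1 j)).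
  by split; apply: eq_bigr => k _; have [_ [E1 E2]] := tr1 (lshift p k); rewrite ?E1 ?E2.
Qed.

End element.
End forward.

(** * The uniform estimate in terms of energies *)

Section mode_estimate.
Context (R : realType) (m p : nat).
Notation leb := (@lebesgue_measure R).
Notation mR := (measurableTypeR R).

Lemma sqr_sum_card_le (I : finType) (t : I -> R) : (\sum_i t i) ^+ 2 <= #|I|%:R * \sum_i t i ^+ 2.
Proof.
rewrite expr2 big_distrlr/=.
apply: (@le_trans _ _ (\sum_i \sum_j (t i ^+ 2 / 2 + t j ^+ 2 / 2))).
  apply: ler_sum => i _; apply: ler_sum => j _.
  by have := sqr_ge0 (t i - t j); rewrite !expr2; lra.
rewrite le_eqVlt; apply/orP; left; apply/eqP.
transitivity (\sum_i (#|I|%:R * (t i ^+ 2 / 2) + (\sum_j t j ^+ 2) / 2)).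
  by apply: eq_bigr => i _; rewrite big_split/= sumr_const mulr_natl -mulr_suml.
by rewrite big_split/= sumr_const -mulr_sumr -mulr_suml -mulr_natl; field.
Qed.

(** Jensen on an interval of length 1, from the nonnegative integral of (g - M)^2 with M the
    mean. *)
Lemma sqr_mean_le (g : R -> R) : leb.-integrable `]0, 1[ (EFin \o g) ->
  leb.-integrable `]0, 1[ (EFin \o (fun x => g x ^+ 2)) ->
  (\int[leb]_(x in `]0, 1[) g x) ^+ 2 <= \int[leb]_(x in `]0, 1[) g x ^+ 2.
Proof.
move=> gi g2i; have mI : measurable (`]0, 1[ : set mR) by exact: measurable_itv.
set M := \int[leb]_(x in `]0, 1[) g x; have [fin fE] := lebesgue_oo (@ler01 R).
have ci : leb.-integrable `]0, 1[ (EFin \o cst (M ^+ 2)) by exact: finite_measure_integrable_cst_on.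
have hi : leb.-integrable `]0, 1[ (EFin \o (fun x => g x ^+ 2 + (-2 * M) * g x)).
  by apply: integrable_add => //; exact: integrable_scale.
have : 0 <= \int[leb]_(x in `]0, 1[) (g x ^+ 2 + (-2 * M) * g x + cst (M ^+ 2) x).
  apply: Rintegral_ge0 => x _ /=; have := sqr_ge0 (g x - M).
  by rewrite (_ : (g x - M) ^+ 2 = g x ^+ 2 + -2 * M * g x + M ^+ 2)//; ring.
rewrite (RintegralD mI hi ci) RintegralD//; last exact: integrable_scale.
rewrite RintegralZl// Rintegral_cst//= fE subr0 mulr1 -/M; lra.
Qed.

Lemma Rmx_reflection (c : R) (a b ia ib : 'I_(m + p) -> R -> R) r0 r1 (s : int) :
  (forall j, coef_rep (a j) (b j) (ia j) (ib j) c) ->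
  Rmx a b r0 r1 s = reflection (phase ia ib s%:~R) r0 r1.
Proof.
move=> rep; apply/matrixP => j k; rewrite !mxE; apply: eq_bigr => l _.
congr (cexp _ * _ * _); have [_ _ _ _ [Ej Ej']] := rep (rshift m j).
have [_ _ _ _ [El El']] := rep (lshift p l).
by apply/eqP; rewrite eq_complex/= /alpha /beta -Ej -Ej' -El -El' mulrBr !eqxx.
Qed.

Definition mode_bounded (ia ib : 'I_(m + p) -> R -> R) r0 r1 (Kc : R) (s : int) :=
  forall FA FB A B : 'I_(m + p) -> R -> R,
    (forall j, leb.-integrable `]0, 1[ (EFin \o FA j)) ->
    (forall j, leb.-integrable `]0, 1[ (EFin \o FB j)) ->
    leb.-integrable `]0, 1[ (EFin \o (fun x => \sum_j (FA j x ^+ 2 + FB j x ^+ 2))) ->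
    is_mode_system ia ib r0 r1 s%:~R FA FB A B ->
  forall j x, 0 <= x <= 1 -> A j x ^+ 2 + B j x ^+ 2 <=
    Kc * \int[leb]_(x in `]0, 1[) (\sum_j (FA j x ^+ 2 + FB j x ^+ 2)).

Lemma mode_estimate (c : R) : 0 < c -> exists2 Kc : R, 0 <= Kc &
  forall (a b ia ib : 'I_(m + p) -> R -> R) (r0 : 'M[R]_(m, p)) (r1 : 'M[R]_(p, m)) (s : int),
    (forall j, coef_rep (a j) (b j) (ia j) (ib j) c) ->
    (forall j k, `|r0 j k| <= c^-1) -> (forall j k, `|r1 j k| <= c^-1) ->
    c <= cmod (\det (1%:M - Rmx a b r0 r1 s)) -> mode_bounded ia ib r0 r1 Kc s.
Proof.
move=> c0; pose K := c^-1 + c^-1 * c^-1.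
have ci0 : 0 <= c^-1 by rewrite invr_ge0 ltW.
have cc0 : 0 <= c^-1 * c^-1 by exact: mulr_ge0.
have K0 : 0 <= K by exact: addr_ge0.
have [k k0 bnd] := mode_system_bound m p c0 K0.
(* The first 2 adds the bounds of A and B, the cardinality comes from Cauchy-Schwarz over
   components, and the last 2 from (|FA| + |FB|)^2 <= 2 (FA^2 + FB^2). *)
exists (2 * k ^+ 2 * (#|'I_(m + p)|%:R * 2)).
  by rewrite mulr_ge0// mulr_ge0// sqr_ge0.
move=> a b ia ib r0 r1 s rep r0c r1c dc FA FB A B FAi FBi Ei AB j x x01.
have mI : measurable (`]0, 1[ : set mR) by exact: measurable_itv.
have {bnd} := bnd ia ib r0 r1 s%:~R FA FB A B.
case/(_ _ _ _ _ r0c r1c _ FAi FBi AB j x x01).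
- by move=> i; have [[h _] _ _ _ _] := rep i.
- by move=> i; have [[_ h] _ _ _ _] := rep i.
- by move=> i y _; have [_ h _ _ _] := rep i; rewrite (le_trans (h y))// lerDl.
- by move=> i y _; have [_ _ h _ _] := rep i; rewrite (le_trans (h y))// lerDr.
- by rewrite -(Rmx_reflection _ _ _ rep).
set t := fun i => \int[leb]_(x in `]0, 1[) (`|FA i x| + `|FB i x|).
move=> hA hB; set E := fun x : R => \sum_j (FA j x ^+ 2 + FB j x ^+ 2).
have S0 : 0 <= \sum_i t i.
  by apply: sumr_ge0 => i _; apply: Rintegral_ge0 => y _; rewrite addr_ge0.
have sq (y : R) : `|y| <= k * \sum_i t i -> y ^+ 2 <= k ^+ 2 * (\sum_i t i) ^+ 2.
  move=> yk; rewrite -exprMn -(real_normK (num_real y)) ler_sqr ?nnegrE//.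
  exact: mulr_ge0.
have mFA i := integrable_measurable (FAi i); have mFB i := integrable_measurable (FBi i).
have Fi i : leb.-integrable `]0, 1[ (EFin \o (fun x => FA i x ^+ 2 + FB i x ^+ 2)).
  apply: (integrable_dominated mI _ Ei).
    by apply: measurable_funD; exact: measurable_funX.
  move=> y _; rewrite ger0_norm ?addr_ge0 ?sqr_ge0// (bigD1 i)//= lerDl.
  by apply: sumr_ge0 => l _; rewrite addr_ge0 ?sqr_ge0.
have t2 i : t i ^+ 2 <= 2 * \int[leb]_(x in `]0, 1[) (FA i x ^+ 2 + FB i x ^+ 2).
  have gi : leb.-integrable `]0, 1[ (EFin \o (fun x => `|FA i x| + `|FB i x|)).
    by apply: integrable_add => //; exact: integrable_norm.
  have pw (y : R) : (`|FA i y| + `|FB i y|) ^+ 2 <= 2 * (FA i y ^+ 2 + FB i y ^+ 2).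
    by rewrite mulrDr -!(real_normK (num_real (FA i y))) -!(real_normK (num_real (FB i y))) sqr_sum_le.
  have F2i : leb.-integrable `]0, 1[ (EFin \o (fun x => 2 * (FA i x ^+ 2 + FB i x ^+ 2))).
    exact: integrable_scale.
  have g2i : leb.-integrable `]0, 1[ (EFin \o (fun x => (`|FA i x| + `|FB i x|) ^+ 2)).
    apply: (integrable_dominated mI _ F2i).
      by apply: measurable_funX; exact: integrable_measurable gi.
    by move=> y _; rewrite ger0_norm ?sqr_ge0.
  rewrite (le_trans (sqr_mean_le gi g2i))// -RintegralZl//.
  by apply: le_Rintegral => // y _; exact: pw.
have S2 : (\sum_i t i) ^+ 2 <= #|'I_(m + p)|%:R * 2 * \int[leb]_(x in `]0, 1[) E x.
  rewrite (le_trans (sqr_sum_card_le _))// -mulrA ler_wpM2l//.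
  by rewrite /E Rintegral_bigsum// mulr_sumr; apply: ler_sum => i _; exact: t2.
have := lerD (sq _ hA) (sq _ hB) => /le_trans; apply.
have k2 : 0 <= 2 * k ^+ 2 by rewrite mulr_ge0// sqr_ge0.
rewrite -[leRHS]mulrA; apply: le_trans (ler_wpM2l k2 S2).
by rewrite -[leRHS]mulrA [leRHS]mulr_natl mulr2n.
Qed.

End mode_estimate.

(** * Weak derivatives of a single wave *)

Section wave_weak_derivatives.
Context (R : realType).
Notation leb := (@lebesgue_measure R).
Notation mR := (measurableTypeR R).
Implicit Types (phi : R * R -> R) (A B : R -> R).

Lemma test_is_derive phi : smooth phi -> forall x t : R,
  is_derive t 1 (fun t => phi (x, t)) ('D_(dt R) phi (x, t)) /\
  is_derive x 1 (fun x => phi (x, t)) ('D_(dx R) phi (x, t)).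
Proof.
move=> sp x t; have dif : differentiable phi (x, t) by exact: (sp [::]).
have dd v : derivable phi (x, t) v by exact: diff_derivable.
have Et : (fun h : R => h^-1 *: ((fun t => phi (x, t)) (h *: 1 + t) - phi (x, t))) =
    (fun h : R => h^-1 *: (phi (h *: dt R + (x, t)) - phi (x, t))).
  apply/funext => h; congr (_ *: (phi _ - _)).
  by rewrite /dt; congr pair => /=; rewrite ?scaler0 ?add0r.
have Ex : (fun h : R => h^-1 *: ((fun x => phi (x, t)) (h *: 1 + x) - phi (x, t))) =
    (fun h : R => h^-1 *: (phi (h *: dx R + (x, t)) - phi (x, t))).
  apply/funext => h; congr (_ *: (phi _ - _)).
  by rewrite /dx; congr pair => /=; rewrite ?scaler0 ?add0r.
split; apply: DeriveDef.
- by have := dd (dt R); rewrite /derivable Et.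
- by rewrite /derive Et.
- by have := dd (dx R); rewrite /derivable Ex.
- by rewrite /derive Ex.
Qed.

Lemma test_section_continuous (T M : R) phi : test_bound T M phi ->
  (forall x, continuous (fun t => phi (x, t))) /\ (forall t, continuous (fun x => phi (x, t))).
Proof.
case=> cp _ _; split=> x t.
  by apply: continuous2_cvg => //; exact: cvg_cst.
by apply: continuous2_cvg => //; exact: cvg_cst.
Qed.

Definition mode_wave A B (s : nat) (z : R * R) : R := wave s (A z.1) (B z.1) z.2.

Lemma loc_integrable_mode_wave A B (s : nat) :
  leb.-integrable `]0, 1[ (EFin \o A) -> leb.-integrable `]0, 1[ (EFin \o B) ->
  loc_integrable (mode_wave A B s).
Proof.
move=> Ai Bi; apply: loc_integrable_add => T.
  exact: (integrable_box_cos T (s%:~R) (loc_integrable_fst Ai)).1.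
exact: (integrable_box_cos T (s%:~R) (loc_integrable_fst Bi)).2.
Qed.

Lemma mode_wave_dt A B (s : nat) phi (T M : R) : 0 < T -> smooth phi -> test_bound T M phi ->
  test_bound T M ('D_(dt R) phi) ->
  leb.-integrable `]0, 1[ (EFin \o A) -> leb.-integrable `]0, 1[ (EFin \o B) ->
  \int[leb2 R]_(z in strip R) (mode_wave A B s z * 'D_(dt R) phi z) =
  - \int[leb2 R]_(z in strip R)
      (mode_wave (fun x => s%:~R * B x) (fun x => - (s%:~R * A x)) s z * phi z).
Proof.
(* The test function may be nonzero at height T, whereas it vanishes at T + 1, so that no boundary
   terms remain. *)
move=> T0 sp tp tdp Ai Bi; set phi' := 'D_(dt R) phi in tdp *; pose T1 := T + 1.
have mI : measurable (`]0, 1[ : set mR) by exact: measurable_itv.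
have mT : measurable (`[- T1, T1] : set mR) by exact: measurable_itv.
have TT1 : T <= T1 by rewrite lerDl.
have tp1 := test_bound_mono TT1 tp; have tdp1 := test_bound_mono TT1 tdp.
have sBi : leb.-integrable `]0, 1[ (EFin \o (fun x => s%:~R * B x)) by exact: integrable_scale.
have sAi : leb.-integrable `]0, 1[ (EFin \o (fun x => - (s%:~R * A x))).
  by apply: integrable_opp => //; exact: integrable_scale.
have l1 := loc_integrable_mode_wave s Ai Bi; have l2 := loc_integrable_mode_wave s sBi sAi.
have i1 := integrable_box_test l1 tdp1; have i2 := integrable_box_test l2 tp1.
rewrite (Rintegral_strip_box _ tdp1) (Rintegral_strip_box _ tp1).
rewrite (Rintegral_setX1 mI mT i1) (Rintegral_setX1 mI mT i2).
rewrite -RintegralN; apply: eq_Rintegral => x _.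
have [cpx _] := test_section_continuous tp; have [cdpx _] := test_section_continuous tdp.
pose w t := wave s (A x) (B x) t; pose w' t := wave s (s%:~R * B x) (- (s%:~R * A x)) t.
have dw (t : R) : is_derive t 1 w (w' t).
  have D1 := is_derive_scaled (s%:~R : R) t (fun x => is_derive_cos x).
  have D2 := is_derive_scaled (s%:~R : R) t (fun x => is_derive_sin x).
  have H1 := is_derive_mul (is_derive_cst (A x) t (1 : R)) D1.
  have H2 := is_derive_mul (is_derive_cst (B x) t (1 : R)) D2.
  by apply: (is_derive_eq (is_derive_add H1 H2)); rewrite /w' /wave /cst; ring.
have cw : continuous w by exact: continuous_wave.
have cw' : continuous w' by exact: continuous_wave.
have cM (f g : R -> R) : continuous f -> continuous g -> continuous (fun t => f t * g t).
  by move=> cf cg t; exact: (cvgM (cf t) (cg t)).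
have dN (t : R) : is_derive t 1 (fun t => w t * phi (x, t)) (w' t * phi (x, t) + w t * phi' (x, t)).
  exact: is_derive_mul (dw t) (test_is_derive sp x t).1.
have cN : continuous (fun t => w' t * phi (x, t) + w t * phi' (x, t)).
  by move=> t; apply: cvgD; apply: cM => //; rewrite ?cpx ?cdpx.
have T11 : - T1 < T1 by rewrite /T1; lra.
have p0 (t : R) : T < `|t| -> phi (x, t) = 0.
  move=> tT; apply/eqP; apply: contraPT tT => ne; have [_ _ sup] := tp.
  by have [_ /= h] := sup _ ne; apply/negP; rewrite -leNgt.
have := Rintegral_derive dN cN T11.
rewrite !p0 ?normrN ?gtr0_norm ?ltrDl// ?addr_gt0//; rewrite ?mulr0 ?subrr.
rewrite RintegralD//; try by apply: integrable_continuous_cc; apply: cM; [..|exact: cpx].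
  move/eqP; rewrite addr_eq0 => /eqP E.
  transitivity (\int[leb]_(t in `[- T1, T1]) (w t * phi' (x, t))) => //.
  by rewrite -[LHS]opprK -E.
by apply: integrable_continuous_cc; apply: cM => //; exact: cdpx.
Qed.

(** For fixed t the product rule is applied to the wave, absolutely continuous in x, and to the
    section of the test function, which vanishes at x = 0 and x = 1. *)
Lemma mode_wave_dx A B hA hB (s : nat) phi (T M : R) : smooth phi -> test_bound T M phi ->
  test_bound T M ('D_(dx R) phi) -> is_prim A hA -> is_prim B hB ->
  \int[leb2 R]_(z in strip R) (mode_wave A B s z * 'D_(dx R) phi z) =
  - \int[leb2 R]_(z in strip R) (mode_wave hA hB s z * phi z).
Proof.
move=> sp tp tdp pA pB; set phi' := 'D_(dx R) phi in tdp *.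
have mI : measurable (`]0, 1[ : set mR) by exact: measurable_itv.
have mT : measurable (`[- T, T] : set mR) by exact: measurable_itv.
have b01 (F f : R -> R) : is_prim F f -> leb.-integrable `]0, 1[ (EFin \o F).
  move=> FP; have [K FK] := is_prim_bounded FP.
  apply: (integrable_bounded (K := K) mI (lebesgue_oo ler01).1).
    apply: measurable_funS (is_prim_measurable FP); first exact: measurable_itv.
    exact: subset_itv_oo_cc.
  by move=> x /=; rewrite in_itv/= => /andP[x0 x1]; apply: FK; rewrite !ltW.
have l1 := loc_integrable_mode_wave s (b01 _ _ pA) (b01 _ _ pB).
have l2 := loc_integrable_mode_wave s (integrable_cc_oo pA.1) (integrable_cc_oo pB.1).
have i1 := integrable_box_test l1 tdp; have i2 := integrable_box_test l2 tp.
rewrite (Rintegral_strip_box _ tdp) (Rintegral_strip_box _ tp).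
rewrite (Rintegral_setX2 mI mT i1) (Rintegral_setX2 mI mT i2).
rewrite -RintegralN; apply: eq_Rintegral => t _.
have [_ cpt] := test_section_continuous tp; have [_ cdpt] := test_section_continuous tdp.
have pp : is_prim (fun x => phi (x, t)) (fun x => phi' (x, t)).
  by apply: is_prim_of_derive; [move=> x; exact: (test_is_derive sp x t).2|exact: cdpt].
have [_ bM _] := tdp; have [_ _ sup] := tp.
have pz (x : R) : ~~ (0 < x < 1) -> phi (x, t) = 0.
  by move=> nx; apply/eqP; apply: contraNT nx => ne; have [] := sup _ ne.
have pW : is_prim (fun x => wave s (A x) (B x) t) (fun x => wave s (hA x) (hB x) t).
  have := is_primD (is_primZ (cos (s%:~R * t)) pA) (is_primZ (sin (s%:~R * t)) pB).
  by rewrite /wave; congr is_prim; apply/funext => x; rewrite mulrC [X in _ + X]mulrC.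
have := is_prim_mul pW pp (fun x _ => bM (x, t)) => P.
have [Pi PE] := P; have := is_prim_incr P (lexx 0) ler01 (lexx 1).
rewrite !pz ?ltxx ?andbF// !mulr0 subrr (Rintegral_itv_oo (integrable_cc_oo Pi)).2.
have [K bP] := is_prim_bounded pW; have [K' bp] := is_prim_bounded pp.
have mW : measurable_fun (`]0, 1[ : set mR) (fun x => phi (x, t)).
  by apply: measurable_funTS; apply: continuous_measurable_fun; exact: cpt.
have mW' : measurable_fun (`]0, 1[ : set mR) (fun x => phi' (x, t)).
  by apply: measurable_funTS; apply: continuous_measurable_fun; exact: cdpt.
have j1 : leb.-integrable `]0, 1[ (EFin \o (fun x => wave s (hA x) (hB x) t * phi (x, t))).
  by apply: (integrable_bounded_mul mI (integrable_cc_oo pW.1) mW) => x _; have [_ b _] := tp; exact: b.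
have j2 : leb.-integrable `]0, 1[ (EFin \o (fun x => wave s (A x) (B x) t * phi' (x, t))).
  by apply: (integrable_bounded_mul mI (b01 _ _ pW) mW') => x _; exact: bM.
rewrite RintegralD// => /esym /eqP; rewrite addrC addr_eq0 => /eqP E.
exact: E.
Qed.

End wave_weak_derivatives.

(** * Weak derivatives of series *)

Section L1_convergence.
Context (R : realType).
Notation leb := (@lebesgue_measure R).
Notation mR := (measurableTypeR R).
Implicit Types (h g : nat -> R * R -> R) (w v : R * R -> R) (c d : nat -> R -> R).

Definition L1cvg h w := [/\ forall n, loc_integrable (h n), loc_integrable w &
  forall q, (fun n => \int[leb2 R]_(z in pbox q) `|h n z - w z|) @ \oo --> (0 : R)].

Lemma L1cvg_squeeze h w (u : nat -> nat -> R) :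
  (forall n, loc_integrable (h n)) -> loc_integrable w ->
  (forall q n, \int[leb2 R]_(z in pbox q) `|h n z - w z| <= u q n) ->
  (forall q, u q @ \oo --> (0 : R)) -> L1cvg h w.
Proof.
move=> hl wl hu u0; split=> // q.
apply: (@squeeze_cvgr _ _ _ _ (cst 0) (u q)); [|exact: cvg_cst|exact: u0].
by apply: nearW => n; rewrite hu andbT; apply: Rintegral_ge0.
Qed.

Lemma L1cvg_add h g w v : L1cvg h w -> L1cvg g v -> L1cvg (fun n z => h n z + g n z) (fun z => w z + v z).
Proof.
case=> hl wl hw [gl vl gv]; apply: (L1cvg_squeeze (u := fun q n =>
    \int[leb2 R]_(z in pbox q) `|h n z - w z| + \int[leb2 R]_(z in pbox q) `|g n z - v z|)).
- by move=> n; exact: loc_integrable_add.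
- exact: loc_integrable_add.
- move=> q n; have mq := @measurable_pbox R q.
  have i1 := integrable_norm (loc_integrable_sub (hl n) wl (2 * pi * q.+1%:R)).
  have i2 := integrable_norm (loc_integrable_sub (gl n) vl (2 * pi * q.+1%:R)).
  rewrite -(RintegralD mq i1 i2); apply: le_Rintegral => //.
  + apply: (integrable_norm (loc_integrable_sub _ _ (2 * pi * q.+1%:R))); exact: loc_integrable_add.
  + exact: integrable_add i1 i2.
  + by move=> z _; rewrite opprD addrACA; exact: ler_normD.
- by move=> q; rewrite -[X in _ --> X](addr0 0); apply: cvgD; [exact: hw|exact: gv].
Qed.

Lemma L1cvg_mul h w (a : R -> R) (K : R) : measurable_fun (`]0, 1[ : set mR) a ->
  (forall x, `|a x| <= K) -> L1cvg h w -> L1cvg (fun n z => a z.1 * h n z) (fun z => a z.1 * w z).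
Proof.
move=> ma aK [hl wl hw].
have aw (g : R * R -> R) : loc_integrable g -> loc_integrable (fun z => a z.1 * g z).
  by move=> gl; apply: (loc_integrable_mul1 gl ma (K := K)); exact: aeW.
apply: (L1cvg_squeeze (u := fun q n => K * \int[leb2 R]_(z in pbox q) `|h n z - w z|)).
- by move=> n; exact: aw.
- exact: aw.
- move=> q n; have mq := @measurable_pbox R q.
  have i1 := integrable_norm (loc_integrable_sub (hl n) wl (2 * pi * q.+1%:R)).
  have -> : K * \int[leb2 R]_(z in pbox q) `|h n z - w z| =
    \int[leb2 R]_(z in pbox q) (K * `|h n z - w z|) by rewrite RintegralZl//; exact: i1.
  apply: le_Rintegral => //.
  + by apply: (integrable_norm (loc_integrable_sub _ _ (2 * pi * q.+1%:R))); exact: aw.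
  + exact: integrable_scale i1.
  + by move=> z _; rewrite -mulrBr normrM ler_wpM2r.
- by move=> q; rewrite -[X in _ --> X](mulr0 K); apply: cvgMr; exact: hw.
Qed.

Lemma L1cvg_ae h w v : L1cvg h w -> loc_integrable v ->
  {ae leb2 R, forall z, strip R z -> w z = v z} -> L1cvg h v.
Proof.
case=> hl wl hw vl wv; split=> // q.
have -> : (fun n => \int[leb2 R]_(z in pbox q) `|h n z - v z|) =
    (fun n => \int[leb2 R]_(z in pbox q) `|h n z - w z|); last exact: hw.
apply/funext => n; apply: esym; have mq := @measurable_pbox R q.
apply: ae_eq_Rintegral => //.
- exact: (integrable_norm (loc_integrable_sub (hl n) wl (2 * pi * q.+1%:R))).
- exact: (integrable_measurable (integrable_norm (loc_integrable_sub (hl n) vl (2 * pi * q.+1%:R)))).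
- by apply: ae_imp wv => z H /box_subset_strip sz; rewrite H.
Qed.

Lemma trig_series_L1cvg c d w : (forall s, leb.-integrable `]0, 1[ (EFin \o c s)) ->
  (forall s, leb.-integrable `]0, 1[ (EFin \o d s)) -> is_trig_series c d w -> L1cvg (tsum c d 0) w.
Proof.
by move=> ci di [wl _ wc]; split=> // n; exact: loc_integrable_tsum.
Qed.

Lemma L1cvg_trig_series c d w v : is_trig_series c d w -> loc_integrable v -> periodic_2pi v ->
  (forall s, leb.-integrable `]0, 1[ (EFin \o c s)) ->
  (forall s, leb.-integrable `]0, 1[ (EFin \o d s)) ->
  {ae leb2 R, forall z, strip R z -> w z = v z} -> is_trig_series c d v.
Proof.
move=> wS vl vp ci di wv.
by have [_ _ vc] := L1cvg_ae (trig_series_L1cvg ci di wS) vl wv.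
Qed.

Lemma weak_derive_limit h h' w w' (e : R * R) : e = dx R \/ e = dt R -> L1cvg h w -> L1cvg h' w' ->
  (forall N phi (T M : R), 0 < T -> smooth phi -> test_bound T M phi -> test_bound T M ('D_e phi) ->
    \int[leb2 R]_(z in strip R) (h N z * 'D_e phi z) =
    - \int[leb2 R]_(z in strip R) (h' N z * phi z)) -> is_weak_derive e w w'.
Proof.
move=> ed [hl wl hw] [h'l w'l h'w'] eqn; split=> // phi tphi.
have [T [M [T0 tp tdp]]] := test_derive_bound tphi ed.
have cv1 := test_integral_cvg hl wl hw tdp.
have cv2 := test_integral_cvg h'l w'l h'w' tp.
have {}cv2 : (fun n => - \int[leb2 R]_(z in strip R) (h' n z * phi z)) @ \oo -->
    - \int[leb2 R]_(z in strip R) (w' z * phi z) by apply: cvgN.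
rewrite -(cvg_lim (@Rhausdorff R) cv1) -(cvg_lim (@Rhausdorff R) cv2).
congr (lim (_ @ \oo)); apply/funext => n.
by apply: eqn tp tdp => //; exact: tphi.1.
Qed.

Lemma tsum_test c d N phi (T M : R) : (forall s, leb.-integrable `]0, 1[ (EFin \o c s)) ->
  (forall s, leb.-integrable `]0, 1[ (EFin \o d s)) -> test_bound T M phi ->
  \int[leb2 R]_(z in strip R) (tsum c d 0 N z * phi z) =
  \sum_(0 <= s < N) \int[leb2 R]_(z in strip R)
    (mode_wave (fun x => kap R s * c s x) (fun x => kap R s * d s x) s z * phi z).
Proof.
move=> ci di tp; rewrite (Rintegral_strip_box _ tp).
under [RHS]eq_bigr do rewrite (Rintegral_strip_box _ tp).
rewrite -Rintegral_bigsum; [|exact: measurable_box|].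
  by apply: eq_Rintegral => z _; rewrite /tsum /wave_sum mulr_suml.
move=> s; apply: (integrable_box_test _ tp); apply: loc_integrable_mode_wave.
  by apply: integrable_scale => //; exact: measurable_itv.
by apply: integrable_scale => //; exact: measurable_itv.
Qed.

Lemma tsum_dt c d N phi (T M : R) : (forall s, leb.-integrable `]0, 1[ (EFin \o c s)) ->
  (forall s, leb.-integrable `]0, 1[ (EFin \o d s)) -> 0 < T -> smooth phi -> test_bound T M phi ->
  test_bound T M ('D_(dt R) phi) ->
  \int[leb2 R]_(z in strip R) (tsum c d 0 N z * 'D_(dt R) phi z) =
  - \int[leb2 R]_(z in strip R)
      (tsum (fun s x => s%:~R * d s x) (fun s x => - (s%:~R * c s x)) 0 N z * phi z).
Proof.
move=> ci di T0 sp tp tdp; have mI : measurable (`]0, 1[ : set mR) by exact: measurable_itv.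
rewrite (tsum_test N ci di tdp) (tsum_test N _ _ tp).
- rewrite -sumrN; apply: eq_bigr => s _; rewrite (mode_wave_dt _ T0 sp tp tdp).
  + congr (- _); apply: eq_Rintegral => z _; rewrite /mode_wave; congr (wave _ _ _ _ * _); ring.
  + exact: integrable_scale.
  + exact: integrable_scale.
- by move=> s; exact: integrable_scale.
- by move=> s; apply: integrable_opp => //; exact: integrable_scale.
Qed.

Lemma tsum_dx c d (hc hd : nat -> R -> R) N phi (T M : R) :
  (forall s, is_prim (c s) (hc s)) -> (forall s, is_prim (d s) (hd s)) ->
  (forall s, leb.-integrable `]0, 1[ (EFin \o c s)) ->
  (forall s, leb.-integrable `]0, 1[ (EFin \o d s)) -> smooth phi -> test_bound T M phi ->
  test_bound T M ('D_(dx R) phi) ->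
  \int[leb2 R]_(z in strip R) (tsum c d 0 N z * 'D_(dx R) phi z) =
  - \int[leb2 R]_(z in strip R) (tsum hc hd 0 N z * phi z).
Proof.
move=> pc pd ci di sp tp tdp.
rewrite (tsum_test N ci di tdp) (tsum_test N _ _ tp).
- rewrite -sumrN; apply: eq_bigr => s _.
  by apply: (mode_wave_dx _ sp tp tdp); exact: is_primZ.
- by move=> s; exact: integrable_cc_oo (pc s).1.
- by move=> s; exact: integrable_cc_oo (pd s).1.
Qed.

Lemma fcosN (g0 : R * R -> R) (s : int) (x : R) : fcos g0 (- s) x = fcos g0 s x /\ fsin g0 (- s) x = - fsin g0 s x.
Proof.
split; first by apply: eq_Rintegral => t _; rewrite mulrNz mulNr cosN.
by rewrite -RintegralN; apply: eq_Rintegral => t _; rewrite mulrNz mulNr sinN mulrN.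
Qed.

(** Riesz-Fischer produces some v with the same coefficients as w, and uniqueness identifies the
    two; negative frequencies reduce to positive ones by parity. *)
Lemma fourier_expansion w : loc_integrable w -> periodic_2pi w ->
  (forall s : nat, leb.-integrable `]0, 1[ (EFin \o (fun x => fcos w s x ^+ 2 + fsin w s x ^+ 2))) ->
  cvgn (series (mode_energy (fun s : nat => fcos w s) (fun s : nat => fsin w s))) ->
  is_trig_series (fun s : nat => fcos w s) (fun s : nat => fsin w s) w.
Proof.
move=> wl wp ei sume.
have ci (s : nat) := (integrable_fcos s wl).1; have di (s : nat) := (integrable_fcos s wl).2.
have [v vS] := riesz_fischer ci di ei sume.
apply: (L1cvg_trig_series vS wl wp ci di); have [vl vp _] := vS.
have H : {ae leb2 R, forall z, strip R z -> v z - w z = 0}.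
  apply: strip_fourier_uniqueness; first exact: loc_integrable_sub.
    by apply: ae_imp2 vp wp => z h1 h2 sz; rewrite h1// h2.
  have H (s : nat) : {ae leb, forall x, 0 < x < 1 ->
      fcos (fun z => v z - w z) s x = 0 /\ fsin (fun z => v z - w z) s x = 0}.
    apply: ae_imp3 (trig_series_fourier ci di s vS) (ae_period_integrable vl) (ae_period_integrable wl).
    move=> x h1 i1 i2 x01; have [e1 e2] := h1 x01.
    have -> : (fun z => v z - w z) = (fun z => (-1) * w z + v z) by apply/funext => z; ring.
    rewrite (fcos_add _ _ (i2 x01) (i1 x01)) (fsin_add _ _ (i2 x01) (i1 x01)) e1 e2 !mulN1r addNr.
    (* At s = 0 the sine coefficient of v is 0 by convention of the series, and that of w is 0
       because sin 0 = 0. *)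
    split=> //; case: eqP => [->|_]; last by rewrite addNr.
    rewrite /fsin; under eq_Rintegral do rewrite mul0r sin0 mulr0.
    by rewrite Rintegral_cst ?mul0r ?oppr0 ?addr0//; exact: measurable_itv.
  case=> n; first exact: H.
  rewrite NegzE; apply: ae_imp (H n.+1) => x h x01; have [e1 e2] := h x01.
  by have [-> ->] := fcosN (fun z => v z - w z) n.+1 x; rewrite e1 e2 oppr0.
by apply: ae_imp H => z h sz; apply/eqP; rewrite -subr_eq0 h.
Qed.

End L1_convergence.

(** * Bounds on energies *)

Section energy_bounds.
Context (R : realType) (n : nat).
Notation leb := (@lebesgue_measure R).
Notation mR := (measurableTypeR R).
Implicit Types w f : 'I_n -> R * R -> R.

Lemma energyN w (s : int) : energy w (- s) = energy w s.
Proof.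
apply: eq_integral => x _; congr EFin; apply: eq_bigr => j _.
by have [-> ->] := fcosN (w j) s x; rewrite sqrrN.
Qed.

Lemma energy_le_cst w (s : int) (L : R) : 0 <= L -> (forall j, loc_integrable (w j)) ->
  (forall j, {ae leb, forall x, 0 < x < 1 -> fcos (w j) s x ^+ 2 + fsin (w j) s x ^+ 2 <= L}) ->
  (energy w s <= (n%:R * L)%:E)%E.
Proof.
move=> L0 wl wL; have mI : measurable (`]0, 1[ : set mR) by exact: measurable_itv.
apply: (@le_trans _ _ (\int[leb]_(x in `]0%R, 1%R[) (cst (n%:R * L)%:E) x)%E).
  apply: ae_ge0_le_integral => //.
  - by move=> x _; rewrite lee_fin amplitude_ge0.
  - by apply/measurable_EFinP; exact: measurable_amplitude.
  - by move=> x _; rewrite lee_fin mulr_ge0.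
  - apply: ae_imp (ae_forall_fin wL) => x H; rewrite /= in_itv/= => x01.
    rewrite lee_fin mulr_natl -[X in _ *+ X](card_ord n) -sumr_const.
    by apply: ler_sum => j _; exact: H.
rewrite integral_cst// -[X in (_ * X)%E]fineK; last first.
  by rewrite ge0_fin_numE//; exact: (lebesgue_oo ler01).1.
by rewrite (lebesgue_oo ler01).2 subr0 mule1.
Qed.

Lemma int_sym_ind (P : int -> Prop) : (forall s : nat, P s) -> (forall s : int, P s -> P (- s)) ->
  forall s, P s.
Proof. by move=> P0 PN [k|k]; [exact: P0|rewrite NegzE; apply: PN; exact: P0]. Qed.

Lemma cvg_inverse_squares : cvgn (series (fun s : nat => (1 + s%:R ^+ 2)^-1 : R)).
Proof.
pose u (s : nat) : R := (s.+1%:R)^-1.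
(* Comparison with a telescoping series: (s + 1) (s + 2) <= 6 (1 + s^2), since the difference 5 s^2
   - 3 s + 4 is positive. *)
apply: (series_le_cvg (v_ := fun s => 6 * (u s - u s.+1))).
- by move=> s; rewrite invr_ge0 addr_ge0 ?sqr_ge0.
- by move=> s; rewrite mulr_ge0// subr_ge0 lef_pV2 ?posrE// ler_nat.
- move=> s; rewrite /u; set x : R := s%:R; have x0 : 0 <= x by exact: ler0n.
  have -> : s.+1%:R = x + 1 :> R by rewrite natr1.
  have -> : s.+2%:R = x + 2 :> R by rewrite -natr1 -natr1 -addrA.
  have -> : 6 * ((x + 1)^-1 - (x + 2)^-1) = 6 / ((x + 1) * (x + 2)).
    by field; apply/andP; split; rewrite gt_eqF//; lra.
  rewrite ler_pdivlMr; last by rewrite mulr_gt0//; lra.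
  rewrite ler_pdivrMl; last by have := sqr_ge0 x; lra.
  clearbody x; have h1 := sqr_ge0 x; have h2 := sqr_ge0 (x - 3 / 2).
  have -> : (1 + x ^+ 2) * 6 = (x + 1) * (x + 2) + (4 * x ^+ 2 + (x - 3 / 2) ^+ 2 + 7 / 4) by field.
  lra.
- apply: nondecreasing_is_cvgn.
    apply: nondecreasing_series => s _ _.
    by rewrite mulr_ge0// subr_ge0 lef_pV2 ?posrE// ler_nat.
  exists 6 => _ [N _ <-]; rewrite /series/= -mulr_sumr.
  rewrite -[leRHS]mulr1 ler_wpM2l//.
  rewrite (eq_bigr (fun k => (- u k.+1) - (- u k))); last by move=> k _; rewrite opprK addrC.
  rewrite (telescope_sumr (fun k => - u k))// opprK /u invr1.
  by rewrite addrC gerBl invr_ge0.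
Qed.

(** The loss of one time derivative costs the factor 1 + s^2 in the energy, which is the weight of
    W^1. *)
Lemma W0_of_W1 w f (L : R) : 0 <= L -> (forall j, loc_integrable (w j)) ->
  (forall j, periodic_2pi (w j)) ->
  (forall s : int, (energy w s <= L%:E * ((1 + s%:~R ^+ 2)%:E * energy f s))%E) -> W 1 f -> W 0 w.
Proof.
move=> L0 wl wp le [_ _ fin]; split; [exact: wl|exact: wp|].
have w0 (s : int) : 0 <= 1 + s%:~R ^+ 2 :> R by rewrite addr_ge0 ?sqr_ge0.
have e0 (s : int) : (0 <= (1 + s%:~R ^+ 2)%:E * energy f s)%E by rewrite mule_ge0 ?energy_ge0// lee_fin.
apply: (@le_lt_trans _ _ (L%:E * Wnorm2 1 f)%E); last first.
  have h : Wnorm2 1 f \is a fin_num by rewrite ge0_fin_numE ?Wnorm2_ge0.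
  by rewrite -(fineK h) -EFinM ltry.
rewrite !Wnorm2E.
apply: (@le_trans _ _ (\esum_(s in [set: int]) (L%:E * ((1 + s%:~R ^+ 2)%:E * energy f s)))%E).
  by apply: le_esum => s _; rewrite powRr0 mul1e.
apply: le_trans (esum_scale_le L0 e0) _; apply: lee_wpmul2l; first by rewrite lee_fin.
by apply: le_esum => s _; rewrite powRr1.
Qed.

End energy_bounds.

(** * Construction of the solution for given data *)

Section backward.
Context (R : realType) (m p : nat).
Notation leb := (@lebesgue_measure R).
Notation mR := (measurableTypeR R).
Variables (c : R) (a b ia ib : 'I_(m + p) -> R -> R) (r0 : 'M[R]_(m, p)) (r1 : 'M[R]_(p, m)).
Hypothesis aL : forall j, Linfty (a j).
Hypothesis bL : forall j, Linfty (b j).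
Hypothesis rep : forall j, coef_rep (a j) (b j) (ia j) (ib j) c.
Variable Kc : R.
Hypothesis Kc0 : 0 <= Kc.
Hypothesis est : forall s : int, mode_bounded ia ib r0 r1 Kc s.
Hypothesis solv : forall (s : int) (FA FB : 'I_(m + p) -> R -> R),
  (forall j, leb.-integrable `]0, 1[ (EFin \o FA j)) ->
  (forall j, leb.-integrable `]0, 1[ (EFin \o FB j)) ->
  exists A B, is_mode_system ia ib r0 r1 s%:~R FA FB A B.
Variables (gamma : R) (f : 'I_(m + p) -> R * R -> R).
Hypothesis g1 : 1 <= gamma.

Let mI : measurable (`]0, 1[ : set mR). Proof. exact: measurable_itv. Qed.

Lemma V_energy (u : 'I_(m + p) -> R * R -> R) : V gamma a r0 r1 u ->
  forall s, (energy u s <= ((m + p)%:R * Kc)%:E * energy (opA a b u) s)%E.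
Proof.
move=> uV s; have g0 : 0 <= gamma by exact: le_trans ler01 g1.
have [fW _] := opA_W aL bL rep uV.
have [fl _ _] := fW; have [Ei ->] := amplitude_integrable fl (W_energy g0 fW s).
have [A [B [AB uAB]]] := V_mode aL bL rep uV s.
have ci j := (integrable_fcos s (fl j)).1; have di j := (integrable_fcos s (fl j)).2.
have ul j : loc_integrable (u j) by have [] := V_regular aL bL rep uV j.
rewrite -EFinM -mulrA; apply: energy_le_cst => //.
  by rewrite mulr_ge0//; apply: Rintegral_ge0 => x _; exact: amplitude_ge0.
move=> j; apply: ae_imp (uAB j) => x H x01; have [-> ->] := H x01.
by apply: (est ci di Ei AB); case/andP: x01 => x0 x1; rewrite !ltW.
Qed.

Hypothesis fW : W gamma f.

Let fl j : loc_integrable (f j). Proof. by case: fW => h _ _; exact: h. Qed.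
Let fp j : periodic_2pi (f j). Proof. by case: fW => _ h _; exact: h. Qed.
Let ci j (s : int) := (integrable_fcos s (fl j)).1.
Let di j (s : int) := (integrable_fcos s (fl j)).2.
Let E (s : int) : R := \int[leb]_(x in `]0, 1[) amplitude f s x.

Let g0 : 0 <= gamma. Proof. exact: le_trans ler01 g1. Qed.

Let Ei (s : int) : leb.-integrable `]0, 1[ (EFin \o amplitude f s).
Proof. exact: (amplitude_integrable fl (W_energy g0 fW s)).1. Qed.

Let eE (s : int) : energy f s = (E s)%:E.
Proof. exact: (amplitude_integrable fl (W_energy g0 fW s)).2. Qed.

Let E0 s : 0 <= E s.
Proof. by apply: Rintegral_ge0 => x _; exact: amplitude_ge0. Qed.

Let sumE : cvgn (series (fun s : nat => Kc * ((1 + s%:R ^+ 2) * E s))).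
Proof. by have := is_cvg_seriesZ (k := Kc) (W_summable g1 fW); apply. Qed.

Section solution.
Variables A B : nat -> 'I_(m + p) -> R -> R.
Hypothesis AB : forall s : nat, is_mode_system ia ib r0 r1 s%:~R
  (fun j => fcos (f j) s) (fun j => fsin (f j) s) (A s) (B s).

Let bnd (s : nat) j x : 0 <= x <= 1 -> A s j x ^+ 2 + B s j x ^+ 2 <= Kc * E s.
Proof. exact: (est (fun j => ci j s) (fun j => di j s) (Ei s) (AB s)). Qed.

(** Weighted AM-GM: |y| <= (v y^2 + 1 / v) / 2 with v = 1 + s^2 and y^2 <= Kc E. Both parts are
    summable, the first by gamma >= 1; this is the Weierstrass majorant. *)
Let M (s : nat) : R := (Kc * ((1 + s%:R ^+ 2) * E s) + (1 + s%:R ^+ 2)^-1) / 2.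

Let AM (s : nat) j x : 0 <= x <= 1 -> `|A s j x| <= M s /\ `|B s j x| <= M s.
Proof.
move=> x01; have h := bnd s j x01.
have w0 : 0 < 1 + s%:R ^+ 2 :> R by rewrite ltr_wpDr// sqr_ge0.
have amgm (y : R) : y ^+ 2 <= Kc * E s -> `|y| <= M s.
  move=> yE; rewrite /M ler_pdivlMr//.
  set v := 1 + s%:R ^+ 2 in w0 *.
  have h1 : v * y ^+ 2 <= Kc * (v * E s) by rewrite (mulrCA Kc); apply: ler_wpM2l => //; exact: ltW.
  have : 0 <= v * (`|y| - v^-1) ^+ 2 by rewrite mulr_ge0 ?sqr_ge0// ltW.
  rewrite (_ : v * (`|y| - v^-1) ^+ 2 = v * y ^+ 2 - 2 * `|y| + v^-1).
    by lra.
  by rewrite -(real_normK (num_real y)); field; rewrite gt_eqF.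
have a2 := sqr_ge0 (A s j x); have b2 := sqr_ge0 (B s j x).
by split; apply: amgm; lra.
Qed.

Let sumM : cvgn (series M).
Proof.
have -> : series M = (fun N => (series (fun s : nat => Kc * ((1 + s%:R ^+ 2) * E s)) N +
    series (fun s : nat => (1 + s%:R ^+ 2)^-1) N) / 2).
  by apply/funext => N; rewrite /series/= -big_split/= mulr_suml.
have h : cvgn (fun=> 2^-1 : R) by exact: is_cvg_cst.
apply: (is_cvgM _ h).
by apply: is_cvgD; [exact: sumE|exact: cvg_inverse_squares].
Qed.

Let pA (s : nat) j := let: And3 h _ _ := AB s in (h j).1.
Let pB (s : nat) j := let: And3 h _ _ := AB s in (h j).2.

Let m01 (F F' : R -> R) : is_prim F F' -> measurable_fun (`]0, 1[ : set mR) F.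
Proof.
move=> FP; apply: measurable_funS (is_prim_measurable FP); first exact: measurable_itv.
exact: subset_itv_oo_cc.
Qed.

Let i01 (F F' : R -> R) : is_prim F F' -> leb.-integrable `]0, 1[ (EFin \o F).
Proof.
move=> FP; have [K FK] := is_prim_bounded FP.
apply: (integrable_bounded (K := K) mI (lebesgue_oo ler01).1 (m01 FP)).
by move=> x /=; rewrite in_itv/= => /andP[x0 x1]; apply: FK; rewrite !ltW.
Qed.

Definition sol j : R * R -> R := tlim (fun s => A s j) (fun s => B s j).

Let Ai j (s : nat) := i01 (pA s j).
Let Bi j (s : nat) := i01 (pB s j).

Let cont j (s : nat) : {within `[0, 1], continuous (A s j)} /\ {within `[0, 1], continuous (B s j)}.
Proof. exact: conj (is_prim_continuous (pA s j)) (is_prim_continuous (pB s j)). Qed.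

Let solS j : is_trig_series (fun s => A s j) (fun s => B s j) (sol j).
Proof. exact: (tlim_trig_series (Ai j) (Bi j) (fun s x x01 => AM s j x01) sumM). Qed.

Let dA j (s : nat) (x : R) : R := s%:~R * B s j x.
Let dB j (s : nat) (x : R) : R := - (s%:~R * A s j x).

Let dAi j s : leb.-integrable `]0, 1[ (EFin \o dA j s).
Proof. by apply: integrable_scale => //; exact: Bi. Qed.

Let dBi j s : leb.-integrable `]0, 1[ (EFin \o dB j s).
Proof. by apply: integrable_opp => //; apply: integrable_scale => //; exact: Ai. Qed.

Let dE (j : 'I_(m + p)) (s : nat) x : 0 <= x <= 1 ->
  dA j s x ^+ 2 + dB j s x ^+ 2 <= Kc * ((1 + s%:R ^+ 2) * E s).
Proof.
move=> x01; have h := bnd s j x01; rewrite /dA /dB sqrrN !exprMn -mulrDr.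
have s0 : 0 <= s%:R ^+ 2 :> R by exact: sqr_ge0.
have := ler_wpM2l s0 h; rewrite addrC => /le_trans; apply.
by rewrite mulrCA ler_wpM2l// ler_wpM2r// lerDr.
Qed.

(** The coefficients s B and - s A of the time derivative have energies bounded by (1 + s^2) times
    that of f, hence summable. *)
Lemma time_derivative_exists j : exists w, is_trig_series (dA j) (dB j) w.
Proof.
have ei s : leb.-integrable `]0, 1[ (EFin \o (fun x => dA j s x ^+ 2 + dB j s x ^+ 2)).
  apply: (integrable_bounded (K := Kc * ((1 + s%:R ^+ 2) * E s)) mI (lebesgue_oo ler01).1).
    apply: measurable_funD; apply: measurable_funX.
      exact: integrable_measurable (dAi j s).
    exact: integrable_measurable (dBi j s).
  move=> x; rewrite /= in_itv/= => /andP[x0 x1]; rewrite ger0_norm ?addr_ge0 ?sqr_ge0//.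
  by apply: dE; rewrite !ltW.
apply: (riesz_fischer (dAi j) (dBi j) ei).
apply: series_le_cvg sumE.
- by move=> s; exact: mode_energy_ge0.
- by move=> s; rewrite mulr_ge0// mulr_ge0// addr_ge0// sqr_ge0.
move=> s; rewrite /mode_energy.
have ic : leb.-integrable `]0, 1[ (EFin \o cst (Kc * ((1 + s%:R ^+ 2) * E s))).
  by apply: finite_measure_integrable_cst_on => //; exact: (lebesgue_oo ler01).1.
apply: (@le_trans _ _ (\int[leb]_(x in `]0, 1[) cst (Kc * ((1 + s%:R ^+ 2) * E s)) x)).
  apply: le_Rintegral => // x; rewrite /= in_itv/= => /andP[x0 x1].
  by apply: dE; rewrite !ltW.
by rewrite Rintegral_cst// (lebesgue_oo ler01).2 subr0 mulr1.
Qed.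

(** The x-derivative of each mode contains the coefficient of f, so summing the mode equations
    requires f to be the limit of its own series. *)
Lemma forcing_series j : is_trig_series (fun s : nat => fcos (f j) s) (fun s : nat => fsin (f j) s) (f j).
Proof.
have le (s : nat) (x : R) : fcos (f j) s x ^+ 2 + fsin (f j) s x ^+ 2 <= amplitude f s x.
  by rewrite /amplitude (bigD1 j)//= lerDl sumr_ge0// => i _; rewrite addr_ge0 ?sqr_ge0.
have ei (s : nat) : leb.-integrable `]0, 1[ (EFin \o (fun x => fcos (f j) s x ^+ 2 + fsin (f j) s x ^+ 2)).
  apply: (integrable_dominated mI _ (Ei s)).
    apply: measurable_funD; apply: measurable_funX.
      exact: integrable_measurable (ci j s).
    exact: integrable_measurable (di j s).
  by move=> x _; rewrite ger0_norm ?addr_ge0 ?sqr_ge0.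
apply: fourier_expansion => //.
apply: series_le_cvg (W_summable g1 fW).
- by move=> s; exact: mode_energy_ge0.
- by move=> s; rewrite mulr_ge0// ?E0// addr_ge0// sqr_ge0.
move=> s; apply: (@le_trans _ _ (E s)); first by apply: le_Rintegral.
by rewrite ler_peMl ?E0// lerDl sqr_ge0.
Qed.

Section with_time_derivative.
Variable h2 : 'I_(m + p) -> R * R -> R.
Hypothesis h2S : forall j, is_trig_series (dA j) (dB j) (h2 j).

(** The equation solved for the x-derivative, (f - b u - d_t u) / a, written with the bounded
    representatives. *)
Definition space_derivative j (z : R * R) : R :=
  ia j z.1 * f j z + ((- ib j z.1) * sol j z + (- ia j z.1) * h2 j z).

Let mia j : measurable_fun (`]0, 1[ : set mR) (ia j).
Proof. by have [[h _] _ _ _ _] := rep j; exact: integrable_measurable (integrable_cc_oo h). Qed.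

Let mib j : measurable_fun (`]0, 1[ : set mR) (ib j).
Proof. by have [[_ h] _ _ _ _] := rep j; exact: integrable_measurable (integrable_cc_oo h). Qed.

Lemma sol_weak_dt j : is_weak_derive (dt R) (sol j) (h2 j).
Proof.
apply: (weak_derive_limit (or_intror erefl) (trig_series_L1cvg (Ai j) (Bi j) (solS j))
  (trig_series_L1cvg (dAi j) (dBi j) (h2S j))) => N phi T K T0 sp tp tdp.
exact: (tsum_dt N (Ai j) (Bi j) T0 sp tp tdp).
Qed.

(** The densities of the modes add up to the same combination of the partial sums of f, of the
    solution and of its time derivative; each converges in L^1, and multiplication by bounded
    functions of x preserves this. *)
Lemma sol_weak_dx j : is_weak_derive (dx R) (sol j) (space_derivative j).
Proof.
have [_ iaK ibK _ _] := rep j.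
have iaN x : `|- ia j x| <= c^-1 by rewrite normrN.
have ibN x : `|- ib j x| <= c^-1 * c^-1 by rewrite normrN.
have L1 := L1cvg_mul (mia j) iaK (trig_series_L1cvg (ci j) (di j) (forcing_series j)).
have L2 := L1cvg_mul (measurable_funN (mib j)) ibN (trig_series_L1cvg (Ai j) (Bi j) (solS j)).
have L3 := L1cvg_mul (measurable_funN (mia j)) iaN (trig_series_L1cvg (dAi j) (dBi j) (h2S j)).
have L := L1cvg_add L1 (L1cvg_add L2 L3).
apply: (weak_derive_limit (or_introl erefl) (trig_series_L1cvg (Ai j) (Bi j) (solS j)) L).
move=> N phi T K T0 sp tp tdp.
rewrite (tsum_dx N (fun s => pA s j) (fun s => pB s j) (Ai j) (Bi j) sp tp tdp); congr (- _).
apply: eq_Rintegral => z _; congr (_ * _).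
rewrite /tsum /wave_sum !mulr_sumr -!big_split/=; apply: eq_bigr => s _.
by rewrite /wave /dA /dB; ring.
Qed.


Lemma sol_energy (s : int) : (energy sol s <= ((m + p)%:R * Kc)%:E * energy f s)%E.
Proof.
elim/int_sym_ind: s => [s|s]; last by rewrite !energyN.
rewrite eE -EFinM -mulrA; apply: energy_le_cst; first by rewrite mulr_ge0.
  by move=> j; case: (solS j).
move=> j; apply: ae_imp (trig_series_fourier (Ai j) (Bi j) s (solS j)) => x H x01.
have [-> ->] := H x01; have x01' : 0 <= x <= 1 by case/andP: x01 => x0 x1; rewrite !ltW.
(* At s = 0 the series has sine coefficient 0 in place of B, which only lowers the left-hand
   side. *)
apply: le_trans (bnd s j x01'); rewrite lerD2l; case: ifP => // _.
by rewrite expr0n sqr_ge0.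
Qed.

Lemma sol_W : W gamma sol.
Proof.
split; [by move=> j; case: (solS j)|by move=> j; case: (solS j)|].
have [_ _ fin] := fW; have k0 : 0 <= (m + p)%:R * Kc by rewrite mulr_ge0.
have := @Wnorm2_le _ _ gamma sol f f ((m + p)%:R * Kc) 0 k0 (lexx 0).
move=> /(_ _)/Wnorm2_lty H; apply: (H _ fin fin).1 => s.
by rewrite mul0e adde0; exact: sol_energy.
Qed.

Lemma time_derivative_W : W 0 h2.
Proof.
have k0 : 0 <= (m + p)%:R * Kc by rewrite mulr_ge0.
apply: (W0_of_W1 k0) (W_mono g1 fW).
- by move=> j; case: (h2S j).
- by move=> j; case: (h2S j).
move=> s; elim/int_sym_ind: s => [s|s]; last by rewrite !energyN mulrNz sqrrN.
rewrite eE -!EFinM -mulrA; apply: energy_le_cst.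
- by rewrite !mulr_ge0// addr_ge0 ?sqr_ge0.
- by move=> j; case: (h2S j).
move=> j; apply: ae_imp (trig_series_fourier (dAi j) (dBi j) s (h2S j)) => x H x01.
have [-> ->] := H x01; have x01' : 0 <= x <= 1 by case/andP: x01 => x0 x1; rewrite !ltW.
apply: le_trans (dE j s x01'); rewrite lerD2l; case: ifP => // _.
by rewrite expr0n sqr_ge0.
Qed.

Let wx j := weak_deriveP (ex_intro _ _ (sol_weak_dx j)).
Let wt j := weak_deriveP (ex_intro _ _ (sol_weak_dt j)).

Let dxE j : weak_derive (dx R) (sol j) = space_derivative j %[ae leb2 R in strip R].
Proof. exact: (is_weak_derive_unique (or_introl erefl) (wx j) (sol_weak_dx j)). Qed.

Let dtE j : weak_derive (dt R) (sol j) = h2 j %[ae leb2 R in strip R].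
Proof. exact: (is_weak_derive_unique (or_intror erefl) (wt j) (sol_weak_dt j)). Qed.

Lemma sol_transport : ae_strip (transport a sol) (combine (fun=> cst 1) (fun j x => - b j x) f sol).
Proof.
apply: ae_strip_fam => j; have [_ _ _ cr _] := rep j.
apply: ae_imp3 (dxE j) (dtE j) (ae_leb2_fst cr) => z ex et cz sz.
have [|aia ibE _] := cz; first by case: sz; rewrite /= in_itv.
rewrite /transport /combine/= ex// et// /space_derivative.
have -> : ib j z.1 = b j z.1 * ia j z.1 by have [] := cz _; case: sz; rewrite /= in_itv.
set w := sol j z; set y := h2 j z.
transitivity (y + (a j z.1 * ia j z.1) * (f j z - b j z.1 * w - y)); first by ring.
by rewrite aia; ring.
Qed.

Lemma sol_equation : ae_strip (opA a b sol) f.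
Proof.
apply: ae_imp sol_transport => z H sz j; rewrite /opA H// /combine/=; ring.
Qed.

Lemma sol_U : U gamma a sol.
Proof.
have ibb : bounded_coef ib (c^-1 / c).
  by move=> j; have [_ _ h _ _] := rep j; split; [exact: mib|exact: aeW].
have iab := coef_ia_bounded rep; have bb := coef_b_bounded bL rep.
have [Ka ab] := coef_a_bounded aL.
have sl j : loc_integrable (sol j) by case: (solS j).
have hl j : loc_integrable (h2 j) by case: (h2S j).
split.
- exact: sol_W.
- by move=> j; exists (space_derivative j); exact: sol_weak_dx.
- have [gW _] := W_combine (bounded_coefN ibb) (bounded_coefN iab) (W_mono g0 sol_W) time_derivative_W
    (fun j => loc_integrable_measurable (combine_loc_integrable (bounded_coefN ibb) (bounded_coefN iab) sl hl j))
    (aeW _ (fun z _ j => erefl)).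
  have [] := W_combine iab (bounded_coef_cst 1) (W_mono g0 fW) gW
    (fun j => loc_integrable_measurable (wx j).1).
    apply: ae_strip_fam => j; apply: ae_imp (dxE j) => z H sz; rewrite H//.
    by rewrite /space_derivative /combine/= mul1r.
  by [].
- by move=> j; exists (h2 j); exact: sol_weak_dt.
have tm j : measurable_fun (strip R) (transport a sol j).
  have [ma ba] := ab j.
  exact: loc_integrable_measurable (loc_integrable_add (wt j).1 (loc_integrable_mul1 (wx j).1 ma ba)).
by have [] := W_combine (bounded_coef_cst 1) (bounded_coefN bb) fW sol_W tm sol_transport.
Qed.

(** Boundary conditions are linear and hold for every mode, hence for partial sums and for their
    limit at each t. *)
Lemma tlim_relation (I : finType) (r : I -> R) (i : 'I_(m + p)) (k : I -> 'I_(m + p)) (y t : R) :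
  0 <= y <= 1 ->
  (forall s : nat, A s i y = \sum_l r l * A s (k l) y /\ B s i y = \sum_l r l * B s (k l) y) ->
  sol i (y, t) = \sum_l r l * sol (k l) (y, t).
Proof.
move=> y01 H.
have lim j := (tsum_tlim (fun s x x01 => AM s j x01) sumM t 0 y01).1.
have lim2 : (fun N => \sum_l r l * tsum (fun s => A s (k l)) (fun s => B s (k l)) 0 N (y, t)) @ \oo -->
    \sum_l r l * sol (k l) (y, t).
  apply: cvg_big => [|l _]; first exact: add_continuous.
  by apply: cvgM; [exact: cvg_cst|exact: lim].
apply: (cvg_unique _ (lim i)) => //.
rewrite (_ : (fun N => tsum _ _ 0 N (y, t)) = (fun N => \sum_l r l * tsum (fun s => A s (k l)) (fun s => B s (k l)) 0 N (y, t)))//.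
apply/funext => N; rewrite /tsum /wave_sum.
under [RHS]eq_bigr do rewrite mulr_sumr.
rewrite exchange_big/=; apply: eq_bigr => s _; rewrite /wave (H s).1 (H s).2.
rewrite !mulr_sumr !mulr_suml -big_split/=; apply: eq_bigr => l _; ring.
Qed.

Lemma sol_V : V gamma a r0 r1 sol.
Proof.
have tr (y : R) : 0 <= y <= 1 -> forall j, is_trace y (sol j) (fun t => sol j (y, t)).
  by move=> y01 j; exact: (tlim_trace (Ai j) (Bi j) (fun s x x01 => AM s j x01) sumM (cont j) y01).
have y0 : 0 <= (0 : R) <= 1 by rewrite lexx ler01.
have y1 : 0 <= (1 : R) <= 1 by rewrite lexx ler01.
split; first exact: sol_U.
exists (fun j t => sol j (0, t)), (fun j t => sol j (1, t)); split.
- exact: tr.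
- exact: tr.
- by move=> j; apply: aeW => t; apply: tlim_relation => // s; case: (AB s).
- by move=> j; apply: aeW => t; apply: tlim_relation => // s; case: (AB s).
Qed.

End with_time_derivative.
End solution.

(** Only the frequencies s >= 0 are solved: in real form, the cosine and sine pair already accounts
    for - s. *)
Lemma V_onto : exists2 u, V gamma a r0 r1 u & ae_strip (opA a b u) f.
Proof.
have /choice [A /choice [B AB]] : forall s : nat, exists A B, is_mode_system ia ib r0 r1 s%:~R
    (fun j => fcos (f j) s) (fun j => fsin (f j) s) A B.
  by move=> s; apply: solv => j; [exact: ci|exact: di].
have /choice [h2 h2S] := time_derivative_exists AB.
by exists (sol A B); [exact: (sol_V AB h2S)|exact: (sol_equation AB h2S)].
Qed.

End backward.

(** * Linearity of traces *)

Section trace_linear.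
Context (R : realType).
Notation leb := (@lebesgue_measure R).
Notation mR := (measurableTypeR R).

Lemma sqr_integral_lin_le (D : set mR) (f g : R -> R) (k : R) : measurable D ->
  measurable_fun D f -> measurable_fun D g ->
  (\int[leb]_(t in D) ((k * f t + g t) ^+ 2)%:E <=
    (2 * k ^+ 2)%:E * \int[leb]_(t in D) (f t ^+ 2)%:E + 2%:E * \int[leb]_(t in D) (g t ^+ 2)%:E)%E.
Proof.
move=> mD mf mg.
have mf2 : measurable_fun D (fun t => (f t ^+ 2)%:E) by apply/measurable_EFinP; exact: measurable_funX.
have mg2 : measurable_fun D (fun t => (g t ^+ 2)%:E) by apply/measurable_EFinP; exact: measurable_funX.
have p0 (h : R -> R) t : D t -> (0 <= (h t ^+ 2)%:E)%E by move=> _; rewrite lee_fin sqr_ge0.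
have k0 : (0 <= (2 * k ^+ 2)%:E)%E by rewrite lee_fin mulr_ge0 ?sqr_ge0.
have two0 : (0 <= 2%:E :> \bar R)%E by rewrite lee_fin.
rewrite -(ge0_integralZl _ mD mf2 (p0 f) k0) -(ge0_integralZl _ mD mg2 (p0 g) two0).
rewrite -ge0_integralD//.
- apply: ge0_le_integral => //.
  + by move=> t _; rewrite lee_fin sqr_ge0.
  + apply/measurable_EFinP; apply: measurable_funX; apply: measurable_funD => //.
    exact: measurable_funM.
  + by apply: emeasurable_funD; exact: measurable_funeM.
  + move=> t _; rewrite -!EFinM -EFinD lee_fin (le_trans (sqr_sum_le _ _))// exprMn mulrA//.
- by move=> t _; rewrite -EFinM lee_fin mulr_ge0 ?sqr_ge0.
- exact: measurable_funeM.
- by move=> t _; rewrite -EFinM lee_fin mulr_ge0 ?sqr_ge0.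
- exact: measurable_funeM.
Qed.

(** The combination of the two representatives works, by squeezing its squared distance with (k u +
    v)^2 <= 2 k^2 u^2 + 2 v^2. *)
Lemma is_trace_lin (y k : R) (g g' : R * R -> R) (h h' : R -> R) :
  is_trace y g h -> is_trace y g' h' ->
  is_trace y (fun z => k * g z + g' z) (fun t => k * h t + h' t).
Proof.
move=> [[mh hT] [r [mr rg rh]]] [[mh' hT'] [r' [mr' rg' rh']]].
have mT T : measurable (`[- T, T] : set mR) by exact: measurable_itv.
have mS (q : R -> R) (D : set mR) : measurable_fun setT q -> measurable_fun D q.
  by move=> mq; exact: measurable_funS mq.
split.
  split; first by apply: measurable_funD => //; exact: measurable_funM.
  move=> T; apply: le_lt_trans (sqr_integral_lin_le k (mT T) (mS _ _ mh) (mS _ _ mh')) _.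
  have k0 : (0 <= (2 * k ^+ 2)%:E)%E by rewrite lee_fin mulr_ge0 ?sqr_ge0.
  have two0 : (0 <= 2%:E :> \bar R)%E by rewrite lee_fin.
  by apply: lte_add_pinfty; [exact: (lte_mul_pinfty k0 _ (hT T))|exact: (lte_mul_pinfty two0 _ (hT' T))].
exists (fun z => k * r z + r' z); split.
- by apply: measurable_funD => //; exact: measurable_funM.
- by apply: ae_imp2 rg rg' => z H H' sz; rewrite H// H'.
move=> T.
have sec (q : R * R -> R) (x : R) : x \in `]0, 1[ -> measurable_fun (strip R : set (mR * mR)) q ->
    measurable_fun (`[- T, T] : set mR) (fun t => q (x, t)).
  move=> x01 mq; apply: (@measurable_comp _ _ _ _ _ _ (strip R) q _ (pair x) (@measurable_strip R) _ mq).
    by move=> _ [t _ <-]; split => //; exact: set_mem.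
  by apply: measurable_funTS; exact: pair1_measurable.
apply: (@squeeze_cvge _ _ _ _ (fun=> 0%E) _ (fun x =>
  (2 * k ^+ 2)%:E * \int[leb]_(t in `[(- T)%R, T]) ((r (x, t) - h t) ^+ 2)%:E +
  2%:E * \int[leb]_(t in `[(- T)%R, T]) ((r' (x, t) - h' t) ^+ 2)%:E)%E).
- have Hx : \forall x \near y, x \in `]0, 1[ ->
    (0 <= \int[leb]_(t in `[(- T)%R, T]) ((k * r (x, t) + r' (x, t) - (k * h t + h' t)) ^+ 2)%:E
     <= (2 * k ^+ 2)%:E * \int[leb]_(t in `[(- T)%R, T]) ((r (x, t) - h t) ^+ 2)%:E +
        2%:E * \int[leb]_(t in `[(- T)%R, T]) ((r' (x, t) - h' t) ^+ 2)%:E)%E.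
    apply: filterE => x x01; apply/andP; split.
      by apply: integral_ge0 => t _; rewrite lee_fin sqr_ge0.
    under eq_integral do rewrite opprD addrACA -mulrBr.
    apply: sqr_integral_lin_le => //; apply: measurable_funB => //; try exact: sec; exact: mS.
  exact: Hx.
- exact: cvg_cst.
have -> : (0 = (2 * k ^+ 2)%:E * 0 + 2%:E * 0 :> \bar R)%E by rewrite !mule0 adde0.
by apply: cvgeD; [rewrite !mule0|apply: cvgeZl => //; exact: rh|apply: cvgeZl => //; exact: rh'].
Qed.

End trace_linear.

(** * Inequalities for the graph norm *)

Section norm_algebra.
Context (R : realDomainType).

Lemma lin_algebra (x y x' y' q k w w' : R) : w = k * x + y -> w' = k * x' + y' ->
  w + q * w' = k * (x + q * x') + (y + q * y').
Proof. by move=> -> ->; ring. Qed.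

Lemma graph_norm_le (u t f K d : R) : 0 <= d -> t <= 2 * f + 2 * d * u -> u <= K * f ->
  u + t <= (K * (1 + 2 * d) + 2) * f.
Proof.
move=> d0 tf uf; have h : (1 + 2 * d) * u <= (1 + 2 * d) * (K * f).
  by apply: ler_wpM2l => //; lra.
have -> : (K * (1 + 2 * d) + 2) * f = (1 + 2 * d) * (K * f) + 2 * f by ring.
move: h; rewrite mulrDl mul1r; lra.
Qed.

Lemma le_graph_norm (u t f d : R) : 0 <= d -> 0 <= u -> 0 <= t -> f <= 2 * t + 2 * d * u ->
  f <= (2 + 2 * d) * (u + t).
Proof.
move=> d0 u0 t0 le; have dt0 := mulr_ge0 d0 t0.
have -> : (2 + 2 * d) * (u + t) = 2 * t + 2 * d * u + (2 * u + 2 * (d * t)) by ring.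
lra.
Qed.

End norm_algebra.

(** * Linearity, injectivity and norm bounds *)

Section isomorphism_of_V.
Context (R : realType) (m p : nat).
Notation leb := (@lebesgue_measure R).
Notation mR := (measurableTypeR R).
Variables (c : R) (a b ia ib : 'I_(m + p) -> R -> R) (r0 : 'M[R]_(m, p)) (r1 : 'M[R]_(p, m)).
Hypothesis aL : forall j, Linfty (a j).
Hypothesis bL : forall j, Linfty (b j).
Hypothesis rep : forall j, coef_rep (a j) (b j) (ia j) (ib j) c.
Variable Kc : R.
Hypothesis Kc0 : 0 <= Kc.
Hypothesis est : forall s : int, mode_bounded ia ib r0 r1 Kc s.
Variable gamma : R.
Hypothesis g1 : 1 <= gamma.
Implicit Types u v : 'I_(m + p) -> R * R -> R.

Let g0 : 0 <= gamma. Proof. exact: le_trans ler01 g1. Qed.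

Lemma V_lin (k : R) u v : V gamma a r0 r1 u -> V gamma a r0 r1 v ->
  let w := fun j z => k * u j z + v j z in
  V gamma a r0 r1 w /\ ae_strip (opA a b w) (fun j z => k * opA a b u j z + opA a b v j z).
Proof.
move=> uV vV w.
have [[uW uhx uxW uht utW] [u0 [u1 [tu0 tu1 bu0 bu1]]]] := uV.
have [[vW vhx vxW vht vtW] [v0 [v1 [tv0 tv1 bv0 bv1]]]] := vV.
have ul : forall j, loc_integrable (u j) by case: uW.
have vl : forall j, loc_integrable (v j) by case: vW.
have wl j : loc_integrable (w j) by apply: loc_integrable_add (vl j); exact: loc_integrable_scale.
have lin e : e = dx R \/ e = dt R -> has_weak_derive e u -> has_weak_derive e v -> forall j,
    is_weak_derive e (w j) (weak_derive e (w j)) /\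
    weak_derive e (w j) = (fun z => k * weak_derive e (u j) z + weak_derive e (v j) z)
      %[ae leb2 R in strip R].
  move=> e_dir hu hv j.
  have W := is_weak_derive_lin e_dir k (ul j) (vl j) (weak_deriveP (hu j)) (weak_deriveP (hv j)).
  have W' := weak_deriveP (ex_intro _ _ W).
  exact: conj W' (is_weak_derive_unique e_dir W' W).
have wx := lin _ (or_introl erefl) uhx vhx.
have wt := lin _ (or_intror erefl) uht vht.
have [Ka ab] := coef_a_bounded aL.
have closed (g : R) (f1 f2 f3 : 'I_(m + p) -> R * R -> R) : W g f1 -> W g f2 -> (forall j, loc_integrable (f3 j)) ->
    ae_strip f3 (combine (fun=> cst k) (fun=> cst 1) f1 f2) -> W g f3.
  move=> w1 w2 l3 E.
  exact: (W_combine (bounded_coef_cst k) (bounded_coef_cst 1) w1 w2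
    (fun j => loc_integrable_measurable (l3 j)) E).1.
have tl j : loc_integrable (transport a w j).
  have [ma ba] := ab j.
  exact: (loc_integrable_add (wt j).1.1 (loc_integrable_mul1 (wx j).1.1 ma ba)).
have tE : ae_strip (transport a w) (combine (fun=> cst k) (fun=> cst 1) (transport a u) (transport a v)).
  apply: ae_strip_fam => j; apply: ae_imp2 (wx j).2 (wt j).2 => z ex et sz.
  by rewrite /combine/= mul1r; exact: lin_algebra (et sz) (ex sz).
split; last first.
  apply: ae_imp tE => z H sz j; have := H sz j; rewrite /combine/= mul1r => E.
  exact: lin_algebra E (erefl _).
split.
  split.
  - have wE : ae_strip w (combine (fun=> cst k) (fun=> cst 1) u v).
      by apply: aeW => z _ j; rewrite /combine/= mul1r.
    exact: (closed gamma u v w uW vW wl wE).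
  - by move=> j; exists (weak_derive (dx R) (w j)); exact: (wx j).1.
  - apply: (closed 0 _ _ _ uxW vxW); first by move=> j; exact: (wx j).1.1.
    by apply: ae_strip_fam => j; apply: ae_imp (wx j).2 => z H sz; rewrite H// /combine/= mul1r.
  - by move=> j; exists (weak_derive (dt R) (w j)); exact: (wt j).1.
  - exact: (closed gamma _ _ _ utW vtW tl tE).
exists (fun j t => k * u0 j t + v0 j t), (fun j t => k * u1 j t + v1 j t); split.
- by move=> j; exact: is_trace_lin.
- by move=> j; exact: is_trace_lin.
- move=> j; apply: ae_imp2 (bu0 j) (bv0 j) => t -> ->.
  by rewrite mulr_sumr -big_split/=; apply: eq_bigr => i _; ring.
- move=> j; apply: ae_imp2 (bu1 j) (bv1 j) => t -> ->.
  by rewrite mulr_sumr -big_split/=; apply: eq_bigr => i _; ring.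
Qed.

(** [weak_derive] is a chosen function, and nothing relates the choices for two representatives
    except uniqueness of weak derivatives almost everywhere. *)
Lemma opA_ae u v : V gamma a r0 r1 u -> V gamma a r0 r1 v -> ae_strip u v ->
  ae_strip (opA a b u) (opA a b v).
Proof.
move=> uV vV uv; have [[[ul _ _] uhx _ uht _] _] := uV; have [[[vl _ _] vhx _ vht _] _] := vV.
have D e : e = dx R \/ e = dt R -> has_weak_derive e u -> has_weak_derive e v -> forall j,
    weak_derive e (u j) = weak_derive e (v j) %[ae leb2 R in strip R].
  move=> e_dir hu hv j; apply: (is_weak_derive_unique e_dir _ (weak_deriveP (hv j))).
  exact: (is_weak_derive_ae e_dir (ul j) (vl j) (ae_strip_comp j uv) (weak_deriveP (hu j))).
have Dx := D _ (or_introl erefl) uhx vhx; have Dt := D _ (or_intror erefl) uht vht.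
apply: ae_strip_fam => j; apply: ae_imp3 (Dx j) (Dt j) (ae_strip_comp j uv) => z ex et e sz.
by rewrite /opA /transport ex// et// e.
Qed.

(** With zero energy on the right, the mode estimate forces every Fourier coefficient of u to
    vanish, and uniqueness of coefficients concludes. *)
Lemma V_kernel u : V gamma a r0 r1 u -> ae_strip (opA a b u) (fun _ _ => 0) -> ae_strip u (fun _ _ => 0).
Proof.
move=> uV fz; have [fW _] := opA_W aL bL rep uV; have [fl _ _] := fW.
have reg := V_regular aL bL rep uV.
apply: ae_strip_fam => j; have [ul up _ _ _] := reg j.
apply: (strip_fourier_uniqueness ul up) => s.
have [A [B [AB uAB]]] := V_mode aL bL rep uV s.
have [Ei eE] := amplitude_integrable fl (W_energy g0 fW s).
(* The zero function is written as 0 times A u, so that [ae_fcos] compares the two and [fcos_scale0]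
   evaluates the coefficients. *)
have zl i : loc_integrable (fun z => 0 * opA a b u i z) by exact: loc_integrable_scale.
have fz' i : opA a b u i = (fun z => 0 * opA a b u i z) %[ae leb2 R in strip R].
  by apply: ae_imp fz => z H sz; rewrite H// mulr0.
have e0 : (energy (opA a b u) s <= ((m + p)%:R * 0)%:E)%E.
  apply: energy_le_cst => // i; apply: ae_imp (ae_fcos s (fl i) (zl i) (fz' i)) => x H x01.
  have [-> ->] := H x01; have [-> ->] := fcos_scale0 (opA a b u i) s x.
  by rewrite expr0n addr0.
apply: ae_imp (uAB j) => x H x01; have [-> ->] := H x01.
have x01' : 0 <= x <= 1 by case/andP: x01 => x0 x1; rewrite !ltW.
have := est (fun i => (integrable_fcos s (fl i)).1) (fun i => (integrable_fcos s (fl i)).2) Ei AB j x01'.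
have E0 : \int[leb]_(x in `]0, 1[) amplitude (opA a b u) s x <= 0.
  by move: e0; rewrite eE mulr0 lee_fin.
have := ler_wpM2l Kc0 E0; rewrite mulr0 => h1 h2.
have {h2} := le_trans h2 h1; have a2 := sqr_ge0 (A j x); have b2 := sqr_ge0 (B j x) => h.
by split; apply/eqP; rewrite -sqrf_eq0; apply/eqP; lra.
Qed.

Lemma opA_injective u v : V gamma a r0 r1 u -> V gamma a r0 r1 v ->
  ae_strip (opA a b u) (opA a b v) -> ae_strip u v.
Proof.
move=> uV vV H; have [wV wE] := V_lin (-1) uV vV.
have : ae_strip (fun j z => -1 * u j z + v j z) (fun _ _ => 0).
  apply: (V_kernel wV); apply: ae_imp2 wE H => z e1 e2 sz j.
  by rewrite e1// e2//; ring.
by apply: ae_imp => z e sz j; have := e sz j; rewrite mulN1r addrC => /eqP; rewrite subr_eq0 => /eqP ->.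
Qed.

(** The energies of u and A u are compared at each frequency, so the constant does not depend on
    gamma; the transport part of the norm is then recovered from the equation. *)
Lemma Unorm_opA u : V gamma a r0 r1 u ->
  Unorm gamma a u <= Num.sqrt ((m + p)%:R * Kc * (1 + 2 * c^-1 ^+ 2) + 2) * Wnorm gamma (opA a b u).
Proof.
move=> uV; have [fW _] := opA_W aL bL rep uV; have [_ _ fin] := fW.
have T := transport_bound aL bL rep uV.
have k0 : 0 <= (m + p)%:R * Kc by rewrite mulr_ge0.
have L : Wnorm gamma u ^+ 2 <= (m + p)%:R * Kc * Wnorm gamma (opA a b u) ^+ 2 + 0 * Wnorm gamma (opA a b u) ^+ 2.
  apply: (Wnorm2_lty _ fin fin).2; apply: Wnorm2_le => // s.
  by rewrite mul0e adde0; exact: (V_energy aL bL rep Kc0 est g1 uV s).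
rewrite mul0r addr0 in L; rewrite /Unorm.
have F0 : 0 <= Wnorm gamma (opA a b u) by exact: sqrtr_ge0.
have ci0 : 0 <= c^-1 ^+ 2 by exact: sqr_ge0.
rewrite -[X in _ <= _ * X](ger0_norm F0) -sqrtr_sqr -sqrtrM; last first.
  by rewrite addr_ge0// mulr_ge0// addr_ge0// mulr_ge0.
by apply: ler_wsqrtr; exact: graph_norm_le ci0 T L.
Qed.

Lemma opA_Unorm u : V gamma a r0 r1 u ->
  Wnorm gamma (opA a b u) <= Num.sqrt (2 + 2 * c^-1 ^+ 2) * Unorm gamma a u.
Proof.
move=> uV; have [_ le] := opA_W aL bL rep uV.
have F0 : 0 <= Wnorm gamma (opA a b u) by exact: sqrtr_ge0.
have ci0 : 0 <= c^-1 ^+ 2 by exact: sqr_ge0.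
rewrite -[leLHS](ger0_norm F0) -sqrtr_sqr /Unorm -sqrtrM; last by rewrite addr_ge0// mulr_ge0.
by apply: ler_wsqrtr; exact: le_graph_norm ci0 (sqr_ge0 _) (sqr_ge0 _) le.
Qed.

End isomorphism_of_V.

(** Relies on ]0, 1[ having positive measure, since an essential supremum over a null space would be
    -oo. It allows single terms to be extracted from the smallness condition. *)
Lemma Linfty_norm_ge0 (R : realType) (f : R -> R) : (0 <= Linfty_norm f)%E.
Proof.
apply: ess_sup_gee; last by apply: aeW => x; rewrite lee_fin.
change (0 < (@lebesgue_measure R) (setT `&` `]0%R, 1%R[))%E.
by rewrite setTI lebesgue_measure_itv/= lte_fin ltr01 oppr0 adde0 lte_fin.
Qed.

Lemma coefficient_bounds (R : realType) (m p : nat) (c : R) (b : 'I_(m + p) -> R -> R)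
    (r0 : 'M[R]_(m, p)) (r1 : 'M[R]_(p, m)) :
  (\sum_(j < m + p) Linfty_norm (b j)
     + (\sum_(j < m) \sum_(k < p) `|r0 j k|)%R%:E
     + (\sum_(j < p) \sum_(k < m) `|r1 j k|)%R%:E <= (c^-1)%R%:E)%E ->
  [/\ forall j, (Linfty_norm (b j) <= (c^-1)%:E)%E, forall j k, `|r0 j k| <= c^-1
    & forall j k, `|r1 j k| <= c^-1].
Proof.
have S0 (q l : nat) (r : 'M[R]_(q, l)) : 0 <= \sum_(j < q) \sum_(k < l) `|r j k|.
  by apply: sumr_ge0 => j _; apply: sumr_ge0.
have Se (q l : nat) (r : 'M[R]_(q, l)) j k : `|r j k| <= \sum_(j < q) \sum_(k < l) `|r j k|.
  rewrite (bigD1 j)//= (bigD1 k)//= -addrA lerDl addr_ge0// ?sumr_ge0// => i _.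
  exact: sumr_ge0.
have B0 : (0 <= \sum_(j < m + p) Linfty_norm (b j))%E.
  by apply: sume_ge0 => j _; exact: Linfty_norm_ge0.
move=> H; split.
- move=> j; apply: le_trans H; rewrite -addeA; apply: (@le_trans _ _ (\sum_(j < m + p) Linfty_norm (b j))%E).
    rewrite (bigD1 j)//= leeDl// sume_ge0// => i _; exact: Linfty_norm_ge0.
  by rewrite leeDl// -EFinD lee_fin addr_ge0.
- move=> j k; rewrite -lee_fin; apply: le_trans H; rewrite addeAC.
  apply: (@le_trans _ _ (\sum_(j < m) \sum_(k < p) `|r0 j k|)%R%:E); first by rewrite lee_fin Se.
  by rewrite leeDr// adde_ge0// lee_fin.
- move=> j k; rewrite -lee_fin; apply: le_trans H.
  apply: (@le_trans _ _ (\sum_(j < p) \sum_(k < m) `|r1 j k|)%R%:E); first by rewrite lee_fin Se.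
  by rewrite leeDr// adde_ge0// lee_fin.
Qed.


(** * Assembly of the isomorphism *)

Theorem theorem1p1 (R : realType) (m p : nat) (hm : (0 < m)%N) (hp : (0 < p)%N)
    (c : R) (hc : 0 < c) :
  exists C : R, 0 < C /\
    forall (a b : 'I_(m + p) -> R -> R)
           (r0 : 'M[R]_(m, p)) (r1 : 'M[R]_(p, m)),
      (forall j, [/\ Linfty (a j), Linfty (b j)
                   & (c%:E <= ess_inf_abs (a j))%E]) ->
      (\sum_(j < m + p) Linfty_norm (b j)
         + (\sum_(j < m) \sum_(k < p) `|r0 j k|)%R%:E
         + (\sum_(j < p) \sum_(k < m) `|r1 j k|)%R%:E <= (c^-1)%R%:E)%E ->
      (forall s : int, c <= cmod (\det (1%:M - Rmx a b r0 r1 s))) ->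
      forall gamma : R, 1 <= gamma ->
        isomorphism (V gamma a r0 r1) (Unorm gamma a)
                    (W gamma) (Wnorm gamma) (opA a b) /\
        (forall u, V gamma a r0 r1 u ->
           Unorm gamma a u <= C * Wnorm gamma (opA a b u)).
Proof.
have [Kc Kc0 est] := mode_estimate m p hc.
(* The constant of [Unorm_opA], a function of c, m and p alone since [Kc] is fixed before the
   coefficients; the summand 2 also makes it positive. *)
exists (Num.sqrt ((m + p)%:R * Kc * (1 + 2 * c^-1 ^+ 2) + 2)); split.
  by rewrite sqrtr_gt0 ltr_wpDl// mulr_ge0 ?mulr_ge0// addr_ge0// mulr_ge0// sqr_ge0.
move=> a b r0 r1 ab small det gamma g1.
have [b_le r0_le r1_le] := coefficient_bounds small.
have aL j : Linfty (a j) by have [] := ab j.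
have bL j : Linfty (b j) by have [] := ab j.
have /choice [ia /choice [ib rep]] : forall j, exists ia ib, coef_rep (a j) (b j) ia ib c.
  by move=> j; have [_ _ a_ge] := ab j; exact: coef_repP.
have {}est s := est a b ia ib r0 r1 s rep r0_le r1_le (det s).
have solv (s : int) (FA FB : 'I_(m + p) -> R -> R) :
    (forall j, (@lebesgue_measure R).-integrable `]0, 1[ (EFin \o FA j)) ->
    (forall j, (@lebesgue_measure R).-integrable `]0, 1[ (EFin \o FB j)) ->
    exists A B, is_mode_system ia ib r0 r1 s%:~R FA FB A B.
  move=> FAi FBi; have ci0 : 0 <= c^-1 by rewrite invr_ge0 ltW.
  apply: (@mode_system_exists _ _ _ _ _ (c^-1 + c^-1 * c^-1)) => //.
  - by move=> j; have [[h _] _ _ _ _] := rep j.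
  - by move=> j; have [[_ h] _ _ _ _] := rep j.
  - by move=> j x _; have [_ h _ _ _] := rep j; rewrite (le_trans (h x))// lerDl mulr_ge0.
  - by move=> j x _; have [_ _ h _ _] := rep j; rewrite (le_trans (h x))// lerDr.
  rewrite -(Rmx_reflection _ _ _ rep); apply/eqP => d0.
  by have := det s; rewrite d0 cmod0 leNgt hc.
split; last by move=> u uV; exact: (Unorm_opA aL bL rep Kc0 est g1 uV).
split.
- by move=> u uV; exact: (opA_W aL bL rep uV).1.
- by move=> k u v uV vV; exact: V_lin.
- move=> u v uV vV; split; first exact: (opA_injective aL bL rep Kc0 est g1 uV vV).
  exact: (opA_ae b uV vV).
- by move=> f fW; exact: (V_onto aL bL rep Kc0 est solv g1 fW).
split; eexists => u uV.
  exact: (opA_Unorm aL bL rep uV).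
exact: (Unorm_opA aL bL rep Kc0 est g1 uV).
Qed.
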